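(* Let $F\colon\mathcal C\to\mathcal D$ be a tensor functor between finite tensor categories and $\mathcal M$ a left $\mathcal D$-module category, and let ${}_F\mathcal M$ be the $\mathcal C$-module category with action $c\triangleright^F m=F(c)\triangleright m$. (1) If $\mathcal M$ is exact and $F$ is perfect, then ${}_F\mathcal M$ is exact. (2) If $\mathcal M$ is unimodular, $F$ is perfect and $F$ is $\otimes$-Frobenius, then ${}_F\mathcal M$ is unimodular. (3) If $\mathcal C,\mathcal D$ are pivotal, $\mathcal M$ is a pivotal $\mathcal D$-module category, and $F$ is perfect, pivotal and $\otimes$-Frobenius, then ${}_F\mathcal M$ is a pivotal $\mathcal C$-module category. (4) If $\mathcal C,\mathcal D$ are (unimodular) spherical, $F$ is perfect, pivotal and $\otimes$-Frobenius, and $\mathcal M$ is a spherical $\mathcal D$-module category, then ${}_F\mathcal M$ is a spherical $\mathcal C$-module category. Precisely: for any isomorphism $u_{\mathcal C}\colon\mathbb 1\to D_{\mathcal C}^{-1}$ and any unimodular structure $u_{\mathcal M}\colon\mathrm{id}_{\mathcal M}\Rightarrow D^{-1}_{\mathcal D^*_{\mathcal M}}$, if the pivotal module category $\mathcal M$ is $(F(u_{\mathcal C}),u_{\mathcal M})$-spherical, then ${}_F\mathcal M$, with the transported pivotal and unimodular structures, is $(u_{\mathcal C},{}_Fu_{\mathcal M})$-spherical.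
   Context: Work over an algebraically closed field $\Bbbk$; all categories are finite $\Bbbk$-linear abelian, functors $\Bbbk$-linear. Finite multitensor category: finite $\Bbbk$-linear rigid monoidal category with bilinear tensor product; finite tensor if also $\mathrm{End}(\mathbb 1)\cong\Bbbk$. Tensor functor: exact $\Bbbk$-linear strong monoidal functor. Right duals $c^\vee$ have $c^\vee\otimes c\to\mathbb 1$, $\mathbb 1\to c\otimes c^\vee$; left duals are ${}^\vee c$. $F^{\mathrm{la}},F^{\mathrm{ra}}$ are adjoints, $F^{\mathrm{rra}}=(F^{\mathrm{ra}})^{\mathrm{ra}}$. $F$ is perfect if $F^{\mathrm{ra}}$ is exact (equivalently $F$ preserves projectives). ${}_F\mathcal D_F$ is $\mathcal D$ as a $\mathcal C$-bimodule category via $F(c)\otimes d\otimes F(c')$; the adjoints $F^{\mathrm{la}},F^{\mathrm{ra}}\colon{}_F\mathcal D_F\to\mathcal C$ are canonically $\mathcal C$-bimodule functors, and $F$ is $\otimes$-Frobenius if these are isomorphic as $\mathcal C$-bimodule functors. A $\mathcal D$-module category is a finite $\Bbbk$-linear category with an action of $\mathcal D$ exact in each variable; it is exact if $p\triangleright m$ is projective for all projective $p\in\mathcal D$ and all $m$. $\mathcal D^*_{\mathcal M}=\mathrm{Fun}_{\mathcal D}(\mathcal M,\mathcal M)$ is the category of $\mathcal D$-module endofunctors (finite multitensor when $\mathcal M$ is exact) under composition. Nakayama functors of a finite category $\mathcal X$: $\mathbb N^l(x)=\int_y\mathrm{Hom}(y,x)\otimes_\Bbbk y$, $\mathbb N^r(x)=\int^y\mathrm{Hom}(x,y)^*\otimes_\Bbbk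 y$. For a finite multitensor category $\mathcal A$: $D_{\mathcal A}=\mathbb N^l_{\mathcal A}(\mathbb 1)$, $D_{\mathcal A}^{-1}=\mathbb N^r_{\mathcal A}(\mathbb 1)$ (mutually inverse invertible objects); $\mathcal A$ is unimodular if $D_{\mathcal A}\cong\mathbb 1$. For a module category there are canonical isomorphisms $\mathbb N^r(c\triangleright m)\cong{}^{\vee\vee}c\triangleright\mathbb N^r(m)$, and for $\mathcal A$ itself also $\mathbb N^r(x\otimes y)\cong\mathbb N^r(x)\otimes y^{\vee\vee}$; combining these gives the Radford isomorphism $\mathcal R_{\mathcal A}\colon D_{\mathcal A}\otimes x\cong x^{\vee\vee\vee\vee}\otimes D_{\mathcal A}$. An exact $\mathcal D$-module category $\mathcal M$ is unimodular if it has a unimodular structure, i.e. a module natural isomorphism $\mathrm{id}_{\mathcal M}\cong D_{\mathcal D^*_{\mathcal M}}$ (equivalently $\mathrm{id}_{\mathcal M}\cong D^{-1}_{\mathcal D^*_{\mathcal M}}$). Internal Hom: $\mathrm{Hom}_{\mathcal M}(d\triangleright m,n)\cong\mathrm{Hom}_{\mathcal D}(d,\underline{\mathrm{Hom}}(m,n))$. For exact $\mathcal M$, the relative Serre functor $\mathbb S^{\mathcal D}_{\mathcal M}$ is the (essentially unique) autoequivalence of $\mathcal M$ with natural isomorphisms $\underline{\mathrm{Hom}}(m,n)^\vee\cong\underline{\mathrm{Hom}}(n,\mathbb S^{\mathcal D}_{\mathcal M}(m))$; $\overline{\mathbb S}{}^{\mathcal D}_{\mathcal M}$ is its quasi-inverse.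 It is canonically twisted: $\mathbb S(d\triangleright m)\cong d^{\vee\vee}\triangleright\mathbb S(m)$. A pivotal structure on $\mathcal D$ is a monoidal isomorphism $\mathfrak p\colon\mathrm{id}\cong(-)^{\vee\vee}$; it makes $\mathbb S^{\mathcal D}_{\mathcal M}$ a $\mathcal D$-module functor (identify $d^{\vee\vee}$ with $d$ by $\mathfrak p_d$). A pivotal $\mathcal D$-module category is an exact $\mathcal M$ with a $\mathcal D$-module natural isomorphism $\tilde{\mathfrak p}\colon\mathrm{id}_{\mathcal M}\cong\mathbb S^{\mathcal D}_{\mathcal M}$. A tensor functor $F$ between pivotal categories is pivotal if $\zeta_c^\vee\circ\mathfrak p^{\mathcal D}_{F(c)}=\zeta_{c^\vee}\circ F(\mathfrak p^{\mathcal C}_c)$, where $\zeta_c\colon F(c^\vee)\cong F(c)^\vee$ is canonical. A unimodular pivotal finite tensor category is spherical if $\mathfrak p_{x^{\vee\vee}}\circ\mathfrak p_x\colon x\to x^{\vee\vee\vee\vee}$ equals the Radford isomorphism (after trivializing $D$). Module Radford isomorphism: for exact $\mathcal M$ over $\mathcal D$ there are canonical isomorphisms $D_{\mathcal D}^{-1}\triangleright\mathbb S^{\mathcal D}_{\mathcal M}\cong\mathbb N^r_{\mathcal M}$ and, viewing $\mathcal M$ as a $\mathcal D^*_{\mathcal M}$-module category by evaluation, $\mathbb N^r_{\mathcal M}\cong D^{-1}_{\mathcal D^*_{\mathcal M}}\circ\mathbb S^{\mathcal D^*_{\mathcal M}}_{\mathcal M}\cong D^{-1}_{\mathcal D^*_{\mathcal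 M}}\circ\overline{\mathbb S}{}^{\mathcal D}_{\mathcal M}$; the composite is $\mathcal R_{\mathcal M}\colon D_{\mathcal D}^{-1}\triangleright\mathbb S^{\mathcal D}_{\mathcal M}\Rightarrow D^{-1}_{\mathcal D^*_{\mathcal M}}\circ\overline{\mathbb S}{}^{\mathcal D}_{\mathcal M}$. Given $u_{\mathcal D}\colon\mathbb 1\cong D_{\mathcal D}^{-1}$ and $u_{\mathcal M}\colon\mathrm{id}_{\mathcal M}\cong D^{-1}_{\mathcal D^*_{\mathcal M}}$, put $\overline{\mathcal R}_{\mathcal M}=(u_{\mathcal M}\circ\mathrm{id})^{-1}\mathcal R_{\mathcal M}(u_{\mathcal D}\triangleright\mathrm{id})\colon\mathbb S^{\mathcal D}_{\mathcal M}\Rightarrow\overline{\mathbb S}{}^{\mathcal D}_{\mathcal M}$. A pivotal $\mathcal M$ over a spherical $\mathcal D$ is $(u_{\mathcal D},u_{\mathcal M})$-spherical if the composite $\mathrm{id}_{\mathcal M}\xrightarrow{\tilde{\mathfrak p}}\mathbb S^{\mathcal D}_{\mathcal M}\xrightarrow{\overline{\mathcal R}_{\mathcal M}}\overline{\mathbb S}{}^{\mathcal D}_{\mathcal M}\xrightarrow{\tilde{\mathfrak p}}\mathrm{id}_{\mathcal M}$ is the identity (the last map being induced by $\tilde{\mathfrak p}$ on the quasi-inverse). Transport. For perfect $F$ let $\chi_F=F^{\mathrm{rra}}(\mathbb 1)\in\mathcal D$, with half-braiding $\sigma_c\colon\chi_F\otimes F(c)\cong F^{\mathrm{rra}}(c)\cong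 F(c)\otimes\chi_F$ given by the $\mathcal C$-bimodule structure of $F^{\mathrm{rra}}\colon\mathcal C\to{}_F\mathcal D_F$. For a $\mathcal D$-module functor $G$, $F^*(G)$ denotes $G$ as a $\mathcal C$-module functor between $F$-twisted categories. There are canonical isomorphisms $F(D_{\mathcal C})\cong\chi_F\otimes D_{\mathcal D}$, $\mathbb S^{\mathcal C}_{{}_F\mathcal M}\cong\chi_F\triangleright F^*(\mathbb S^{\mathcal D}_{\mathcal M})$ and $D^{-1}_{\mathcal C^*_{{}_F\mathcal M}}\cong\chi_F\triangleright F^*(D^{-1}_{\mathcal D^*_{\mathcal M}})$. If $F$ is $\otimes$-Frobenius, $\chi_F$ with $\sigma$ is isomorphic to the trivial object $\mathbb 1$ with trivial half-braiding; fix such an isomorphism. It yields $F(u_{\mathcal C})\colon\mathbb 1\cong F(D_{\mathcal C}^{-1})\cong D_{\mathcal D}^{-1}$, the transported pivotal structure $\mathrm{id}\xrightarrow{F^*(\tilde{\mathfrak p})}F^*(\mathbb S^{\mathcal D}_{\mathcal M})\cong\mathbb S^{\mathcal C}_{{}_F\mathcal M}$, and the transported unimodular structure ${}_Fu_{\mathcal M}\colon\mathrm{id}\xrightarrow{F^*(u_{\mathcal M})}F^*(D^{-1}_{\mathcal D^*_{\mathcal M}})\cong D^{-1}_{\mathcal C^*_{{}_F\mathcal M}}$. *)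

(* Defs.v *)
From HB Require Import structures.
From mathcomp Require Import all_boot all_algebra.
From mathcomp Require Import boolp classical_sets.

Set Implicit Arguments.
Unset Strict Implicit.
Unset Printing Implicit Defensive.
Import GRing.Theory.
Local Open Scope ring_scope.

Record lincat (k : fieldType) := LinCat {
  obj :> Type;
  hom : obj -> obj -> lmodType k;
  idm : forall x, hom x x;
  comp : forall x y z, hom y z -> hom x y -> hom x z;
  compA : forall w x y z (f : hom y z) (g : hom x y) (h : hom w x),
    comp f (comp g h) = comp (comp f g) h;
  comp1m : forall x y (f : hom x y), comp (idm y) f = f;
  compm1 : forall x y (f : hom x y), comp f (idm x) = f;
  compPl : forall x y z a (f f' : hom y z) (g : hom x y),
    comp (a *: f + f') g = a *: comp f g + comp f' g;
  compPr : forall x y z a (f : hom y z) (g g' : hom x y),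
    comp f (a *: g + g') = a *: comp f g + comp f g' }.

Arguments hom {k C} x y : rename.
Arguments idm {k C} x : rename.
Arguments comp {k C x y z} f g : rename.
Notation "f ∘ g" := (comp f g) (at level 40, left associativity).

Section LinCat.
Variables (k : fieldType) (C : lincat k).
Implicit Types x y z : C.

(* The morphism with property P (0 if there is none); it is applied to
   properties that determine a unique morphism. *)
Definition the_mor x y (P : hom x y -> Prop) : hom x y := xget 0 P.

Definition inverse_mor x y (f : hom x y) (g : hom y x) : Prop :=
  g ∘ f = idm x /\ f ∘ g = idm y.

Definition is_iso x y (f : hom x y) : Prop := exists g, inverse_mor f g.

(* Total inverse: meaningful on isomorphisms only. *)
Definition hinv x y (f : hom x y) : hom y x := the_mor (inverse_mor f).

Lemma hinvP x y (f : hom x y) : is_iso f -> inverse_mor f (hinv f).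
Proof. by move=> hf; rewrite /hinv /the_mor; apply: xgetPex. Qed.

Lemma hinvK x y (f : hom x y) : is_iso f -> hinv f ∘ f = idm x.
Proof. by case/hinvP. Qed.

Lemma hinvV x y (f : hom x y) : is_iso f -> f ∘ hinv f = idm y.
Proof. by case/hinvP. Qed.

Lemma is_iso_hinv x y (f : hom x y) : is_iso f -> is_iso (hinv f).
Proof. by move=> hf; exists f; split; [apply: hinvV | apply: hinvK]. Qed.

Lemma is_iso_comp x y z (f : hom y z) (g : hom x y) :
  is_iso f -> is_iso g -> is_iso (f ∘ g).
Proof.
move=> [f' [ff' f'f]] [g' [gg' g'g]]; exists (g' ∘ f'); split.
  by rewrite compA -(compA g') ff' compm1.
by rewrite compA -(compA f) g'g compm1.
Qed.

Lemma iso_cancel x y z (f : hom x y) (g h : hom y z) :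
  is_iso f -> g ∘ f = h ∘ f -> g = h.
Proof.
move=> [f' [_ f'f]] /(congr1 (fun u => u ∘ f')).
by rewrite -!compA f'f !compm1.
Qed.

Lemma iso_cancell x y z (f : hom y z) (g h : hom x y) :
  is_iso f -> f ∘ g = f ∘ h -> g = h.
Proof.
move=> [f' [f'f _]] /(congr1 (fun u => f' ∘ u)).
by rewrite !compA f'f !comp1m.
Qed.

Lemma comp0l x y z (g : hom x y) : (0 : hom y z) ∘ g = 0.
Proof.
have := compPl 1 (0 : hom y z) 0 g.
rewrite !scale1r addr0 => /(congr1 (fun u => u - (0 : hom y z) ∘ g)).
by rewrite subrr addrK.
Qed.

Lemma comp0r x y z (g : hom y z) : g ∘ (0 : hom x y) = 0.
Proof.
have := compPr 1 g (0 : hom x y) 0.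
rewrite !scale1r addr0 => /(congr1 (fun u => u - g ∘ (0 : hom x y))).
by rewrite subrr addrK.
Qed.

Definition is_mono x y (f : hom x y) : Prop :=
  forall w (g h : hom w x), f ∘ g = f ∘ h -> g = h.

Definition is_epi x y (f : hom x y) : Prop :=
  forall z (g h : hom y z), g ∘ f = h ∘ f -> g = h.

Definition is_kernel x y z (f : hom x y) (g : hom y z) : Prop :=
  g ∘ f = 0 /\ forall w (h : hom w y), g ∘ h = 0 -> exists! h', f ∘ h' = h.

Definition is_cokernel x y z (f : hom x y) (g : hom y z) : Prop :=
  g ∘ f = 0 /\ forall w (h : hom y w), h ∘ f = 0 -> exists! h', h' ∘ g = h.

Definition short_exact x y z (f : hom x y) (g : hom y z) : Prop :=
  is_kernel f g /\ is_cokernel f g.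

Definition is_zero x : Prop := idm x = 0.

Definition is_biproduct x y z (i : hom x z) (j : hom y z)
    (p : hom z x) (q : hom z y) : Prop :=
  [/\ p ∘ i = idm x, q ∘ j = idm y, p ∘ j = 0, q ∘ i = 0
    & i ∘ p + j ∘ q = idm z].

Definition is_abelian : Prop :=
  (exists x : C, is_zero x)
  /\ (forall x y, exists z (i : hom x z) (j : hom y z) p q,
        is_biproduct i j p q)
  /\ (forall x y (f : hom x y), exists w (h : hom w x), is_kernel h f)
  /\ (forall x y (f : hom x y), exists w (h : hom y w), is_cokernel f h)
  /\ (forall x y (f : hom x y), is_mono f ->
        exists z (g : hom y z), is_kernel f g)
  /\ (forall x y (f : hom x y), is_epi f ->
        exists w (g : hom w x), is_cokernel g f).

Definition is_projective p : Prop :=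
  forall x y (e : hom x y) (f : hom p y), is_epi e -> exists g, e ∘ g = f.

Definition is_simple x : Prop :=
  ~ is_zero x
  /\ forall y (f : hom y x), is_mono f -> is_zero y \/ is_iso f.

Inductive finite_length : C -> Prop :=
| FiniteLength0 x : is_zero x -> finite_length x
| FiniteLengthS x y s (f : hom x y) (g : hom y s) :
    finite_length x -> is_simple s -> short_exact f g -> finite_length y.

Definition findim (V : lmodType k) : Prop :=
  exists n (f : {linear V -> 'rV[k]_n}), bijective f.

Definition is_finite : Prop :=
  is_abelian
  /\ (forall x y, findim (hom x y))
  /\ (forall x, finite_length x)
  /\ (forall x, exists p (e : hom p x), is_projective p /\ is_epi e)
  /\ (exists n (s : 'I_n -> C),
        forall x, is_simple x -> exists i (f : hom x (s i)), is_iso f).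

(* A cowedge from Hom(x,y)^* ⊗ y to z, as a family of linear maps
   Hom(x,y)^* -> Hom(y,z) (universal property of the copower). *)
Definition cowedge x z (j : forall y, {scalar hom x y} -> hom y z) : Prop :=
  (forall y a (f g h : {scalar hom x y}),
     (forall v, h v = a * f v + g v) -> j y h = a *: j y f + j y g)
  /\ (forall y y' (v : hom y y') (f : {scalar hom x y'}) (g : {scalar hom x y}),
     (forall w, g w = f (v ∘ w)) -> j y' f ∘ v = j y g).

(* The coend N^r(x) of Hom(x,y)^* ⊗ y over y. *)
Record nakr x := NakR {
  nr_obj :> C;
  nr_in : forall y, {scalar hom x y} -> hom y nr_obj;
  nr_cowedge : cowedge nr_in;
  nr_univ : forall z (j : forall y, {scalar hom x y} -> hom y z), cowedge j ->
    exists! h : hom nr_obj z, forall y f, h ∘ nr_in f = j y f }.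

(* A wedge from z to Hom(y,x) ⊗ y, as a family of linear maps
   Hom(y,x)^* -> Hom(z,y): since Hom(y,x) is finite-dimensional,
   Hom(z, Hom(y,x) ⊗ y) = Hom(y,x) ⊗ Hom(z,y) = Lin(Hom(y,x)^*, Hom(z,y)). *)
Definition wedge x z (j : forall y, {scalar hom y x} -> hom z y) : Prop :=
  (forall y a (f g h : {scalar hom y x}),
     (forall v, h v = a * f v + g v) -> j y h = a *: j y f + j y g)
  /\ (forall y y' (v : hom y y') (f : {scalar hom y x}) (g : {scalar hom y' x}),
     (forall w, g w = f (w ∘ v)) -> v ∘ j y f = j y' g).

(* The end N^l(x) of Hom(y,x) ⊗ y over y. *)
Record nakl x := NakL {
  nl_obj :> C;
  nl_out : forall y, {scalar hom y x} -> hom nl_obj y;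
  nl_wedge : wedge nl_out;
  nl_univ : forall z (j : forall y, {scalar hom y x} -> hom z y), wedge j ->
    exists! h : hom z nl_obj, forall y f, nl_out f ∘ h = j y f }.

End LinCat.

Arguments the_mor {k C x y} P.
Arguments nr_in {k C x} n {y} f.
Arguments nl_out {k C x} n {y} f.

(* Canonical morphism N^r(G x) -> S (N^r x) for adjoints G ⊣ R ⊣ S, where
   gx = G x, adj : Hom(x, R y) -> Hom(G x, y) is the first adjunction, and
   can : Hom(R y, N^r x) -> Hom(y, S (N^r x)) the second one. It is the
   isomorphism of coends
     ∫^y Hom(Gx,y)^* ⊗ y = ∫^y Hom(x,Ry)^* ⊗ y = ∫^z Hom(x,z)^* ⊗ S z. *)
Definition nak_mate k (A B : lincat k) (x : A) (gx : B)
    (Nx : nakr x) (Ngx : nakr gx) (R : B -> A) (SNx : B)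
    (adj : forall y, hom x (R y) -> hom gx y)
    (can : forall y, hom (R y) Nx -> hom y SNx) : hom Ngx SNx :=
  the_mor (fun h => forall y (f : {scalar hom gx y}) (g : {scalar hom x (R y)}),
    (forall w, g w = f (adj y w)) -> h ∘ nr_in Ngx f = can y (nr_in Nx g)).

Arguments nak_mate {k A B x gx} Nx Ngx R {SNx} adj can.

Record functor k (A B : lincat k) := Functor {
  fobj :> A -> B;
  fmor : forall x y, hom x y -> hom (fobj x) (fobj y);
  fmor1 : forall x, fmor (idm x) = idm (fobj x);
  fmorM : forall x y z (f : hom y z) (g : hom x y),
    fmor (f ∘ g) = fmor f ∘ fmor g;
  fmorP : forall x y a (f g : hom x y), fmor (a *: f + g) = a *: fmor f + fmor g }.

Arguments fmor {k A B} F {x y} f : rename.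

Definition exact k (A B : lincat k) (F : functor A B) : Prop :=
  forall x y z (f : hom x y) (g : hom y z),
    short_exact f g -> short_exact (fmor F f) (fmor F g).

Record adjunction k (A B : lincat k) (L : functor A B) (R : functor B A) :=
  Adjunction {
  aunit : forall a, hom a (R (L a));
  acounit : forall b, hom (L (R b)) b;
  aunit_nat : forall a a' (f : hom a a'),
    aunit a' ∘ f = fmor R (fmor L f) ∘ aunit a;
  acounit_nat : forall b b' (f : hom b b'),
    f ∘ acounit b = acounit b' ∘ fmor L (fmor R f);
  adj_triL : forall a, acounit (L a) ∘ fmor L (aunit a) = idm (L a);
  adj_triR : forall b, fmor R (acounit b) ∘ aunit (R b) = idm (R b) }.

Reserved Notation "x ⊗ y" (at level 38, left associativity).
Reserved Notation "f ⊠ g" (at level 38, left associativity).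
Reserved Notation "d ▷ m" (at level 35, right associativity).
Reserved Notation "f ▶ g" (at level 35, right associativity).

Record moncat (k : fieldType) := MonCat {
  moncat_cat :> lincat k;
  unitc : moncat_cat;
  tens : moncat_cat -> moncat_cat -> moncat_cat
    where "x ⊗ y" := (tens x y);
  tensm : forall x x' y y', hom x x' -> hom y y' -> hom (x ⊗ y) (x' ⊗ y')
    where "f ⊠ g" := (tensm f g);
  tensm1 : forall x y, idm x ⊠ idm y = idm (x ⊗ y);
  tensmM : forall x x' x'' y y' y'' (f : hom x' x'') (f' : hom x x')
      (g : hom y' y'') (g' : hom y y'),
    (f ∘ f') ⊠ (g ∘ g') = (f ⊠ g) ∘ (f' ⊠ g');
  tensmPl : forall x x' y y' a (f f' : hom x x') (g : hom y y'),
    (a *: f + f') ⊠ g = a *: (f ⊠ g) + f' ⊠ g;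
  tensmPr : forall x x' y y' a (f : hom x x') (g g' : hom y y'),
    f ⊠ (a *: g + g') = a *: (f ⊠ g) + f ⊠ g';
  assoc : forall x y z, hom ((x ⊗ y) ⊗ z) (x ⊗ (y ⊗ z));
  assoc_iso : forall x y z, is_iso (assoc x y z);
  assoc_nat : forall x x' y y' z z' (f : hom x x') (g : hom y y') (h : hom z z'),
    assoc x' y' z' ∘ ((f ⊠ g) ⊠ h) = (f ⊠ (g ⊠ h)) ∘ assoc x y z;
  lunit : forall x, hom (unitc ⊗ x) x;
  lunit_iso : forall x, is_iso (lunit x);
  lunit_nat : forall x y (f : hom x y), lunit y ∘ (idm unitc ⊠ f) = f ∘ lunit x;
  runit : forall x, hom (x ⊗ unitc) x;
  runit_iso : forall x, is_iso (runit x);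
  runit_nat : forall x y (f : hom x y), runit y ∘ (f ⊠ idm unitc) = f ∘ runit x;
  pentagon : forall w x y z,
    assoc w x (y ⊗ z) ∘ assoc (w ⊗ x) y z
    = (idm w ⊠ assoc x y z) ∘ assoc w (x ⊗ y) z ∘ (assoc w x y ⊠ idm z);
  triangle : forall x y,
    (idm x ⊠ lunit y) ∘ assoc x unitc y = runit x ⊠ idm y }.

Arguments unitc {k} C : rename.
Arguments tens {k C} x y : rename.
Arguments tensm {k C x x' y y'} f g : rename.
Arguments assoc {k C} x y z : rename.
Arguments lunit {k C} x : rename.
Arguments runit {k C} x : rename.
Notation "x ⊗ y" := (tens x y).
Notation "f ⊠ g" := (tensm f g).

(* Right duals (rdual): ev : c^∨ ⊗ c -> 1, coev : 1 -> c ⊗ c^∨.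
   Left duals (ldual):  ev : c ⊗ ^∨c -> 1, coev : 1 -> ^∨c ⊗ c. *)
Record rigidity k (C : moncat k) := Rigidity {
  rdual_of : C -> C;
  rev_of : forall c, hom (rdual_of c ⊗ c) (unitc C);
  rcoev_of : forall c, hom (unitc C) (c ⊗ rdual_of c);
  rdual_zig : forall c,
    runit c ∘ (idm c ⊠ rev_of c) ∘ assoc c (rdual_of c) c
      ∘ (rcoev_of c ⊠ idm c) = lunit c;
  rdual_zag : forall c,
    lunit (rdual_of c) ∘ (rev_of c ⊠ idm (rdual_of c))
      ∘ hinv (assoc (rdual_of c) c (rdual_of c))
      ∘ (idm (rdual_of c) ⊠ rcoev_of c) = runit (rdual_of c);
  ldual_of : C -> C;
  lev_of : forall c, hom (c ⊗ ldual_of c) (unitc C);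
  lcoev_of : forall c, hom (unitc C) (ldual_of c ⊗ c);
  ldual_zig : forall c,
    lunit c ∘ (lev_of c ⊠ idm c) ∘ hinv (assoc c (ldual_of c) c)
      ∘ (idm c ⊠ lcoev_of c) = runit c;
  ldual_zag : forall c,
    runit (ldual_of c) ∘ (idm (ldual_of c) ⊠ lev_of c)
      ∘ assoc (ldual_of c) c (ldual_of c)
      ∘ (lcoev_of c ⊠ idm (ldual_of c)) = lunit (ldual_of c) }.

Record ftcat (k : fieldType) := FTCat {
  ftcat_moncat :> moncat k;
  ftcat_rigid : rigidity ftcat_moncat;
  ftcat_finite : is_finite ftcat_moncat;
  ftcat_one : forall f : hom (unitc ftcat_moncat) (unitc ftcat_moncat),
    exists! a : k, f = a *: idm (unitc ftcat_moncat) }.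

Section Duals.
Variables (k : fieldType) (D : ftcat k).
Implicit Types c d x y z : D.

Definition rdual x : D := rdual_of (ftcat_rigid D) x.
Definition rev x : hom (rdual x ⊗ x) (unitc D) := rev_of (ftcat_rigid D) x.
Definition rcoev x : hom (unitc D) (x ⊗ rdual x) := rcoev_of (ftcat_rigid D) x.
Definition ldual x : D := ldual_of (ftcat_rigid D) x.
Definition lev x : hom (x ⊗ ldual x) (unitc D) := lev_of (ftcat_rigid D) x.
Definition lcoev x : hom (unitc D) (ldual x ⊗ x) := lcoev_of (ftcat_rigid D) x.

Local Notation "x ^v" := (rdual x) (at level 2, format "x ^v").

(* The morphism w -> x^∨ with pairing g. *)
Definition rcurry w x (g : hom (w ⊗ x) (unitc D)) : hom w x^v :=
  lunit _ ∘ (g ⊠ idm x^v) ∘ hinv (assoc w x x^v) ∘ (idm w ⊠ rcoev x)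
    ∘ hinv (runit w).

(* The morphism w -> ^∨x with pairing g. *)
Definition lcurry w x (g : hom (x ⊗ w) (unitc D)) : hom w (ldual x) :=
  runit _ ∘ (idm (ldual x) ⊠ g) ∘ assoc (ldual x) x w ∘ (lcoev x ⊠ idm w)
    ∘ hinv (lunit w).

Definition rdualm x y (f : hom x y) : hom y^v x^v :=
  rcurry (rev y ∘ (idm y^v ⊠ f)).

Definition rdual_tens c d : hom (d^v ⊗ c^v) (c ⊗ d)^v :=
  rcurry (rev d ∘ (idm d^v ⊠ (lunit d ∘ (rev c ⊠ idm d)
      ∘ hinv (assoc c^v c d))) ∘ assoc d^v c^v (c ⊗ d)).

Definition rdual_one : hom (unitc D) (unitc D)^v := rcurry (lunit (unitc D)).

Record pivotal := Pivotal {
  piv :> forall c, hom c c^v^v;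
  piv_iso : forall c, is_iso (piv c);
  piv_nat : forall c d (f : hom c d),
    piv d ∘ f = rdualm (rdualm f) ∘ piv c;
  (* the monoidal structure of the double dual is
     c^∨∨ ⊗ d^∨∨ -> (d^∨ ⊗ c^∨)^∨ <- (c ⊗ d)^∨∨ *)
  piv_tens : forall c d,
    rdualm (rdual_tens c d) ∘ piv (c ⊗ d)
    = rdual_tens d^v c^v ∘ (piv c ⊠ piv d);
  piv_one : rdualm rdual_one ∘ piv (unitc D) = rdual_one }.

(* The isomorphism N^r(c ⊗ m) ≅ ^∨∨c ⊗ N^r(m) for c = x^∨∨ and m = 1;
   here - ⊗ x^∨∨ (on the left) has right adjoint x^∨ ⊗ -, which in turn has
   right adjoint x ⊗ -, i.e. ^∨∨(x^∨∨) is taken to be x. *)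
Definition nakr_tensl x (N1 : nakr (unitc D)) (Nx : nakr x^v^v) :
    hom Nx (x ⊗ N1) :=
  nak_mate N1 Nx (fun z => x^v ⊗ z)
    (fun z w => lunit z ∘ (rev x^v ⊠ idm z) ∘ hinv (assoc x^v^v x^v z)
                  ∘ (idm x^v^v ⊠ w) ∘ hinv (runit x^v^v))
    (fun z h => (idm x ⊠ h) ∘ assoc x x^v z ∘ (rcoev x ⊠ idm z)
                  ∘ hinv (lunit z)).

(* The isomorphism N^r(x ⊗ y) ≅ N^r(x) ⊗ y^∨∨ for x = 1. *)
Definition nakr_tensr y (N1 : nakr (unitc D)) (Ny : nakr y) :
    hom Ny (N1 ⊗ y^v^v) :=
  nak_mate N1 Ny (fun z => z ⊗ y^v)
    (fun z w => runit z ∘ (idm z ⊠ rev y) ∘ assoc z y^v y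
                  ∘ (w ⊠ idm y) ∘ hinv (lunit y))
    (fun z h => (h ⊠ idm y^v^v) ∘ hinv (assoc z y^v y^v^v)
                  ∘ (idm z ⊠ rcoev y^v) ∘ hinv (runit z)).

(* The Radford isomorphism Dl ⊗ x -> x^∨∨∨∨ ⊗ Dl, where Dl = N^l(1) has
   inverse Di = N^r(1) through eps : Dl ⊗ Di ≅ 1: it is obtained by moving
   both copies of Di in  x ⊗ Di ≅ N^r(x^∨∨) ≅ Di ⊗ x^∨∨∨∨  to the other
   side. *)
Definition radford (Dl : nakl (unitc D)) (Di : nakr (unitc D))
    (eps : hom (Dl ⊗ Di) (unitc D)) x (Nx : nakr x^v^v) :
    hom (Dl ⊗ x) (x^v^v^v^v ⊗ Dl) :=
  the_mor (fun R =>
    runit _ ∘ (idm _ ⊠ eps) ∘ assoc _ _ _ ∘ (R ⊠ idm Di)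
    = lunit _ ∘ (eps ⊠ idm _) ∘ hinv (assoc _ _ _)
        ∘ (idm Dl ⊠ (nakr_tensr Di Nx ∘ hinv (nakr_tensl Di Nx)))
        ∘ assoc Dl x Di).

Definition unimodular : Prop :=
  exists (Dl : nakl (unitc D)) (f : hom (unitc D) Dl), is_iso f.

(* Neither the choice of representatives of N^l(1) and N^r, nor that of eps
   and u, matters: the latter two are unique up to a scalar, which cancels. *)
Definition spherical (p : pivotal) : Prop :=
  unimodular
  /\ exists (Dl : nakl (unitc D)) (Di : nakr (unitc D)) (N : forall x, nakr x^v^v)
       (eps : hom (Dl ⊗ Di) (unitc D)) (u : hom (unitc D) Dl),
     [/\ is_iso eps, is_iso u
       & forall x,
           radford eps (N x) ∘ (u ⊠ idm x) ∘ hinv (lunit x)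
           = (idm _ ⊠ u) ∘ hinv (runit _) ∘ (p x^v^v ∘ p x)].

End Duals.

Notation "x ^v" := (rdual x) (at level 2, format "x ^v").

Record modcat k (D : ftcat k) := ModCat {
  modcat_cat :> lincat k;
  modcat_finite : is_finite modcat_cat;
  act : D -> modcat_cat -> modcat_cat
    where "d ▷ m" := (act d m);
  actm : forall c d m n, hom c d -> hom m n -> hom (c ▷ m) (d ▷ n)
    where "f ▶ g" := (actm f g);
  actm1 : forall d m, idm d ▶ idm m = idm (d ▷ m);
  actmM : forall c c' c'' m m' m'' (f : hom c' c'') (f' : hom c c')
      (g : hom m' m'') (g' : hom m m'),
    (f ∘ f') ▶ (g ∘ g') = (f ▶ g) ∘ (f' ▶ g');
  actmPl : forall c d m n a (f f' : hom c d) (g : hom m n),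
    (a *: f + f') ▶ g = a *: (f ▶ g) + f' ▶ g;
  actmPr : forall c d m n a (f : hom c d) (g g' : hom m n),
    f ▶ (a *: g + g') = a *: (f ▶ g) + f ▶ g';
  act_exactl : forall m (x y z : D) (f : hom x y) (g : hom y z),
    short_exact f g -> short_exact (f ▶ idm m) (g ▶ idm m);
  act_exactr : forall d (x y z : modcat_cat) (f : hom x y) (g : hom y z),
    short_exact f g -> short_exact (idm d ▶ f) (idm d ▶ g);
  mass : forall c d m, hom ((c ⊗ d) ▷ m) (c ▷ (d ▷ m));
  mass_iso : forall c d m, is_iso (mass c d m);
  mass_nat : forall c c' d d' m m' (f : hom c c') (g : hom d d') (h : hom m m'),
    mass c' d' m' ∘ ((f ⊠ g) ▶ h) = (f ▶ (g ▶ h)) ∘ mass c d m;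
  munit : forall m, hom (unitc D ▷ m) m;
  munit_iso : forall m, is_iso (munit m);
  munit_nat : forall m n (f : hom m n),
    munit n ∘ (idm (unitc D) ▶ f) = f ∘ munit m;
  mpentagon : forall c d e m,
    mass c d (e ▷ m) ∘ mass (c ⊗ d) e m
    = (idm c ▶ mass d e m) ∘ mass c (d ⊗ e) m ∘ (assoc c d e ▶ idm m);
  mtriangle : forall c m,
    (idm c ▶ munit m) ∘ mass c (unitc D) m = runit c ▶ idm m }.

Arguments act {k D M} d m : rename.
Arguments actm {k D M c d m n} f g : rename.
Arguments mass {k D M} c d m : rename.
Arguments munit {k D M} m : rename.
Notation "d ▷ m" := (act d m).
Notation "f ▶ g" := (actm f g).

Definition exact_module k (D : ftcat k) (M : modcat D) : Prop :=
  forall (p : D) (m : M), is_projective p -> is_projective (p ▷ m).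

Section ModEnd.
Variables (k : fieldType) (D : ftcat k) (M : modcat D).

Record modfun := ModFun {
  mf_fun :> functor M M;
  mf_str : forall (d : D) m, hom (mf_fun (d ▷ m)) (d ▷ mf_fun m);
  mf_iso : forall d m, is_iso (mf_str d m);
  mf_nat : forall (c d : D) (m n : M) (f : hom c d) (g : hom m n),
    mf_str d n ∘ fmor mf_fun (f ▶ g) = (f ▶ fmor mf_fun g) ∘ mf_str c m;
  mf_ass : forall c d m,
    mass c d (mf_fun m) ∘ mf_str (c ⊗ d) m
    = (idm c ▶ mf_str d m) ∘ mf_str c (d ▷ m) ∘ fmor mf_fun (mass c d m);
  mf_unit : forall m,
    munit (mf_fun m) ∘ mf_str (unitc D) m = fmor mf_fun (munit m) }.

Record modnat (G H : modfun) := ModNat {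
  mn_fun :> forall m, hom (G m) (H m);
  mn_nat : forall m n (f : hom m n), mn_fun n ∘ fmor G f = fmor H f ∘ mn_fun m;
  mn_mod : forall (d : D) m,
    mf_str H d m ∘ mn_fun (d ▷ m) = (idm d ▶ mn_fun m) ∘ mf_str G d m }.

Lemma modnatP (G H : modfun) (s t : modnat G H) : (forall m, s m = t m) -> s = t.
Proof.
case: s t => s s1 s2 [t t1 t2] /= st.
have e : s = t by apply: functional_extensionality_dep.
by subst t; congr ModNat; apply: Prop_irrelevance.
Qed.

Lemma actm0r (c d : D) (m n : M) (f : hom c d) : f ▶ (0 : hom m n) = 0.
Proof.
have := actmPr 1 f (0 : hom m n) 0.
rewrite !scale1r addr0 => /(congr1 (fun u => u - f ▶ (0 : hom m n))).
by rewrite subrr addrK.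
Qed.

Section HomSpace.
Variables G H : modfun.

Program Definition modnat0 : modnat G H := @ModNat G H (fun _ => 0) _ _.
Next Obligation. by rewrite comp0l comp0r. Qed.
Next Obligation. by rewrite actm0r comp0l comp0r. Qed.

(* a s + t *)
Program Definition modnat_lin (a : k) (s t : modnat G H) : modnat G H :=
  @ModNat G H (fun m => a *: s m + t m) _ _.
Next Obligation. by rewrite compPl compPr !mn_nat. Qed.
Next Obligation. by rewrite compPr actmPr compPl !mn_mod. Qed.

Definition modnat_add (s t : modnat G H) := modnat_lin 1 s t.
Definition modnat_opp (s : modnat G H) := modnat_lin (-1) s modnat0.
Definition modnat_scale a (s : modnat G H) := modnat_lin a s modnat0.

HB.instance Definition _ := gen_eqMixin (modnat G H).
HB.instance Definition _ := gen_choiceMixin (modnat G H).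

Fact modnat_addA : associative modnat_add.
Proof. by move=> r s t; apply: modnatP => m /=; rewrite !scale1r addrA. Qed.
Fact modnat_addC : commutative modnat_add.
Proof. by move=> s t; apply: modnatP => m /=; rewrite !scale1r addrC. Qed.
Fact modnat_add0 : left_id modnat0 modnat_add.
Proof. by move=> s; apply: modnatP => m /=; rewrite scale1r add0r. Qed.
Fact modnat_addN : left_inverse modnat0 modnat_opp modnat_add.
Proof.
by move=> s; apply: modnatP => m /=; rewrite scale1r addr0 scaleN1r addNr.
Qed.
HB.instance Definition _ :=
  GRing.isZmodule.Build (modnat G H)
    modnat_addA modnat_addC modnat_add0 modnat_addN.

Fact modnat_scaleA a b (s : modnat G H) :
  modnat_scale a (modnat_scale b s) = modnat_scale (a * b) s.
Proof. by apply: modnatP => m /=; rewrite !addr0 scalerA. Qed.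
Fact modnat_scale1 : left_id 1 modnat_scale.
Proof. by move=> s; apply: modnatP => m /=; rewrite addr0 scale1r. Qed.
Fact modnat_scaleDr : right_distributive modnat_scale +%R.
Proof.
by move=> a s t; apply: modnatP => m /=; rewrite !addr0 !scale1r scalerDr.
Qed.
Fact modnat_scaleDl s : {morph modnat_scale^~ s : a b / a + b}.
Proof. by move=> a b; apply: modnatP => m /=; rewrite !addr0 !scale1r scalerDl. Qed.
HB.instance Definition _ :=
  GRing.Zmodule_isLmodule.Build k (modnat G H)
    modnat_scaleA modnat_scale1 modnat_scaleDr modnat_scaleDl.

End HomSpace.

Program Definition modnat_id (G : modfun) : modnat G G :=
  @ModNat G G (fun m => idm (G m)) _ _.
Next Obligation. by rewrite comp1m compm1. Qed.
Next Obligation. by rewrite actm1 comp1m compm1. Qed.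

Program Definition modnat_comp (G H K : modfun) (s : modnat H K)
    (t : modnat G H) : modnat G K :=
  @ModNat G K (fun m => s m ∘ t m) _ _.
Next Obligation. by rewrite -compA mn_nat compA mn_nat -compA. Qed.
Next Obligation.
rewrite compA mn_mod -compA mn_mod compA.
by rewrite -actmM comp1m.
Qed.

Fact modnat_compA G H K L (f : modnat K L) (g : modnat H K) (h : modnat G H) :
  modnat_comp f (modnat_comp g h) = modnat_comp (modnat_comp f g) h.
Proof. by apply: modnatP => m; apply: compA. Qed.
Fact modnat_comp1m G H (f : modnat G H) : modnat_comp (modnat_id H) f = f.
Proof. by apply: modnatP => m; apply: comp1m. Qed.
Fact modnat_compm1 G H (f : modnat G H) : modnat_comp f (modnat_id G) = f.
Proof. by apply: modnatP => m; apply: compm1. Qed.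
Fact modnat_compPl G H K a (f f' : modnat H K) (g : modnat G H) :
  modnat_comp (a *: f + f') g = a *: modnat_comp f g + modnat_comp f' g.
Proof. by apply: modnatP => m /=; rewrite !scale1r !addr0 compPl. Qed.
Fact modnat_compPr G H K a (f : modnat H K) (g g' : modnat G H) :
  modnat_comp f (a *: g + g') = a *: modnat_comp f g + modnat_comp f g'.
Proof. by apply: modnatP => m /=; rewrite !scale1r !addr0 compPr. Qed.

(* The dual category D^*_M = Fun_D(M,M). *)
Definition modend : lincat k :=
  LinCat modnat_compA modnat_comp1m modnat_compm1 modnat_compPl modnat_compPr.

Program Definition functor_id : functor M M := @Functor k M M id (fun _ _ f => f) _ _ _.

Program Definition modfun_id : modfun :=
  @ModFun functor_id (fun d m => idm (d ▷ m)) _ _ _ _.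
Next Obligation. by exists (idm _); split; rewrite comp1m. Qed.
Next Obligation. by rewrite comp1m compm1. Qed.
Next Obligation. by rewrite actm1 !comp1m compm1. Qed.
Next Obligation. by rewrite compm1. Qed.

(* The unit object of the dual category. *)
Definition dual_one : modend := modfun_id.

(* A unimodular structure on M is such an isomorphism f. *)
Definition unimodular_module : Prop :=
  exact_module M
  /\ exists (Dl : nakl dual_one) (f : hom dual_one Dl), is_iso f.

End ModEnd.

Record tfunctor k (C D : ftcat k) := TFunctor {
  tf_fun :> functor C D;
  tf_exact : exact tf_fun;
  tf_mul : forall c d, hom (tf_fun c ⊗ tf_fun d) (tf_fun (c ⊗ d));
  tf_mul_iso : forall c d, is_iso (tf_mul c d);
  tf_mul_nat : forall c c' d d' (f : hom c c') (g : hom d d'),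
    tf_mul c' d' ∘ (fmor tf_fun f ⊠ fmor tf_fun g)
    = fmor tf_fun (f ⊠ g) ∘ tf_mul c d;
  tf_one : hom (unitc D) (tf_fun (unitc C));
  tf_one_iso : is_iso tf_one;
  tf_assoc : forall c d e,
    tf_mul c (d ⊗ e) ∘ (idm (tf_fun c) ⊠ tf_mul d e)
      ∘ assoc (tf_fun c) (tf_fun d) (tf_fun e)
    = fmor tf_fun (assoc c d e) ∘ tf_mul (c ⊗ d) e
      ∘ (tf_mul c d ⊠ idm (tf_fun e));
  tf_lunit : forall c,
    fmor tf_fun (lunit c) ∘ tf_mul (unitc C) c ∘ (tf_one ⊠ idm (tf_fun c))
    = lunit (tf_fun c);
  tf_runit : forall c,
    fmor tf_fun (runit c) ∘ tf_mul c (unitc C) ∘ (idm (tf_fun c) ⊠ tf_one)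
    = runit (tf_fun c) }.

Arguments tf_mul {k C D} F c d : rename.
Arguments tf_one {k C D} F : rename.

Section Pullback.
Variables (k : fieldType) (C D : ftcat k) (F : tfunctor C D) (M : modcat D).

Definition pb_act (c : C) (m : M) : M := F c ▷ m.
Definition pb_actm (c d : C) (m n : M) (f : hom c d) (g : hom m n) :
  hom (pb_act c m) (pb_act d n) := fmor F f ▶ g.
Definition pb_mass (c d : C) (m : M) :
    hom (pb_act (c ⊗ d) m) (pb_act c (pb_act d m)) :=
  mass (F c) (F d) m ∘ (hinv (tf_mul F c d) ▶ idm m).
Definition pb_munit (m : M) : hom (pb_act (unitc C) m) m :=
  munit m ∘ (hinv (tf_one F) ▶ idm m).

Fact is_iso_actm (c d : D) (m n : M) (f : hom c d) (g : hom m n) :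
  is_iso f -> is_iso g -> is_iso (f ▶ g).
Proof.
move=> [f' [ff' f'f]] [g' [gg' g'g]]; exists (f' ▶ g').
by split; rewrite -actmM ?ff' ?f'f ?gg' ?g'g actm1.
Qed.

Fact is_iso_id (A : lincat k) (x : A) : is_iso (idm x).
Proof. by exists (idm x); split; rewrite comp1m. Qed.

Fact pb_actm1 (d : C) (m : M) : pb_actm (idm d) (idm m) = idm (pb_act d m).
Proof. by rewrite /pb_actm fmor1 actm1. Qed.

Fact pb_actmM (c c' c'' : C) (m m' m'' : M) (f : hom c' c'') (f' : hom c c')
    (g : hom m' m'') (g' : hom m m') :
  pb_actm (f ∘ f') (g ∘ g') = pb_actm f g ∘ pb_actm f' g'.
Proof. by rewrite /pb_actm fmorM actmM. Qed.

Fact pb_actmPl (c d : C) (m n : M) a (f f' : hom c d) (g : hom m n) :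
  pb_actm (a *: f + f') g = a *: pb_actm f g + pb_actm f' g.
Proof. by rewrite /pb_actm fmorP actmPl. Qed.

Fact pb_actmPr (c d : C) (m n : M) a (f : hom c d) (g g' : hom m n) :
  pb_actm f (a *: g + g') = a *: pb_actm f g + pb_actm f g'.
Proof. by rewrite /pb_actm actmPr. Qed.

Fact pb_act_exactl (m : M) (x y z : C) (f : hom x y) (g : hom y z) :
  short_exact f g -> short_exact (pb_actm f (idm m)) (pb_actm g (idm m)).
Proof. by move=> fg; apply: act_exactl; apply: tf_exact. Qed.

Fact pb_act_exactr (d : C) (x y z : M) (f : hom x y) (g : hom y z) :
  short_exact f g -> short_exact (pb_actm (idm d) f) (pb_actm (idm d) g).
Proof. by move=> fg; rewrite /pb_actm fmor1; apply: act_exactr. Qed.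

Fact pb_mass_iso (c d : C) (m : M) : is_iso (pb_mass c d m).
Proof.
apply: is_iso_comp; first exact: mass_iso.
apply: is_iso_actm; last exact: is_iso_id.
by apply: is_iso_hinv; apply: tf_mul_iso.
Qed.

Fact hinv_nat (A : lincat k) (x x' y y' : A) (f : hom x y) (f' : hom x' y')
    (g : hom x x') (h : hom y y') :
  is_iso f -> is_iso f' -> f' ∘ g = h ∘ f -> hinv f' ∘ h = g ∘ hinv f.
Proof.
move=> fi fi' e; apply: (iso_cancel fi); rewrite -!compA hinvK // compm1 -e.
by rewrite compA hinvK // comp1m.
Qed.

Fact pb_mass_nat (c c' d d' : C) (m m' : M) (f : hom c c') (g : hom d d')
    (h : hom m m') :
  pb_mass c' d' m' ∘ pb_actm (f ⊠ g) h
  = pb_actm f (pb_actm g h) ∘ pb_mass c d m.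
Proof.
rewrite /pb_mass /pb_actm -compA -actmM comp1m.
have -> : hinv (tf_mul F c' d') ∘ fmor F (f ⊠ g)
    = (fmor F f ⊠ fmor F g) ∘ hinv (tf_mul F c d).
  by apply: hinv_nat; [apply: tf_mul_iso..|apply: tf_mul_nat].
by rewrite -{1}(compm1 h) actmM compA mass_nat -!compA.
Qed.

Fact pb_munit_iso (m : M) : is_iso (pb_munit m).
Proof.
apply: is_iso_comp; first exact: munit_iso.
apply: is_iso_actm; last exact: is_iso_id.
by apply: is_iso_hinv; apply: tf_one_iso.
Qed.

Fact pb_munit_nat (m n : M) (f : hom m n) :
  pb_munit n ∘ pb_actm (idm (unitc C)) f = f ∘ pb_munit m.
Proof.
rewrite /pb_munit /pb_actm fmor1 -compA -actmM comp1m compm1.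
rewrite compA -munit_nat -compA -actmM comp1m compm1 //.
Qed.

Fact tf_assoc_inv (c d e : C) :
  (idm (F c) ⊠ hinv (tf_mul F d e)) ∘ hinv (tf_mul F c (d ⊗ e))
    ∘ fmor F (assoc c d e)
  = assoc (F c) (F d) (F e) ∘ (hinv (tf_mul F c d) ⊠ idm (F e))
    ∘ hinv (tf_mul F (c ⊗ d) e).
Proof.
apply: (@iso_cancel _ _ _ _ _ (tf_mul F (c ⊗ d) e)); first exact: tf_mul_iso.
rewrite -[in RHS]compA hinvK ?compm1; last exact: tf_mul_iso.
apply: (@iso_cancel _ _ _ _ _ (tf_mul F c d ⊠ idm (F e))).
  have [g [h1 h2]] := tf_mul_iso F c d.
  by exists (g ⊠ idm _); split; rewrite -tensmM ?h1 ?h2 comp1m tensm1.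
rewrite -[in RHS]compA -tensmM hinvK; last exact: tf_mul_iso.
rewrite comp1m tensm1 compm1 -!compA (compA (fmor F _)) -tf_assoc.
rewrite !compA -(compA _ _ (tf_mul F c (d ⊗ e))) hinvK; last exact: tf_mul_iso.
rewrite compm1 -tensmM hinvK; last exact: tf_mul_iso.
by rewrite comp1m tensm1 comp1m.
Qed.

Fact pb_pentagon (c d e : C) (m : M) :
  pb_mass c d (pb_act e m) ∘ pb_mass (c ⊗ d) e m
  = pb_actm (idm c) (pb_mass d e m) ∘ pb_mass c (d ⊗ e) m
    ∘ pb_actm (assoc c d e) (idm m).
Proof.
rewrite /pb_mass /pb_actm /pb_act fmor1.
have -> : mass (F c) (F d) (F e ▷ m)
    ∘ (hinv (tf_mul F c d) ▶ idm (F e ▷ m))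
    ∘ (mass (F (c ⊗ d)) (F e) m ∘ (hinv (tf_mul F (c ⊗ d) e) ▶ idm m))
  = mass (F c) (F d) (F e ▷ m) ∘ mass (F c ⊗ F d) (F e) m
    ∘ (((hinv (tf_mul F c d) ⊠ idm (F e)) ∘ hinv (tf_mul F (c ⊗ d) e))
         ▶ idm m).
  rewrite -{2}(comp1m (idm m)) actmM !compA; congr (_ ∘ _).
  by rewrite -!compA -actm1 mass_nat.
rewrite mpentagon.
have -> : idm (F c) ▶ (mass (F d) (F e) m ∘ (hinv (tf_mul F d e) ▶ idm m))
  = (idm (F c) ▶ mass (F d) (F e) m)
    ∘ (idm (F c) ▶ (hinv (tf_mul F d e) ▶ idm m)).
  by rewrite -actmM comp1m.
rewrite -!compA; congr (_ ∘ _).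
rewrite (compA (idm (F c) ▶ (_ ▶ _))) -mass_nat -!compA; congr (_ ∘ _).
by rewrite -!actmM !comp1m !compA tf_assoc_inv.
Qed.

Fact pb_triangle (c : C) (m : M) :
  pb_actm (idm c) (pb_munit m) ∘ pb_mass c (unitc C) m
  = pb_actm (runit c) (idm m).
Proof.
rewrite /pb_mass /pb_actm /pb_act /pb_munit fmor1.
have -> : idm (F c) ▶ (munit m ∘ (hinv (tf_one F) ▶ idm m))
  = (idm (F c) ▶ munit m) ∘ (idm (F c) ▶ (hinv (tf_one F) ▶ idm m)).
  by rewrite -actmM comp1m.
rewrite -!compA (compA (idm (F c) ▶ (_ ▶ _))) -mass_nat !compA mtriangle.
rewrite -!actmM !comp1m; congr (_ ▶ _).
apply: (@iso_cancel _ _ _ _ _ (tf_mul F c (unitc C))); first exact: tf_mul_iso.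
rewrite -compA hinvK; last exact: tf_mul_iso.
rewrite compm1.
apply: (@iso_cancel _ _ _ _ _ (idm (F c) ⊠ tf_one F)).
  have [g [h1 h2]] := tf_one_iso F.
  by exists (idm _ ⊠ g); split; rewrite -tensmM ?h1 ?h2 comp1m tensm1.
rewrite tf_runit -compA -tensmM hinvK; last exact: tf_one_iso.
by rewrite comp1m tensm1 compm1.
Qed.

(* The C-module category _F M. *)
Definition pullback : modcat C :=
  @ModCat k C M (modcat_finite M) pb_act pb_actm pb_actm1 pb_actmM
    pb_actmPl pb_actmPr pb_act_exactl pb_act_exactr pb_mass pb_mass_iso
    pb_mass_nat pb_munit pb_munit_iso pb_munit_nat pb_pentagon pb_triangle.

End Pullback.

Definition perfect k (C D : ftcat k) (F : tfunctor C D) : Prop :=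
  exists (R : functor D C) (aR : adjunction F R), exact R.

Section PivotalFunctor.
Variables (k : fieldType) (C D : ftcat k) (F : tfunctor C D).

Definition tf_rdual (c : C) : hom (F c^v) (F c)^v :=
  rcurry (hinv (tf_one F) ∘ fmor F (rev c) ∘ tf_mul F c^v c).

Definition pivotal_functor (pC : pivotal C) (pD : pivotal D) : Prop :=
  forall c : C, rdualm (tf_rdual c) ∘ pD (F c) = tf_rdual c^v ∘ fmor F (pC c).

End PivotalFunctor.

Section Adjoints.
Variables (k : fieldType) (C D : ftcat k) (F : tfunctor C D).

(* The C-bimodule structure of a left adjoint L : _F D_F -> C. *)
Section Left.
Variables (L : functor D C) (aL : adjunction L F).

Definition la_l (c : C) (d : D) : hom (L (F c ⊗ d)) (c ⊗ L d) :=
  acounit aL (c ⊗ L d) ∘ fmor L (tf_mul F c (L d) ∘ (idm (F c) ⊠ aunit aL d)).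

Definition la_r (d : D) (c : C) : hom (L (d ⊗ F c)) (L d ⊗ c) :=
  acounit aL (L d ⊗ c) ∘ fmor L (tf_mul F (L d) c ∘ (aunit aL d ⊠ idm (F c))).

End Left.

(* The C-bimodule structure of a right adjoint R : _F D_F -> C, with the
   inverses given by the adjunction. *)
Section Right.
Variables (R : functor D C) (aR : adjunction F R).

Definition ra_l_inv (c : C) (d : D) : hom (c ⊗ R d) (R (F c ⊗ d)) :=
  fmor R ((idm (F c) ⊠ acounit aR d) ∘ hinv (tf_mul F c (R d)))
    ∘ aunit aR (c ⊗ R d).

Definition ra_r_inv (d : D) (c : C) : hom (R d ⊗ c) (R (d ⊗ F c)) :=
  fmor R ((acounit aR d ⊠ idm (F c)) ∘ hinv (tf_mul F (R d) c))
    ∘ aunit aR (R d ⊗ c).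

Definition ra_l c d : hom (R (F c ⊗ d)) (c ⊗ R d) := hinv (ra_l_inv c d).
Definition ra_r d c : hom (R (d ⊗ F c)) (R d ⊗ c) := hinv (ra_r_inv d c).

(* The C-bimodule structure of a right adjoint RR : C -> _F D_F of R. *)
Variables (RR : functor C D) (aRR : adjunction R RR).

Definition rra_l_inv (c c' : C) : hom (F c ⊗ RR c') (RR (c ⊗ c')) :=
  fmor RR ((idm c ⊠ acounit aRR c') ∘ ra_l c (RR c'))
    ∘ aunit aRR (F c ⊗ RR c').

Definition rra_r_inv (c' c : C) : hom (RR c' ⊗ F c) (RR (c' ⊗ c)) :=
  fmor RR ((acounit aRR c' ⊠ idm c) ∘ ra_r (RR c') c)
    ∘ aunit aRR (RR c' ⊗ F c).

Definition chi : D := RR (unitc C).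

Definition half_braiding (c : C) : hom (chi ⊗ F c) (F c ⊗ chi) :=
  hinv (rra_l_inv c (unitc C)) ∘ fmor RR (hinv (runit c) ∘ lunit c)
    ∘ rra_r_inv (unitc C) c.

(* t is an isomorphism from 1 with trivial half-braiding to chi. *)
Definition chi_trivialization (t : hom (unitc D) chi) : Prop :=
  is_iso t
  /\ forall c : C,
       half_braiding c ∘ (t ⊠ idm (F c)) ∘ hinv (lunit (F c))
       = (idm (F c) ⊠ t) ∘ hinv (runit (F c)).

(* The isomorphism N^r_D(1) ≅ N^r_D(F 1) ≅ RR(N^r_C(1)). *)
Definition nakr_rra (EC : nakr (unitc C)) (ED : nakr (unitc D)) :
    hom ED (RR EC) :=
  nak_mate EC ED (fun y => R y)
    (fun y w => acounit aR y ∘ fmor F w ∘ tf_one F)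
    (fun y h => fmor RR h ∘ aunit aRR y).

(* F(u) : 1 ≅ F(N^r_C(1)) ≅ F(N^r_C(1)) ⊗ chi ≅ RR(N^r_C(1)) ≅ N^r_D(1). *)
Definition transport_one (t : hom (unitc D) chi) (EC : nakr (unitc C))
    (ED : nakr (unitc D)) (u : hom (unitc C) EC) : hom (unitc D) ED :=
  hinv (nakr_rra EC ED) ∘ fmor RR (runit EC) ∘ rra_l_inv EC (unitc C)
    ∘ (idm (F EC) ⊠ t) ∘ hinv (runit (F EC)) ∘ fmor F u ∘ tf_one F.

End Right.

Definition tensor_frobenius : Prop :=
  exists (L R : functor D C) (aL : adjunction L F) (aR : adjunction F R)
    (phi : forall d : D, hom (L d) (R d)),
    [/\ forall d, is_iso (phi d),
        forall (d d' : D) (f : hom d d'), phi d' ∘ fmor L f = fmor R f ∘ phi d,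
        forall (c : C) (d : D),
          ra_l aR c d ∘ phi (F c ⊗ d) = (idm c ⊠ phi d) ∘ la_l aL c d
      & forall (c : C) (d : D),
          ra_r aR d c ∘ phi (d ⊗ F c) = (phi d ⊠ idm c) ∘ la_r aL d c].

End Adjoints.

Record ihom k (D : ftcat k) (M : modcat D) (m n : M) := IHom {
  ih_obj :> D;
  ih_ev : hom (ih_obj ▷ m) n;
  ih_univ : forall (d : D) (f : hom (d ▷ m) n),
    exists! g : hom d ih_obj, ih_ev ∘ (g ▶ idm m) = f }.

Section InternalHom.
Variables (k : fieldType) (D : ftcat k) (M : modcat D).
Variable H : forall m n : M, ihom m n.
Implicit Types (c d : D) (m n p : M).

Definition icurry d m n (f : hom (d ▷ m) n) : hom d (H m n) :=
  the_mor (fun g => ih_ev (H m n) ∘ (g ▶ idm m) = f).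

Definition ipost m n n' (g : hom n n') : hom (H m n) (H m n') :=
  icurry (g ∘ ih_ev (H m n)).

Definition ipre m' m n (f : hom m' m) : hom (H m n) (H m' n) :=
  icurry (ih_ev (H m n) ∘ (idm _ ▶ f)).

Definition iid m : hom (unitc D) (H m m) := icurry (munit m).

Definition icomp m n p : hom (H n p ⊗ H m n) (H m p) :=
  icurry (ih_ev (H n p) ∘ (idm _ ▶ ih_ev (H m n)) ∘ mass _ _ m).

Definition istr d m n : hom (d ⊗ H m n) (H m (d ▷ n)) :=
  icurry ((idm d ▶ ih_ev (H m n)) ∘ mass d _ m).

Definition icostr d m n : hom (H m n ⊗ d^v) (H (d ▷ m) n) :=
  icurry (ih_ev (H m n)
    ∘ (idm _ ▶ (munit m ∘ (rev d ▶ idm m) ∘ hinv (mass d^v d m)))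
    ∘ mass (H m n) d^v (d ▷ m)).

End InternalHom.

Arguments ipost {k D M} H m {n n'} g.
Arguments ipre {k D M} H {m' m} n f.

(* Internal Homs, and a relative Serre functor S with a quasi-inverse.
   sr_bal is D-linearity in n of the isomorphisms
   Hom(m,n)^∨ ≅ Hom(n,S m), expressed for the corresponding pairings
   Hom(n,S m) ⊗ Hom(m,n) -> 1; it is what makes S canonically twisted. *)
Section Serre.
Variables (k : fieldType) (D : ftcat k) (M : modcat D).

Definition ipairing (H : forall m n : M, ihom m n) (S : M -> M)
    (phi : forall m n, hom (H m n)^v (H n (S m))) (m n : M) :
    hom (H n (S m) ⊗ H m n) (unitc D) :=
  rev (H m n) ∘ (hinv (phi m n) ⊠ idm _).

Record serre := Serre {
  sr_hom : forall m n : M, ihom m n;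
  sr_fun :> functor M M;
  sr_inv : functor M M;
  sr_adj : adjunction sr_inv sr_fun;
  sr_unit_iso : forall m, is_iso (aunit sr_adj m);
  sr_counit_iso : forall m, is_iso (acounit sr_adj m);
  sr_phi : forall m n, hom (sr_hom m n)^v (sr_hom n (sr_fun m));
  sr_phi_iso : forall m n, is_iso (sr_phi m n);
  sr_phi_natr : forall m n n' (g : hom n n'),
    sr_phi m n ∘ rdualm (ipost sr_hom m g)
    = ipre sr_hom (sr_fun m) g ∘ sr_phi m n';
  sr_phi_natl : forall m m' n (f : hom m m'),
    sr_phi m' n ∘ rdualm (ipre sr_hom n f)
    = ipost sr_hom n (fmor sr_fun f) ∘ sr_phi m n;
  sr_bal : forall m n n',
    ipairing sr_phi m n' ∘ (idm _ ⊠ icomp sr_hom m n n') ∘ assoc _ _ _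
    = ipairing sr_phi m n ∘ (icomp sr_hom n n' (sr_fun m) ⊠ idm _) }.

Variable S : serre.
Local Notation H := (sr_hom S).
Local Notation Sb := (sr_inv S).

Definition serre_tr (m : M) : hom (H m (S m)) (unitc D) :=
  ipairing (sr_phi S) m m ∘ (idm _ ⊠ iid H m) ∘ hinv (runit _).

(* The isomorphism d^∨∨ ▷ S m -> S(d ▷ m) induced by
   Hom(n, d^∨∨ ▷ S m) ≅ d^∨∨ ⊗ Hom(m,n)^∨ ≅ Hom(d ▷ m, n)^∨ ≅ Hom(n, S(d ▷ m)),
   read off at the level of traces. *)
Definition serre_twist (d : D) (m : M) : hom (d^v^v ▷ S m) (S (d ▷ m)) :=
  the_mor (fun tw =>
    serre_tr (d ▷ m) ∘ ipost H (d ▷ m) tw ∘ istr H d^v^v (d ▷ m) (S m)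
      ∘ (idm d^v^v ⊠ icostr H d m (S m))
    = rev d^v ∘ (idm d^v^v ⊠ (lunit d^v ∘ (serre_tr m ⊠ idm d^v)))).

Definition pivotal_structure (p : pivotal D) (pt : forall m, hom m (S m)) :
    Prop :=
  [/\ forall m, is_iso (pt m),
      forall m n (f : hom m n), pt n ∘ f = fmor S f ∘ pt m
    & forall (d : D) m,
        pt (d ▷ m) = serre_twist d m ∘ (p d ▶ idm (S m)) ∘ (idm d ▶ pt m)].

(* The isomorphism N^r(m) ≅ N^r_D(1) ▷ S m: the functor - ▷ m from D to M has
   right adjoint Hom(m,-), which has right adjoint - ▷ S m. *)
Definition nakr_serre (E : nakr (unitc D)) m (Nm : nakr m) : hom Nm (E ▷ S m) :=
  nak_mate E Nm (fun n => H m n)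
    (fun n w => ih_ev (H m n) ∘ (w ▶ idm m) ∘ hinv (munit m))
    (fun n h => the_mor (fun g : hom n (E ▷ S m) =>
       runit E ∘ (idm E ⊠ serre_tr m) ∘ hinv (istr H E m (S m)) ∘ ipost H m g
       = h)).

(* Internal Hom of M over its dual category, acting by evaluation. *)
Record dual_ihom (m n : M) := DualIHom {
  dh_obj :> modfun M;
  dh_ev : hom (dh_obj m) n;
  dh_univ : forall (G : modfun M) (f : hom (G m) n),
    exists! g : modnat G dh_obj, dh_ev ∘ g m = f }.

(* The isomorphism A(x) ≅ ^∨Hom(x,m) ▷ n for A the internal Hom from m to n
   over the dual category. *)
Definition dual_ihomE m n (A : dual_ihom m n) (x : M) :
    hom (A x) (ldual (H x m) ▷ n) :=
  (idm _ ▶ dh_ev A) ∘ mf_str A _ m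
    ∘ fmor A ((idm _ ▶ ih_ev (H x m)) ∘ mass _ _ x
                ∘ (lcoev (H x m) ▶ idm x) ∘ hinv (munit x)).

(* The quasi-inverse Sb is a relative Serre functor of M over the dual
   category: the functor G |-> G(m) from the dual category to M has right
   adjoint A(m,-), which has right adjoint G |-> G(Sb m). This is the unit
   n -> A(m,n)(Sb m) ≅ ^∨Hom(Sb m, m) ▷ n of the last adjunction, given by the
   trace Hom(Sb m, m) ≅ Hom(Sb m, S(Sb m)) -> 1. *)
Definition dual_serre_unit m n (A : dual_ihom m n) : hom n (A (Sb m)) :=
  the_mor (fun u =>
    dual_ihomE A (Sb m) ∘ u
    = (lcurry (serre_tr (Sb m) ∘ ipost H (Sb m) (aunit (sr_adj S) m)
                 ∘ runit _) ▶ idm n) ∘ hinv (munit n)).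

Definition dual_nr (E : nakr (dual_one M)) : modfun M := nr_obj E.

(* The isomorphism N^r(m) ≅ N^r_{D^*_M}(id)(Sb m). *)
Definition nakr_dual_serre (A : forall m n, dual_ihom m n)
    (E : nakr (dual_one M)) (m : M) (Nm : nakr m) : hom Nm (dual_nr E (Sb m)) :=
  nak_mate E Nm (fun n => (A m n : modend M))
    (fun n (w : modnat (modfun_id M) (A m n)) => dh_ev (A m n) ∘ w m)
    (fun n (h : modnat (A m n) (dual_nr E)) =>
       h (Sb m) ∘ dual_serre_unit (A m n)).

Section Spherical.
Variables (A : forall m n, dual_ihom m n) (N : forall m : M, nakr m).
Variables (ED : nakr (unitc D)) (EM : nakr (dual_one M)).

Definition module_radford m : hom (ED ▷ S m) (dual_nr EM (Sb m)) :=
  nakr_dual_serre A EM (N m) ∘ hinv (nakr_serre ED (N m)).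

Definition module_radford_bar (uD : hom (unitc D) ED)
    (uM : modnat (modfun_id M) (dual_nr EM)) m : hom (S m) (Sb m) :=
  hinv (uM (Sb m)) ∘ module_radford m ∘ (uD ▶ idm (S m)) ∘ hinv (munit (S m)).

(* (uD, uM)-sphericality of the pivotal structure pt. *)
Definition spherical_at (uD : hom (unitc D) ED)
    (uM : modnat (modfun_id M) (dual_nr EM)) (pt : forall m, hom m (S m)) :
    Prop :=
  forall m,
    acounit (sr_adj S) m ∘ fmor Sb (pt m) ∘ module_radford_bar uD uM m ∘ pt m
    = idm m.

End Spherical.

End Serre.

Definition pivotal_module k (D : ftcat k) (p : pivotal D) (M : modcat D) :
    Prop :=
  exact_module M
  /\ exists (S : serre M) (pt : forall m, hom m (S m)), pivotal_structure p pt.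

Definition spherical_module k (D : ftcat k) (p : pivotal D) (M : modcat D) :
    Prop :=
  exact_module M
  /\ exists (S : serre M) (A : forall m n : M, dual_ihom m n)
       (N : forall m : M, nakr m) (ED : nakr (unitc D)) (EM : nakr (dual_one M))
       (uD : hom (unitc D) ED) (uM : @hom k (modend M) (dual_one M) EM)
       (pt : forall m, hom m (S m)),
     [/\ is_iso uD, is_iso uM, pivotal_structure p pt
       & spherical_at A N uD uM pt].

Section Transport.
Variables (k : fieldType) (C D : ftcat k) (F : tfunctor C D) (M : modcat D).
Variables (R : functor D C) (aR : adjunction F R).
Variables (RR : functor C D) (aRR : adjunction R RR).
Variable t : hom (unitc D) (chi RR).
Variables (SD : serre M) (SC : serre (pullback F M)).

Local Notation HD := (sr_hom SD).
Local Notation HC := (sr_hom SC).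

(* The isomorphism from the internal Hom of _F M to R(Hom(m,n)). *)
Definition pb_ihom (m n : M) : hom (HC m n) (R (HD m n)) :=
  fmor R (icurry HD (ih_ev (HC m n) : @hom k M (F (HC m n) ▷ m) n))
    ∘ aunit aR (HC m n).

(* The isomorphism chi ▷ SD m ≅ SC m. Both sides represent the functor
   n |-> Hom(Hom^C(m,n), 1) = Hom(R Hom^D(m,n), 1) = Hom(Hom^D(m,n), chi);
   the isomorphism is the one that matches the universal elements. *)
Definition pb_serre (m : M) : @hom k M (chi RR ▷ SD m) (SC m) :=
  the_mor (fun j : @hom k M (chi RR ▷ SD m) (SC m) =>
    serre_tr SC m ∘ ipost HC m (j : @hom k (pullback F M) _ _)
    = acounit aRR (unitc C)
        ∘ fmor R (runit _ ∘ (idm (chi RR) ⊠ serre_tr SD m)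
                    ∘ hinv (istr HD (chi RR) m (SD m)))
        ∘ pb_ihom m (chi RR ▷ SD m)).

(* SD ≅ chi ▷ SD ≅ SC *)
Definition pb_serre_triv (m : M) : @hom k M (SD m) (SC m) :=
  pb_serre m ∘ (t ▶ idm (SD m)) ∘ hinv (munit (SD m)).

Definition transport_pivotal (pt : forall m, hom m (SD m)) (m : pullback F M) :
    hom m (SC m) :=
  pb_serre_triv m ∘ pt m.

(* The induced isomorphism between the quasi-inverses of SC and SD. *)
Definition pb_serre_inv (m : M) : @hom k M (sr_inv SC m) (sr_inv SD m) :=
  acounit (sr_adj SC) (sr_inv SD m)
    ∘ fmor (sr_inv SC) (pb_serre_triv (sr_inv SD m) ∘ aunit (sr_adj SD) m
                        : @hom k (pullback F M) _ _).

Variables (AD : forall m n : M, dual_ihom m n).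
Variables (AC : forall m n : pullback F M, dual_ihom m n).
Variables (N : forall m : M, nakr m).
Variables (ED : nakr (dual_one M)) (EC : nakr (dual_one (pullback F M))).

(* The isomorphism chi ▷ N^r_{D^*_M}(id) ≅ N^r_{C^*_{FM}}(id), with chi
   identified with 1 by t: since N^r_M does not depend on the action, the second
   half of the Radford isomorphism identifies N^r_{D^*_M}(id) with N^r_M ∘ SD
   and N^r_{C^*_{FM}}(id) with N^r_M ∘ SC, and SC ≅ chi ▷ SD ≅ SD. *)
Definition pb_dual (x : M) :
    @hom k M (dual_nr ED x) (dual_nr EC x) :=
  let y : M := SC x in
  fmor (dual_nr EC) (acounit (sr_adj SC) x)
    ∘ nakr_dual_serre SC AC EC (N y : @nakr k (pullback F M) y)
    ∘ hinv (nakr_dual_serre SD AD ED (N y))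
    ∘ fmor (dual_nr ED) (pb_serre_inv y)
    ∘ fmor (dual_nr ED) (hinv (acounit (sr_adj SC) x)).

Definition transport_unimodular (uM : modnat (modfun_id M) (dual_nr ED))
    (x : pullback F M) : hom x (dual_nr EC x) :=
  pb_dual x ∘ uM x.

End Transport.

(* Main.v *)
(* A relative Serre functor S is encoded by its traces Hom(m, S m) -> 1. The
   traces turn evaluation at S x, the module functors Hom(x, -) ▷ n and
   evaluation at x into a string of adjoint functors between M and its dual
   category. As N^r and N^l are exchanged with adjoints, a module functor K is
   N^r(id) in the dual category exactly when the objects K x are N^r(S x) in M,
   naturally and D-linearly in x; similarly K is N^l(id) when K (S x) is N^l(x).
   So the dual category enters only through M and S, and everything can be
   transported along F once S^C is compared with S^D.

   For this, a trivialization 1 = chi_F compatible with the half-braiding gives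
   isomorphisms F c -> F^rra c, hence maps hat : Hom(F c, F d) -> Hom(c, d) that
   are natural and C-linear on both sides. The hat of the trace of S^D is a trace
   for the internal Homs of _F M, which yields S^D = S^C; two-sided linearity of
   hat makes this isomorphism compatible with the twists
   S(d ▷ m) = d^∨∨ ▷ S m. It transports pivotal structures and the families
   describing N^r(id) and N^l(id), and matches the two halves of the module
   Radford isomorphism over C with those over D. *)

From Stdlib Require List.
From HB Require Import structures.
From mathcomp Require Import all_boot all_algebra.
From mathcomp Require Import boolp classical_sets.
Require Import Defs.
From mathcomp Require Import ssreflect ssralg.

Set Implicit Arguments.
Unset Strict Implicit.
Unset Printing Implicit Defensive.
Import GRing.Theory.
Local Open Scope ring_scope.

(** Unimodularity and sphericality over C ask for N^l(id) or N^r(id) in the dual category of [_F M],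
    and pivotality for a Serre functor of [_F M], so existence has to be proved along with
    compatibility. Serre functors come from a pointwise adjoint functor theorem: over a projective
    generator P, a universal arrow lives on a quotient of a finite sum of copies of P. Essential
    surjectivity uses the same theorem in the opposite category, where exactness of the module
    category supplies enough injectives. Traces are a good encoding because H(m, d ▷ n) = d ⊗ H(m,
    n): a balanced family H(m, n)^∨ = H(n, S m) amounts to one universal morphism H(m, S m) -> 1,
    and identities about S become identities of morphisms into 1, to which hat applies. Left and
    right are not symmetric: evaluation at S x sees D-linearity only through objects d^∨∨, and the
    left case recovers the action of all d from these. The Radford composite is cut at N^r(m), an
    object of M whatever acts on it; so m -> N^r(m) and N^r(m) -> m can be compared separately over
    C and D. *)

Variant bij (A B : Type) (f : A -> B) : Prop := Bij of forall b, exists! a, f a = b.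

Lemma bij_inj A B (f : A -> B) : bij f -> injective f.
Proof. by move=> [h] x y e; have [z [_ hz]] := h (f y); rewrite -(hz x e) (hz y). Qed.

Lemma bij_surj A B (f : A -> B) b : bij f -> exists a, f a = b.
Proof. by move=> [h]; have [z [hz _]] := h b; exists z. Qed.

Lemma bij_uniq A B (f : A -> B) b : bij f -> exists! a, f a = b.
Proof. by case. Qed.

Lemma bijI A B (f : A -> B) : injective f -> (forall b, exists a, f a = b) -> bij f.
Proof.
by move=> i s; split=> b; have [a ha] := s b; exists a; split=> // a' e; apply: i; rewrite ha.
Qed.

Lemma can_bij A B (f : A -> B) g : cancel f g -> cancel g f -> bij f.
Proof. by move=> fg gf; apply: bijI; [exact: can_inj fg | move=> b; exists (g b)]. Qed.

Lemma eq_bij A B (f h : A -> B) : (forall a, h a = f a) -> bij f -> bij h.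
Proof.
move=> e bf; apply: bijI => [x y|b]; first by rewrite !e => /(bij_inj bf).
by have [a ha] := bij_surj b bf; exists a; rewrite e.
Qed.

Lemma bij_comp A B C (f : B -> C) (g : A -> B) : bij f -> bij g -> bij (fun a => f (g a)).
Proof.
move=> bf bg; apply: bijI => [x y /(bij_inj bf) /(bij_inj bg) //|c].
by have [b <-] := bij_surj c bf; have [a <-] := bij_surj b bg; exists a.
Qed.

Section Scalars.
Variables (k : fieldType) (V : lmodType k) (f : V -> k).
Hypothesis fP : forall a u v, f (a *: u + v) = a * f u + f v.

Definition mkscalar_fun := f.
Fact mkscalar_is_scalar : scalar mkscalar_fun. Proof. exact: fP. Qed.
HB.instance Definition _ :=
  GRing.isLinear.Build k V k *%R mkscalar_fun mkscalar_is_scalar.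
Definition mkscalar : {scalar V} := mkscalar_fun.

End Scalars.

Lemma scalarPl (k : fieldType) (V : lmodType k) (f : {scalar V}) a u v :
  f (a *: u + v) = a * f u + f v.
Proof. exact: linearP. Qed.

Lemma scalar_ext (k : fieldType) (V : lmodType k) (f g : {scalar V}) :
  (forall v, f v = g v) -> f = g.
Proof.
case: f g => f [[f1] [f2]] [g [[g1] [g2]]] /= h.
have e : f = g by apply: functional_extensionality_dep.
subst g.
by do 4 f_equal; apply: Prop_irrelevance.
Qed.

(** * Linear categories and adjunctions *)

Section CatBasics.
Variables (k : fieldType) (C : lincat k).
Implicit Types x y z : C.

Lemma cl x y z w (f : hom y z) (g : hom x y) h (u : hom z w) :
  f ∘ g = h -> u ∘ f ∘ g = u ∘ h.
Proof. by move=> <-; rewrite compA. Qed.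

Lemma cl3 x y z w v (f : hom z w) (g : hom y z) (h : hom x y) r (u : hom w v) :
  f ∘ g ∘ h = r -> u ∘ f ∘ g ∘ h = u ∘ r.
Proof. by move=> <-; rewrite !compA. Qed.

Lemma hinvE x y (f : hom x y) g : inverse_mor f g -> hinv f = g.
Proof.
move=> [gf fg]; have [h1 h2] : inverse_mor f (hinv f) by apply: hinvP; exists g.
by rewrite -(compm1 (hinv f)) -fg compA h1 comp1m.
Qed.

Lemma hinv1 x : hinv (idm x) = idm x.
Proof. by apply: hinvE; split; rewrite comp1m. Qed.

Lemma hinv_comp x y z (f : hom y z) (g : hom x y) :
  is_iso f -> is_iso g -> hinv (f ∘ g) = hinv g ∘ hinv f.
Proof.
move=> fi gi; apply: hinvE; split.
  by rewrite compA (cl _ (hinvK fi)) compm1 hinvK.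
by rewrite compA (cl _ (hinvV gi)) compm1 hinvV.
Qed.

Lemma hinv_hinv x y (f : hom x y) : is_iso f -> hinv (hinv f) = f.
Proof. by move=> fi; apply: hinvE; split; [exact: hinvV|exact: hinvK]. Qed.

Lemma iso_of_cancelr x y z (f : hom y z) (g : hom x y) :
  is_iso g -> is_iso (f ∘ g) -> is_iso f.
Proof.
move=> gi fgi; have -> : f = (f ∘ g) ∘ hinv g by rewrite -compA hinvV // compm1.
by apply: is_iso_comp => //; apply: is_iso_hinv.
Qed.

Lemma compDl x y z (f f' : hom y z) (g : hom x y) : (f + f') ∘ g = f ∘ g + f' ∘ g.
Proof. by have := compPl 1 f f' g; rewrite !scale1r. Qed.
Lemma compDr x y z (f : hom y z) (g g' : hom x y) : f ∘ (g + g') = f ∘ g + f ∘ g'.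
Proof. by have := compPr 1 f g g'; rewrite !scale1r. Qed.
Lemma compZl x y z a (f : hom y z) (g : hom x y) : (a *: f) ∘ g = a *: (f ∘ g).
Proof. by have := compPl a f 0 g; rewrite !addr0 comp0l addr0. Qed.
Lemma compZr x y z a (f : hom y z) (g : hom x y) : f ∘ (a *: g) = a *: (f ∘ g).
Proof. by have := compPr a f g 0; rewrite !addr0 comp0r addr0. Qed.
Lemma compBl x y z (f f' : hom y z) (g : hom x y) : (f - f') ∘ g = f ∘ g - f' ∘ g.
Proof. by rewrite compDl -scaleN1r compZl scaleN1r. Qed.
Lemma compBr x y z (f : hom y z) (g g' : hom x y) : f ∘ (g - g') = f ∘ g - f ∘ g'.
Proof. by rewrite compDr -scaleN1r compZr scaleN1r. Qed.

Lemma epi0P x y (f : hom x y) :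
  (forall z (u : hom y z), u ∘ f = 0 -> u = 0) -> is_epi f.
Proof.
move=> h z u v e; apply/eqP; rewrite -subr_eq0; apply/eqP; apply: (h z).
by rewrite compBl e subrr.
Qed.

Lemma mono0P x y (f : hom x y) :
  (forall z (u : hom z x), f ∘ u = 0 -> u = 0) -> is_mono f.
Proof.
move=> h z u v e; apply/eqP; rewrite -subr_eq0; apply/eqP; apply: (h z).
by rewrite compBr e subrr.
Qed.

Lemma epi0 x y z (f : hom x y) (u : hom y z) : is_epi f -> u ∘ f = 0 -> u = 0.
Proof. by move=> fe e; apply: fe; rewrite e comp0l. Qed.

Lemma iso_epi x y (f : hom x y) : is_iso f -> is_epi f.
Proof. by move=> fi z g h; apply: iso_cancel. Qed.
Lemma epi_comp x y z (f : hom y z) (g : hom x y) : is_epi f -> is_epi g -> is_epi (f ∘ g).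
Proof. by move=> fe ge w u v; rewrite !compA => /ge /fe. Qed.
Lemma mono_comp x y z (f : hom y z) (g : hom x y) : is_mono f -> is_mono g -> is_mono (f ∘ g).
Proof. by move=> fe ge w u v; rewrite -!compA => /fe /ge. Qed.

Lemma kernel_mono x y z (f : hom x y) (g : hom y z) : is_kernel f g -> is_mono f.
Proof.
move=> [gf h]; apply: mono0P => w u e.
have [v [_ hv]] := h _ (0 : hom w y) (comp0r _ _).
by rewrite -(hv u e) (hv 0 (comp0r _ _)).
Qed.

Lemma cokernel_epi x y z (f : hom x y) (g : hom y z) : is_cokernel f g -> is_epi g.
Proof.
move=> [gf h]; apply: epi0P => w u e.
have [v [_ hv]] := h _ (0 : hom y w) (comp0l _ _).
by rewrite -(hv u e) (hv 0 (comp0l _ _)).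
Qed.

Lemma iso_yoneda x y (f : hom x y) :
  (forall c, bij (fun g : hom c x => f ∘ g)) -> is_iso f.
Proof.
move=> h; have [g hg] := bij_surj (idm y) (h y); exists g; split=> //.
by apply: (bij_inj (h x)); rewrite compA hg comp1m compm1.
Qed.

Lemma iso_yonedar x y (f : hom x y) :
  (forall c, bij (fun g : hom y c => g ∘ f)) -> is_iso f.
Proof.
move=> h; have [g hg] := bij_surj (idm x) (h x); exists g; split=> //.
by apply: (bij_inj (h y)); rewrite -compA hg comp1m compm1.
Qed.

Lemma iso_bij c x y (f : hom x y) : is_iso f -> bij (fun g : hom c x => f ∘ g).
Proof.
move=> fi; apply: (@can_bij _ _ _ (fun g => hinv f ∘ g)) => g.
  by rewrite compA hinvK // comp1m.
by rewrite compA hinvV // comp1m.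
Qed.

Lemma iso_bijr c x y (f : hom x y) : is_iso f -> bij (fun g : hom y c => g ∘ f).
Proof.
move=> fi; apply: (@can_bij _ _ _ (fun g => g ∘ hinv f)) => g.
  by rewrite -compA hinvV // compm1.
by rewrite -compA hinvK // compm1.
Qed.

Lemma the_morP x y (P : hom x y -> Prop) :
  (exists f, P f) -> P (the_mor P).
Proof. by move=> [f hf]; apply: (xgetPex 0); exists f. Qed.

Lemma the_morE x y (P : hom x y -> Prop) f :
  P f -> (forall g, P g -> g = f) -> the_mor P = f.
Proof. by move=> hf u; apply: u; apply: the_morP; exists f. Qed.

Definition opc : lincat k :=
  @LinCat k (obj C) (fun x y => hom y x) (fun x => idm x)
    (fun x y z f g => g ∘ f)
    (fun w x y z f g h => esym (compA h g f))
    (fun x y f => compm1 f) (fun x y f => comp1m f)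
    (fun x y z a f f' g => compPr a g f f')
    (fun x y z a f g g' => compPl a g g' f).

End CatBasics.
Arguments opc {k} C.

Section Functors.
Variable k : fieldType.

Definition opf (A B : lincat k) (F : functor A B) : functor (opc A) (opc B).
Proof.
refine (@Functor k (opc A) (opc B) (fun x => F x) (fun x y f => fmor F f) _ _ _).
- by move=> x; exact: fmor1.
- by move=> x y z f g; exact: fmorM.
- by move=> x y a f g; exact: fmorP.
Defined.

Lemma fmor0 (A B : lincat k) (F : functor A B) x y : fmor F (0 : hom x y) = 0.
Proof.
have := fmorP F 1 (0 : hom x y) 0; rewrite !scale1r addr0.
by move=> /(congr1 (fun u => u - fmor F 0)); rewrite subrr addrK.
Qed.
Lemma fmorD (A B : lincat k) (F : functor A B) x y (f g : hom x y) :
  fmor F (f + g) = fmor F f + fmor F g.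
Proof. by have := fmorP F 1 f g; rewrite !scale1r. Qed.
Lemma fmorZ (A B : lincat k) (F : functor A B) x y a (f : hom x y) :
  fmor F (a *: f) = a *: fmor F f.
Proof. by have := fmorP F a f 0; rewrite fmor0 !addr0. Qed.

Lemma fmor_iso (A B : lincat k) (F : functor A B) x y (f : hom x y) :
  is_iso f -> is_iso (fmor F f).
Proof. by move=> [g [h1 h2]]; exists (fmor F g); split; rewrite -fmorM ?h1 ?h2 fmor1. Qed.

Lemma fmor_hinv (A B : lincat k) (F : functor A B) x y (f : hom x y) :
  is_iso f -> fmor F (hinv f) = hinv (fmor F f).
Proof. by move=> fi; apply/esym/hinvE; split; rewrite -fmorM ?hinvK ?hinvV ?fmor1. Qed.

Section Adj.
Variables (A B : lincat k) (L : functor A B) (R : functor B A) (a : adjunction L R).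

Definition adjr x y (f : hom (L x) y) : hom x (R y) := fmor R f ∘ aunit a x.
Definition adjl x y (g : hom x (R y)) : hom (L x) y := acounit a y ∘ fmor L g.

Lemma adjrK x y (f : hom (L x) y) : adjl (adjr f) = f.
Proof. by rewrite /adjl /adjr fmorM compA -acounit_nat -compA adj_triL compm1. Qed.
Lemma adjlK x y (g : hom x (R y)) : adjr (adjl g) = g.
Proof. by rewrite /adjl /adjr fmorM -compA -aunit_nat compA adj_triR comp1m. Qed.
Lemma adjr_bij x y : bij (@adjr x y).
Proof. exact: can_bij (@adjrK x y) (@adjlK x y). Qed.
Lemma adjl_bij x y : bij (@adjl x y).
Proof. exact: can_bij (@adjlK x y) (@adjrK x y). Qed.
Lemma adjr_inj x y : injective (@adjr x y). Proof. exact: bij_inj (@adjr_bij x y). Qed.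
Lemma adjl_inj x y : injective (@adjl x y). Proof. exact: bij_inj (@adjl_bij x y). Qed.

Lemma adjr_natl x x' y (f : hom (L x) y) (g : hom x' x) :
  adjr (f ∘ fmor L g) = adjr f ∘ g.
Proof. by rewrite /adjr fmorM -!compA aunit_nat. Qed.
Lemma adjr_natr x y y' (f : hom (L x) y) (g : hom y y') :
  adjr (g ∘ f) = fmor R g ∘ adjr f.
Proof. by rewrite /adjr fmorM compA. Qed.
Lemma adjl_natl x x' y (f : hom x (R y)) (g : hom x' x) :
  adjl (f ∘ g) = adjl f ∘ fmor L g.
Proof. by rewrite /adjl fmorM compA. Qed.
Lemma adjl_natr x y y' (f : hom x (R y)) (g : hom y y') :
  adjl (fmor R g ∘ f) = g ∘ adjl f.
Proof. by rewrite /adjl fmorM compA -acounit_nat compA. Qed.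
Lemma adjlP x y c (f g : hom x (R y)) : adjl (c *: f + g) = c *: adjl f + adjl g.
Proof. by rewrite /adjl fmorP compPr. Qed.
Lemma adjl_unit x : adjl (aunit a x) = idm (L x).
Proof. exact: adj_triL. Qed.
Lemma adjr_counit y : adjr (acounit a y) = idm (R y).
Proof. exact: adj_triR. Qed.
End Adj.

Definition adj_natiso (A B : lincat k) (L L' : functor A B) (R : functor B A)
    (e : forall x, hom (L' x) (L x)) (ei : forall x, is_iso (e x))
    (en : forall x y (f : hom x y), e y ∘ fmor L' f = fmor L f ∘ e x)
    (a : adjunction L R) : adjunction L' R.
Proof.
refine (@Adjunction k A B L' R (fun x => fmor R (hinv (e x)) ∘ aunit a x)
  (fun y => acounit a y ∘ e (R y)) _ _ _ _).
- move=> x y f; have en' : hinv (e y) ∘ fmor L f = fmor L' f ∘ hinv (e x) by apply: hinv_nat.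
  by rewrite -compA aunit_nat !compA -!fmorM en'.
- by move=> x y f; rewrite compA acounit_nat -!compA en.
- move=> x; rewrite -!compA en fmorM !compA -acounit_nat -!compA (compA (acounit a _)).
  by rewrite adj_triL comp1m hinvK.
- by move=> y; rewrite compA -fmorM -compA hinvV // compm1 adj_triR.
Defined.

Definition id_functor (A : lincat k) : functor A A :=
  @Functor k A A id (fun _ _ f => f) (fun _ => erefl) (fun _ _ _ _ _ => erefl)
    (fun _ _ _ _ _ => erefl).

Definition id_adj (A : lincat k) : adjunction (id_functor A) (id_functor A).
Proof.
by refine (@Adjunction k A A (id_functor A) (id_functor A) (fun x => idm x) (fun x => idm x) _ _ _ _)
  => *; rewrite /= ?comp1m ?compm1.
Defined.

Definition opadj (A B : lincat k) (L : functor A B) (R : functor B A)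
    (a : adjunction L R) : adjunction (opf R) (opf L).
Proof.
refine (@Adjunction k (opc B) (opc A) (opf R) (opf L)
  (fun b => acounit a b) (fun x => aunit a x) _ _ _ _) => /=.
- by move=> x y f; exact: acounit_nat.
- by move=> x y f; exact: aunit_nat.
- by move=> x; exact: adj_triR.
- by move=> x; exact: adj_triL.
Defined.

Section UnivAdj.
Variables (A B : lincat k) (L : functor A B) (R : B -> A) (e : forall y, hom (L (R y)) y).
Hypothesis eU : forall x y, bij (fun g : hom x (R y) => e y ∘ fmor L g).

Lemma univ_factor x y (f : hom (L x) y) : {g : hom x (R y) | e y ∘ fmor L g = f}.
Proof. by apply: cid; apply: (bij_surj f (eU x y)). Qed.

Let cur x y (f : hom (L x) y) := sval (univ_factor f).
Let curP x y (f : hom (L x) y) : e y ∘ fmor L (cur f) = f := svalP (univ_factor f).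
Let curI x y (f g : hom x (R y)) : e y ∘ fmor L f = e y ∘ fmor L g -> f = g.
Proof. exact: (bij_inj (eU x y)). Qed.

(** Only the object map and the universal arrows are given; the action on morphisms is forced by
    universality. Where a closed formula for it is wanted, it has to be derived afterwards, as [VE]
    does. *)
Definition univ_functor : functor B A.
Proof.
refine (@Functor k B A R (fun x y f => cur (f ∘ e x)) _ _ _).
- by move=> x; apply: curI; rewrite curP fmor1 comp1m compm1.
- by move=> x y z f g; apply: curI; rewrite curP fmorM compA curP -!compA curP.
- move=> x y a f g; apply: curI.
  by rewrite curP fmorD fmorZ compDr compZr !curP compDl compZl.
Defined.

Definition univ_adj : adjunction L univ_functor.
Proof.
refine (@Adjunction k A B L univ_functor (fun x => cur (idm (L x))) e _ _ _ _).
- by move=> x y f; apply: curI; rewrite /= !fmorM !compA !curP comp1m -!compA curP compm1.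
- by move=> x y f; rewrite /= curP.
- by move=> x; rewrite curP.
- by move=> y; apply: curI; rewrite /= fmorM compA curP -compA curP fmor1.
Defined.
End UnivAdj.

End Functors.

Lemma In_mem (T : eqType) (x : T) (s : seq T) : List.In x s <-> x \in s.
Proof.
elim: s => //= a s [IH1 IH2]; rewrite inE; split=> [[->|/IH1 ->]|].
- by rewrite eqxx.
- exact: orbT.
- by move=> /predU1P [->|/IH2]; [left|right].
Qed.

(** * Existence of adjoints between finite categories *)

Section Findim.
Variables (k : fieldType) (V : lmodType k).

Definition lin_closed (K : V -> Prop) : Prop :=
  K 0 /\ forall a u v, K u -> K v -> K (a *: u + v).

Lemma lin_closed_sum (K : V -> Prop) n (c : 'I_n -> k) (v : 'I_n -> V) :
  lin_closed K -> (forall i, K (v i)) -> K (\sum_i c i *: v i).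
Proof.
move=> [K0 KP] h; elim/big_ind: _ => // [x y hx hy|i _].
  by rewrite -(scale1r x); apply: KP.
by rewrite -[c i *: v i]addr0; apply: KP.
Qed.

(* A subspace of maximal dimension among the subspaces contained in K is K. *)
Lemma findim_span (K : V -> Prop) : findim V -> lin_closed K ->
  exists vs : seq V, (forall v, List.In v vs -> K v)
    /\ forall Q, lin_closed Q -> (forall v, List.In v vs -> Q v) ->
       forall v, K v -> Q v.
Proof.
move=> [n [f [g fg gf]]] Kl.
pose inK (U : {vspace 'rV[k]_n}) := forall v, v \in U -> K (g v).
pose p d := `[< exists U, inK U /\ \dim U = d >].
have gP a u v : g (a *: u + v) = a *: g u + g v.
  by apply: (can_inj fg); rewrite gf linearP !gf.
have g0 : g 0 = 0 by apply: (can_inj fg); rewrite gf linear0.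
have p0 : exists d, p d.
  exists 0%N; apply/asboolP; exists 0%VS; split; last exact: dimv0.
  by move=> v; rewrite memv0 => /eqP ->; rewrite g0; case: Kl.
have pmax d : p d -> (d <= n)%N.
  move=> /asboolP [U [_ <-]]; apply: leq_trans (dimvS (subvf U)) _.
  by rewrite dimvf /dim /= mul1n.
case: (ex_maxnP p0 pmax) => d /asboolP [U [UK dU]] dmax.
exists [seq g u | u <- vbasis U]; split=> [v|Q Ql hQ v Kv].
  move=> /List.in_map_iff [u [<- hu]]; apply: UK; apply: vbasis_mem.
  exact/In_mem.
have vU : f v \in U.
  pose W := (U + <[f v]>)%VS.
  have WK : inK W.
    move=> w /memv_addP [u1 u1U [u2 /vlineP [a ea] ew]].
    rewrite ew ea addrC gP fg; apply: Kl.2 => //; exact: UK.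
  have hW : (\dim W <= d)%N by apply: dmax; apply/asboolP; exists W.
  have UW : (U <= W)%VS by apply: addvSl.
  have /eqP -> : U == W by rewrite eqEdim UW dU.
  by apply: (subvP (addvSr _ _)); apply: memv_line.
rewrite -(fg v) (coord_vbasis vU).
have -> : g (\sum_(i < \dim U) coord (vbasis U) i (f v) *: (vbasis U)`_i)
    = \sum_(i < \dim U) coord (vbasis U) i (f v) *: g (vbasis U)`_i.
  elim/big_rec2: _ => [|i x y _ <-]; first exact: g0.
  by rewrite gP.
apply: lin_closed_sum => // i; apply: hQ; apply: List.in_map.
by apply/In_mem; apply: mem_nth; rewrite size_tuple.
Qed.

End Findim.

Section Abelian.
Variables (k : fieldType) (X : lincat k).
Implicit Types x y z : X.

Lemma zero_hom x y (f : hom x y) : is_zero x -> f = 0.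
Proof. by move=> x0; rewrite -(compm1 f) x0 comp0r. Qed.

Lemma epi_coker_ker x y (e : hom x y) w (i : hom w x) :
  is_abelian X -> is_epi e -> is_kernel i e -> is_cokernel i e.
Proof.
move=> [_ [_ [_ [_ [_ h]]]]] /h [v [g [eg gU]]] [ei iU].
split=> // z u ui; have [g' [gg' _]] := iU _ _ eg.
by apply: gU; rewrite -gg' compA ui comp0l.
Qed.

Lemma coker_comp_epi w' w x y (e : hom x y) (i : hom w x) (f : hom w' w) :
  is_cokernel i e -> is_epi f -> is_cokernel (i ∘ f) e.
Proof.
move=> [ei eU] fe; split=> [|z u uif]; first by rewrite compA ei comp0l.
by apply: eU; apply: (epi0 fe); rewrite -compA.
Qed.

(** If u kills [f'], then [f'] factors through the kernel j of u. The mono i ∘ j is the kernel of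
    some h, and h kills f, so h factors through g and kills i. Hence i factors through i ∘ j, which
    splits j and forces u = 0. *)
Lemma abelian_image x y z w (f : hom x y) (g : hom y z) (i : hom w y) :
  is_abelian X -> is_cokernel f g -> is_kernel i g ->
  exists f', i ∘ f' = f /\ is_epi f'.
Proof.
move=> [_ [_ [hk [_ [hm _]]]]] [gf gU] iK; have im := kernel_mono iK.
have [gi iU] := iK; have [f' [iff' _]] := iU _ _ gf; exists f'; split=> //.
apply: epi0P => v u uf'; have [v' [j jK]] := hk _ _ u.
have [uj jU] := jK; have [f'' [jf'' _]] := jU _ _ uf'.
have [t [h [hij hU]]] := hm _ _ _ (mono_comp im (kernel_mono jK)).
have [h' [h'g _]] : exists! h', h' ∘ g = h.
  by apply: gU; rewrite -iff' -jf'' (compA i) compA hij comp0l.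
have hi : h ∘ i = 0 by rewrite -h'g -compA gi comp0r.
have [s [hs _]] := hU _ i hi.
have js : j ∘ s = idm _ by apply: im; rewrite compA hs compm1.
by rewrite -(compm1 u) -js compA uj comp0l.
Qed.

(** Finite direct sums of copies of [P], in a form suited to induction. *)
Inductive addc (P : X) : X -> Prop :=
| addc_base : addc P P
| addc_zero z : is_zero z -> addc P z
| addc_sum x y z (i : hom x z) (j : hom y z) p q :
    addc P x -> addc P y -> is_biproduct i j p q -> addc P z.

Lemma zero_projective x : is_zero x -> is_projective x.
Proof. by move=> x0 y z e f _; exists 0; rewrite comp0r (zero_hom f x0). Qed.

Lemma biproduct_projective x y z (i : hom x z) (j : hom y z) p q :
  is_biproduct i j p q -> is_projective x -> is_projective y -> is_projective z.
Proof.
move=> [_ _ _ _ e] px py u v f g fe.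
have [a ha] := px _ _ f (g ∘ i) fe; have [b hb] := py _ _ f (g ∘ j) fe.
by exists (a ∘ p + b ∘ q); rewrite compDr !compA ha hb -!compA -compDr e compm1.
Qed.

Lemma addc_projective P x : is_projective P -> addc P x -> is_projective x.
Proof.
move=> pP; elim=> // [z|a b z i j p q _ IHa _ IHb h].
  exact: zero_projective.
exact: (biproduct_projective h).
Qed.

Definition covered (P : X) x : Prop := exists q (e : hom q x), addc P q /\ is_epi e.

Definition generator (P : X) : Prop := is_projective P /\ forall x, covered P x.

Lemma covered_epi P x y (f : hom x y) : is_epi f -> covered P x -> covered P y.
Proof. by move=> fe [q [e [hq ee]]]; exists q, (f ∘ e); split=> //; apply: epi_comp. Qed.

(** Horseshoe argument: the cover of the quotient s lifts along g because sums of copies of P are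
    projective, and together with the cover of x it covers y. *)
Lemma covered_ext P x y s (f : hom x y) (g : hom y s) :
  is_abelian X -> is_projective P -> short_exact f g ->
  covered P x -> covered P s -> covered P y.
Proof.
move=> ab pP [_ gC] [q [e [hq ee]]] [r [e' [hr e'e]]].
have [l hl] := addc_projective pP hr e' (cokernel_epi gC).
have [z [i [j [p [t h]]]]] := (proj1 (proj2 ab)) q r.
have [pi tj pj ti _] := h.
exists z, (f ∘ e ∘ p + l ∘ t); split; first exact: addc_sum hq hr h.
apply: epi0P => w u hu.
have /(epi0 ee) uf : u ∘ f ∘ e = 0.
  move: hu => /(congr1 (fun v => v ∘ i)).
  rewrite comp0l compDr compDl -!compA pi ti !(comp0r, compm1) addr0 !compA //.
have [_ gU] := gC; have [v [vg _]] := gU _ _ uf.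
move: hu => /(congr1 (fun v => v ∘ j)).
rewrite comp0l compDr compDl -!compA pj tj !(comp0r, compm1) add0r.
rewrite -vg -compA hl => /(epi0 e'e) ->; exact: comp0l.
Qed.

Lemma projective_cover_seq (ss : seq X) : is_abelian X ->
  (forall x, exists p (e : hom p x), is_projective p /\ is_epi e) ->
  exists P, is_projective P /\ forall s, List.In s ss -> exists e : hom P s, is_epi e.
Proof.
move=> ab hp; elim: ss => [|s ss [P [pP hP]]].
  by have [[z z0] _] := ab; exists z; split=> //; apply: zero_projective.
have [Q [e [pQ ee]]] := hp s.
have [z [i [j [p [t h]]]]] := (proj1 (proj2 ab)) Q P.
exists z; split; first exact: (biproduct_projective h).
have [pi tj _ _ _] := h.
have split_epi a b (u : hom a b) (v : hom b a) : v ∘ u = idm a -> is_epi v.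
  by move=> vu c f g /(congr1 (fun w => w ∘ u)); rewrite -!compA vu !compm1.
move=> s' [<-|/hP [e' e'e]]; first by exists (e ∘ p); apply: epi_comp => //; apply: split_epi pi.
by exists (e' ∘ t); apply: epi_comp => //; apply: split_epi tj.
Qed.

(* Every object is built from zero objects and the objects of ss by extensions;
   unlike finite_length this is visibly self-dual. *)
Definition ext_generated (ss : seq X) : Prop :=
  forall Q : X -> Prop, (forall x, is_zero x -> Q x) ->
    (forall x y (f : hom x y), is_iso f -> Q x -> Q y) ->
    (forall s, List.In s ss -> Q s) ->
    (forall x y s (f : hom x y) (g : hom y s), short_exact f g -> Q x -> Q s -> Q y) ->
    forall x, Q x.

(** The objects covered by sums of copies of P are closed under extensions, so it is enough that P
    maps onto every member of [ss]. *)
Lemma generator_exists ss : is_abelian X -> ext_generated ss ->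
  (forall x, exists p (e : hom p x), is_projective p /\ is_epi e) ->
  exists P, generator P.
Proof.
move=> ab hss hp; have [P [pP hP]] := projective_cover_seq ss ab hp.
exists P; split=> //; apply: hss => [x x0|x y f fi|s /hP [e ee]|x y s f g fg].
- by exists x, (idm x); split; [exact: addc_zero|exact: iso_epi (is_iso_id x)].
- exact: covered_epi (iso_epi fi).
- by exists P, e; split=> //; apply: addc_base.
- exact: covered_ext fg.
Qed.

Lemma finite_ext_generated : is_finite X -> exists ss, ext_generated ss.
Proof.
move=> [_ [_ [fl [_ [n [s hs]]]]]]; exists [seq s i | i <- enum 'I_n].
move=> Q Q0 Qi Qs Qe x; elim: (fl x) => // a b c f g _ Qa /hs [i [h hi]] fg.
apply: Qe fg Qa _; apply: (Qi _ _ (hinv h)); first exact: is_iso_hinv.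
by apply: Qs; apply: List.in_map; apply/In_mem; rewrite mem_enum.
Qed.

Lemma finite_generator : is_finite X -> exists P, generator P.
Proof.
move=> fX; have [ss hss] := finite_ext_generated fX.
by apply: generator_exists hss _; [case: fX | case: fX => _ [_ [_ []]]].
Qed.

Lemma generator_presentation P x : is_abelian X -> generator P ->
  exists a b (f : hom a b) (g : hom b x), [/\ addc P a, addc P b & is_cokernel f g].
Proof.
move=> ab [_ hP]; have [q [e [hq ee]]] := hP x.
have [w [i iK]] := (proj1 (proj2 (proj2 ab))) _ _ e.
have [r [e' [hr e'e]]] := hP w.
exists r, q, (i ∘ e'), e; split=> //; apply: coker_comp_epi => //.
exact: epi_coker_ker.
Qed.

End Abelian.

Lemma is_abelian_op (k : fieldType) (X : lincat k) : is_abelian X -> is_abelian (opc X).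
Proof.
move=> [h0 [hb [hk [hc [hm he]]]]]; do !split=> //.
- move=> x y; have [z [i [j [p [q [h1 h2 h3 h4 h5]]]]]] := hb x y.
  by exists z, p, q, i, j; split.
- by move=> x y f; apply: hc.
- by move=> x y f; apply: hk.
- by move=> x y f fm; apply: he.
- by move=> x y f fe; apply: hm.
Qed.

Lemma ext_generated_op (k : fieldType) (X : lincat k) ss :
  @ext_generated k X ss -> @ext_generated k (opc X) ss.
Proof.
move=> h Q Q0 Qi Qs Qe x; apply: h => // [a b f [g [gf fg]]|a b s f g [fK gC] Qa Qs'].
  by apply: (Qi a b g); exists f; split.
exact: (Qe s b a g f).
Qed.

Section AdjointFunctorTheorem.
Variables (k : fieldType) (X Y : lincat k) (F : functor X Y) (P : X) (y : Y).
Hypothesis ab : is_abelian X.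
Hypothesis fdX : forall x x' : X, findim (hom x x').
Hypothesis fdY : findim (hom (F P) y).
Hypothesis genP : generator P.
Hypothesis Fr : forall (a b c : X) (f : hom a b) (g : hom b c),
  is_cokernel f g -> is_cokernel (fmor F f) (fmor F g).

(** First half of the universal arrow: the object is a finite sum of copies of P, one for each
    prescribed morphism F P -> y. *)
Lemma aft_cover (vs : seq (hom (F P) y)) : exists x (e : hom (F x) y),
  forall v, List.In v vs -> exists g : hom P x, e ∘ fmor F g = v.
Proof.
elim: vs => [|v vs [x [e he]]].
  by have [[z z0] _] := ab; exists z, 0.
have [z [i [j [p [q [pi qj pj qi _]]]]]] := (proj1 (proj2 ab)) x P.
exists z, (e ∘ fmor F p + v ∘ fmor F q) => u [<-|/he [g hg]].
  by exists j; rewrite compDl -!compA -!fmorM pj qj fmor0 fmor1 comp0r compm1 add0r.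
exists (i ∘ g); rewrite fmorM compA compDl -!(compA _ _ (fmor F i)) -!fmorM pi qi.
by rewrite fmor0 fmor1 comp0r compm1 addr0.
Qed.

(** Second half: divide out finitely many P-points on which e vanishes. At each step e descends to
    the quotient because F preserves cokernels. *)
Lemma aft_kill n : forall x (e : hom (F x) y) (fs : seq (hom P x)), size fs = n ->
  (forall f, List.In f fs -> e ∘ fmor F f = 0) ->
  exists x' (q : hom x x') (e' : hom (F x') y),
    [/\ is_epi q, e' ∘ fmor F q = e & forall f, List.In f fs -> q ∘ f = 0].
Proof.
elim: n => [|n IH] x e [|f fs] //= => [_ _|[sz] h].
  exists x, (idm x), e; split=> //; first exact: iso_epi (is_iso_id x).
  by rewrite fmor1 compm1.
have [w [q qC]] := (proj1 (proj2 (proj2 (proj2 ab)))) _ _ f.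
have [_ qU] := Fr qC; have [e1 [he1 _]] := qU _ _ (h f (or_introl erefl)).
have [|g|x' [q' [e' [q'e he' hq']]]] := IH w e1 [seq q ∘ f | f <- fs].
- by rewrite size_map.
- move=> /List.in_map_iff [f' [<- f'fs]].
  by rewrite fmorM compA he1 h //; right.
exists x', (q' ∘ q), e'; split; first by apply: epi_comp => //; apply: cokernel_epi qC.
  by rewrite fmorM compA he'.
move=> g [<-|gfs]; first by have [qf _] := qC; rewrite -compA qf comp0r.
by rewrite -compA; apply: hq'; apply: List.in_map.
Qed.

(** The arrow is made bijective on P-points, first surjective by enlarging the source and then
    injective by a quotient; this extends to sums of copies of P by additivity and to all objects by
    presentations. *)
Theorem right_adjoint_at : exists n (e : hom (F n) y),
  forall x, bij (fun g : hom x n => e ∘ fmor F g).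
Proof.
(* With K the whole space, [vs] spans Hom(F P, y). *)
have [vs [_ vsP]] := findim_span fdY (K := fun _ => True) (conj I (fun _ _ _ _ _ => I)).
have [x0 [e0 h0]] := aft_cover vs.
have s0 v : exists g : hom P x0, e0 ∘ fmor F g = v.
  refine (vsP (fun v => exists g : hom P x0, e0 ∘ fmor F g = v) _ h0 v I).
  split=> [|a u w [g <-] [g' <-]]; first by exists 0; rewrite fmor0 comp0r.
  by exists (a *: g + g'); rewrite fmorP compPr.
(* [fs] spans the P-points of x0 on which e0 vanishes; these are the ones to be killed. *)
have [|fs [fs0 fsP]] := findim_span (fdX P x0) (K := fun g => e0 ∘ fmor F g = 0).
  split=> [|a u w hu hw]; first by rewrite fmor0 comp0r.
  by rewrite fmorP compPr hu hw scaler0 addr0.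
have [n [q [e [qe eq hq]]]] := aft_kill (erefl (size fs)) fs0.
exists n, e.
have qker (g : hom P x0) : e0 ∘ fmor F g = 0 -> q ∘ g = 0.
  move=> hg; refine (fsP (fun g => q ∘ g = 0) _ hq g hg).
  split=> [|a u w hu hw]; first exact: comp0r.
  by rewrite compPr hu hw scaler0 addr0.
(* Injectivity: a difference of two P-points lifts along q, as P is projective, to a P-point of x0
   on which e0 vanishes, and q kills all of those. *)
have bP : bij (fun g : hom P n => e ∘ fmor F g).
  apply: bijI => [g g' h|v]; last first.
    have [g <-] := s0 v; exists (q ∘ g); by rewrite fmorM compA eq.
  apply/eqP; rewrite -subr_eq0; apply/eqP.
  have [l hl] := genP.1 _ _ q (g - g') qe; rewrite -hl; apply: qker.
  by rewrite -eq -compA -fmorM hl fmorD compDr -scaleN1r fmorZ compZr scaleN1r h subrr.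
have badd x : addc P x -> bij (fun g : hom x n => e ∘ fmor F g).
  elim=> // [z z0|a b z i j p r _ ba _ bb [pi rj pj ri pr]].
    apply: bijI => [g g' _|v]; first by rewrite (zero_hom g z0) (zero_hom g' z0).
    by exists 0; rewrite fmor0 comp0r -(compm1 v) -fmor1 z0 fmor0 comp0r.
  apply: bijI => [g g' h|v].
    have gi : g ∘ i = g' ∘ i by apply: (bij_inj ba); rewrite !fmorM !compA h.
    have gj : g ∘ j = g' ∘ j by apply: (bij_inj bb); rewrite !fmorM !compA h.
    by rewrite -(compm1 g) -(compm1 g') -pr !compDr !compA gi gj.
  have [u hu] := bij_surj (v ∘ fmor F i) ba; have [w hw] := bij_surj (v ∘ fmor F j) bb.
  exists (u ∘ p + w ∘ r); rewrite fmorD compDr !fmorM !compA hu hw.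
  by rewrite -!compA -compDr -!fmorM -fmorD pr fmor1 compm1.
(* Present x as the cokernel of a map between sums of copies of P; both Hom(-, n) and Hom(F -, y)
   turn this cokernel into a kernel. *)
move=> x; have [a [b [f [g [ha hb gC]]]]] := generator_presentation x ab genP.
have ge := cokernel_epi gC; have Fge := cokernel_epi (Fr gC).
apply: bijI => [h h' hh|v].
  by apply: ge; apply: (bij_inj (badd _ hb)); rewrite !fmorM !compA hh.
have [w hw] := bij_surj (v ∘ fmor F g) (badd _ hb).
have wf : w ∘ f = 0.
  apply: (bij_inj (badd _ ha)); rewrite fmorM compA hw fmor0 comp0r.
  by rewrite -compA -fmorM gC.1 fmor0 comp0r.
have [h [hg _]] := gC.2 _ _ wf; exists h; apply: Fge.
by rewrite -compA -fmorM hg.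
Qed.

End AdjointFunctorTheorem.

(** A cokernel g is the cokernel of its own kernel, and f maps onto that kernel; F preserves the
    kernel and both epimorphisms. *)
Lemma right_exact_of_epi (k : fieldType) (X Y : lincat k) (F : functor X Y) :
  is_abelian X -> is_abelian Y ->
  (forall (a b c : X) (f : hom a b) (g : hom b c),
     is_kernel f g -> is_kernel (fmor F f) (fmor F g)) ->
  (forall (a b : X) (f : hom a b), is_epi f -> is_epi (fmor F f)) ->
  forall (a b c : X) (f : hom a b) (g : hom b c),
    is_cokernel f g -> is_cokernel (fmor F f) (fmor F g).
Proof.
move=> aX aY hk he a b c f g gC.
have [w [i iK]] := (proj1 (proj2 (proj2 aX))) _ _ g.
have [f' [<- f'e]] := abelian_image aX gC iK.
rewrite fmorM; apply: coker_comp_epi; last exact: he.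
apply: epi_coker_ker => //; first by apply: he; apply: cokernel_epi gC.
exact: hk.
Qed.

Lemma left_adjoint_coker (k : fieldType) (X Y : lincat k) (F : functor X Y)
    (R : functor Y X) (a : adjunction F R) (x y z : X) (f : hom x y) (g : hom y z) :
  is_cokernel f g -> is_cokernel (fmor F f) (fmor F g).
Proof.
move=> [gf gU]; split=> [|w h hf]; first by rewrite -fmorM gf fmor0.
have : adjr a h ∘ f = 0.
  by rewrite -adjr_natl hf /adjr fmor0 comp0l.
move=> /gU [u [hu uU]]; exists (adjl a u); split; first by rewrite -adjl_natl hu adjrK.
move=> v hv; rewrite -(adjrK a v); congr (adjl a _); apply: uU.
by rewrite -adjr_natl hv.
Qed.

Lemma right_adjoint_ker (k : fieldType) (X Y : lincat k) (F : functor X Y)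
    (R : functor Y X) (a : adjunction F R) (x y z : Y) (f : hom x y) (g : hom y z) :
  is_kernel f g -> is_kernel (fmor R f) (fmor R g).
Proof. exact: (left_adjoint_coker (opadj a)). Qed.

(** Common form of all dualities that occur: right and left duals ([rdp], [ldp]), their images under
    a tensor functor ([tf_pair]), and the pairings of internal Homs given by a trace ([trpair]). *)
Record dualpair (k : fieldType) (C : moncat k) (c c' : C) := DualPair {
  dp_ev : hom (c' ⊗ c) (unitc C);
  dp_coev : hom (unitc C) (c ⊗ c');
  dp_zig : runit c ∘ (idm c ⊠ dp_ev) ∘ assoc c c' c ∘ (dp_coev ⊠ idm c) = lunit c;
  dp_zag : lunit c' ∘ (dp_ev ⊠ idm c') ∘ hinv (assoc c' c c') ∘ (idm c' ⊠ dp_coev)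
    = runit c' }.

(* An action of a monoidal category, without the finiteness and exactness that
   modcat requires, so as to apply also to a tensor category acting on itself. *)
(** * Duals and module categories *)

Section Action.
Variables (k : fieldType) (C : moncat k) (X : lincat k) (act : C -> X -> X).
Variable actm : forall c d m n, hom c d -> hom m n -> hom (act c m) (act d n).
Local Notation "d ▷ m" := (act d m).
Local Notation "f ▶ g" := (actm f g).
Hypothesis actm1 : forall d m, idm d ▶ idm m = idm (d ▷ m).
Hypothesis actmM : forall c c' c'' m m' m'' (f : hom c' c'') (f' : hom c c')
      (g : hom m' m'') (g' : hom m m'),
    (f ∘ f') ▶ (g ∘ g') = (f ▶ g) ∘ (f' ▶ g').
Variable mass : forall c d m, hom ((c ⊗ d) ▷ m) (c ▷ (d ▷ m)).
Hypothesis mass_iso : forall c d m, is_iso (mass c d m).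
Hypothesis mass_nat :
  forall c c' d d' m m' (f : hom c c') (g : hom d d') (h : hom m m'),
    mass c' d' m' ∘ ((f ⊠ g) ▶ h) = (f ▶ (g ▶ h)) ∘ mass c d m.
Variable munit : forall m, hom (unitc C ▷ m) m.
Hypothesis munit_iso : forall m, is_iso (munit m).
Hypothesis munit_nat : forall m n (f : hom m n),
    munit n ∘ (idm (unitc C) ▶ f) = f ∘ munit m.
Hypothesis mpentagon : forall c d e m,
    mass c d (e ▷ m) ∘ mass (c ⊗ d) e m
    = (idm c ▶ mass d e m) ∘ mass c (d ⊗ e) m ∘ (assoc c d e ▶ idm m).
Hypothesis mtriangle : forall c m,
    (idm c ▶ munit m) ∘ mass c (unitc C) m = runit c ▶ idm m.

Let actMl c d e m (f : hom d e) (g : hom c d) : (f ∘ g) ▶ idm m = (f ▶ idm m) ∘ (g ▶ idm m).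
Proof. by rewrite -actmM comp1m. Qed.
Let actMr c m n p (f : hom n p) (g : hom m n) : idm c ▶ (f ∘ g) = (idm c ▶ f) ∘ (idm c ▶ g).
Proof. by rewrite -actmM comp1m. Qed.
Let acti c d m n (f : hom c d) (g : hom m n) : f ▶ g = (f ▶ idm n) ∘ (idm c ▶ g).
Proof. by rewrite -actmM comp1m compm1. Qed.
Let acti' c d m n (f : hom c d) (g : hom m n) : f ▶ g = (idm d ▶ g) ∘ (f ▶ idm m).
Proof. by rewrite -actmM comp1m compm1. Qed.
Let act_iso c d m n (f : hom c d) (g : hom m n) : is_iso f -> is_iso g -> is_iso (f ▶ g).
Proof.
move=> [f' [ff' f'f]] [g' [gg' g'g]]; exists (f' ▶ g').
by split; rewrite -actmM ?ff' ?f'f ?gg' ?g'g actm1.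
Qed.

(* Kelly's redundancy of the second unit axiom. *)
Lemma munit_mass c m : munit (c ▷ m) ∘ mass (unitc C) c m = lunit c ▶ idm m.
Proof.
have u1 m' n (f g : hom m' n) : idm (unitc C) ▶ f = idm (unitc C) ▶ g -> f = g.
  move=> e; apply: (iso_cancel (munit_iso m')).
  by rewrite -!munit_nat e.
apply: u1; apply: (@iso_cancel _ _ _ _ _ (mass (unitc C) (unitc C ⊗ c) m)); first exact: mass_iso.
apply: (@iso_cancel _ _ _ _ _ (assoc (unitc C) (unitc C) c ▶ idm m)).
  by apply: act_iso; [exact: assoc_iso|exact: is_iso_id].
rewrite -[in RHS]mass_nat -[in RHS]compA -actMl triangle mass_nat actm1.
rewrite actMr -!compA (compA _ (mass _ _ _) (_ ▶ _)) -mpentagon compA.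
by rewrite mtriangle.
Qed.

Variables (c c' : C) (dp : dualpair c c').

Definition aev_of m : hom (c' ▷ (c ▷ m)) m :=
  munit m ∘ (dp_ev dp ▶ idm m) ∘ hinv (mass c' c m).
Definition acoev_of m : hom m (c ▷ (c' ▷ m)) :=
  mass c c' m ∘ (dp_coev dp ▶ idm m) ∘ hinv (munit m).

Lemma aev_of_nat m n (f : hom m n) :
  f ∘ aev_of m = aev_of n ∘ (idm c' ▶ (idm c ▶ f)).
Proof.
rewrite /aev_of !compA -munit_nat -!compA; congr (_ ∘ _); rewrite !compA.
rewrite -acti' acti -!compA; congr (_ ∘ _).
apply/esym; apply: hinv_nat; [exact: mass_iso..|].
by rewrite -mass_nat tensm1.
Qed.

Lemma acoev_of_nat m n (f : hom m n) :
  acoev_of n ∘ f = (idm c ▶ (idm c' ▶ f)) ∘ acoev_of m.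
Proof.
rewrite /acoev_of !compA -mass_nat tensm1 -!(compA (mass _ _ _)); congr (_ ∘ _).
rewrite -acti' [in RHS]acti -!compA; congr (_ ∘ _).
by apply: hinv_nat; [exact: munit_iso..|exact: munit_nat].
Qed.

(** This is [dp_zig] acting on [m]; [munit_mass] turns the left unit constraint at its end into
    [munit]. *)
Lemma aev_of_triL m : (idm c ▶ aev_of m) ∘ acoev_of (c ▷ m) = idm (c ▷ m).
Proof.
rewrite /aev_of /acoev_of !actMr !compA.
have -> : (idm c ▶ munit m) ∘ (idm c ▶ (dp_ev dp ▶ idm m))
   ∘ (idm c ▶ hinv (mass c' c m)) ∘ mass c c' (c ▷ m)
 = ((runit c ∘ (idm c ⊠ dp_ev dp) ∘ assoc c c' c) ▶ idm m) ∘ hinv (mass (c ⊗ c') c m).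
  apply: (@iso_cancel _ _ _ _ _ (mass (c ⊗ c') c m)); first exact: mass_iso.
  rewrite -[in RHS]compA hinvK // compm1 -!compA mpentagon !compA.
  rewrite (cl _ (esym (actMr _ _ _))) hinvK // actm1 compm1.
  by rewrite (cl _ (esym (mass_nat _ _ _))) !compA mtriangle -!actMl.
rewrite -!compA (compA (hinv _)).
have -> : hinv (mass (c ⊗ c') c m) ∘ (dp_coev dp ▶ idm (c ▷ m))
    = ((dp_coev dp ⊠ idm c) ▶ idm m) ∘ hinv (mass (unitc C) c m).
  by apply: hinv_nat => //; rewrite mass_nat actm1.
rewrite !compA -actMl dp_zig -munit_mass -!compA (compA (mass _ _ _)) hinvV // comp1m.
exact: hinvV.
Qed.

Lemma aev_of_triR m : aev_of (c' ▷ m) ∘ (idm c' ▶ acoev_of m) = idm (c' ▷ m).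
Proof.
rewrite /aev_of /acoev_of !actMr !compA.
have -> : munit (c' ▷ m) ∘ (dp_ev dp ▶ idm (c' ▷ m)) ∘ hinv (mass c' c (c' ▷ m))
    ∘ (idm c' ▶ mass c c' m)
  = ((lunit c' ∘ (dp_ev dp ⊠ idm c') ∘ hinv (assoc c' c c')) ▶ idm m)
    ∘ hinv (mass c' (c ⊗ c') m).
  apply: (@iso_cancel _ _ _ _ _ (mass c' (c ⊗ c') m)); first exact: mass_iso.
  rewrite -[in RHS]compA hinvK // compm1.
  apply: (@iso_cancel _ _ _ _ _ (assoc c' c c' ▶ idm m)).
    by apply: act_iso; [exact: assoc_iso|exact: is_iso_id].
  rewrite -(actMl _ _ (assoc c' c c')) -[in RHS](compA _ (hinv _)) hinvK; last exact: assoc_iso.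
  rewrite compm1 -!compA (compA (idm c' ▶ _)) -mpentagon (compA (hinv _)) hinvK //.
  by rewrite comp1m -actm1 -mass_nat !compA munit_mass -actMl.
rewrite -!compA (compA (hinv _)).
have -> : hinv (mass c' (c ⊗ c') m) ∘ (idm c' ▶ (dp_coev dp ▶ idm m))
    = ((idm c' ⊠ dp_coev dp) ▶ idm m) ∘ hinv (mass c' (unitc C) m).
  by apply: hinv_nat => //; rewrite mass_nat.
rewrite !compA -actMl dp_zag -mtriangle -!compA (compA (mass _ _ _)) hinvV // comp1m.
by rewrite -actMr hinvV // actm1.
Qed.

End Action.

Section Tensor.
Variables (k : fieldType) (C : moncat k).
Implicit Types x y z c d : C.

Lemma tensMl x x' x'' y (f : hom x' x'') (g : hom x x') :
  (f ∘ g) ⊠ idm y = (f ⊠ idm y) ∘ (g ⊠ idm y).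
Proof. by rewrite -tensmM comp1m. Qed.
Lemma tensMr x y y' y'' (f : hom y' y'') (g : hom y y') :
  idm x ⊠ (f ∘ g) = (idm x ⊠ f) ∘ (idm x ⊠ g).
Proof. by rewrite -tensmM comp1m. Qed.
Lemma tensi x x' y y' (f : hom x x') (g : hom y y') : f ⊠ g = (f ⊠ idm _) ∘ (idm _ ⊠ g).
Proof. by rewrite -tensmM comp1m compm1. Qed.
Lemma tensi' x x' y y' (f : hom x x') (g : hom y y') : f ⊠ g = (idm _ ⊠ g) ∘ (f ⊠ idm _).
Proof. by rewrite -tensmM comp1m compm1. Qed.
Lemma tens_iso x x' y y' (f : hom x x') (g : hom y y') : is_iso f -> is_iso g -> is_iso (f ⊠ g).
Proof.
move=> [f' [ff' f'f]] [g' [gg' g'g]]; exists (f' ⊠ g').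
by split; rewrite -tensmM ?ff' ?f'f ?gg' ?g'g tensm1.
Qed.

Lemma runit_inj x y (f g : hom x y) : f ⊠ idm (unitc C) = g ⊠ idm (unitc C) -> f = g.
Proof. by move=> e; apply: (iso_cancel (runit_iso x)); rewrite -!runit_nat e. Qed.

Lemma lunit_tens x y : lunit (x ⊗ y) ∘ assoc (unitc C) x y = lunit x ⊠ idm y.
Proof.
exact: (munit_mass (@tensm1 k C) (@tensmM k C) (@assoc_iso k C)
  (@assoc_nat k C) (@lunit_iso k C) (@lunit_nat k C) (@pentagon k C) (@triangle k C)).
Qed.

(** Tensoring with the unit is faithful ([runit_inj]), so it suffices to compare after tensoring
    once more, where pentagon and triangle apply. *)
Lemma runit_tens x y : (idm x ⊠ runit y) ∘ assoc x y (unitc C) = runit (x ⊗ y).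
Proof.
apply: runit_inj.
apply: (iso_cancell (assoc_iso x y (unitc C))).
rewrite -(triangle (x ⊗ y)) tensMl compA assoc_nat -triangle tensMr.
by rewrite [RHS]compA -(tensm1 x y) assoc_nat -!compA pentagon !compA.
Qed.

Lemma lunit_runit1 : lunit (unitc C) = runit (unitc C).
Proof.
apply: runit_inj; rewrite -lunit_tens -triangle; congr (_ ∘ _).
by apply: (iso_cancell (lunit_iso _)); rewrite lunit_nat.
Qed.

Lemma hassoc_nat x x' y y' z z' (f : hom x x') (g : hom y y') (h : hom z z') :
  hinv (assoc x' y' z') ∘ (f ⊠ (g ⊠ h)) = ((f ⊠ g) ⊠ h) ∘ hinv (assoc x y z).
Proof. by apply: hinv_nat; [exact: assoc_iso..|exact: assoc_nat]. Qed.

Section DualTens.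
Variables (c c' : C) (dp : dualpair c c').

Definition tev x : hom (c' ⊗ (c ⊗ x)) x :=
  locked (lunit x ∘ (dp_ev dp ⊠ idm x) ∘ hinv (assoc c' c x)).
Definition tcoev x : hom x (c ⊗ (c' ⊗ x)) :=
  locked (assoc c c' x ∘ (dp_coev dp ⊠ idm x) ∘ hinv (lunit x)).

Lemma tev_nat x y (f : hom x y) : f ∘ tev x = tev y ∘ (idm c' ⊠ (idm c ⊠ f)).
Proof.
rewrite /tev -!lock.
exact: (aev_of_nat (@tensmM k C) (@assoc_iso k C)
  (@assoc_nat k C) (@lunit_nat k C) dp).
Qed.
Lemma tcoev_nat x y (f : hom x y) : tcoev y ∘ f = (idm c ⊠ (idm c' ⊠ f)) ∘ tcoev x.
Proof.
rewrite /tcoev -!lock.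
exact: (acoev_of_nat (@tensmM k C)
  (@assoc_nat k C) (@lunit_iso k C) (@lunit_nat k C) dp).
Qed.
Lemma tev_triL x : (idm c ⊠ tev x) ∘ tcoev (c ⊗ x) = idm (c ⊗ x).
Proof.
rewrite /tev /tcoev -!lock.
exact: (aev_of_triL (@tensm1 k C) (@tensmM k C) (@assoc_iso k C)
  (@assoc_nat k C) (@lunit_iso k C) (@lunit_nat k C) (@pentagon k C) (@triangle k C) dp).
Qed.
Lemma tev_triR x : tev (c' ⊗ x) ∘ (idm c' ⊠ tcoev x) = idm (c' ⊗ x).
Proof.
rewrite /tev /tcoev -!lock.
exact: (aev_of_triR (@tensm1 k C) (@tensmM k C) (@assoc_iso k C)
  (@assoc_nat k C) (@lunit_iso k C) (@lunit_nat k C) (@pentagon k C) (@triangle k C) dp).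
Qed.

Definition rtev x : hom ((x ⊗ c') ⊗ c) x :=
  locked (runit x ∘ (idm x ⊠ dp_ev dp) ∘ assoc x c' c).
Definition rtcoev x : hom x ((x ⊗ c) ⊗ c') :=
  locked (hinv (assoc x c c') ∘ (idm x ⊠ dp_coev dp) ∘ hinv (runit x)).

Lemma rtev_nat x y (f : hom x y) : f ∘ rtev x = rtev y ∘ ((f ⊠ idm c') ⊠ idm c).
Proof.
rewrite /rtev -!lock !compA -runit_nat -!compA assoc_nat tensm1; congr (_ ∘ _).
by rewrite !compA -!tensmM !(comp1m, compm1).
Qed.
Lemma rtcoev_nat x y (f : hom x y) : rtcoev y ∘ f = ((f ⊠ idm c) ⊠ idm c') ∘ rtcoev x.
Proof.
rewrite /rtcoev -!lock !compA -hassoc_nat tensm1 -!(compA (hinv (assoc _ _ _))); congr (_ ∘ _).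
have -> : f ⊠ idm (c ⊗ c') ∘ (idm x ⊠ dp_coev dp) = (idm y ⊠ dp_coev dp) ∘ (f ⊠ idm _).
  by rewrite -!tensmM !(comp1m, compm1).
rewrite -!compA; congr (_ ∘ _).
by apply: hinv_nat; [exact: runit_iso..|exact: runit_nat].
Qed.

Lemma rtev_triL x : rtev (x ⊗ c) ∘ (rtcoev x ⊠ idm c) = idm (x ⊗ c).
Proof.
rewrite /rtev /rtcoev -!lock !tensMl !compA.
have -> : runit (x ⊗ c) ∘ (idm (x ⊗ c) ⊠ dp_ev dp) ∘ assoc (x ⊗ c) c' c
    ∘ (hinv (assoc x c c') ⊠ idm c)
  = (idm x ⊠ (runit c ∘ (idm c ⊠ dp_ev dp) ∘ assoc c c' c)) ∘ assoc x (c ⊗ c') c.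
  apply: (@iso_cancel _ _ _ _ _ (assoc x c c' ⊠ idm c)).
    by apply: tens_iso; [exact: assoc_iso|exact: is_iso_id].
  rewrite -compA -tensMl hinvK; last exact: assoc_iso.
  rewrite tensm1 compm1 !tensMr -!compA (compA (idm x ⊠ assoc _ _ _)) -pentagon.
  rewrite (compA (idm x ⊠ (idm c ⊠ _))) -assoc_nat tensm1 !compA runit_tens //.
rewrite -!compA (compA (assoc _ _ _)) assoc_nat -!compA (compA (idm x ⊠ _)) -tensMr.
rewrite (compA (runit _)) dp_zig compA triangle -tensMl hinvV; last exact: runit_iso.
exact: tensm1.
Qed.

Lemma rtev_triR x : (rtev x ⊠ idm c') ∘ rtcoev (x ⊗ c') = idm (x ⊗ c').
Proof.
rewrite /rtev /rtcoev -!lock !tensMl !compA.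
have -> : (runit x ⊠ idm c') ∘ ((idm x ⊠ dp_ev dp) ⊠ idm c')
    ∘ (assoc x c' c ⊠ idm c') ∘ hinv (assoc (x ⊗ c') c c')
  = (idm x ⊠ (lunit c' ∘ (dp_ev dp ⊠ idm c') ∘ hinv (assoc c' c c'))) ∘ assoc x c' (c ⊗ c').
  apply: (@iso_cancel _ _ _ _ _ (assoc (x ⊗ c') c c')); first exact: assoc_iso.
  rewrite -compA hinvK ?compm1; last exact: assoc_iso.
  rewrite -[in RHS]compA pentagon !compA -tensMr -[in RHS](compA _ (hinv _)) hinvK; last exact: assoc_iso.
  rewrite compm1 tensMr -[in RHS](compA _ _ (assoc _ _ _)) -assoc_nat compA triangle.
  by [].
rewrite -!compA (compA (assoc _ _ _)) -(tensm1 x c') assoc_nat -!compA.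
rewrite (compA (idm x ⊠ _)) -tensMr (compA (lunit _)) dp_zag compA runit_tens hinvV ?tensm1 //.
exact: runit_iso.
Qed.

Lemma rtens_bij w y : bij (fun g : hom w (y ⊗ c') => rtev y ∘ (g ⊠ idm c)).
Proof.
apply: (@can_bij _ _ _ (fun f => (f ⊠ idm c') ∘ rtcoev w)) => [g|f].
  by rewrite tensMl -compA -rtcoev_nat compA rtev_triR comp1m.
by rewrite tensMl compA -rtev_nat -compA rtev_triL compm1.
Qed.

Lemma ltens_bij w y : bij (fun g : hom w (c ⊗ y) => tev y ∘ (idm c' ⊠ g)).
Proof.
apply: (@can_bij _ _ _ (fun f => (idm c ⊠ f) ∘ tcoev w)) => [g|f].
  by rewrite tensMr -compA -tcoev_nat compA tev_triL comp1m.
by rewrite tensMr compA -tev_nat -compA tev_triR compm1.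
Qed.

Definition pair_bij w : bij (fun g : hom w c' => dp_ev dp ∘ (g ⊠ idm c)).
Proof.
have h : bij (fun g : hom w c' => hinv (lunit c') ∘ g).
  by apply: iso_bij; apply: is_iso_hinv; apply: lunit_iso.
refine (eq_bij _ (bij_comp (@rtens_bij w (unitc C)) h)) => g.
rewrite /rtev -lock -lunit_runit1.
have -> : lunit (unitc C) ∘ (idm (unitc C) ⊠ dp_ev dp) ∘ assoc (unitc C) c' c
   = dp_ev dp ∘ (lunit c' ⊠ idm c).
  by rewrite lunit_nat -compA lunit_tens.
by rewrite -compA -tensMl compA hinvV ?comp1m //; apply: lunit_iso.
Qed.

Definition pair_bijl w : bij (fun g : hom w c => dp_ev dp ∘ (idm c' ⊠ g)).
Proof.
have h : bij (fun g : hom w c => hinv (runit c) ∘ g).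
  by apply: iso_bij; apply: is_iso_hinv; apply: runit_iso.
refine (eq_bij _ (bij_comp (@ltens_bij w (unitc C)) h)) => g.
rewrite /tev -lock.
have -> : lunit (unitc C) ∘ (dp_ev dp ⊠ idm (unitc C)) ∘ hinv (assoc c' c (unitc C))
   = dp_ev dp ∘ (idm c' ⊠ runit c).
  rewrite lunit_runit1 runit_nat -runit_tens -!compA hinvV ?compm1 //.
  exact: assoc_iso.
by rewrite -compA -tensMr compA hinvV ?comp1m //; apply: runit_iso.
Qed.

End DualTens.
End Tensor.

Section FTDuals.
Variables (k : fieldType) (D : ftcat k).
Implicit Types x y z w c d : D.

Definition rdp x : dualpair x x^v := DualPair (rdual_zig (ftcat_rigid D) x)
  (rdual_zag (ftcat_rigid D) x).
Definition ldp x : dualpair (ldual x) x := DualPair (ldual_zag (ftcat_rigid D) x)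
  (ldual_zig (ftcat_rigid D) x).

Lemma rcurryK w x (g : hom (w ⊗ x) (unitc D)) : rev x ∘ (rcurry g ⊠ idm x) = g.
Proof.
pose f := (g ⊠ idm x^v) ∘ rtcoev (rdp x) w.
have fP : rtev (rdp x) (unitc D) ∘ (f ⊠ idm x) = g.
  by rewrite tensMl compA -rtev_nat -compA rtev_triL compm1.
have -> : rcurry g = lunit _ ∘ f by rewrite /rcurry /f /rtcoev -lock /= !compA.
rewrite -{}fP /rtev -lock -lunit_runit1 tensMl -lunit_tens lunit_nat !compA //.
Qed.

Lemma rcurry_uniq w x (g h : hom w x^v) :
  rev x ∘ (g ⊠ idm x) = rev x ∘ (h ⊠ idm x) -> g = h.
Proof. exact: (bij_inj (pair_bij (rdp x) w)). Qed.

Lemma rcurryE w x (g : hom (w ⊗ x) (unitc D)) h : rev x ∘ (h ⊠ idm x) = g -> rcurry g = h.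
Proof. by move=> e; apply: rcurry_uniq; rewrite rcurryK. Qed.

Lemma lcurryK w x (g : hom (x ⊗ w) (unitc D)) : lev x ∘ (idm x ⊠ lcurry g) = g.
Proof.
pose f := (idm (ldual x) ⊠ g) ∘ tcoev (ldp x) w.
have fP : tev (ldp x) (unitc D) ∘ (idm x ⊠ f) = g.
  by rewrite tensMr compA -tev_nat -compA tev_triR compm1.
have -> : lcurry g = runit _ ∘ f by rewrite /lcurry /f /tcoev -lock /= !compA.
rewrite -fP tensMr compA; congr (_ ∘ _).
rewrite /tev -lock lunit_runit1 runit_nat -runit_tens -!compA hinvV ?compm1 //.
exact: assoc_iso.
Qed.

Lemma lcurry_uniq w x (g h : hom w (ldual x)) :
  lev x ∘ (idm x ⊠ g) = lev x ∘ (idm x ⊠ h) -> g = h.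
Proof. exact: (bij_inj (pair_bijl (ldp x) w)). Qed.

Lemma rdualmP x y (f : hom x y) : rev x ∘ (rdualm f ⊠ idm x) = rev y ∘ (idm y^v ⊠ f).
Proof. exact: rcurryK. Qed.

Lemma rdualm_iso x y (f : hom x y) : is_iso f -> is_iso (rdualm f).
Proof.
move=> fi; exists (rdualm (hinv f)); split; apply: rcurry_uniq;
  rewrite tensMl compA rdualmP -compA -tensi' tensi compA rdualmP -compA -tensMr.
  by rewrite hinvV // tensm1.
by rewrite hinvK // tensm1.
Qed.

Lemma pairing_adjoint a a' b b' (p : hom (a ⊗ b) (unitc D)) (p' : hom (a' ⊗ b') (unitc D))
    (f : hom a' a) (g : hom b b') :
  p ∘ (f ⊠ idm b) = p' ∘ (idm a' ⊠ g) -> rcurry p ∘ f = rdualm g ∘ rcurry p'.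
Proof.
move=> e; apply: rcurry_uniq.
move: (rcurry p) (rcurryK p) (rcurry p') (rcurryK p') (rdualm g) (rdualmP g).
move=> r hr r' hr' g' hg; rewrite !tensMl !compA hr hg -(compA (rev b')) -tensi' [in RHS]tensi.
by rewrite compA hr'.
Qed.

Lemma pair_iso c c' (dp : dualpair c c') : is_iso (rcurry (dp_ev dp)).
Proof.
apply: iso_yoneda => w.
have h := pair_bij dp w; have h' := pair_bij (rdp c) w.
apply: bijI => [f g /= e|g].
  by apply: (bij_inj h); rewrite -(rcurryK (dp_ev dp)) -!compA -!tensMl e.
have [f hf] := bij_surj (rev c ∘ (g ⊠ idm c)) h; exists f; apply: rcurry_uniq.
by rewrite -hf tensMl compA rcurryK.
Qed.

(** The coevaluation of the chosen right dual of c, carried over along the isomorphism c' = c^∨ that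
    p defines. *)
Lemma pair_of_iso c c' (p : hom (c' ⊗ c) (unitc D)) : is_iso (rcurry p) ->
  {dp : dualpair c c' | dp_ev dp = p}.
Proof.
move: (rcurry p) (rcurryK p) => r hp ri.
pose coev := (idm c ⊠ hinv r) ∘ rcoev c.
have zig : runit c ∘ (idm c ⊠ p) ∘ assoc c c' c ∘ (coev ⊠ idm c) = lunit c.
  rewrite /coev tensMl -{1}hp !compA (cl _ (assoc_nat _ _ _)) !compA.
  rewrite (cl _ (esym (tensMr _ _ _))) -(compA (rev c)) -tensMl hinvV // tensm1 compm1.
  exact: rdual_zig.
have zag : lunit c' ∘ (p ⊠ idm c') ∘ hinv (assoc c' c c') ∘ (idm c' ⊠ coev) = runit c'.
  apply: (iso_cancell ri); rewrite -runit_nat -(rdual_zag (ftcat_rigid D) c).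
  rewrite !compA -lunit_nat -hp tensMl -/(rev c) -/(rcoev c) -/(rdual c).
  rewrite -!compA; congr (_ ∘ _); rewrite (compA (idm _ ⊠ r)) -tensi' tensi -!compA.
  congr (_ ∘ _); rewrite -tensi' /coev tensMr !compA.
  rewrite -tensi' -hassoc_nat -!compA; congr (_ ∘ _).
  by rewrite -tensMr -tensmM compm1 compA -tensMr hinvV // tensm1 comp1m.
by exists (DualPair zig zag).
Qed.

Lemma pair_of_liso c c' (p : hom (c' ⊗ c) (unitc D)) : is_iso (lcurry p) ->
  {dp : dualpair c c' | dp_ev dp = p}.
Proof.
move: (lcurry p) (lcurryK p) => r hp ri.
pose coev := (hinv r ⊠ idm c') ∘ lcoev c'.
have zig : runit c ∘ (idm c ⊠ p) ∘ assoc c c' c ∘ (coev ⊠ idm c) = lunit c.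
  apply: (iso_cancell ri); rewrite -lunit_nat -(ldual_zag (ftcat_rigid D) c').
  rewrite !compA -runit_nat -hp tensMr -/(lev c') -/(lcoev c') -/(ldual c').
  rewrite -!compA; congr (_ ∘ _); rewrite (compA (r ⊠ idm _)) -tensi tensi' -!compA.
  congr (_ ∘ _); rewrite -tensi !compA.
  rewrite -tensi -assoc_nat -!compA; congr (_ ∘ _).
  by rewrite -tensmM compm1 compA -tensMl hinvV // tensm1 comp1m.
have zag : lunit c' ∘ (p ⊠ idm c') ∘ hinv (assoc c' c c') ∘ (idm c' ⊠ coev) = runit c'.
  rewrite /coev tensMr -{1}hp !compA (cl _ (hassoc_nat _ _ _)) !compA.
  rewrite (cl _ (esym (tensMl _ _ _))) -(compA (lev c')) -tensMr hinvV // tensm1 compm1.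
  exact: ldual_zig.
by exists (DualPair zig zag).
Qed.

(** Nondegeneracy in one variable implies it in the other: the hypothesis makes c the left dual of
    c' by Yoneda, so p is the evaluation of a duality, and then c' is the right dual of c. *)
Lemma pairing_perfect c c' (p : hom (c' ⊗ c) (unitc D)) :
  (forall w, bij (fun g : hom w c => p ∘ (idm c' ⊠ g))) -> is_iso (rcurry p).
Proof.
move=> h; suff ri : is_iso (lcurry p).
  by have [dp <-] := pair_of_liso ri; apply: pair_iso.
apply: iso_yoneda => w; have h' := pair_bijl (ldp c') w.
apply: bijI => [f g /= e|g].
  by apply: (bij_inj (h w)); rewrite -(lcurryK p) -!compA -!tensMr e.
have [f hf] := bij_surj (lev c' ∘ (idm c' ⊠ g)) (h w); exists f; apply: lcurry_uniq.
by rewrite -hf tensMr compA lcurryK.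
Qed.

Lemma pairing_perfectr c c' (p : hom (c' ⊗ c) (unitc D)) :
  (forall w, bij (fun g : hom w c' => p ∘ (g ⊠ idm c))) -> is_iso (rcurry p).
Proof.
move=> h; apply: iso_yoneda => w; have h' := pair_bij (rdp c) w.
apply: bijI => [f g /= e|g].
  by apply: (bij_inj (h w)); rewrite -(rcurryK p) -!compA -!tensMl e.
have [f hf] := bij_surj (rev c ∘ (g ⊠ idm c)) (h w); exists f; apply: rcurry_uniq.
by rewrite -hf tensMl compA rcurryK.
Qed.

End FTDuals.

Section ModuleBasics.
Variables (k : fieldType) (D : ftcat k) (M : modcat D).
Implicit Types (c d e : D) (m n : M).

Lemma actMl c d e m (f : hom d e) (g : hom c d) : (f ∘ g) ▶ idm m = (f ▶ idm m) ∘ (g ▶ idm m).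
Proof. by rewrite -actmM comp1m. Qed.
Lemma actMr c m n p (f : hom n p) (g : hom m n) : idm c ▶ (f ∘ g) = (idm c ▶ f) ∘ (idm c ▶ g).
Proof. by rewrite -actmM comp1m. Qed.
Lemma acti c d m n (f : hom c d) (g : hom m n) : f ▶ g = (f ▶ idm n) ∘ (idm c ▶ g).
Proof. by rewrite -actmM comp1m compm1. Qed.
Lemma acti' c d m n (f : hom c d) (g : hom m n) : f ▶ g = (idm d ▶ g) ∘ (f ▶ idm m).
Proof. by rewrite -actmM comp1m compm1. Qed.
Lemma act_hinv c d m n (f : hom c d) (g : hom m n) :
  is_iso f -> is_iso g -> hinv (f ▶ g) = hinv f ▶ hinv g.
Proof. by move=> fi gi; apply: hinvE; split; rewrite -actmM ?hinvK ?hinvV // actm1. Qed.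

Lemma act0l c d m n (g : hom m n) : (0 : hom c d) ▶ g = 0.
Proof.
have := actmPl 1 (0 : hom c d) 0 g; rewrite !scale1r addr0.
by move=> /(congr1 (fun u => u - (0 : hom c d) ▶ g)); rewrite subrr addrK.
Qed.

Lemma mod_munit_mass c m : munit (c ▷ m) ∘ mass (unitc D) c m = lunit c ▶ idm m.
Proof.
exact: (munit_mass (@actm1 k D M) (@actmM k D M) (@mass_iso k D M)
  (@mass_nat k D M) (@munit_iso k D M) (@munit_nat k D M) (@mpentagon k D M) (@mtriangle k D M)).
Qed.

Lemma hmass_nat c c' d d' m m' (f : hom c c') (g : hom d d') (h : hom m m') :
  hinv (mass c' d' m') ∘ (f ▶ (g ▶ h)) = ((f ⊠ g) ▶ h) ∘ hinv (mass c d m).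
Proof. by apply: hinv_nat; [exact: mass_iso..|exact: mass_nat]. Qed.

Lemma hmunit_nat m n (f : hom m n) :
  hinv (munit n) ∘ f = (idm (unitc D) ▶ f) ∘ hinv (munit m).
Proof. by apply: hinv_nat; [exact: munit_iso..|exact: munit_nat]. Qed.

Definition actF d : functor M M.
Proof.
refine (@Functor k M M (fun m => d ▷ m) (fun m n f => idm d ▶ f) _ _ _).
- by move=> x; exact: actm1.
- by move=> x y z f g; exact: actMr.
- by move=> x y a f g; exact: actmPr.
Defined.

Definition actL m : functor D M.
Proof.
refine (@Functor k D M (fun d => d ▷ m) (fun c d f => f ▶ idm m) _ _ _).
- by move=> x; exact: actm1.
- by move=> x y z f g; exact: actMl.
- by move=> x y a f g; exact: actmPl.
Defined.

Section Pair.
Variables (c c' : D) (dp : dualpair c c').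

Definition aev m : hom (c' ▷ (c ▷ m)) m :=
  locked (munit m ∘ (dp_ev dp ▶ idm m) ∘ hinv (mass c' c m)).
Definition acoev m : hom m (c ▷ (c' ▷ m)) :=
  locked (mass c c' m ∘ (dp_coev dp ▶ idm m) ∘ hinv (munit m)).

Lemma aev_nat m n (f : hom m n) : f ∘ aev m = aev n ∘ (idm c' ▶ (idm c ▶ f)).
Proof.
rewrite /aev -!lock.
exact: (aev_of_nat (@actmM k D M) (@mass_iso k D M)
  (@mass_nat k D M) (@munit_nat k D M) dp).
Qed.
Lemma acoev_nat m n (f : hom m n) : acoev n ∘ f = (idm c ▶ (idm c' ▶ f)) ∘ acoev m.
Proof.
rewrite /acoev -!lock.
exact: (acoev_of_nat (@actmM k D M)
  (@mass_nat k D M) (@munit_iso k D M) (@munit_nat k D M) dp).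
Qed.
Lemma aev_triL m : (idm c ▶ aev m) ∘ acoev (c ▷ m) = idm (c ▷ m).
Proof.
rewrite /aev /acoev -!lock.
exact: (aev_of_triL (@actm1 k D M) (@actmM k D M) (@mass_iso k D M)
  (@mass_nat k D M) (@munit_iso k D M) (@munit_nat k D M) (@mpentagon k D M) (@mtriangle k D M) dp).
Qed.
Lemma aev_triR m : aev (c' ▷ m) ∘ (idm c' ▶ acoev m) = idm (c' ▷ m).
Proof.
rewrite /aev /acoev -!lock.
exact: (aev_of_triR (@actm1 k D M) (@actmM k D M) (@mass_iso k D M)
  (@mass_nat k D M) (@munit_iso k D M) (@munit_nat k D M) (@mpentagon k D M) (@mtriangle k D M) dp).
Qed.

Definition act_adj : adjunction (actF c') (actF c).
Proof.
refine (@Adjunction k M M (actF c') (actF c) acoev aev _ _ _ _).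
- by move=> x y f; exact: acoev_nat.
- by move=> x y f; exact: aev_nat.
- by move=> x; exact: aev_triR.
- by move=> x; exact: aev_triL.
Defined.

End Pair.
End ModuleBasics.

(** * Internal Homs *)

Section PairMass.
Variables (k : fieldType) (D : ftcat k) (M : modcat D).
Variables (c c' : D) (dp : dualpair c c').

Lemma aev_mass x (m : M) :
  aev dp (x ▷ m) ∘ (idm c' ▶ mass c x m) = (tev dp x ▶ idm m) ∘ hinv (mass c' (c ⊗ x) m).
Proof.
apply: (@iso_cancel _ _ _ _ _ (mass c' (c ⊗ x) m ∘ (assoc c' c x ▶ idm m))).
  apply: is_iso_comp; first exact: mass_iso.
  by apply: is_iso_actm; [exact: assoc_iso|exact: is_iso_id].
rewrite !compA -(compA (aev dp _)) -(compA (aev dp _)) -mpentagon.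
rewrite /aev -lock -!compA (compA (hinv _)) hinvK ?comp1m; last exact: mass_iso.
rewrite (compA (hinv _)) hinvK ?comp1m; last exact: mass_iso.
rewrite -actm1 -mass_nat !compA mod_munit_mass -!actMl /tev -lock.
by rewrite -[in RHS](compA _ (hinv _)) hinvK ?compm1 //; exact: assoc_iso.
Qed.

Lemma aev_massr x (m : M) :
  (idm x ▶ aev dp m) ∘ mass x c' (c ▷ m) ∘ mass (x ⊗ c') c m = rtev dp x ▶ idm m.
Proof.
rewrite -compA mpentagon /aev /rtev -!lock !actMr -!compA (compA (_ ▶ hinv _)) -actMr.
rewrite hinvK ?actm1 ?comp1m; last exact: mass_iso.
by rewrite (compA (_ ▶ (_ ▶ _))) -mass_nat !compA mtriangle -!actMl.
Qed.
End PairMass.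

Section IHomCalculus.
Variables (k : fieldType) (D : ftcat k) (M : modcat D).
Variable H : forall m n : M, ihom m n.
Implicit Types (c d e x : D) (m n p q : M).

Definition iunc d m n (g : hom d (H m n)) : hom (d ▷ m) n :=
  locked (ih_ev (H m n) ∘ (g ▶ idm m)).

Lemma iuncE d m n (g : hom d (H m n)) : iunc g = ih_ev (H m n) ∘ (g ▶ idm m).
Proof. by rewrite /iunc -lock. Qed.

Lemma iunc_bij d m n : bij (@iunc d m n).
Proof.
split=> f; have [g [hg gU]] := ih_univ (H m n) f; exists g; split; first by rewrite iuncE.
by move=> g'; rewrite iuncE; apply: gU.
Qed.

Lemma iunc_inj d m n : injective (@iunc d m n).
Proof. exact: (bij_inj (@iunc_bij d m n)). Qed.

Lemma icurryK d m n (f : hom (d ▷ m) n) : iunc (icurry H f) = f.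
Proof.
rewrite iuncE; apply: (the_morP (P := fun g => ih_ev (H m n) ∘ (g ▶ idm m) = f)).
by have [g hg] := bij_surj f (@iunc_bij d m n); exists g; rewrite -iuncE.
Qed.

Lemma iuncK d m n (g : hom d (H m n)) : icurry H (iunc g) = g.
Proof. by apply: iunc_inj; rewrite icurryK. Qed.

Lemma iunc1 m n : iunc (idm (H m n)) = ih_ev (H m n).
Proof. by rewrite iuncE actm1 compm1. Qed.

Lemma iunc_nat c d m n (g : hom d (H m n)) (u : hom c d) : iunc (g ∘ u) = iunc g ∘ (u ▶ idm m).
Proof. by rewrite !iuncE actMl compA. Qed.

Lemma iunc_post d m n p (f : hom n p) (g : hom d (H m n)) :
  iunc (ipost H m f ∘ g) = f ∘ iunc g.
Proof. by rewrite iunc_nat icurryK -compA -iuncE. Qed.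

Lemma iunc_post1 m n p (f : hom n p) : iunc (ipost H m f) = f ∘ ih_ev (H m n).
Proof. exact: icurryK. Qed.

Lemma iunc_pre d m m' n (f : hom m' m) (g : hom d (H m n)) :
  iunc (ipre H n f ∘ g) = iunc g ∘ (idm d ▶ f).
Proof. by rewrite iunc_nat icurryK -compA -acti' acti compA -iuncE. Qed.

Lemma iunc_pre1 m m' n (f : hom m' m) :
  iunc (ipre H n f) = ih_ev (H m n) ∘ (idm _ ▶ f).
Proof. exact: icurryK. Qed.

Lemma iunc_icomp c d m n p (f : hom c (H n p)) (g : hom d (H m n)) :
  iunc (icomp H m n p ∘ (f ⊠ g)) = iunc f ∘ (idm c ▶ iunc g) ∘ mass c d m.
Proof.
rewrite iunc_nat icurryK -!compA mass_nat !compA; congr (_ ∘ _).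
by rewrite !iuncE -!compA -!actmM !(comp1m, compm1).
Qed.

Lemma iunc_istr c d m n x (u : hom c d) (g : hom x (H m n)) :
  iunc (istr H d m n ∘ (u ⊠ g)) = (u ▶ iunc g) ∘ mass c x m.
Proof.
rewrite iunc_nat icurryK -!compA mass_nat !compA; congr (_ ∘ _).
by rewrite iuncE -!actmM !(comp1m, compm1).
Qed.

Lemma icostr1 d m n :
  iunc (icostr H d m n) = ih_ev (H m n) ∘ (idm _ ▶ aev (rdp d) m) ∘ mass (H m n) d^v (d ▷ m).
Proof. by rewrite icurryK /aev -lock. Qed.

Lemma iunc_icostr d m n x y (u : hom x (H m n)) (g : hom y d^v) :
  iunc (icostr H d m n ∘ (u ⊠ g)) = iunc u ∘ (idm x ▶ (aev (rdp d) m ∘ (g ▶ idm _))) ∘ mass x y (d ▷ m).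
Proof.
rewrite iunc_nat icostr1 -!compA mass_nat !compA.
by congr (_ ∘ _); rewrite iuncE -!compA -!actmM !(comp1m, compm1).
Qed.

Lemma iunc_iid m : iunc (iid H m) = munit m.
Proof. exact: icurryK. Qed.

Lemma ipost1 m n : ipost H m (idm n) = idm (H m n).
Proof. by apply: iunc_inj; rewrite iunc_post1 iunc1 comp1m. Qed.
Lemma ipostM m n p q (f : hom p q) (g : hom n p) : ipost H m (f ∘ g) = ipost H m f ∘ ipost H m g.
Proof. by apply: iunc_inj; rewrite iunc_post !iunc_post1 compA. Qed.
Lemma ipostP m n p a (f g : hom n p) : ipost H m (a *: f + g) = a *: ipost H m f + ipost H m g.
Proof.
apply: iunc_inj; rewrite iunc_post1 compPl -!iunc_post1 !iuncE.
by rewrite -compPr -actmPl.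
Qed.

Lemma ipre1 m n : ipre H n (idm m) = idm (H m n).
Proof. by apply: iunc_inj; rewrite iunc_pre1 iunc1 actm1 compm1. Qed.
Lemma ipreM m n p q (f : hom p q) (g : hom m p) : ipre H n (f ∘ g) = ipre H n g ∘ ipre H n f.
Proof. by apply: iunc_inj; rewrite iunc_pre !iunc_pre1 -compA -actMr. Qed.
Lemma ipreP m n p a (f g : hom m p) : ipre H n (a *: f + g) = a *: ipre H n f + ipre H n g.
Proof.
apply: iunc_inj; rewrite iunc_pre1 actmPr compPr -!iunc_pre1 !iuncE.
by rewrite -compPr -actmPl.
Qed.

Lemma ipre_post m m' n n' (f : hom m' m) (g : hom n n') :
  ipre H n' f ∘ ipost H m g = ipost H m' g ∘ ipre H n f.
Proof. by apply: iunc_inj; rewrite iunc_pre iunc_post iunc_post1 iunc_pre1 compA. Qed.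

Definition ihF m : functor M D.
Proof.
refine (@Functor k M D (fun n => ih_obj (H m n)) (fun n p f => ipost H m f) _ _ _).
- by move=> n; exact: ipost1.
- by move=> x y z f g; exact: ipostM.
- by move=> n p a f g; exact: ipostP.
Defined.

Definition ihG n : functor (opc M) D.
Proof.
refine (@Functor k (opc M) D (fun m => ih_obj (H m n)) (fun p m f => ipre H n f) _ _ _).
- by move=> m; exact: ipre1.
- by move=> x y z f g; exact: ipreM.
- by move=> m p a f g; exact: ipreP.
Defined.

Definition ih_adj m : adjunction (actL m) (ihF m).
Proof.
refine (@Adjunction k D M (actL m) (ihF m) (fun d => icurry H (idm (d ▷ m)))
   (fun n => ih_ev (H m n)) _ _ _ _) => /=.
- by move=> c d f; apply: iunc_inj; rewrite iunc_post iunc_nat !icurryK comp1m compm1.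
- by move=> n p f; rewrite -iunc_post1 iuncE.
- by move=> d; rewrite -iuncE icurryK.
- by move=> n; apply: iunc_inj; rewrite iunc_post icurryK iunc1 compm1.
Defined.

Lemma istr_nat c d m n p (u : hom c d) (f : hom n p) :
  istr H d m p ∘ (u ⊠ ipost H m f) = ipost H m (u ▶ f) ∘ istr H c m n.
Proof.
apply: iunc_inj; rewrite iunc_istr iunc_post iunc_post1.
rewrite -(compm1 (istr _ _ _ _)) -tensm1 iunc_istr iunc1 compA.
by rewrite -actmM compm1.
Qed.

Lemma istr1 d m n : iunc (istr H d m n) = (idm d ▶ ih_ev (H m n)) ∘ mass d _ m.
Proof. exact: icurryK. Qed.

Lemma istr_mass c d m n :
  ipost H m (mass c d n) ∘ istr H (c ⊗ d) m n
  = istr H c m (d ▷ n) ∘ (idm c ⊠ istr H d m n) ∘ assoc c d (H m n).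
Proof.
apply: iunc_inj; rewrite iunc_post iunc_nat iunc_istr !istr1 actMr.
by rewrite compA -tensm1 mass_nat -compA mpentagon !compA.
Qed.

Lemma istr_unit m n : ipost H m (munit n) ∘ istr H (unitc D) m n = lunit (H m n).
Proof.
apply: iunc_inj; rewrite iunc_post istr1 compA munit_nat -compA mod_munit_mass.
by rewrite -iunc1 -iunc_nat comp1m.
Qed.

(** Yoneda: Hom(c, d ⊗ H(m,n)) = Hom(d^∨ ⊗ c, H(m,n)) = Hom((d^∨ ⊗ c) ▷ m, n) = Hom(c ▷ m, d ▷
    n). *)
Lemma istr_iso d m n : is_iso (istr H d m n).
Proof.
apply: iso_yoneda => c.
pose A (g : hom c (d ⊗ H m n)) := tev (rdp d) (H m n) ∘ (idm d^v ⊠ g).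
have bA : bij A by apply: (@ltens_bij _ _ _ _ (rdp d)).
have bB := @adjl_bij _ _ _ _ _ (act_adj M (rdp d)) (c ▷ m) n.
have bi := @iunc_bij; have bm := @iso_bijr _ _ n _ _ _ (mass_iso d^v c m).
have key g : iunc (A g) = adjl (act_adj M (rdp d)) (iunc (istr H d m n ∘ g)) ∘ mass d^v c m.
  rewrite /A iunc_nat /adjl /= iunc_nat istr1 !actMr -!compA -mass_nat.
  rewrite (compA (idm _ ▶ mass _ _ _)) (compA (aev _ _)) -aev_nat -!compA.
  rewrite (compA (aev _ _) (idm _ ▶ _)) aev_mass -!compA (compA (hinv _)) hinvK; last exact: mass_iso.
  by rewrite comp1m iuncE compA.
apply: bijI => [g g' /= e|f].
  by apply: (bij_inj bA); apply: iunc_inj; rewrite !key e.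
have [h hh] := bij_surj (adjl (act_adj M (rdp d)) (iunc f) ∘ mass d^v c m) (@bi _ _ _).
have [g hg] := bij_surj h bA; exists g; apply: iunc_inj; apply: (bij_inj bB).
by apply: (bij_inj bm); rewrite /= -key hg hh.
Qed.

Section Costrength.
Variables (d d' : D) (dp : dualpair d d').

(** [icostr] for an arbitrary dual pair. The case of a left dual, H(n, s) ⊗ w = H(^∨w ▷ n, s), is
    what [couniversal_perfect] relies on. *)
Definition gcostr m n : hom (H m n ⊗ d') (H (d ▷ m) n) :=
  icurry H (ih_ev (H m n) ∘ (idm _ ▶ aev dp m) ∘ mass (H m n) d' (d ▷ m)).

Lemma gcostr1 m n :
  iunc (gcostr m n) = ih_ev (H m n) ∘ (idm _ ▶ aev dp m) ∘ mass (H m n) d' (d ▷ m).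
Proof. exact: icurryK. Qed.

Lemma iunc_gcostr m n x y (u : hom x (H m n)) (g : hom y d') :
  iunc (gcostr m n ∘ (u ⊠ g)) = iunc u ∘ (idm x ▶ (aev dp m ∘ (g ▶ idm _))) ∘ mass x y (d ▷ m).
Proof.
rewrite iunc_nat gcostr1 -!compA mass_nat !compA.
by congr (_ ∘ _); rewrite iuncE -!compA -!actmM !(comp1m, compm1).
Qed.

Lemma gcostr_iso m n : is_iso (gcostr m n).
Proof.
apply: iso_yoneda => c.
pose A (g : hom c (H m n ⊗ d')) := rtev dp (H m n) ∘ (g ⊠ idm d).
have bA : bij A by apply: (@rtens_bij _ _ _ _ dp).
have bi := @iunc_bij; have bm := @iso_bijr _ _ n _ _ _ (mass_iso c d m).
have key g : iunc (A g) = iunc (gcostr m n ∘ g) ∘ mass c d m.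
  rewrite /A iunc_nat iunc_nat icurryK -!compA -actm1 -mass_nat.
  rewrite (compA (mass _ _ _)) (compA (idm _ ▶ _)) (compA (_ ▶ aev _ _)) aev_massr.
  by rewrite iuncE -compA.
apply: bijI => [g g' /= e|f].
  by apply: (bij_inj bA); apply: iunc_inj; rewrite !key e.
have [h hh] := bij_surj (iunc f ∘ mass c d m) (@bi _ _ _).
have [g hg] := bij_surj h bA; exists g; apply: iunc_inj.
by apply: (bij_inj bm); rewrite /= -key hg hh.
Qed.
End Costrength.

Lemma icostrE d m n : icostr H d m n = gcostr (rdp d) m n.
Proof. by apply: iunc_inj; rewrite icostr1 icurryK. Qed.

Lemma icostr_iso d m n : is_iso (icostr H d m n).
Proof. by rewrite icostrE; apply: gcostr_iso. Qed.

Lemma icomp1 m n p : iunc (icomp H m n p) = ih_ev (H n p) ∘ (idm _ ▶ ih_ev (H m n)) ∘ mass _ _ m.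
Proof. exact: icurryK. Qed.

Lemma icomp_postl m n p q (f : hom p q) :
  icomp H m n q ∘ (ipost H n f ⊠ idm _) = ipost H m f ∘ icomp H m n p.
Proof.
by apply: iunc_inj; rewrite iunc_icomp iunc_post iunc_post1 iunc1 icomp1 !compA.
Qed.

Lemma icomp_mid m n n' p (f : hom n n') :
  icomp H m n' p ∘ (idm _ ⊠ ipost H m f) = icomp H m n p ∘ (ipre H p f ⊠ idm _).
Proof.
by apply: iunc_inj; rewrite !iunc_icomp iunc_post1 iunc_pre1 !iunc1 actMr !compA.
Qed.

Lemma icomp_prer m' m n p (f : hom m' m) :
  icomp H m' n p ∘ (idm _ ⊠ ipre H n f) = ipre H p f ∘ icomp H m n p.
Proof.
apply: iunc_inj; rewrite iunc_icomp iunc_pre iunc_pre1 iunc1 icomp1 actMr -!compA.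
by rewrite -mass_nat tensm1.
Qed.

Lemma icompA m n p q :
  icomp H m p q ∘ (idm _ ⊠ icomp H m n p) ∘ assoc _ _ _
  = icomp H m n q ∘ (icomp H n p q ⊠ idm _).
Proof.
apply: iunc_inj; rewrite iunc_nat !iunc_icomp !icomp1 !iunc1 !actMr -tensm1.
by rewrite -!compA (compA (mass _ _ n)) mass_nat -!compA mpentagon !compA.
Qed.

Lemma iunc0 d m n : iunc (0 : hom d (H m n)) = 0.
Proof. by rewrite iuncE act0l comp0r. Qed.

Lemma icomp_iidr m n : icomp H m m n ∘ (idm _ ⊠ iid H m) = runit (H m n).
Proof.
apply: iunc_inj; rewrite iunc_icomp iunc_iid iunc1 -compA mtriangle.
by rewrite -iunc1 -iunc_nat comp1m.
Qed.

Lemma icomp_iidl m n : icomp H m n n ∘ (iid H n ⊠ idm _) = lunit (H m n).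
Proof.
apply: iunc_inj; rewrite iunc_icomp iunc_iid iunc1 munit_nat -compA mod_munit_mass.
by rewrite -iunc1 -iunc_nat comp1m.
Qed.

(** Composition with the canonical morphism d -> H(n, d ▷ n). It moves a strength from the second
    factor of a composition to the first one ([icomp_istrr]). *)
Definition icontr d n p : hom (H (d ▷ n) p ⊗ d) (H n p) :=
  icurry H (ih_ev (H (d ▷ n) p) ∘ mass _ d n).

Lemma icomp_istrr d m n p :
  icomp H m (d ▷ n) p ∘ (idm _ ⊠ istr H d m n)
  = icomp H m n p ∘ (icontr d n p ⊠ idm _) ∘ hinv (assoc _ d _).
Proof.
apply: (iso_cancel (assoc_iso _ _ _)); rewrite -[RHS]compA hinvK ?compm1; last exact: assoc_iso.
apply: iunc_inj; rewrite iunc_nat !iunc_icomp istr1 !iunc1 icurryK !actMr -tensm1 -!compA.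
by rewrite (compA (mass _ d n)) mass_nat -!compA mpentagon !compA.
Qed.

Lemma ipost_icomp m n p (g : hom n p) :
  ipost H m g = icomp H m n p ∘ (icurry H (g ∘ munit n) ⊠ idm _) ∘ hinv (lunit _).
Proof.
apply: (iso_cancel (lunit_iso _)); rewrite -[RHS]compA hinvK ?compm1; last exact: lunit_iso.
apply: iunc_inj; rewrite iunc_icomp icurryK iunc_nat iunc_post1 iunc1.
by rewrite -!compA -mod_munit_mass !compA -(compA g) -munit_nat compA.
Qed.

Lemma ipre_icomp m n p (f : hom m n) :
  ipre H p f = icomp H m n p ∘ (idm _ ⊠ icurry H (f ∘ munit m)) ∘ hinv (runit _).
Proof.
apply: (iso_cancel (runit_iso _)); rewrite -[RHS]compA hinvK ?compm1; last exact: runit_iso.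
apply: iunc_inj; rewrite iunc_icomp icurryK iunc_nat iunc_pre1 iunc1.
by rewrite actMr -!compA mtriangle -acti' acti.
Qed.

Lemma icomp_iunc c m n p (g : hom c (H n p)) :
  icomp H m n p ∘ (g ⊠ idm _) = ipost H m (iunc g) ∘ istr H c m n.
Proof. by apply: iunc_inj; rewrite iunc_icomp iunc_post istr1 iunc1 compA. Qed.

End IHomCalculus.

(** * Relative Serre functors *)

(* The data of a relative Serre functor S read off from its traces. *)
Record trdata (k : fieldType) (D : ftcat k) (M : modcat D) := TrData {
  td_hom : forall m n : M, ihom m n;
  td_fun :> functor M M;
  td_tr : forall m, hom (td_hom m (td_fun m)) (unitc D);
  td_perf : forall m n, is_iso (rcurry (td_tr m ∘ icomp td_hom m n (td_fun m)));
  td_nat : forall m m' (f : hom m m'),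
    td_tr m' ∘ ipost td_hom m' (fmor td_fun f) = td_tr m ∘ ipre td_hom (td_fun m) f }.

Section TraceCalculus.
Variables (k : fieldType) (D : ftcat k) (M : modcat D).
Variable H : forall m n : M, ihom m n.
Variables (m s : M) (tr : hom (H m s) (unitc D)).

(** Three equivalent ways for a trace to be nondegenerate: s represents n |-> Hom(H(m,n), 1), m
    corepresents n |-> Hom(H(n,s), 1), or the pairings H(n,s) ⊗ H(m,n) -> 1 exhibit H(n,s) as the
    right dual of H(m,n). *)
Definition tr_universal : Prop := forall n, bij (fun f : hom n s => tr ∘ ipost H m f).
Definition tr_couniversal : Prop := forall n, bij (fun f : hom m n => tr ∘ ipre H s f).
Definition tr_perfect : Prop := forall n, is_iso (rcurry (tr ∘ icomp H m n s)).

(** Apply universality at w ▷ n for all w: through the strength, morphisms w ⊗ H(m,n) -> 1 are the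
    same as morphisms w -> H(n,s). *)
Lemma universal_perfect : tr_universal -> tr_perfect.
Proof.
move=> U n; apply: pairing_perfectr => w.
have key (g : hom w (H n s)) : tr ∘ icomp H m n s ∘ (g ⊠ idm _)
    = tr ∘ ipost H m (iunc g) ∘ istr H w m n by rewrite -!compA icomp_iunc.
have bs := @iso_bijr _ _ (unitc D) _ _ _ (istr_iso H w m n).
apply: (eq_bij key); apply: (bij_comp bs).
exact: (bij_comp (U (w ▷ n)) (@iunc_bij _ _ _ H w n s)).
Qed.

Lemma perfect_universal : tr_perfect -> tr_universal.
Proof.
move=> P n; have [dp hdp] := pair_of_iso (P n).
have bl := @iso_bijr _ _ s _ _ _ (munit_iso n).
have bh : bij (fun f : hom (unitc D ▷ n) s => icurry H f).
  by apply: (@can_bij _ _ _ (@iunc _ _ _ H _ _ _)) => f; [exact: icurryK|exact: iuncK].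
have br := @iso_bijr _ _ (unitc D) _ _ _ (is_iso_hinv (lunit_iso (H m n))).
have bp := pair_bij dp (unitc D).
refine (eq_bij _ (bij_comp br (bij_comp bp (bij_comp bh bl)))) => f /=.
by rewrite hdp ipost_icomp !compA.
Qed.

Lemma perfect_couniversal : tr_perfect -> tr_couniversal.
Proof.
move=> P n; have [dp hdp] := pair_of_iso (P n).
have bl := @iso_bijr _ _ n _ _ _ (munit_iso m).
have bh : bij (fun f : hom (unitc D ▷ m) n => icurry H f).
  by apply: (@can_bij _ _ _ (@iunc _ _ _ H _ _ _)) => f; [exact: icurryK|exact: iuncK].
have br := @iso_bijr _ _ (unitc D) _ _ _ (is_iso_hinv (runit_iso (H n s))).
have bp := pair_bijl dp (unitc D).
refine (eq_bij _ (bij_comp br (bij_comp bp (bij_comp bh bl)))) => f /=.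
by rewrite hdp ipre_icomp !compA.
Qed.

(** Same idea at ^∨w ▷ n, where the costrength reads H(^∨w ▷ n, s) = H(n,s) ⊗ w. *)
Lemma couniversal_perfect : tr_couniversal -> tr_perfect.
Proof.
move=> U n; apply: pairing_perfect => w.
pose a := act_adj M (ldp w).
have key (g : hom w (H m n)) :
    tr ∘ ipre H s (adjr a (iunc g)) ∘ gcostr H (ldp w) n s
    = tr ∘ icomp H m n s ∘ (idm _ ⊠ g).
  rewrite -!compA; congr (_ ∘ _); apply: (iunc_inj (H := H)).
  rewrite iunc_pre /gcostr icurryK iunc_icomp iunc1 -!compA -tensm1 mass_nat !compA.
  congr (_ ∘ _); rewrite -!compA -!actMr; congr (_ ∘ (_ ▶ _)).
  exact: (adjrK a (iunc g)).
have b1 := @adjr_bij _ _ _ _ _ a m n; have b2 := U (ldual w ▷ n).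
have bs := @iso_bijr _ _ (unitc D) _ _ _ (gcostr_iso H (ldp w) n s).
apply: (eq_bij (fun g => esym (key g))); apply: (bij_comp bs).
exact: (bij_comp b2 (bij_comp b1 (@iunc_bij _ _ _ H w m n))).
Qed.

End TraceCalculus.

Section Balanced.
Variables (k : fieldType) (D : ftcat k) (M : modcat D).
Variable H : forall m n : M, ihom m n.

Lemma hrunit_nat (x y : D) (f : hom x y) :
  hinv (runit y) ∘ f = (f ⊠ idm _) ∘ hinv (runit x).
Proof. by apply: hinv_nat; [exact: runit_iso..|exact: runit_nat]. Qed.

Lemma hlunit_nat (x y : D) (f : hom x y) :
  hinv (lunit y) ∘ f = (idm _ ⊠ f) ∘ hinv (lunit x).
Proof. by apply: hinv_nat; [exact: lunit_iso..|exact: lunit_nat]. Qed.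

(** Insert the identity of m: balancedness moves everything into the first factor, so the whole
    family of pairings is recovered from its value on H(m,s) ⊗ id. *)
Lemma balanced_tr (m s : M) (p : forall n, hom (H n s ⊗ H m n) (unitc D)) :
  (forall n n', p n' ∘ (idm _ ⊠ icomp H m n n') ∘ assoc _ _ _
     = p n ∘ (icomp H n n' s ⊠ idm _)) ->
  forall n, p n = p m ∘ (idm _ ⊠ iid H m) ∘ hinv (runit _) ∘ icomp H m n s.
Proof.
move=> bal n; rewrite -!compA hrunit_nat (compA (_ ⊠ iid H m)) -tensi' tensi -!compA.
rewrite (compA (p m)) -bal -!compA (compA (assoc _ _ _)) -tensm1 assoc_nat.
rewrite -!compA (compA (idm _ ⊠ _)) -tensMr icomp_iidr (compA (_ ⊠ runit _)) runit_tens.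
by rewrite hinvV ?compm1 //; apply: runit_iso.
Qed.

Lemma dinatural_tr (m m' s s' : M) (f : hom m m') (g : hom s s')
    (tr : hom (H m s) (unitc D)) (tr' : hom (H m' s') (unitc D)) :
  tr' ∘ icomp H m' m' s' ∘ (ipost H m' g ⊠ idm _)
    = tr ∘ icomp H m m' s ∘ (idm _ ⊠ ipre H m' f) ->
  tr' ∘ ipost H m' g = tr ∘ ipre H s f.
Proof.
move/(congr1 (fun u => u ∘ (idm _ ⊠ iid H m') ∘ hinv (runit _))) => /=.
rewrite -(compA tr') -(compA tr) icomp_postl icomp_prer -!compA.
rewrite !(compA (icomp _ _ _ _)) !icomp_iidr !hinvV ?compm1 //; exact: runit_iso.
Qed.
End Balanced.

Section SerreTrace.
Variables (k : fieldType) (D : ftcat k) (M : modcat D) (S : serre M).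
Local Notation H := (sr_hom S).

Lemma ipairing_tr m n :
  ipairing (sr_phi S) m n = serre_tr S m ∘ icomp H m n (S m).
Proof. exact: (balanced_tr (sr_bal S m)). Qed.

Lemma serre_perfect m : tr_perfect (serre_tr S m).
Proof.
move=> n; rewrite -ipairing_tr.
have -> : rcurry (ipairing (sr_phi S) m n) = hinv (sr_phi S m n) by apply: rcurryE.
by apply: is_iso_hinv; apply: sr_phi_iso.
Qed.

Lemma serre_tr_nat m m' (f : hom m m') :
  serre_tr S m' ∘ ipost H m' (fmor S f) = serre_tr S m ∘ ipre H (S m) f.
Proof.
have pnat : ipairing (sr_phi S) m' m' ∘ (ipost H m' (fmor S f) ⊠ idm _)
    = ipairing (sr_phi S) m m' ∘ (idm _ ⊠ ipre H m' f).
  rewrite /ipairing -!compA -tensMl.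
  have -> : hinv (sr_phi S m' m') ∘ ipost H m' (fmor S f)
      = rdualm (ipre H m' f) ∘ hinv (sr_phi S m m').
    by apply: hinv_nat; [exact: sr_phi_iso..|exact: sr_phi_natl].
  by rewrite tensMl compA rdualmP -compA -tensi' tensi.
by move: pnat; rewrite !ipairing_tr; apply: dinatural_tr.
Qed.

Definition serre_td : trdata M := TrData serre_perfect serre_tr_nat.

End SerreTrace.

Section ExactFunctors.
Variables (k : fieldType) (A B : lincat k) (F : functor A B).
Hypotheses (abA : is_abelian A) (Fe : exact F).

Lemma epi_short_exact (X : lincat k) (x y : X) (g : hom x y) : is_abelian X -> is_epi g ->
  exists w (f : hom w x), short_exact f g.
Proof.
move=> ab ge; have [w [f fK]] := (proj1 (proj2 (proj2 ab))) _ _ g.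
by exists w, f; split=> //; apply: epi_coker_ker.
Qed.

Lemma mono_short_exact (X : lincat k) (x y : X) (f : hom x y) : is_abelian X -> is_mono f ->
  exists w (g : hom y w), short_exact f g.
Proof.
move=> ab fm; have [w [g gC]] := (proj1 (proj2 (proj2 (proj2 ab)))) _ _ f.
exists w, g; split=> //.
exact: (@epi_coker_ker k (opc X) _ _ f _ g (is_abelian_op ab)).
Qed.

Lemma exact_epi x y (g : hom x y) : is_epi g -> is_epi (fmor F g).
Proof.
by move=> /(epi_short_exact abA) [w [f /Fe [_ h]]]; apply: cokernel_epi h.
Qed.

Lemma exact_coker x y z (f : hom x y) (g : hom y z) :
  is_cokernel f g -> is_cokernel (fmor F f) (fmor F g).
Proof.
move=> gC; have ge := cokernel_epi gC.
have [w [i iK]] := (proj1 (proj2 (proj2 abA))) _ _ g.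
have [f' [<- f'e]] := abelian_image abA gC iK.
have [_ h] : short_exact (fmor F i) (fmor F g).
  by apply: Fe; split=> //; apply: epi_coker_ker.
by rewrite fmorM; apply: coker_comp_epi => //; apply: exact_epi.
Qed.
End ExactFunctors.

Section Equivalence.
Variables (k : fieldType) (M : lincat k) (S : functor M M).
Hypothesis Sff : forall m n, bij (fun f : hom m n => fmor S f).
Variables (T : M -> M) (u : forall y, hom y (S (T y))).
Hypothesis ui : forall y, is_iso (u y).

Let op := opf S.
Let uU (x y : opc M) : bij (fun g : @hom k (opc M) x (T y) => (u y : @hom k (opc M) _ y) ∘ fmor op g).
Proof.
exact: (bij_comp (@iso_bijr _ M (S x) _ _ _ (ui y)) (Sff (T y) x)).
Qed.

(** The isomorphisms y -> S (T y) are universal because S is fully faithful. They yield a right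
    adjoint between the opposite categories, which is read back as a left adjoint of S. *)
Lemma equivalence_adjoint : exists (T' : functor M M) (a : adjunction T' S),
  (forall m, is_iso (aunit a m)) /\ (forall m, is_iso (acounit a m)).
Proof.
pose a := univ_adj uU; pose R := univ_functor uU.
pose T' := @Functor k M M (fun x => R x) (fun x y f => fmor R f)
  (fun x => fmor1 R x) (fun x y z f g => fmorM R g f) (fun x y c f g => fmorP R c f g).
have a1 x y (f : @hom k M x y) : u y ∘ f = fmor S (fmor T' f) ∘ u x by exact: (acounit_nat a f).
have a2 x y (f : @hom k M x y) : f ∘ (aunit a x : @hom k M (T' (S x)) x)
    = (aunit a y : @hom k M (T' (S y)) y) ∘ fmor T' (fmor S f).
  by exact: (aunit_nat a f).
have a3 x : (aunit a (T' x) : @hom k M (T' (S (T' x))) _) ∘ fmor T' (u x) = idm (T' x) by exact: (adj_triR a x).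
have a4 x : fmor S (aunit a x : @hom k M (T' (S x)) x) ∘ u (S x) = idm (S x) by exact: (adj_triL a x).
pose a' := @Adjunction k M M T' S (fun y => u y) (fun y => aunit a y) a1 a2 a3 a4.
exists T', a'; split=> // m.
(* S of the counit is invertible by a triangle identity, and a fully faithful S reflects
   isomorphisms. *)
have Si : is_iso (fmor S (acounit a' m)).
  apply: (iso_of_cancelr (ui (S m))); have /= -> := adj_triR a' m; exact: is_iso_id.
have [g [h1 h2]] := Si; have [v hv] := bij_surj g (Sff m (T' (S m))).
exists v; split; apply: (bij_inj (Sff _ _)); rewrite /= fmorM fmor1 hv //.
Qed.
End Equivalence.

Section SerreExists.
Variables (k : fieldType) (D : ftcat k) (M : modcat D).
Hypothesis Mex : exact_module M.

Let abM : is_abelian M. Proof. by case: (modcat_finite M). Qed.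
Let abD : is_abelian D. Proof. by case: (ftcat_finite D). Qed.
Let fdM (x y : M) : findim (hom x y). Proof. by case: (modcat_finite M) => _ []. Qed.
Let fdD (x y : D) : findim (hom x y). Proof. by case: (ftcat_finite D) => _ []. Qed.
Let coverD (x : D) : exists p (e : hom p x), is_projective p /\ is_epi e.
Proof. by case: (ftcat_finite D) => _ [_ [_ []]]. Qed.

Lemma ihom_exists (m n : M) : inhabited (ihom m n).
Proof.
have [P gP] := finite_generator (ftcat_finite D).
have Fe : exact (actL (M := M) m) by move=> x y z f g; apply: act_exactl.
have [h [e he]] := right_adjoint_at abD fdD (fdM _ n) gP (fun a b c f g => exact_coker abD Fe (f := f) (g := g)).
by constructor; exact: (IHom (fun d f => bij_uniq f (he d))).
Qed.

Let H (m n : M) : ihom m n := sval (cid (let: inhabits h := ihom_exists m n in ex_intro (fun=> True) h I)).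

(** Acting by p gives a short exact sequence ending in p ▷ c for c the cokernel of i. As p ▷ c is
    projective, the sequence splits. *)
Lemma project_mono (p : D) (a b : M) (i : hom a b) : is_projective p -> is_mono i ->
  exists r, r ∘ (idm p ▶ i) = idm (p ▷ a).
Proof.
move=> pp im; have [c [g ig]] := mono_short_exact abM im.
have [[gi iU] [_ gU]] := act_exactr p ig.
have [s gs] := @Mex p c pp _ _ _ (idm (p ▷ c)) (cokernel_epi (act_exactr p ig).2).
have [|r [hr _]] := iU _ (idm _ - s ∘ (idm p ▶ g)).
  by rewrite compBr compm1 compA gs comp1m subrr.
exists r; apply: (kernel_mono (act_exactr p ig).1).
by rewrite compA hr compBl comp1m -compA gi comp0r subr0 compm1.
Qed.

(** For a projective cover p -> 1, the object x embeds into ^∨p ▷ x, the transpose of p ▷ x -> x.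
    Maps into ^∨p ▷ x are maps out of p ▷ -, which extend along monomorphisms because these split
    after acting by p. *)
Lemma enough_injectives (x : opc M) :
  exists q (e : hom q x), is_projective q /\ is_epi e.
Proof.
have [p [e [pp ee]]] := coverD (unitc D).
pose a := act_adj M (ldp p).
have ee' (m : M) : is_epi (munit m ∘ (e ▶ idm m)).
  apply: epi_comp; first by apply: iso_epi; apply: munit_iso.
  have Fe : exact (actL m) by move=> u v w f g; apply: act_exactl.
  exact: (exact_epi abD Fe ee).
exists (ldual p ▷ (x : M)), (adjr a (munit x ∘ (e ▶ idm x)) : @hom k M _ _); split.
  move=> y z i f im; have [r hr] := project_mono pp (im : @is_mono k M _ _ i).
  have h : @comp k M _ _ _ (adjr a (adjl a (f : @hom k M _ _) ∘ r)) (i : @hom k M _ _) = f.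
    by rewrite -adjr_natl /= -compA hr compm1 adjlK.
  by exists (adjr a (adjl a (f : @hom k M _ _) ∘ r) : @hom k M _ _).
apply: (@mono0P k M) => z u hu; apply: (epi0 (ee' _)).
have hu' : @comp k M _ _ _ (adjr a (munit x ∘ (e ▶ idm x))) (u : @hom k M z x) = 0 by exact: hu.
have := congr1 (fun v => adjl a v) hu'.
rewrite -adjr_natl adjrK {1}/adjl fmor0 comp0r /= -compA -acti acti' => <-.
by rewrite [RHS]compA munit_nat -!compA.
Qed.

(** H(m,-) is left exact as a right adjoint. It preserves epimorphisms because maps p -> H(m,b) from
    a projective p are maps p ▷ m -> b, and p ▷ m is projective. *)
Lemma ihF_coker (m a b c : M) (f : hom a b) (g : hom b c) :
  is_cokernel f g -> is_cokernel (ipost H m f) (ipost H m g).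
Proof.
move: a b c f g; apply: (right_exact_of_epi (F := ihF H m) abM abD).
  by move=> a b c f g; apply: (right_adjoint_ker (ih_adj H m)).
move=> a b f fe /=; apply: epi0P => z u uf.
have [p [e [pp ee]]] := coverD (H m b); apply: (epi0 ee).
have [g hg] := @Mex p m pp _ _ f (iunc e) fe.
have <- : ipost H m f ∘ icurry H g = e.
  by apply: (iunc_inj (H := H)); rewrite iunc_post icurryK.
by rewrite compA uf comp0l.
Qed.

(** H(-,y) sends cokernels to kernels since w ▷ - preserves cokernels, and monomorphisms to
    epimorphisms by [project_mono]. *)
Lemma ihG_ker (y a b c : M) (f : hom a b) (g : hom b c) :
  is_kernel f g -> is_cokernel (ipre H y g) (ipre H y f).
Proof.
move=> fK; have := @right_exact_of_epi k (opc M) D (ihG H y) (is_abelian_op abM) abD _ _ c b a g f.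
apply=> // {a b c f g fK}.
  move=> a b c f g [gf gU]; split; first by rewrite -fmorM gf fmor0.
  move=> w h hh; have adj := act_adj M (ldp w).
  have [gf' gU'] := left_adjoint_coker (act_adj M (ldp w)) (conj gf gU : @is_cokernel k M _ _ _ g f).
  have [|v [hv vU]] := gU' _ (iunc h).
    by move: hh => /= hh; rewrite /= -iunc_pre hh iunc0.
  exists (icurry H v); split.
    by apply: (iunc_inj (H := H)); rewrite iunc_pre icurryK.
  move=> v' hv'; apply: (iunc_inj (H := H)); rewrite icurryK; apply: vU.
  by rewrite -hv' iunc_pre.
move=> a b i im; apply: epi0P => z u ui.
have [p [e [pp ee]]] := coverD (H b y); apply: (epi0 ee).
have [r hr] := project_mono pp (im : @is_mono k M _ _ i).
have <- : ipre H y i ∘ icurry H (iunc e ∘ r) = e.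
  by apply: (iunc_inj (H := H)); rewrite iunc_pre icurryK -compA hr compm1.
by rewrite compA ui comp0l.
Qed.

Lemma trace_exists (m : M) : exists s (tr : hom (H m s) (unitc D)), tr_universal tr.
Proof.
have [P gP] := finite_generator (modcat_finite M).
exact: (@right_adjoint_at k M D (ihF H m) P (unitc D) abM fdM (fdD _ _) gP (@ihF_coker m)).
Qed.

(** The adjoint functor theorem for H(-,s) on the opposite category. Its generator is an injective
    cogenerator of M, which exists because [ext_generated] is self-dual. *)
Lemma cotrace_exists (s : M) : exists m (tr : hom (H m s) (unitc D)), tr_couniversal tr.
Proof.
have [ss hss] := finite_ext_generated (modcat_finite M).
have [P gP] := generator_exists (is_abelian_op abM) (ext_generated_op hss) enough_injectives.
exact: (@right_adjoint_at k (opc M) D (ihG H s) P (unitc D) (is_abelian_op abM)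
  (fun x y => fdM y x) (fdD _ _) gP (fun a b c f g => @ihG_ker s c b a g f)).
Qed.

(** Universality of the traces defines S on objects and morphisms; couniversality makes it fully
    faithful; cotraces make it essentially surjective. *)
Theorem serre_exists : serre M.
Proof.
pose S m := sval (cid (trace_exists m)).
pose tr m : hom (H m (S m)) (unitc D) := sval (cid (svalP (cid (trace_exists m)))).
have trU m : tr_universal (tr m) := svalP (cid (svalP (cid (trace_exists m)))).
have trP m := universal_perfect (trU m).
have trC m := perfect_couniversal (trP m).
pose fm m m' (f : hom m m') : hom (S m) (S m') :=
  sval (cid (bij_surj (tr m ∘ ipre H (S m) f) (trU m' (S m)))).
have fmP m m' (f : hom m m') : tr m' ∘ ipost H m' (fm _ _ f) = tr m ∘ ipre H (S m) f.
  exact: svalP (cid (bij_surj (tr m ∘ ipre H (S m) f) (trU m' (S m)))).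
have f1 m : fm _ _ (idm m) = idm (S m).
  by apply: (bij_inj (trU m (S m))); rewrite fmP ipre1 ipost1.
have fM x y z (f : hom y z) (g : hom x y) : fm _ _ (f ∘ g) = fm _ _ f ∘ fm _ _ g.
  apply: (bij_inj (trU z (S x))); rewrite fmP ipostM compA fmP -compA ipre_post compA fmP.
  by rewrite -compA ipreM.
have fP x y c (f g : hom x y) : fm _ _ (c *: f + g) = c *: fm _ _ f + fm _ _ g.
  by apply: (bij_inj (trU y (S x))); rewrite fmP ipreP ipostP !compPr !fmP.
pose F := @Functor k M M S fm f1 fM fP.
(* A morphism h : S m -> S n gives a functional on H(n, S m), which couniversality of the trace at m
   writes as precomposition with a unique f : m -> n. *)
have Fff m n : bij (fun f : hom m n => fmor F f).
  apply: bijI => [f g /= e|h].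
    by apply: (bij_inj (trC m n)); rewrite -!fmP e.
  have [f hf] := bij_surj (tr n ∘ ipost H n h) (trC m n); exists f.
  by apply: (bij_inj (trU n (S m))); rewrite fmP.
(* A cotrace H(x,y) -> 1 is also universal, so y and S x represent the same functor. *)
have ess y : {x & {u : hom y (F x) | is_iso u}}.
  have [x hx] := cid (cotrace_exists y); have [e he] := cid hx; exists x; apply: cid.
  have eU := perfect_universal (couniversal_perfect he).
  have [u hu] := bij_surj e (trU x y); have [v hv] := bij_surj (tr x) (eU (S x)).
  exists u, v; split.
    by apply: (bij_inj (eU y)); rewrite ipostM compA hv hu ipost1 compm1.
  by apply: (bij_inj (trU x (S x))); rewrite ipostM compA hu hv ipost1 compm1.
have [F' /cid [a [a1 a2]]] := cid (equivalence_adjoint Fff (fun y => svalP (projT2 (ess y)))).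
pose phi m n := hinv (rcurry (tr m ∘ icomp H m n (S m))).
have pE m n : ipairing phi m n = tr m ∘ icomp H m n (S m).
  by rewrite /ipairing hinv_hinv; [exact: rcurryK|exact: trP].
apply: (@Serre k D M H F F' a a1 a2 phi).
- by move=> m n; apply: is_iso_hinv; apply: trP.
- move=> m n n' g; apply: hinv_nat; [exact: trP..|apply: pairing_adjoint].
  by rewrite -!compA icomp_mid.
- move=> m m' n f; apply: hinv_nat; [exact: trP..|apply: pairing_adjoint].
  by rewrite -!compA icomp_prer icomp_postl !compA fmP.
- by move=> m n n'; rewrite !pE -!compA -icompA !compA.
Qed.
End SerreExists.

Lemma hmpentagon (k : fieldType) (D : ftcat k) (M : modcat D) (c d e : D) (m : M) :
  (hinv (assoc c d e) ▶ idm m) ∘ hinv (mass c (d ⊗ e) m) ∘ (idm c ▶ hinv (mass d e m))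
  = hinv (mass (c ⊗ d) e m) ∘ hinv (mass c d (e ▷ m)).
Proof.
have ai := assoc_iso c d e; have i1 : is_iso (assoc c d e ▶ idm m).
  by apply: is_iso_actm; [|exact: is_iso_id].
have mi := mass_iso d e m; have i2 : is_iso (idm c ▶ mass d e m).
  by apply: is_iso_actm; [exact: is_iso_id|].
rewrite -hinv_comp ?mpentagon; try exact: mass_iso.
rewrite !hinv_comp ?act_hinv ?hinv1 ?compA //; try exact: is_iso_id; try exact: mass_iso.
by apply: is_iso_comp => //; exact: mass_iso.
Qed.

Lemma hmass_pre (k : fieldType) (D : ftcat k) (M : modcat D) (c c' d : D) (m w : M)
    (f : hom c c') (g : hom w (d ▷ m)) :
  hinv (mass c' d m) ∘ (f ▶ g) = ((f ⊠ idm d) ▶ idm m) ∘ hinv (mass c d m) ∘ (idm c ▶ g).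
Proof. by rewrite -hmass_nat -compA -actmM compm1 actm1 comp1m. Qed.

(** * Evaluation functors on the dual category *)

Section ModuleEvaluation.
Variables (k : fieldType) (D : ftcat k) (M : modcat D).
Variable H : forall m n : M, ihom m n.
Implicit Types (c d : D) (m n x y z : M) (G K : modfun M).

Lemma modnat_iso G K (s : modnat G K) :
  (forall m, is_iso (s m)) -> @is_iso k (modend M) G K s.
Proof.
move=> si.
have n1 m n (f : hom m n) : hinv (s n) ∘ fmor K f = fmor G f ∘ hinv (s m).
  by apply: hinv_nat => //; apply: mn_nat.
have n2 d m : mf_str G d m ∘ hinv (s (d ▷ m)) = (idm d ▶ hinv (s m)) ∘ mf_str K d m.
  apply: (iso_cancel (si (d ▷ m))); rewrite -!compA hinvK // compm1.
  by rewrite mn_mod compA -actMr hinvK // actm1 comp1m.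
by exists (ModNat n1 n2 : @hom k (modend M) K G); split; apply: modnatP => m /=;
  rewrite ?hinvK ?hinvV.
Qed.

Lemma modnat_isoP G K (s : modnat G K) m : @is_iso k (modend M) G K s -> is_iso (s m).
Proof.
move=> [t [ts st]]; exists (t m); split.
  by have := congr1 (fun u : modnat G G => u m) ts.
by have := congr1 (fun u : modnat K K => u m) st.
Qed.

(** Module functors are D-enriched functors; this is the action of G on internal Homs, transposed to
    a morphism of M. *)
Definition mev G x y : hom (H x y ▷ G x) (G y) :=
  locked (fmor G (ih_ev (H x y)) ∘ hinv (mf_str G (H x y) x)).

Lemma hmf_nat G c d m n (f : hom c d) (g : hom m n) :
  hinv (mf_str G d n) ∘ (f ▶ fmor G g) = fmor G (f ▶ g) ∘ hinv (mf_str G c m).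
Proof. by apply: hinv_nat; [exact: mf_iso..|exact: mf_nat]. Qed.

Lemma mev_unc G d x y (g : hom d (H x y)) :
  mev G x y ∘ (g ▶ idm (G x)) = fmor G (iunc g) ∘ hinv (mf_str G d x).
Proof. by rewrite /mev -lock -compA -fmor1 hmf_nat iuncE fmorM !compA. Qed.

Lemma mevE G x y : mev G x y = fmor G (ih_ev (H x y)) ∘ hinv (mf_str G (H x y) x).
Proof. by rewrite /mev -lock. Qed.

Lemma mev_post G x y y' (f : hom y y') :
  fmor G f ∘ mev G x y = mev G x y' ∘ (ipost H x f ▶ idm (G x)).
Proof. by rewrite mev_unc iunc_post1 mevE fmorM compA. Qed.

Lemma mev_pre G x' x y (f : hom x' x) :
  mev G x y ∘ (idm _ ▶ fmor G f) = mev G x' y ∘ (ipre H y f ▶ idm (G x')).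
Proof. by rewrite mev_unc iunc_pre1 mevE -compA hmf_nat fmorM !compA. Qed.

Lemma mev_nat G K (s : modnat G K) x y : s y ∘ mev G x y = mev K x y ∘ (idm _ ▶ s x).
Proof.
rewrite !mevE compA mn_nat -!compA; congr (_ ∘ _).
by apply/esym; apply: hinv_nat; [exact: mf_iso..|exact: mn_mod].
Qed.

Lemma hmf_mass G c d m :
  fmor G (mass c d m) ∘ hinv (mf_str G (c ⊗ d) m)
  = hinv (mf_str G c (d ▷ m)) ∘ (idm c ▶ hinv (mf_str G d m)) ∘ mass c d (G m).
Proof.
apply: (iso_cancel (mf_iso G (c ⊗ d) m)); rewrite -compA hinvK ?compm1; last exact: mf_iso.
rewrite -compA mf_ass !compA (cl _ (esym (actMr _ _ _))) hinvK; last exact: mf_iso.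
by rewrite actm1 compm1 hinvK ?comp1m //; apply: mf_iso.
Qed.

Lemma mev_mod G d x y :
  mf_str G d y ∘ mev G x (d ▷ y) ∘ (istr H d x y ▶ idm (G x))
  = (idm d ▶ mev G x y) ∘ mass d (H x y) (G x).
Proof.
rewrite -compA mev_unc istr1 fmorM -compA hmf_mass !compA mf_nat -!compA.
rewrite (compA (mf_str _ _ _)) hinvV ?comp1m; last exact: mf_iso.
by rewrite compA -actMr mevE.
Qed.

Lemma mev_iid G x : mev G x x ∘ (iid H x ▶ idm (G x)) = munit (G x).
Proof. by rewrite mev_unc iunc_iid -mf_unit -compA hinvV ?compm1 //; apply: mf_iso. Qed.

Lemma mev_contr G d y p :
  mev G y p ∘ (icontr H d y p ▶ idm (G y))
  = mev G (d ▷ y) p ∘ (idm _ ▶ hinv (mf_str G d y)) ∘ mass _ d (G y).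
Proof. by rewrite mev_unc icurryK fmorM -compA hmf_mass mevE !compA. Qed.

Definition ihact_fun x n : functor M M.
Proof.
refine (@Functor k M M (fun y => H x y ▷ n) (fun y z f => ipost H x f ▶ idm n) _ _ _).
- by move=> y; rewrite ipost1 actm1.
- by move=> y z w f g; rewrite ipostM actMl.
- by move=> y z a f g; rewrite ipostP actmPl.
Defined.

(** The enriched representable functor H(x,-) tensored with n; its module structure is the inverse
    of the strength. *)
Definition ihact x n : modfun M.
Proof.
refine (@ModFun k D M (ihact_fun x n)
  (fun d y => mass d (H x y) n ∘ (hinv (istr H d x y) ▶ idm n)) _ _ _ _).
- move=> d y; apply: is_iso_comp; first exact: mass_iso.
  by apply: is_iso_actm; [apply: is_iso_hinv; apply: istr_iso|exact: is_iso_id].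
- move=> c d y z f g /=; rewrite -compA -actMl.
  have -> : hinv (istr H d x z) ∘ ipost H x (f ▶ g) = (f ⊠ ipost H x g) ∘ hinv (istr H c x y).
    by apply: hinv_nat; [exact: istr_iso..|rewrite istr_nat].
  by rewrite actMl compA mass_nat compA.
- move=> c d y /=; apply: (@iso_cancel _ _ _ _ _ (istr H (c ⊗ d) x y ▶ idm n)).
    by apply: is_iso_actm; [exact: istr_iso|exact: is_iso_id].
  have e : hinv (istr H c x (d ▷ y)) ∘ ipost H x (mass c d y) ∘ istr H (c ⊗ d) x y
     = (idm c ⊠ istr H d x y) ∘ assoc c d (H x y).
    by rewrite -compA istr_mass !compA hinvK ?comp1m //; exact: istr_iso.
  rewrite !compA -!(compA _ (_ ▶ idm n)) -!actMl hinvK; last exact: istr_iso.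
  rewrite actm1 compm1 !compA e actMl mpentagon !compA; congr (_ ∘ _).
  rewrite -!compA mass_nat !compA; congr (_ ∘ _).
  rewrite -actMr -compA -actMl hinvK; last exact: istr_iso.
  by rewrite actm1 compm1.
- move=> y /=; rewrite compA mod_munit_mass -actMl; congr (_ ▶ _).
  by rewrite -(istr_unit H x y) -compA hinvV ?compm1 //; exact: istr_iso.
Defined.

Lemma mev_ihact x n y z :
  mev (ihact x n) y z = (icomp H x y z ▶ idm n) ∘ hinv (mass _ _ n).
Proof.
rewrite mevE /=.
have mi := mass_iso (H y z) (H x y) n; have ii := istr_iso H (H y z) x y.
have hi : is_iso (hinv (istr H (H y z) x y) ▶ idm n).
  by apply: is_iso_actm; [apply: is_iso_hinv|exact: is_iso_id].
rewrite hinv_comp // act_hinv; [|exact: is_iso_hinv|exact: is_iso_id].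
rewrite hinv_hinv // hinv1 compA -actMl; congr ((_ ▶ _) ∘ _).
by have := icomp_iunc x (idm (H y z)); rewrite tensm1 compm1 iunc1 => ->.
Qed.

Lemma ihact_str x n d y (G : M) (f : hom G (d ▷ (H x y ▷ n))) (g : hom G (ihact x n (d ▷ y))) :
  mf_str (ihact x n) d y ∘ g = f -> g = (istr H d x y ▶ idm n) ∘ hinv (mass d _ n) ∘ f.
Proof.
move=> <- /=; rewrite !compA -(compA _ _ (mass _ _ _)) hinvK ?compm1; last exact: mass_iso.
by rewrite -actMl hinvV ?actm1 ?comp1m //; exact: istr_iso.
Qed.

Definition ihactm x m n (f : hom m n) : modnat (ihact x m) (ihact x n).
Proof.
refine (@ModNat k D M (ihact x m) (ihact x n) (fun y => idm (H x y) ▶ f) _ _).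
- by move=> y z g /=; rewrite -acti' -acti.
- move=> d y /=; rewrite -compA -acti acti' !compA; congr (_ ∘ _).
  by rewrite -tensm1 mass_nat.
Defined.

Definition ihactF x : functor M (modend M).
Proof.
refine (@Functor k M (modend M) (ihact x) (@ihactm x) _ _ _).
- by move=> m; apply: modnatP => y /=; rewrite actm1.
- by move=> m n p f g; apply: modnatP => y /=; rewrite actMr.
- by move=> m n a f g; apply: modnatP => y /=; rewrite actmPr !scale1r addr0.
Defined.

Definition evalF x : functor (modend M) M.
Proof.
refine (@Functor k (modend M) M (fun G : modfun M => G x) (fun G K (s : modnat G K) => s x) _ _ _) => //.
by move=> G K a f g /=; rewrite !scale1r addr0.
Defined.

Definition ihact_counit G x : modnat (ihact x (G x)) G.
Proof.
refine (@ModNat k D M (ihact x (G x)) G (fun y => mev G x y) _ _).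
- by move=> y z g; rewrite mev_post.
- move=> d y /=; apply: (@iso_cancel _ _ _ _ _ (istr H d x y ▶ idm _)).
    by apply: is_iso_actm; [exact: istr_iso|exact: is_iso_id].
  rewrite mev_mod -!compA -actMl hinvK ?actm1 ?compm1 //; exact: istr_iso.
Defined.

Definition ihact_unit x n : hom n (H x x ▷ n) := (iid H x ▶ idm n) ∘ hinv (munit n).

(** Enriched Yoneda lemma: a module transformation H(x,-) ▷ n -> G is determined by its value at the
    identity of x, a morphism n -> G x. *)
Definition ihact_adj x : adjunction (ihactF x) (evalF x).
Proof.
refine (@Adjunction k M (modend M) (ihactF x) (evalF x) (fun n => ihact_unit x n)
  (fun G => ihact_counit G x) _ _ _ _).
- move=> m n f; rewrite /ihact_unit /= -compA hmunit_nat !compA.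
  by rewrite -acti' -acti.
- by move=> G K s; apply: modnatP => y /=; rewrite mev_nat.
- move=> n; apply: modnatP => y /=.
  rewrite mev_ihact /ihact_unit actMr compA.
  have -> : (icomp H x x y ▶ idm n) ∘ hinv (mass (H x y) (H x x) n) ∘ (idm (H x y) ▶ (iid H x ▶ idm n))
     = (runit _ ▶ idm n) ∘ hinv (mass (H x y) (unitc D) n).
    by rewrite -compA hmass_nat compA -actMl icomp_iidr.
  rewrite -mtriangle -compA -compA (compA (mass _ _ _)) hinvV ?comp1m; last exact: mass_iso.
  by rewrite -actMr hinvV ?actm1 //; exact: munit_iso.
- by move=> G /=; rewrite /ihact_unit compA mev_iid hinvV //; exact: munit_iso.
Defined.

Section CostrengthMap.
Variables (d d' : D) (dp : dualpair d d').

Lemma gcostr_post x y z (f : hom y z) :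
  gcostr H dp x z ∘ (ipost H x f ⊠ idm d') = ipost H (d ▷ x) f ∘ gcostr H dp x y.
Proof.
apply: (iunc_inj (H := H)); rewrite iunc_gcostr iunc_post gcostr1 iunc_post1.
by rewrite actm1 compm1 !compA.
Qed.

Lemma gcostr_istr c x y :
  gcostr H dp x (c ▷ y) ∘ (istr H c x y ⊠ idm d')
  = istr H c (d ▷ x) y ∘ (idm c ⊠ gcostr H dp x y) ∘ assoc c (H x y) d'.
Proof.
apply: (iunc_inj (H := H)); rewrite iunc_gcostr iunc_nat iunc_istr istr1 gcostr1.
rewrite -tensm1 -!compA (compA (mass _ _ x)) mass_nat -!compA mpentagon.
by rewrite actm1 compm1 !actMr !compA.
Qed.

Definition ihact_shift x n : modnat (ihact x (d' ▷ n)) (ihact (d ▷ x) n).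
Proof.
refine (@ModNat k D M (ihact x (d' ▷ n)) (ihact (d ▷ x) n)
  (fun y => (gcostr H dp x y ▶ idm n) ∘ hinv (mass (H x y) d' n)) _ _).
- move=> y z f /=; rewrite !compA -actMl -gcostr_post actMl -!compA; congr (_ ∘ _).
  by rewrite -hmass_nat actm1.
- move=> c y /=; rewrite !compA -(compA _ (hinv (istr H c (d ▷ x) y) ▶ _)) -actMl.
  have -> : hinv (istr H c (d ▷ x) y) ∘ gcostr H dp x (c ▷ y)
      = (idm c ⊠ gcostr H dp x y) ∘ assoc c (H x y) d' ∘ (hinv (istr H c x y) ⊠ idm d').
    apply: (@iso_cancel _ _ _ _ _ (istr H c x y ⊠ idm d')).
      by apply: tens_iso; [exact: istr_iso|exact: is_iso_id].
    rewrite -!compA -tensMl hinvK ?tensm1 ?compm1 ?gcostr_istr; last exact: istr_iso.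
    by rewrite !compA hinvK ?comp1m //; exact: istr_iso.
  rewrite !actMl !compA mass_nat -!compA; rewrite actMr -!compA; congr (_ ∘ _).
  rewrite -hmass_nat actm1 !compA; congr (_ ∘ _).
  apply: (iso_cancel (mass_iso (c ⊗ H x y) d' n)); rewrite -!compA hinvK ?compm1; last exact: mass_iso.
  apply: (@iso_cancell _ _ _ _ _ (idm c ▶ mass (H x y) d' n)).
    by apply: is_iso_actm; [exact: is_iso_id|exact: mass_iso].
  by rewrite [RHS]compA -actMr hinvV ?actm1 ?comp1m ?mpentagon ?compA //; exact: mass_iso.
Defined.

Lemma ihact_shift_iso x n : @is_iso k (modend M) _ _ (ihact_shift x n).
Proof.
apply: modnat_iso => y /=; apply: is_iso_comp; last by apply: is_iso_hinv; exact: mass_iso.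
by apply: is_iso_actm; [exact: gcostr_iso|exact: is_iso_id].
Qed.

(* Under the adjunctions ihact x -| evaluation at x, the shift is the mate of
   the module structure. *)
Lemma ihact_shift_unit x n :
  (idm d ▶ (ihact_shift x n x ∘ ihact_unit x (d' ▷ n))) ∘ acoev dp n
  = mf_str (ihact (d ▷ x) n) d x ∘ ihact_unit (d ▷ x) n.
Proof.
pose mu := icurry H (aev dp x).
have -> : ihact_shift x n x ∘ ihact_unit x (d' ▷ n) = mu ▶ idm n.
  rewrite /ihact_unit /= -actm1 -!compA (compA (hinv (mass _ _ _))) hmass_nat -!compA.
  have -> : hinv (mass (unitc D) d' n) ∘ hinv (munit (d' ▷ n)) = hinv (lunit d') ▶ idm n.
    rewrite -hinv_comp; [|exact: munit_iso|exact: mass_iso].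
    by rewrite mod_munit_mass act_hinv ?hinv1; [|exact: lunit_iso|exact: is_iso_id].
  rewrite compA -!actMl; congr (_ ▶ _); apply: (iunc_inj (H := H)).
  rewrite icurryK iunc_nat iunc_gcostr iunc_iid actm1 compm1 munit_nat -!compA.
  rewrite (compA (munit _)) mod_munit_mass -actMl hinvV ?actm1 ?compm1 //.
  exact: lunit_iso.
rewrite /acoev -lock /= /ihact_unit !compA -mass_nat.
rewrite -(compA (mass d _ n)) -actMl -[in RHS](compA _ (_ ▶ _) (_ ▶ _)) -actMl.
congr (_ ∘ _ ▶ _ ∘ _).
apply: (iso_cancell (istr_iso H d (d ▷ x) x)); rewrite !compA hinvV ?comp1m; last exact: istr_iso.
apply: (iunc_inj (H := H)); rewrite iunc_nat iunc_istr icurryK iunc_iid.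
apply: (iso_cancel (is_iso_hinv (munit_iso (d ▷ x)))); rewrite hinvV; last exact: munit_iso.
by have := aev_triL dp x; rewrite /acoev -lock !compA.
Qed.

End CostrengthMap.

End ModuleEvaluation.

Section SerreAdjunction.
Variables (k : fieldType) (D : ftcat k) (M : modcat D) (T : trdata M).
Local Notation H := (td_hom T).
Local Notation tr := (td_tr T).
Implicit Types (c d : D) (m n x y z : M) (G K : modfun M).

Lemma td_universal m : tr_universal (tr m).
Proof. by apply: perfect_universal => n; exact: td_perf. Qed.

Definition trpair x y : dualpair (H x y) (H y (T x)) := sval (pair_of_iso (td_perf T x y)).
Lemma trpairE x y : dp_ev (trpair x y) = tr x ∘ icomp H x y (T x).
Proof. exact: svalP (pair_of_iso (td_perf T x y)). Qed.

Lemma aev_trpair x y n : aev (trpair x y) n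
  = munit n ∘ ((tr x ∘ icomp H x y (T x)) ▶ idm n) ∘ hinv (mass _ _ n).
Proof. by rewrite /aev -lock trpairE. Qed.

Lemma aev_trpair_post x y y' n w (f : hom y y') (g : hom w (H x y ▷ n)) :
  aev (trpair x y') n ∘ (idm _ ▶ ((ipost H x f ▶ idm n) ∘ g))
  = aev (trpair x y) n ∘ (ipre H (T x) f ▶ g).
Proof.
rewrite actMr !compA !aev_trpair -!(compA _ (hinv _)) hmass_nat [in RHS]hmass_pre !compA.
by rewrite -!(compA (munit n)) -!actMl -!(compA (tr x)) icomp_mid.
Qed.

Lemma aev_trpair_istr d x y n w (g : hom w (H x y ▷ n)) :
  aev (trpair x (d ▷ y)) n
    ∘ (idm _ ▶ ((istr H d x y ▶ idm n) ∘ hinv (mass d _ n) ∘ (idm d ▶ g)))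
  = aev (trpair x y) n ∘ (icontr H d y (T x) ▶ g) ∘ hinv (mass _ d w).
Proof.
rewrite !actMr !compA !aev_trpair -(compA _ (hinv (mass _ _ n))) hmass_nat !compA.
rewrite -(compA (munit n)) -actMl -(compA (tr x)) icomp_istrr !compA actMl.
rewrite !compA (cl3 _ (hmpentagon _ _ _ _)) -!compA hmass_nat tensm1.
rewrite (compA (hinv _) (icontr _ _ _ _ ▶ _)) hmass_pre !actMl -!compA //.
Qed.

(** The trace makes H(y, T x) the right dual of H(x,y), so the action H(y, T x) ▷ G y -> G (T x) can
    be transposed. *)
Definition trev_map G x y : hom (G y) (H x y ▷ G (T x)) :=
  adjr (act_adj M (trpair x y)) (mev H G y (T x)).

Lemma trev_mapP G x y : aev (trpair x y) _ ∘ (idm _ ▶ trev_map G x y) = mev H G y (T x).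
Proof. exact: (adjrK (act_adj M (trpair x y))). Qed.

Lemma trev_mapE G x y w (g : hom w (H x y ▷ G (T x))) (f : hom w (G y)) :
  aev (trpair x y) _ ∘ (idm _ ▶ g) = mev H G y (T x) ∘ (idm _ ▶ f) -> g = trev_map G x y ∘ f.
Proof.
move=> e; apply: (@adjl_inj _ _ _ _ _ (act_adj M (trpair x y))).
by rewrite /adjl /= actMr compA trev_mapP.
Qed.

Definition ihact_counit' x n : hom (H x (T x) ▷ n) n := munit n ∘ (tr x ▶ idm n).

Lemma ihact_counit'E x n : ihact_counit' x n
  = aev (trpair x (T x)) n ∘ (iid H (T x) ▶ idm _) ∘ hinv (munit _).
Proof.
rewrite aev_trpair -!compA (compA (hinv (mass _ _ _))) -actm1 hmass_nat -!compA.
have -> : hinv (mass (unitc D) (H x (T x)) n) ∘ hinv (munit (H x (T x) ▷ n)) = hinv (lunit _) ▶ idm n.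
  rewrite -hinv_comp; [|exact: munit_iso|exact: mass_iso].
  by rewrite mod_munit_mass act_hinv ?hinv1; [|exact: lunit_iso|exact: is_iso_id].
rewrite (compA (_ ▶ idm n)) -actMl -(compA (tr x)) icomp_iidl -actMl -compA hinvV ?compm1 //.
exact: lunit_iso.
Qed.

Definition trev G x : modnat G (ihact H x (G (T x))).
Proof.
refine (@ModNat k D M G (ihact H x (G (T x))) (fun y => trev_map G x y) _ _).
- move=> y z f /=; apply/esym; apply: trev_mapE.
  by rewrite aev_trpair_post acti' compA trev_mapP mev_pre acti'.
- move=> d y.
  have e : (istr H d x y ▶ idm _) ∘ hinv (mass d _ _) ∘ (idm d ▶ trev_map G x y)
      = trev_map G x (d ▷ y) ∘ hinv (mf_str G d y).
    apply: trev_mapE; rewrite aev_trpair_istr acti' compA trev_mapP mev_contr -!compA.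
    by rewrite hinvV ?compm1 //; exact: mass_iso.
  have -> : trev_map G x (d ▷ y) = trev_map G x (d ▷ y) ∘ hinv (mf_str G d y) ∘ mf_str G d y.
    by rewrite -compA hinvK ?compm1 //; exact: mf_iso.
  rewrite -e /= !compA -(compA (mass _ _ _)) -actMl hinvK; last exact: istr_iso.
  by rewrite actm1 compm1 hinvV ?comp1m //; exact: mass_iso.
Defined.

(** With [ihact_adj] this gives the string: evaluation at T x, then H(x,-) ▷ -, then evaluation at
    x, each left adjoint to the next. *)
Definition trev_adj x : adjunction (evalF (T x)) (ihactF H x).
Proof.
refine (@Adjunction k (modend M) M (evalF (T x)) (ihactF H x) (fun G => trev G x)
  (fun n => ihact_counit' x n) _ _ _ _).
- move=> G K s; apply: modnatP => y /=; apply/esym; apply: trev_mapE.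
  by rewrite actMr compA -aev_nat -compA trev_mapP mev_nat.
- move=> m n f; rewrite /ihact_counit' /= compA -munit_nat -!compA.
  by rewrite -acti' acti.
- move=> G /=; rewrite ihact_counit'E -!compA hmunit_nat (compA (_ ▶ idm _)) -acti acti'.
  by rewrite !compA trev_mapP mev_iid hinvV //; exact: munit_iso.
- move=> n; apply: modnatP => y /=.
  apply: (@adjl_inj _ _ _ _ _ (act_adj M (trpair x y))).
  have e := trev_mapP (ihact H x n) x y; rewrite /= in e.
  rewrite /adjl /= actm1 compm1 actMr compA -aev_nat -compA e mev_ihact.
  by rewrite /ihact_counit' aev_trpair actMl !compA.
Defined.

Section Twist.
Variables (d : D) (m : M).

(* The property defining serre_twist. *)
Definition is_twist (tw : hom (d^v^v ▷ T m) (T (d ▷ m))) : Prop :=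
  tr (d ▷ m) ∘ ipost H (d ▷ m) tw ∘ istr H d^v^v (d ▷ m) (T m)
      ∘ (idm d^v^v ⊠ icostr H d m (T m))
    = rev d^v ∘ (idm d^v^v ⊠ (lunit d^v ∘ (tr m ⊠ idm d^v))).

Lemma twist_bij e n : bij (fun f : hom (e ▷ n) (T (d ▷ m)) =>
  tr (d ▷ m) ∘ ipost H (d ▷ m) f ∘ istr H e (d ▷ m) n ∘ (idm e ⊠ icostr H d m n)).
Proof.
have i2 : is_iso (idm e ⊠ icostr H d m n).
  by apply: tens_iso; [exact: is_iso_id|exact: icostr_iso].
exact: (bij_comp (iso_bijr _ i2) (bij_comp (iso_bijr _ (istr_iso H e (d ▷ m) n))
  (td_universal (d ▷ m) (e ▷ n)))).
Qed.

Lemma twist_exists : exists tw, is_twist tw.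
Proof. exact: bij_surj (twist_bij _ _). Qed.

(** Both Hom(T m, d^∨ ▷ n) and Hom(T (d ▷ m), n) are spaces of module transformations from the
    identity, into H(m,-) ▷ (d^∨ ▷ n) and H(d ▷ m,-) ▷ n, and the costrength identifies these two
    functors. *)
Definition twist_transpose n (v : hom (T m) (d^v ▷ n)) : hom (T (d ▷ m)) n :=
  adjl (trev_adj (d ▷ m))
    ((ihact_shift H (rdp d) m n : @hom k (modend M) _ _) ∘ adjr (trev_adj m) (v : hom (evalF (T m) (dual_one M)) _)).

Lemma twist_transpose_bij n : bij (@twist_transpose n).
Proof.
exact: (bij_comp (f := fun s => adjl (trev_adj (d ▷ m)) s) (adjl_bij (trev_adj (d ▷ m)) (dual_one M) n)
  (bij_comp (iso_bij (dual_one M : modend M) (ihact_shift_iso H (rdp d) m n))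
     (adjr_bij (trev_adj m) (dual_one M) (d^v ▷ n)))).
Qed.

Lemma twist_counit tw n : is_twist tw ->
  ihact_counit' (d ▷ m) n ∘ (ipost H (d ▷ m) tw ▶ idm n)
    ∘ ((istr H d^v^v (d ▷ m) (T m) ▶ idm n) ∘ hinv (mass d^v^v _ n))
    ∘ (idm d^v^v ▶ ihact_shift H (rdp d) m n (T m))
  = aev (rdp d^v) n ∘ (idm d^v^v ▶ ihact_counit' m (d^v ▷ n)).
Proof.
rewrite /is_twist icostrE /ihact_counit' /= => htw.
have e4 : (lunit d^v ∘ (tr m ⊠ idm d^v)) ▶ idm n
    = munit (d^v ▷ n) ∘ (tr m ▶ idm _) ∘ mass (H m (T m)) d^v n.
  by rewrite actMl -mod_munit_mass -compA mass_nat actm1 compA.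
move: (tr (d ▷ m)) (tr m) e4 htw => t1 t2 e4 htw.
rewrite !actMr !compA (cl _ (hmass_nat _ _ _)) !compA.
rewrite -!(compA (munit n)) -!actMl htw actMl -!compA.
rewrite (compA (_ ▶ idm n) (hinv _)) -hmass_nat e4 !actMr -!compA -actMr.
rewrite hinvV ?actm1 ?compm1; last exact: mass_iso.
by rewrite /aev -lock -!compA.
Qed.

(** After precomposition with a twist, the transpose becomes the ordinary adjunction between d^∨∨ ▷
    - and d^∨ ▷ -. This is how the defining trace equation of the twist enters. *)
Lemma twist_transposeP tw n (v : hom (T m) (d^v ▷ n)) : is_twist tw ->
  twist_transpose v ∘ tw = aev (rdp d^v) n ∘ (idm d^v^v ▶ v).
Proof.
move=> htw.
pose w : modnat (modfun_id M) _ := adjr (trev_adj m) (v : hom (evalF (T m) (dual_one M)) _).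
have <- : ihact_counit' m _ ∘ w (T m) = v.
  exact: (adjrK (trev_adj m) (v : hom (evalF (T m) (dual_one M)) _)).
pose a : modnat (modfun_id M) (ihact H (d ▷ m) n) := modnat_comp (ihact_shift H (rdp d) m n) w.
have -> : twist_transpose (ihact_counit' m _ ∘ w (T m)) = ihact_counit' (d ▷ m) n ∘ a (T (d ▷ m)).
  by rewrite /twist_transpose; have -> := adjlK (trev_adj m) (w : @hom k (modend M) (dual_one M) _).
have e1 : a (T (d ▷ m)) ∘ tw = (ipost H (d ▷ m) tw ▶ idm n) ∘ a (d^v^v ▷ T m).
  exact: (mn_nat a tw).
have e2 : a (d^v^v ▷ T m) = (istr H d^v^v (d ▷ m) (T m) ▶ idm n)
    ∘ hinv (mass d^v^v _ n) ∘ (idm d^v^v ▶ a (T m)).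
  apply: (ihact_str (H := H) (x := d ▷ m) (n := n)); rewrite (mn_mod a) /=; exact: compm1.
rewrite [in RHS]actMr [RHS]compA -(twist_counit n htw) -[in LHS]compA e1 e2.
have -> : a (T m) = ihact_shift H (rdp d) m n (T m) ∘ w (T m) by [].
move: (ihact_counit' (d ▷ m) n) (ihact_shift H (rdp d) m n (T m)) (w (T m)) => c1 c2 c3.
by rewrite actMr !compA.
Qed.

(** By [twist_transposeP], precomposition with tw is a quotient of two bijections, so Yoneda
    applies. *)
Lemma twist_iso tw : is_twist tw -> is_iso tw.
Proof.
move=> htw; apply: iso_yonedar => n.
have b := adjl_bij (act_adj M (rdp d^v)) (T m) n.
apply: bijI => [f g /= e|f].
  have [v hv] := bij_surj f (twist_transpose_bij n); have [w hw] := bij_surj g (twist_transpose_bij n).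
  rewrite -hv -hw; congr twist_transpose; apply: (bij_inj b); rewrite /adjl /=.
  by rewrite -!(twist_transposeP _ htw) hv hw.
have [v hv] := bij_surj f b; exists (twist_transpose v).
by rewrite /= (twist_transposeP _ htw).
Qed.

End Twist.
End SerreAdjunction.

(** * Nakayama functors and adjoints *)

Section ScalarPullback.
Variables (k : fieldType) (V W : lmodType k) (h : V -> W).
Hypothesis hP : forall a u v, h (a *: u + v) = a *: h u + h v.

Definition spull (f : {scalar W}) : {scalar V} :=
  locked (mkscalar (f := fun v => f (h v)) (fun a u v => etrans (congr1 f (hP a u v)) (scalarPl f a (h u) (h v)))).

Lemma spullE f v : spull f v = f (h v). Proof. by rewrite /spull -lock. Qed.
End ScalarPullback.

(** The structure of N^r(x) on a given object t. Separating it from the object lets a functor fixed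
    in advance, such as the identity, carry it. *)
Record nakstr (k : fieldType) (C : lincat k) (x t : C) := NakStr {
  ns_in : forall y, {scalar hom x y} -> hom y t;
  ns_cow : cowedge ns_in;
  ns_univ : forall z (j : forall y, {scalar hom x y} -> hom y z), cowedge j ->
    exists! h : hom t z, forall y f, h ∘ ns_in f = j y f }.

Arguments ns_in {k C x t} n {y} f.

Definition nakr_of (k : fieldType) (C : lincat k) (x t : C) (W : nakstr x t) : nakr x :=
  @NakR k C x t (@ns_in _ _ _ _ W) (ns_cow W) (@ns_univ _ _ _ _ W).

Definition nakstr_of (k : fieldType) (C : lincat k) (x : C) (N : nakr x) : nakstr x N :=
  @NakStr k C x N (@nr_in _ _ _ N) (nr_cowedge N) (@nr_univ _ _ _ N).

Section NakayamaUniqueness.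
Variables (k : fieldType) (C : lincat k) (x : C).

Lemma nr_ext (N : nakr x) z (g h : hom N z) :
  (forall y (f : {scalar hom x y}), g ∘ nr_in N f = h ∘ nr_in N f) -> g = h.
Proof.
move=> e; pose j y (f : {scalar hom x y}) := h ∘ nr_in N f.
have cj : cowedge j.
  have [c1 c2] := nr_cowedge N; split=> [y a f g' h' H|y y' v f g' H].
    by rewrite /j (c1 y a f g' h' H) compPr.
  by rewrite /j -compA (c2 _ _ _ _ _ H).
have [u [_ uU]] := nr_univ N cj; by rewrite -(uU g e) -(uU h).
Qed.

Lemma nakr_iso_exists (N N' : nakr x) :
  exists h : hom N N', is_iso h /\ forall y (f : {scalar hom x y}), h ∘ nr_in N f = nr_in N' f.
Proof.
have [h [hh _]] := nr_univ N (nr_cowedge N').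
have [g [hg _]] := nr_univ N' (nr_cowedge N).
exists h; split=> //; exists g; split; apply: nr_ext => y f.
  by rewrite -compA hh hg comp1m.
by rewrite -compA hg hh comp1m.
Qed.

Lemma nr_in_nat (N : nakr x) y y' (v : hom y y') (f : {scalar hom x y'}) (g : {scalar hom x y}) :
  (forall w, g w = f (v ∘ w)) -> nr_in N f ∘ v = nr_in N g.
Proof. by have [_ h] := nr_cowedge N; apply: h. Qed.

End NakayamaUniqueness.

Section NakayamaAdjoint.
Variables (k : fieldType) (E M : lincat k) (R : functor M E) (V : functor E M) (Q : functor M E).
Variables (b : adjunction R V) (c : adjunction V Q).
Variables (one : E) (gx : M) (NE : nakr one).
Variables (al : forall y, hom one (R y) -> hom gx y) (ar : forall y, hom gx y -> hom one (R y)).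
Hypotheses (alK : forall y, cancel (@al y) (@ar y)) (arK : forall y, cancel (@ar y) (@al y)).
Hypothesis alP : forall y a u v, al (a *: u + v) = a *: @al y u + al v.
Hypothesis al_nat : forall y z (f : hom y z) (w : hom one (R y)), al (fmor R f ∘ w) = f ∘ al w.
Arguments al {y} _.
Arguments ar {y} _.

Lemma ar_nat y z (f : hom y z) (w : hom gx y) : ar (f ∘ w) = fmor R f ∘ ar w.
Proof. by rewrite -[in LHS](arK w) -al_nat alK. Qed.
Lemma arP y a u v : ar (a *: u + v) = a *: @ar y u + ar v.
Proof. by rewrite -[in LHS](arK u) -[in LHS](arK v) -alP alK. Qed.

(** Component at n of the coend N^r(gx) realised on V (N^r(one)): a form on Hom(gx, n) = Hom(one, R
    n) gives the component at R n of N^r(one), transposed along R ⊣ V. *)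
Definition mate_in n (f : {scalar hom gx n}) : hom n (V NE) :=
  fmor V (nr_in NE (spull (@alP n) f)) ∘ aunit b n.

Let rho G (w : hom gx (V G)) : hom one G := acounit b G ∘ ar w.
Let rhoP G a u v : rho (a *: u + v) = a *: @rho G u + rho v.
Proof. by rewrite /rho arP compPr. Qed.

Lemma mate_in_eval G (f : {scalar hom one G}) (g : {scalar hom gx (V G)}) :
  (forall w, g (al w) = f (acounit b G ∘ w)) -> fmor V (nr_in NE f) = mate_in g.
Proof.
move=> h; rewrite /mate_in.
rewrite -(@nr_in_nat _ _ _ NE _ _ (acounit b G) f (spull (@alP (V G)) g)); last first.
  by move=> w; rewrite spullE h.
by rewrite fmorM -compA adj_triR compm1.
Qed.

Lemma mate_in_cowedge : cowedge mate_in.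
Proof.
have [c1 c2] := nr_cowedge NE; split=> [y a f g h H|y y' v f g H].
  have e := c1 _ a (spull (@alP y) f) (spull (@alP y) g) (spull (@alP y) h).
  by rewrite /mate_in e ?fmorP ?compPl // => w; rewrite !spullE H.
rewrite /mate_in -compA aunit_nat compA -fmorM; congr (fmor V _ ∘ _).
by apply: c2 => w; rewrite !spullE al_nat H.
Qed.

(** N^r(gx) = V (N^r(one)) when gx is the value at one of a left adjoint of R. The right adjoint Q
    of V turns a cowedge into z on Hom(gx,-) into a cowedge into Q z on Hom(one,-), whose universal
    property is known. *)
Definition mate_nakr : nakr gx.
Proof.
refine (@NakR k M gx (V NE) mate_in mate_in_cowedge _) => z j [j1 j2].
pose J G (f : {scalar hom one G}) : hom G (Q z) := adjr c (j (V G) (spull (@rhoP G) f)).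
have cJ : cowedge J.
  split=> [G a f g h H|G G' v f g H].
    have e := j1 _ a (spull (@rhoP G) f) (spull (@rhoP G) g) (spull (@rhoP G) h).
    by rewrite /J e /adjr ?fmorP ?compPl // => w; rewrite !spullE H.
  rewrite /J -adjr_natl; congr (adjr c _); apply: j2 => w; rewrite !spullE H; congr (f _).
  by rewrite /rho ar_nat !compA acounit_nat.
have ev G (f : {scalar hom one G}) : fmor V (nr_in NE f) = mate_in (spull (@rhoP G) f).
  by apply: mate_in_eval => w; rewrite spullE /rho alK.
have [h [hh hU]] := nr_univ NE cJ.
have key G (f : {scalar hom one G}) : adjl c h ∘ mate_in (spull (@rhoP G) f) = j _ (spull (@rhoP G) f).
  by rewrite -ev -adjl_natl hh adjrK.
exists (adjl c h); split=> [y f|g hg].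
  have -> : mate_in f = mate_in (spull (@rhoP (R y)) (spull (@alP y) f)) ∘ aunit b y.
    by rewrite -ev.
  rewrite compA key; apply: j2 => w; rewrite !spullE; congr (f _).
  by rewrite /rho ar_nat compA adj_triL comp1m arK.
apply: (bij_inj (adjr_bij c _ _)); rewrite adjlK; apply: hU => G f.
by rewrite -adjr_natl ev hg.
Defined.

Section Mate.
Variable Ngx : nakr gx.
Variables (can : forall y, hom (R y) NE -> hom y (V NE)).
Hypothesis canE : forall y (h : hom (R y) NE), can h = fmor V h ∘ aunit b y.

(** Evaluates the description-operator definition [nak_mate]: it is the comparison of coends with
    [mate_nakr], hence invertible and known on every component. *)
Lemma nak_mateP : is_iso (nak_mate NE Ngx (fun y => R y) (@al) can)
  /\ forall y (f : {scalar hom gx y}), nak_mate NE Ngx (fun y => R y) (@al) can ∘ nr_in Ngx f = mate_in f.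
Proof.
have [h [hi hh]] := nakr_iso_exists Ngx mate_nakr.
suff -> : nak_mate NE Ngx (fun y => R y) (@al) can = h by split.
apply: the_morE => [y f g H|g Hg].
  rewrite hh canE /= /mate_in; congr (fmor V _ ∘ _).
  congr (nr_in NE _); apply: scalar_ext => w.
  by rewrite spullE H.
apply: nr_ext => y f; rewrite hh /=.
by rewrite (Hg y f (spull (@alP y) f)) ?canE // => w; rewrite spullE.
Qed.
End Mate.

End NakayamaAdjoint.

Section NakayamaDescent.
Variables (k : fieldType) (E M : lincat k) (I : Type).
Variables (V' V : I -> functor E M) (R : I -> functor M E).
Variables (a : forall i, adjunction (V' i) (R i)) (b : forall i, adjunction (R i) (V i)).
Variables (O : Type) (s t : O -> I) (Phi Psi : O -> functor M M).
Variable u : forall o, adjunction (Psi o) (Phi o).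
Variable th : forall o G, hom (V (s o) G) (Phi o (V (t o) G)).
Variable om : forall o n, hom (R (t o) (Psi o n)) (R (s o) n).
Hypothesis th_nat : forall o (G G' : E) (f : hom G G'),
  th o G' ∘ fmor (V (s o)) f = fmor (Phi o) (fmor (V (t o)) f) ∘ th o G.
Hypothesis om_unit : forall o n,
  fmor (Phi o) (fmor (V (t o)) (om o n) ∘ aunit (b (t o)) (Psi o n)) ∘ aunit (u o) n
  = th o (R (s o) n) ∘ aunit (b (s o)) n.

(** Each index i carries adjoints V' i ⊣ R i ⊣ V i. An operation o relates the indices s o and t o
    on all three levels: [th] for V, its mate [om] for R, and this map for V'. *)
Definition transp o (one : E) n (v : hom (V' (t o) one) (Psi o n)) : hom (V' (s o) one) n :=
  adjl (a (s o)) (om o n ∘ adjr (a (t o)) v).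

Lemma mate_in_compat o one (NE : nakr one) n (f : {scalar hom (V' (s o) one) n})
    (g : {scalar hom (V' (t o) one) (Psi o n)}) :
  (forall v, g v = f (transp v)) ->
  th o NE ∘ mate_in (b (s o)) NE (@adjlP _ _ _ _ _ (a (s o)) one) f
  = fmor (Phi o) (mate_in (b (t o)) NE (@adjlP _ _ _ _ _ (a (t o)) one) g) ∘ aunit (u o) n.
Proof.
move=> H; rewrite /mate_in compA th_nat -compA -om_unit compA -fmorM compA -fmorM.
congr (fmor _ (fmor _ _ ∘ _) ∘ _); apply: nr_in_nat => w.
by rewrite !spullE H /transp adjlK.
Qed.

Variables (one T : E).
Variable W : forall i, nakstr (V' i one) (V i T).
Hypothesis W_compat : forall o n (f : {scalar hom (V' (s o) one) n})
    (g : {scalar hom (V' (t o) one) (Psi o n)}), (forall v, g v = f (transp v)) ->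
  th o T ∘ ns_in (W (s o)) f = fmor (Phi o) (ns_in (W (t o)) g) ∘ aunit (u o) n.
Hypothesis faithful : forall A B (f g : hom A B),
  (forall i, fmor (V i) f = fmor (V i) g) -> f = g.
Hypothesis descent : forall A B (h : forall i, hom (V i A) (V i B)),
  (forall o, th o B ∘ h (s o) = fmor (Phi o) (h (t o)) ∘ th o A) ->
  exists f : hom A B, forall i, fmor (V i) f = h i.

Let rho i G (w : hom (V' i one) (V i G)) : hom one G := acounit (b i) G ∘ adjr (a i) w.
Let rhoP i G c p q : rho (c *: p + q) = c *: @rho i G p + rho q.
Proof. by rewrite /rho /adjr fmorP compPl compPr. Qed.

Let transpP o n c p q : transp (c *: p + q) = c *: @transp o one n p + transp q.
Proof. by rewrite /transp /adjr fmorP compPl compPr -adjlP. Qed.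

Lemma counit_om o G :
  acounit (b (s o)) G ∘ om o (V (s o) G) = acounit (b (t o)) G ∘ fmor (R (t o)) (adjl (u o) (th o G)).
Proof.
apply: (bij_inj (adjr_bij (b (t o)) _ _)); rewrite adjr_natl adjr_counit comp1m.
apply: (bij_inj (adjr_bij (u o) _ _)); rewrite adjlK adjr_natr /adjr fmorM -compA.
rewrite om_unit compA -th_nat -compA adj_triR compm1 //.
Qed.

Let rho_nat i G G' (v : hom G G') w : @rho i G' (fmor (V i) v ∘ w) = v ∘ rho w.
Proof. by rewrite /rho adjr_natr !compA acounit_nat. Qed.

Let in_exists G (f : {scalar hom one G}) :
  exists h : hom G T, forall i, fmor (V i) h = ns_in (W i) (spull (@rhoP i G) f).
Proof.
apply: descent => o.
pose g : {scalar hom (V' (t o) one) (Psi o (V (s o) G))} :=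
  spull (@transpP o _) (spull (@rhoP (s o) G) f).
rewrite (W_compat (g := g)); last by move=> v; rewrite /g spullE.
have -> : ns_in (W (t o)) g = ns_in (W (t o)) (spull (@rhoP (t o) G) f) ∘ adjl (u o) (th o G).
  apply/esym; have [_ h] := ns_cow (W (t o)); apply: h => v.
  rewrite /g !spullE; congr (f _); rewrite /rho /transp adjlK compA counit_om -compA.
  by rewrite -adjr_natr.
by rewrite fmorM -compA -/(adjr (u o) _) adjlK.
Qed.

Let inE G (f : {scalar hom one G}) : hom G T := sval (cid (in_exists f)).
Let inEP G (f : {scalar hom one G}) i : fmor (V i) (inE f) = ns_in (W i) (spull (@rhoP i G) f).
Proof. exact: (svalP (cid (in_exists f)) i). Qed.

(** Morphisms of E are compatible families of morphisms between the values of V. So the inclusions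
    of the coend and the morphisms out of it are built at each index, where W provides them, and
    compatibility of W with the operations glues them. *)
Definition descent_nakr : nakstr one T.
Proof.
refine (@NakStr k E one T (@inE) _ _).
  split=> [G c f g h H|G G' v f g H]; apply: faithful => i; rewrite ?fmorP ?fmorM !inEP.
    by have [h1 _] := ns_cow (W i); apply: h1 => w; rewrite !spullE H.
  have [_ h2] := ns_cow (W i); apply: h2 => w; rewrite !spullE H; congr (f _).
  by rewrite rho_nat.
move=> K j [j1 j2].
pose J i n (f : {scalar hom (V' i one) n}) : hom n (V i K) :=
  fmor (V i) (j (R i n) (spull (@adjlP _ _ _ _ _ (a i) one n) f)) ∘ aunit (b i) n.
have cJ i : cowedge (J i).
  split=> [n c f g h H|n n' v f g H].
    have e := j1 _ c (spull (@adjlP _ _ _ _ _ (a i) one n) f) (spull (@adjlP _ _ _ _ _ (a i) one n) g) (spull (@adjlP _ _ _ _ _ (a i) one n) h).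
    by rewrite /J e ?fmorP ?compPl // => w; rewrite !spullE H.
  rewrite /J -compA aunit_nat compA -fmorM; congr (fmor _ _ ∘ _); apply: j2 => w.
  by rewrite !spullE H adjl_natr.
have [h hh] : exists h : hom T K, forall i n (f : {scalar hom (V' i one) n}),
    fmor (V i) h ∘ ns_in (W i) f = J i n f.
  pose hi i := sval (cid (ns_univ (W i) (cJ i))).
  have hiP i n (f : {scalar hom (V' i one) n}) : hi i ∘ ns_in (W i) f = J i n f.
    by have [H _] := svalP (cid (ns_univ (W i) (cJ i))); apply: H.
  have [|h hE] := @descent T K hi; last by exists h => i n f; rewrite hE hiP.
  move=> o; apply: (@nr_ext _ _ _ (nakr_of (W (s o)))) => n f /=.
  pose g : {scalar hom (V' (t o) one) (Psi o n)} := spull (@transpP o n) f.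
  rewrite -!compA hiP (W_compat (g := g)); last by move=> v; rewrite spullE.
  rewrite compA -fmorM hiP /J compA th_nat -compA -om_unit compA -fmorM compA -fmorM.
  congr (fmor _ (fmor _ _ ∘ _) ∘ _); apply: j2 => w.
  by rewrite /g !spullE /transp adjlK.
have key G (f : {scalar hom one G}) i :
    J i (V i G) (spull (@rhoP i G) f) = fmor (V i) (j G f).
  rewrite /J -[RHS]compm1 -(adj_triR (b i)) compA -fmorM; congr (fmor _ _ ∘ _).
  by apply/esym/j2 => w; rewrite !spullE /rho adjlK.
exists h; split=> [G f|h' hh'].
  by apply: faithful => i; rewrite fmorM inEP hh key.
apply: faithful => i; apply: (@nr_ext _ _ _ (nakr_of (W i))) => n f /=.
have -> : ns_in (W i) f = fmor (V i) (inE (spull (@adjlP _ _ _ _ _ (a i) one n) f)) ∘ aunit (b i) n.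
  rewrite inEP; have [_ h2] := ns_cow (W i); apply/esym/h2 => w; rewrite !spullE; congr (f _).
  by rewrite /rho adjr_natr compA adj_triL comp1m adjrK.
by rewrite !compA; congr (_ ∘ _); rewrite -[RHS]fmorM hh' inEP hh key.
Qed.

End NakayamaDescent.

(** * Nakayama functors of the dual category *)

Section TraceNakayama.
Variables (k : fieldType) (D : ftcat k) (M : modcat D) (T : trdata M).
Local Notation H := (td_hom T).
Local Notation tr := (td_tr T).
Implicit Types (c d : D) (m n x y z : M) (G K : modfun M).

(* Morphisms in M and in D act on families indexed by the objects of M: a family
   of morphisms compatible with all of them is a module natural transformation. *)
Inductive mod_op :=
| OpNat x x' of hom x x'
| OpAct of D & M.

Definition ihact_pre x x' (f : hom x x') n : modnat (ihact H x' n) (ihact H x n).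
Proof.
refine (@ModNat k D M (ihact H x' n) (ihact H x n) (fun y => ipre H y f ▶ idm n) _ _).
- by move=> y z g /=; rewrite -!actMl ipre_post.
- move=> d y /=; apply: (@iso_cancel _ _ _ _ _ (istr H d x' y ▶ idm n)).
    by apply: is_iso_actm; [exact: istr_iso|exact: is_iso_id].
  have e : ipre H (d ▷ y) f ∘ istr H d x' y = istr H d x y ∘ (idm d ⊠ ipre H y f).
    by apply: (iunc_inj (H := H)); rewrite iunc_pre istr1 iunc_istr iunc_pre1 actMr -!compA -mass_nat tensm1.
  rewrite -!compA -!actMl e (compA (hinv _)) hinvK ?comp1m; last exact: istr_iso.
  by rewrite hinvK ?actm1 ?compm1 ?mass_nat //; exact: istr_iso.
Defined.

Lemma ihact_pre_counit x x' (f : hom x x') n :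
  ihact_counit' T x n ∘ ihact_pre f n (T x)
  = ihact_counit' T x' n ∘ (ipost H x' (fmor T f) ▶ idm n).
Proof. by rewrite /ihact_counit' /= -!compA -!actMl td_nat. Qed.

Section Operations.
Definition op_src (o : mod_op) : M :=
  match o with @OpNat x x' f => x | OpAct d x => d ▷ x end.
Definition op_tgt (o : mod_op) : M :=
  match o with @OpNat x x' f => x' | OpAct d x => x end.
Definition op_Phi (o : mod_op) : functor M M :=
  match o with @OpNat x x' f => id_functor M | OpAct d x => actF M d end.
Definition op_Psi (o : mod_op) : functor M M :=
  match o with @OpNat x x' f => id_functor M | OpAct d x => actF M d^v end.
Definition op_adj (o : mod_op) : adjunction (op_Psi o) (op_Phi o) :=
  match o with @OpNat x x' f => id_adj M | OpAct d x => act_adj M (rdp d) end.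
Definition op_th (o : mod_op) (G : modend M) :
    hom (evalF (op_src o) G) (op_Phi o (evalF (op_tgt o) G)) :=
  match o with @OpNat x x' f => fmor (mf_fun G) f | OpAct d x => mf_str G d x end.
Definition op_om (o : mod_op) (n : M) :
    hom (ihactF H (op_tgt o) (op_Psi o n)) (ihactF H (op_src o) n) :=
  match o with @OpNat x x' f => ihact_pre f n | OpAct d x => ihact_shift H (rdp d) x n end.

Lemma op_th_nat o (G G' : modend M) (f : hom G G') :
  op_th o G' ∘ fmor (evalF (op_src o)) f = fmor (op_Phi o) (fmor (evalF (op_tgt o)) f) ∘ op_th o G.
Proof. by case: o => [x x' g|d x] /=; [rewrite -mn_nat|rewrite mn_mod]. Qed.

Lemma op_om_unit o n :
  fmor (op_Phi o) (fmor (evalF (op_tgt o)) (op_om o n) ∘ aunit (ihact_adj H (op_tgt o)) (op_Psi o n))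
    ∘ aunit (op_adj o) n
  = op_th o (ihactF H (op_src o) n) ∘ aunit (ihact_adj H (op_src o)) n.
Proof.
case: o => [x x' f|d x] /=; last exact: ihact_shift_unit.
rewrite compm1 /ihact_unit !compA -!actMl; congr (_ ▶ _ ∘ _).
by apply: (iunc_inj (H := H)); rewrite iunc_pre iunc_post !iunc_iid munit_nat.
Qed.

Lemma op_descent G K (h : forall x, hom (G x) (K x)) :
  (forall o, op_th o K ∘ h (op_src o) = fmor (op_Phi o) (h (op_tgt o)) ∘ op_th o G) ->
  exists s : modnat G K, forall x, s x = h x.
Proof.
move=> e.
have e1 x x' (f : hom x x') : h x' ∘ fmor G f = fmor K f ∘ h x.
  by have /= -> := e (OpNat f).
have e2 d x : mf_str K d x ∘ h (d ▷ x) = (idm d ▶ h x) ∘ mf_str G d x.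
  by have /= -> := e (OpAct d x).
by exists (ModNat e1 e2).
Qed.
End Operations.

(* A family of structures of N^r(T x) on K x that is natural and D-linear in x. *)
Record nakfam K := NakFam {
  nf_str :> forall x, nakstr (T x) (K x);
  nf_nat : forall x x' (f : hom x x') n (p : {scalar hom (T x) n}) (q : {scalar hom (T x') n}),
    (forall v, q v = p (v ∘ fmor T f)) ->
    fmor K f ∘ ns_in (nf_str x) p = ns_in (nf_str x') q;
  nf_act : forall d x tw, is_twist (T := T) tw ->
    forall n (p : {scalar hom (T (d ▷ x)) n}) (q : {scalar hom (T x) (d^v ▷ n)}),
    (forall v w, w ∘ tw = aev (rdp d^v) n ∘ (idm d^v^v ▶ v) -> q v = p w) ->
    mf_str K d x ∘ ns_in (nf_str (d ▷ x)) p = (idm d ▶ ns_in (nf_str x) q) ∘ acoev (rdp d) n }.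

Lemma transp_nat x x' (f : hom x x') n (v : hom (T x') n) :
  transp (V' := fun x => evalF (T x)) (R := ihactF H) (trev_adj T) op_om
    (o := OpNat f) (one := dual_one M) v = v ∘ fmor T f.
Proof.
pose w : modnat (modfun_id M) _ := adjr (trev_adj T x') (v : hom (evalF (T x') (dual_one M)) _).
have {2}<- : ihact_counit' T x' n ∘ w (T x') = v.
  exact: (adjrK (trev_adj T x') (v : hom (evalF (T x') (dual_one M)) _)).
have e1 : w (T x') ∘ fmor T f = (ipost H x' (fmor T f) ▶ idm n) ∘ w (T x).
  exact: (mn_nat w (fmor T f)).
by rewrite -compA e1 compA -ihact_pre_counit -compA.
Qed.

(** Although this transpose is what descent produces, [nf_act] is phrased by the equation of
    [twist_transposeP], which characterises it because twists are invertible and which can be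
    compared along F. *)
Lemma transp_act d x n (v : hom (T x) (d^v ▷ n)) :
  transp (V' := fun x => evalF (T x)) (R := ihactF H) (trev_adj T) op_om
    (o := OpAct d x) (one := dual_one M) v = twist_transpose v.
Proof. by []. Qed.

Definition ess_surjective (k' : fieldType) (A B : lincat k') (F : functor A B) : Prop :=
  forall b, exists a (f : hom (F a) b), is_iso f.

Section FromNakayama.
Hypothesis Tsurj : ess_surjective T.

(** Write x as T y up to isomorphism; evaluation at T y has the right adjoint H(y,-) ▷ -. *)
Definition eval_right x : {Q : functor M (modend M) & adjunction (evalF x) Q}.
Proof.
pose y := sval (cid (Tsurj x)); have /cid [f fi] := svalP (cid (Tsurj x)).
have gi := is_iso_hinv fi.
exists (ihactF H y).
apply: (@adj_natiso k (modend M) M (evalF (T y)) (evalF x) (ihactF H y)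
  (fun G : modfun M => fmor G (hinv f)) _ _ (trev_adj T y)).
- by move=> G; exact: (@fmor_iso k M M (mf_fun (G : modfun M)) _ _ _ gi).
- by move=> G K s /=; rewrite mn_nat.
Defined.

Variable NE : nakr (dual_one M).

Definition nakfam_str x : nakstr (T x) ((nr_obj NE : modfun M) x) :=
  nakstr_of (mate_nakr (ihact_adj H x) (projT2 (eval_right x)) NE (@adjlK _ _ _ _ _ (trev_adj T x) (dual_one M))
  (@adjrK _ _ _ _ _ (trev_adj T x) (dual_one M)) (@adjlP _ _ _ _ _ (trev_adj T x) (dual_one M))
  (fun y z f w => adjl_natr (trev_adj T x) w f)).

Definition nakfam_of : nakfam (NE : modend M).
Proof.
refine (@NakFam (NE : modend M) nakfam_str _ _).
- move=> x x' f n p q h.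
  have := mate_in_compat op_th_nat op_om_unit (o := OpNat f) (V' := fun x => evalF (T x)) (a := fun x => trev_adj T x) (one := dual_one M) NE (f := p) (g := q).
  by rewrite /= compm1; apply=> v; rewrite transp_nat h.
- move=> d x tw htw n p q h.
  apply: (mate_in_compat op_th_nat op_om_unit (o := OpAct d x) (V' := fun x => evalF (T x)) (a := fun x => trev_adj T x) (one := dual_one M) NE (f := p) (g := q)) => v.
  by rewrite transp_act; apply: h; exact: twist_transposeP.
Defined.
End FromNakayama.

(** Converse of [nakfam_of] for the identity functor, by descent along evaluation at all objects. *)
Definition nakstr_of_fam (W : nakfam (modfun_id M)) : @nakstr k (modend M) (dual_one M) (dual_one M).
Proof.
have Wc : forall o n (f : {scalar hom (T (op_src o)) n}) (g : {scalar hom (T (op_tgt o)) (op_Psi o n)}),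
    (forall v, g v = f (transp (V' := fun x => evalF (T x)) (trev_adj T) op_om (one := dual_one M) v)) ->
    op_th o (dual_one M) ∘ ns_in (W (op_src o)) f = fmor (op_Phi o) (ns_in (W (op_tgt o)) g) ∘ aunit (op_adj o) n.
  case=> [x x' f|d x] n p q h.
    rewrite /= compm1; apply: (nf_nat W (f := f)) => v; by rewrite h transp_nat.
  have [tw htw] := twist_exists T d x.
  apply: (nf_act W htw) => v w e; rewrite h transp_act; congr (p _).
  apply: (iso_cancel (twist_iso htw)); by rewrite e (twist_transposeP _ htw).
apply: (@descent_nakr _ _ _ _ (fun x => evalF (T x)) _ _ (trev_adj T) (ihact_adj H) _ _ _ _ _ _ _ _ op_th_nat op_om_unit
  (dual_one M) (dual_one M) (fun x => W x) Wc).
- by move=> A B f g e; apply: modnatP.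
- by move=> A B h e; have [s hs] := op_descent e; exists s.
Defined.

End TraceNakayama.

Section LeftNakayama.
Variables (k : fieldType) (C : lincat k) (x : C).

Definition nakl_of (t : C) (W : @nakstr k (opc C) x t) : nakl x.
Proof.
refine (@NakL k C x t (fun y f => ns_in W f) _ _).
  have [h1 h2] := ns_cow W; split=> [|y y' v f g e]; first exact: h1.
  exact: (h2 y' y v f g e).
move=> z j [h1 h2]; apply: (ns_univ W); split=> [|y y' v f g e]; first exact: h1.
exact: (h2 y' y v f g e).
Defined.

Definition nakr_op (N : nakl x) : @nakr k (opc C) x.
Proof.
refine (@NakR k (opc C) x (N : C) (fun y f => nl_out N f) _ _).
  have [h1 h2] := nl_wedge N; split=> [|y y' v f g e]; first exact: h1.
  exact: (h2 y' y v f g e).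
move=> z j [h1 h2]; apply: (nl_univ N); split=> [|y y' v f g e]; first exact: h1.
exact: (h2 y' y v f g e).
Defined.
End LeftNakayama.

Section TraceNakayamaLeft.
Variables (k : fieldType) (D : ftcat k) (M : modcat D) (T : trdata M).
Local Notation H := (td_hom T).
Local Notation tr := (td_tr T).
Local Notation E := (modend M).
Implicit Types (c d : D) (m n x y z : M) (G K : modfun M).

Let tw d x := sval (cid (twist_exists T d x)).
Let twP d x : is_twist (tw d x) := svalP (cid (twist_exists T d x)).

(** The left case runs in opposite categories, where the adjoint string is reversed: evaluation at x
    now plays the part of V', and evaluation at T x that of V. Since T (d ▷ x) = d^∨∨ ▷ T x, the
    action operation only sees double duals. *)
Definition lop_src (o : mod_op M) : opc M :=
  match o with @OpNat _ _ _ x x' f => x' | OpAct d x => d ▷ x end.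
Definition lop_tgt (o : mod_op M) : opc M :=
  match o with @OpNat _ _ _ x x' f => x | OpAct d x => x end.
Definition lop_Phi (o : mod_op M) : functor (opc M) (opc M) :=
  match o with @OpNat _ _ _ x x' f => id_functor (opc M) | OpAct d x => opf (actF M d^v^v) end.
Definition lop_Psi (o : mod_op M) : functor (opc M) (opc M) :=
  match o with @OpNat _ _ _ x x' f => id_functor (opc M) | OpAct d x => opf (actF M d^v) end.
Definition lop_adj (o : mod_op M) : adjunction (lop_Psi o) (lop_Phi o) :=
  match o with @OpNat _ _ _ x x' f => id_adj (opc M) | OpAct d x => opadj (act_adj M (rdp d^v)) end.
Definition lop_th (o : mod_op M) (G : opc E) :
    hom (opf (evalF (T (lop_src o))) G) (lop_Phi o (opf (evalF (T (lop_tgt o))) G)) :=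
  match o with
  | @OpNat _ _ _ x x' f => fmor (G : modfun M) (fmor T f)
  | OpAct d x => fmor (G : modfun M) (tw d x) ∘ hinv (mf_str (G : modfun M) d^v^v (T x))
  end.
Definition lop_om (o : mod_op M) (n : opc M) :
    hom (opf (ihactF H (lop_tgt o)) (lop_Psi o n)) (opf (ihactF H (lop_src o)) n) :=
  match o with
  | @OpNat _ _ _ x x' f => ihact_pre T f n
  | OpAct d x => @hinv k E _ _ (ihact_shift H (rdp d) x n)
  end.

Lemma hmn_mod G K (s : modnat G K) d x :
  s (d ▷ x) ∘ hinv (mf_str G d x) = hinv (mf_str K d x) ∘ (idm d ▶ s x).
Proof. by apply/esym/hinv_nat; [exact: mf_iso..|exact: mn_mod]. Qed.

Lemma lop_th_nat o (G G' : opc E) (f : hom G G') :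
  lop_th o G' ∘ fmor (opf (evalF (T (lop_src o)))) f = fmor (lop_Phi o) (fmor (opf (evalF (T (lop_tgt o)))) f) ∘ lop_th o G.
Proof.
case: o => [x x' g|d x] /=; first exact: mn_nat.
by rewrite compA mn_nat -compA hmn_mod compA.
Qed.

Lemma hinv_modnat G K (s : @hom k E G K) x : is_iso s ->
  mn_fun (hinv s) x = hinv (mn_fun s x).
Proof.
move=> si; apply/esym/hinvE; split.
  by have := congr1 (fun u : modnat G G => u x) (hinvK si).
by have := congr1 (fun u : modnat K K => u x) (hinvV si).
Qed.

Lemma hstr_ihact x n d y : hinv (mf_str (ihact H x n) d y) = (istr H d x y ▶ idm n) ∘ hinv (mass d _ n).
Proof.
have ii : is_iso (hinv (istr H d x y)) by apply: is_iso_hinv; exact: istr_iso.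
rewrite /= hinv_comp; [|exact: mass_iso|by apply: is_iso_actm; [|exact: is_iso_id]].
by rewrite act_hinv ?hinv1 ?hinv_hinv //; [exact: istr_iso|exact: is_iso_id].
Qed.

Lemma lop_om_unit o n :
  fmor (lop_Phi o) (fmor (opf (evalF (T (lop_tgt o)))) (lop_om o n)
      ∘ aunit (opadj (trev_adj T (lop_tgt o))) (lop_Psi o n))
    ∘ aunit (lop_adj o) n
  = lop_th o (opf (ihactF H (lop_src o)) n) ∘ aunit (opadj (trev_adj T (lop_src o))) n.
Proof.
case: o => [x x' f|d x] /=.
  rewrite comp1m; exact: ihact_pre_counit.
have si := ihact_shift_iso H (rdp d) x n.
rewrite hinv_modnat // [hinv (mass _ _ n ∘ _)](hstr_ihact (d ▷ x) n d^v^v (T x)).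
apply: (@iso_cancel _ _ _ _ _ (idm d^v^v ▶ ihact_shift H (rdp d) x n (T x))).
  by apply: is_iso_actm; [exact: is_iso_id|exact: modnat_isoP].
have := twist_counit n (twP d x).
rewrite !compA => ->.
by rewrite -!compA -actMr -!compA hinvK ?compm1 //; exact: modnat_isoP.
Qed.

(** Double left duals undo double right duals; so linearity with respect to all c^∨∨ is linearity
    with respect to all of D. *)
Lemma rdual2_surj d : exists c (g : hom c^v^v d), is_iso g.
Proof.
pose c := ldual (ldual d); exists c.
have i1 := rdualm_iso (pair_iso (ldp (ldual d))); have i2 := pair_iso (ldp d).
by exists (hinv (rcurry (dp_ev (ldp d))) ∘ rdualm (rcurry (dp_ev (ldp (ldual d))))); apply: is_iso_comp => //; apply: is_iso_hinv.
Qed.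

Record nakfaml K := NakFaml {
  nfl_str :> forall x, @nakstr k (opc M) x (K (T x));
  nfl_nat : forall x x' (f : hom x x') n (p : {scalar @hom k M n x'}) (q : {scalar @hom k M n x}),
    (forall v, q v = p (f ∘ v)) ->
    @comp k M _ _ _ (ns_in (nfl_str x') p) (fmor K (fmor T f)) = ns_in (nfl_str x) q;
  nfl_act : forall d x tw, is_twist (T := T) tw ->
    forall n (p : {scalar @hom k M n (d ▷ x)}) (q : {scalar @hom k M (d^v ▷ n) x}),
    (forall v, q v = p ((idm d ▶ v) ∘ acoev (rdp d) n)) ->
    @comp k M _ _ _ (ns_in (nfl_str (d ▷ x)) p) (fmor K tw)
    = aev (rdp d^v) n ∘ (idm d^v^v ▶ (ns_in (nfl_str x) q : @hom k M _ _)) ∘ mf_str K d^v^v (T x) }.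

Lemma ltransp_act d x n (v : @hom k M (d^v ▷ n) x) :
  transp (V' := fun x => opf (evalF x)) (fun x => opadj (ihact_adj H x)) lop_om
    (o := OpAct d x) (one := dual_one M) v = ((idm d ▶ v) ∘ acoev (rdp d) n : @hom k M _ _).
Proof.
pose L : modnat (ihact H x (d^v ▷ n)) (modfun_id M) := adjl (ihact_adj H x) (v : hom _ (evalF x (dual_one M))).
have si := ihact_shift_iso H (rdp d) x n.
pose h : modnat _ _ := @hinv k E _ _ (ihact_shift H (rdp d) x n).
pose Z : modnat (ihact H (d ▷ x) n) (modfun_id M) := modnat_comp L h.
have -> : transp (V' := fun x => opf (evalF x)) (fun x => opadj (ihact_adj H x)) lop_om
    (o := OpAct d x) (one := dual_one M) v = Z (d ▷ x) ∘ ihact_unit H (d ▷ x) n by [].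
have -> : Z (d ▷ x) = (idm d ▶ Z x) ∘ mf_str (ihact H (d ▷ x) n) d x.
  by rewrite -(mn_mod Z) comp1m.
rewrite -compA -(ihact_shift_unit H (rdp d)) compA -actMr; congr ((_ ▶ _) ∘ _).
have -> : Z x = L x ∘ hinv (mn_fun (ihact_shift H (rdp d) x n) x) by rewrite -hinv_modnat.
have hL : L x ∘ ihact_unit H x (d^v ▷ n) = v := adjlK (ihact_adj H x) (v : hom _ (evalF x (dual_one M))).
move: (modnat_isoP x si); move: (mn_fun (ihact_shift H (rdp d) x n) x) => sh shi.
by rewrite compA -(compA (mn_fun L x)) hinvK // compm1 hL.
Qed.

Lemma ltransp_nat x x' (f : hom x x') n (v : @hom k M n x) :
  transp (V' := fun x => opf (evalF x)) (fun x => opadj (ihact_adj H x)) lop_om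
    (o := OpNat f) (one := dual_one M) v = (f ∘ v : @hom k M _ _).
Proof.
pose L : modnat (ihact H x n) (modfun_id M) := adjl (ihact_adj H x) (v : hom _ (evalF x (dual_one M))).
have e : transp (V' := fun x => opf (evalF x)) (fun x => opadj (ihact_adj H x)) lop_om
    (o := OpNat f) (one := dual_one M) v = L x' ∘ ihact_pre T f n x' ∘ ihact_unit H x' n by [].
rewrite e -compA.
have := op_om_unit T (OpNat f) n; rewrite /= compm1 => ->.
have e2 : L x' ∘ (ipost H x f ▶ idm n) = f ∘ L x := mn_nat L f.
rewrite compA e2 -compA; congr (_ ∘ _).
exact: (adjlK (ihact_adj H x) (v : hom _ (evalF x (dual_one M)))).
Qed.

Lemma iso_rot (X : lincat k) (u v w z : X) (f : hom u v) (a : hom w z) (b : hom u w) (c : hom v z) :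
  is_iso f -> a ∘ (b ∘ hinv f) = c -> a ∘ b = c ∘ f.
Proof. by move=> fi <-; rewrite -!compA hinvK // compm1. Qed.

Hypothesis Tsurj : ess_surjective T.

Definition nakfaml_of (N : nakl (dual_one M)) : nakfaml (N : E).
Proof.
pose NE := nakr_op N.
pose a x := opadj (ihact_adj H x).
pose W x := mate_nakr (opadj (trev_adj T x)) (opadj (ihact_adj H (T x))) NE (@adjlK _ _ _ _ _ (a x) (dual_one M))
  (@adjrK _ _ _ _ _ (a x) (dual_one M)) (@adjlP _ _ _ _ _ (a x) (dual_one M))
  (fun y z f w => adjl_natr (a x) w f).
have key o := mate_in_compat (b := fun x => opadj (trev_adj T x)) (V := fun x => opf (evalF (T x))) lop_th_nat lop_om_unit (o := o) (V' := fun x => opf (evalF x)) (a := a) (one := dual_one M) NE.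
refine (@NakFaml (N : E) (fun x => nakstr_of (W x)) _ _).
- move=> x x' f n p q h.
  have e := key (OpNat f) n p q (fun v => etrans (h v) (congr1 (fun u => p u) (esym (ltransp_nat f v)))).
  exact: (etrans e (@compm1 k (opc M) _ _ _)).
- move=> d x t ht n p q h.
  have -> : t = tw d x by apply: (bij_inj (twist_bij T d x _ _)); rewrite /= ht (twP d x).
  have e := key (OpAct d x) n p q (fun v => etrans (h v) (congr1 (fun u => p u) (esym (ltransp_act v)))).
  pose Nf : modfun M := nl_obj N.
  refine (@iso_rot M (Nf (d^v^v ▷ T x)) (d^v^v ▷ Nf (T x)) (Nf (T (d ▷ x))) n (mf_str Nf d^v^v (T x)) (ns_in (nakstr_of (W (d ▷ x))) p) (fmor Nf (tw d x)) (aev (rdp d^v) n ∘ (idm d^v^v ▶ (ns_in (nakstr_of (W x)) q : @hom k M _ _))) (mf_iso Nf d^v^v (T x)) _).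
  exact: e.
Defined.

Hypothesis Tfull : forall x y (g : hom (T x) (T y)), exists f, fmor T f = g.

(** The family is given only at objects T x and is linear only for double duals. Essential
    surjectivity and fullness of T extend it to all of M, and then linearity spreads in two
    steps. *)
Lemma lop_descent G K (h : forall x, hom (K (T x)) (G (T x))) :
  (forall o, @comp k (opc M) _ _ _ (lop_th o K) (h (lop_src o)) = @comp k (opc M) _ _ _ (fmor (lop_Phi o) (h (lop_tgt o))) (lop_th o G)) ->
  exists s : modnat K G, forall x, s (T x) = h x.
Proof.
move=> e.
have e1 x x' (g : hom (T x) (T x')) : h x' ∘ fmor K g = fmor G g ∘ h x.
  by have [f <-] := Tfull g; have /= := e (OpNat f).
pose y x := sval (cid (Tsurj x)).
pose f x : hom (T (y x)) x := sval (cid (svalP (cid (Tsurj x)))).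
have fi x : is_iso (f x) := svalP (cid (svalP (cid (Tsurj x)))).
pose s x := fmor G (f x) ∘ h (y x) ∘ fmor K (hinv (f x)).
have sE x x' (g : hom (T x) x') : s x' ∘ fmor K g = fmor G g ∘ h x.
  rewrite /s -compA -fmorM -compA e1 compA -fmorM compA hinvV //.
  by rewrite comp1m.
have sT x : s (T x) = h x by have := sE x _ (idm _); rewrite !fmor1 compm1 comp1m.
have s1 m n (g : hom m n) : s n ∘ fmor K g = fmor G g ∘ s m.
  apply: (iso_cancel (fmor_iso K (fi m))).
  by rewrite -compA -fmorM sE fmorM -(compA _ (s m)) sE compA.
clearbody s.
(* Linearity for d^∨∨ at objects T x, where the twist replaces T (d ▷ x) by d^∨∨ ▷ T x. [s4] passes
   to all objects of M, [s2] to all objects of D. *)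
have s3 d x : mf_str G d^v^v (T x) ∘ s (d^v^v ▷ T x) = (idm _ ▶ s (T x)) ∘ mf_str K d^v^v (T x).
  have e3 : h (d ▷ x) ∘ (fmor K (tw d x) ∘ hinv (mf_str K d^v^v (T x)))
      = fmor G (tw d x) ∘ hinv (mf_str G d^v^v (T x)) ∘ (idm d^v^v ▶ h x) by exact: (e (OpAct d x)).
  apply: (iso_cancel (is_iso_hinv (mf_iso K d^v^v (T x)))).
  rewrite -[RHS]compA hinvV ?compm1; last exact: mf_iso.
  apply: (iso_cancell (is_iso_hinv (mf_iso G d^v^v (T x)))).
  rewrite !compA hinvK ?comp1m; last exact: mf_iso.
  apply: (iso_cancell (fmor_iso G (twist_iso (twP d x)))).
  by rewrite !compA -s1 !sT -compA e3.
have s4 d z : mf_str G d^v^v z ∘ s (d^v^v ▷ z) = (idm _ ▶ s z) ∘ mf_str K d^v^v z.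
  have i1 : is_iso (idm d^v^v ▶ f z) by apply: is_iso_actm; [exact: is_iso_id|].
  apply: (iso_cancel (fmor_iso K i1)); rewrite -compA s1 compA mf_nat -compA s3.
  by rewrite -[in RHS]compA mf_nat !compA -!actMr s1.
have s2 d z : mf_str G d z ∘ s (d ▷ z) = (idm _ ▶ s z) ∘ mf_str K d z.
  have [c [g gi]] := rdual2_surj d.
  have i1 : is_iso (g ▶ idm z) by apply: is_iso_actm; [|exact: is_iso_id].
  apply: (iso_cancel (fmor_iso K i1)); rewrite -compA s1 compA mf_nat -compA fmor1 s4.
  by rewrite -[in RHS]compA mf_nat fmor1 !compA -acti acti'.
by exists (ModNat s1 s2).
Qed.

Definition nakstrl_of_fam (W : nakfaml (modfun_id M)) : @nakstr k (opc E) (dual_one M) (dual_one M).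
Proof.
have Wc : forall o n (f : {scalar @hom k (opc M) (lop_src o) n}) (g : {scalar @hom k (opc M) (lop_tgt o) (lop_Psi o n)}),
    (forall v, g v = f (transp (V' := fun x => opf (evalF x)) (fun x => opadj (ihact_adj H x)) lop_om (one := dual_one M) v)) ->
    lop_th o (dual_one M) ∘ ns_in (W (lop_src o)) f = fmor (lop_Phi o) (ns_in (W (lop_tgt o)) g) ∘ aunit (lop_adj o) n.
  case=> [x x' f|d x] n p q h.
    rewrite /= comp1m; apply: (nfl_nat W (f := f)) => v; by rewrite h ltransp_nat.
  have := nfl_act W (twP d x) (p := p) (q := q).
  by rewrite /= compm1 hinv1 compm1; apply=> v; rewrite h ltransp_act.
apply: (@descent_nakr _ _ _ _ (fun x => opf (evalF x)) _ _ (fun x => opadj (ihact_adj H x)) (fun x => opadj (trev_adj T x)) _ _ _ _ _ _ _ _ lop_th_nat lop_om_unit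
  (dual_one M) (dual_one M) (fun x => W x) Wc).
- move=> A B f g e; apply: modnatP => x.
  have [y [u ui]] := Tsurj x.
  apply: (iso_cancel (fmor_iso (B : modfun M) ui)); rewrite !mn_nat; congr (_ ∘ _); exact: e.
- by move=> A B h e; have [s hs] := lop_descent e; exists s.
Defined.

End TraceNakayamaLeft.

(** * Tensor functors and their adjoints *)

Section TensorFunctor.
Variables (k : fieldType) (C D : ftcat k) (F : tfunctor C D).
Implicit Types (c d e x y : C).
Local Notation mul := (tf_mul F).
Local Notation mul' c d := (hinv (tf_mul F c d)).
Local Notation one := (tf_one F).
Local Notation one' := (hinv (tf_one F)).

Lemma hmul_nat c c' d d' (f : hom c c') (g : hom d d') :
  mul' c' d' ∘ fmor F (f ⊠ g) = (fmor F f ⊠ fmor F g) ∘ mul' c d.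
Proof. by apply: hinv_nat; [exact: tf_mul_iso..|exact: tf_mul_nat]. Qed.

Lemma tf_runit' c : runit (F c) ∘ (idm (F c) ⊠ one') ∘ mul' c (unitc C) = fmor F (runit c).
Proof.
have i1 := tf_one_iso F; have i2 := tf_mul_iso F c (unitc C).
rewrite -(tf_runit F c) -!compA (compA (idm _ ⊠ one)) -tensMr hinvV // tensm1 comp1m.
by rewrite hinvV // compm1.
Qed.

Lemma tf_lunit' c : lunit (F c) ∘ (one' ⊠ idm (F c)) ∘ mul' (unitc C) c = fmor F (lunit c).
Proof.
have i1 := tf_one_iso F; have i2 := tf_mul_iso F (unitc C) c.
rewrite -(tf_lunit F c) -!compA (compA (one ⊠ idm _)) -tensMl hinvV // tensm1 comp1m.
by rewrite hinvV // compm1.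
Qed.

Lemma tf_assoc1 c d e : (idm (F c) ⊠ mul d e) ∘ assoc _ _ _ ∘ (mul' c d ⊠ idm (F e))
  = mul' c (d ⊗ e) ∘ fmor F (assoc c d e) ∘ mul (c ⊗ d) e.
Proof.
have i1 := tf_mul_iso F c d; have i2 := tf_mul_iso F c (d ⊗ e).
apply: (iso_cancell i2); rewrite !compA hinvV // comp1m tf_assoc -compA -tensMl hinvV //.
by rewrite tensm1 compm1.
Qed.

Lemma tf_assoc2 c d e : (mul c d ⊠ idm (F e)) ∘ hinv (assoc _ _ _) ∘ (idm (F c) ⊠ mul' d e)
  = mul' (c ⊗ d) e ∘ fmor F (hinv (assoc c d e)) ∘ mul c (d ⊗ e).
Proof.
have i1 := tf_mul_iso F d e; have i2 := tf_mul_iso F (c ⊗ d) e.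
have ai := assoc_iso c d e; have ai' := assoc_iso (F c) (F d) (F e).
apply: (iso_cancell i2); rewrite !compA hinvV // comp1m.
apply: (iso_cancell (fmor_iso F ai)).
rewrite !compA -fmorM hinvV // fmor1 comp1m -tf_assoc -!compA (compA (assoc _ _ _)) hinvV // comp1m.
by rewrite -tensMr hinvV // tensm1 compm1.
Qed.

Section Pair.
Variables (c c' : C) (dp : dualpair c c').

Definition tf_pair : dualpair (F c) (F c').
Proof.
refine (@DualPair k D (F c) (F c') (one' ∘ fmor F (dp_ev dp) ∘ mul c' c)
  (mul' c c' ∘ fmor F (dp_coev dp) ∘ one) _ _).
- have i1 := tf_one_iso F.
  rewrite !tensMr !tensMl !compA (cl3 _ (tf_assoc1 c c' c)) !compA.
  rewrite -(fmor1 F c) (cl _ (esym (hmul_nat _ _))) (cl _ (tf_mul_nat F _ _)) !compA fmor1 tf_runit'.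
  by rewrite -!fmorM dp_zig tf_lunit.
- rewrite !tensMr !tensMl !compA (cl3 _ (tf_assoc2 c' c c')) !compA.
  rewrite -(fmor1 F c') (cl _ (esym (hmul_nat _ _))) (cl _ (tf_mul_nat F _ _)) !compA fmor1 tf_lunit'.
  by rewrite -!fmorM dp_zag tf_runit.
Defined.

Lemma tf_tev x : fmor F (tev dp x) ∘ mul c' (c ⊗ x) = tev tf_pair (F x) ∘ (idm _ ⊠ mul' c x).
Proof.
rewrite /tev -!lock /= !fmorM !tensMl -!compA.
have i1 := tf_mul_iso F c' c.
have -> : hinv (assoc (F c') (F c) (F x)) ∘ (idm (F c') ⊠ mul' c x)
   = (mul' c' c ⊠ idm _) ∘ mul' _ _ ∘ fmor F (hinv (assoc c' c x)) ∘ mul c' (c ⊗ x).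
  by rewrite -(compA (_ ⊠ _)) -(compA (_ ⊠ _)) -tf_assoc2 !compA -tensMl hinvK // tensm1 comp1m.
rewrite !compA (cl _ (esym (tensMl _ _ _))) hinvV // tensm1 compm1.
by rewrite -(fmor1 F x) (cl _ (esym (hmul_nat _ _))) !compA fmor1 tf_lunit'.
Qed.

Lemma tf_rtev x : fmor F (rtev dp x) ∘ mul (x ⊗ c') c = rtev tf_pair (F x) ∘ (mul' x c' ⊠ idm _).
Proof.
rewrite /rtev -!lock /= !fmorM !tensMr -!compA.
have i1 := tf_mul_iso F c' c.
rewrite (compA (idm _ ⊠ mul _ _)) tf_assoc1.
by rewrite -(fmor1 F x) !compA (cl _ (esym (hmul_nat _ _))) !compA fmor1 tf_runit'.
Qed.
End Pair.

Lemma tf_rdualP c : rev (F c) ∘ (tf_rdual F c ⊠ idm (F c)) = dp_ev (tf_pair (rdp c)).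
Proof. exact: rcurryK. Qed.

Lemma tf_rdual_iso c : is_iso (tf_rdual F c).
Proof. exact: (pair_iso (tf_pair (rdp c))). Qed.

(** The comparison of F with double duals. In terms of it, pivotality of F reads
    [pD (F c) = tf_rdual2 c ∘ fmor F (pC c)]. *)
Definition tf_rdual2 c : hom (F c^v^v) (F c)^v^v := hinv (rdualm (tf_rdual F c)) ∘ tf_rdual F c^v.

Lemma tf_rdual2P c : rev (F c)^v ∘ (tf_rdual2 c ⊠ tf_rdual F c) = dp_ev (tf_pair (rdp c^v)).
Proof.
have zi := rdualm_iso (tf_rdual_iso c).
rewrite tensi' compA -rdualmP -compA -tensMl /tf_rdual2 compA hinvV // comp1m.
exact: tf_rdualP.
Qed.

Section RightAdjoint.
Variables (R : functor D C) (aR : adjunction F R).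
Implicit Types (a b : D).

Lemma adjl_ra_l_inv c a : adjl aR (ra_l_inv aR c a) = (idm (F c) ⊠ acounit aR a) ∘ mul' c (R a).
Proof. exact: (adjrK aR). Qed.

Lemma ra_l_inv_nat c a b (f : hom a b) :
  ra_l_inv aR c b ∘ (idm c ⊠ fmor R f) = fmor R (idm (F c) ⊠ f) ∘ ra_l_inv aR c a.
Proof.
apply: (adjl_inj (a := aR)); rewrite adjl_natr adjl_natl !adjl_ra_l_inv -compA hmul_nat fmor1 !compA.
by rewrite -!tensMr acounit_nat.
Qed.

Lemma ra_r_inv_nat c a b (f : hom a b) :
  ra_r_inv aR b c ∘ (fmor R f ⊠ idm c) = fmor R (f ⊠ idm (F c)) ∘ ra_r_inv aR a c.
Proof.
apply: (adjl_inj (a := aR)); rewrite adjl_natr adjl_natl !(adjrK aR) -compA hmul_nat fmor1 !compA.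
by rewrite -!tensMl acounit_nat.
Qed.

(** Yoneda: Hom(x, c ⊗ R a) = Hom(F(c^∨ ⊗ x), a) = Hom(F(c^∨) ⊗ F x, a) = Hom(F x, F c ⊗ a). The
    right-hand version uses the left dual of c. *)
Lemma ra_l_inv_iso c a : is_iso (ra_l_inv aR c a).
Proof.
apply: iso_yoneda => x.
pose A (g : hom x (c ⊗ R a)) := adjl aR (tev (rdp c) (R a) ∘ (idm _ ⊠ g)) ∘ mul c^v x.
have bA : bij A.
  apply: (bij_comp (iso_bijr a (tf_mul_iso F c^v x))).
  exact: (bij_comp (adjl_bij aR _ _) (ltens_bij (rdp c) x (R a))).
have key g : A g = tev (tf_pair (rdp c)) a ∘ (idm _ ⊠ adjl aR (ra_l_inv aR c a ∘ g)).
  rewrite /A adjl_natl /adjl fmorM -!compA -tf_mul_nat (compA (fmor F (tev _ _))) tf_tev fmor1.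
  rewrite !compA tev_nat -!compA -!tensMr; congr (_ ∘ (_ ⊠ _)).
  by rewrite [in RHS]compA -/(adjl aR _) adjl_ra_l_inv !compA.
have b2 := bij_comp (ltens_bij (tf_pair (rdp c)) (F x) a) (adjl_bij aR x (F c ⊗ a)).
apply: bijI => [g g' /= e|f]; first by apply: (bij_inj bA); rewrite !key e.
have [g hg] := bij_surj (tev (tf_pair (rdp c)) a ∘ (idm _ ⊠ adjl aR f)) bA.
by exists g; apply: (bij_inj b2); rewrite /= -key.
Qed.

Lemma ra_r_inv_iso c a : is_iso (ra_r_inv aR a c).
Proof.
apply: iso_yoneda => x.
pose A (g : hom x (R a ⊗ c)) := adjl aR (rtev (ldp c) (R a) ∘ (g ⊠ idm _)) ∘ mul x (ldual c).
have bA : bij A.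
  apply: (bij_comp (iso_bijr a (tf_mul_iso F x (ldual c)))).
  exact: (bij_comp (adjl_bij aR _ _) (rtens_bij (ldp c) x (R a))).
have key g : A g = rtev (tf_pair (ldp c)) a ∘ (adjl aR (ra_r_inv aR a c ∘ g) ⊠ idm _).
  rewrite /A adjl_natl /adjl fmorM -!compA -tf_mul_nat (compA (fmor F (rtev _ _))) tf_rtev fmor1.
  rewrite !compA rtev_nat -!compA -!tensMl; congr (_ ∘ (_ ⊠ _)).
  by rewrite [in RHS]compA -/(adjl aR _) (adjrK aR) !compA.
have b2 := bij_comp (rtens_bij (tf_pair (ldp c)) (F x) a) (adjl_bij aR x (a ⊗ F c)).
apply: bijI => [g g' /= e|f]; first by apply: (bij_inj bA); rewrite !key e.
have [g hg] := bij_surj (rtev (tf_pair (ldp c)) a ∘ (adjl aR f ⊠ idm _)) bA.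
by exists g; apply: (bij_inj b2); rewrite /= -key.
Qed.

Lemma ra_l_unit c d : fmor R (mul' c d) ∘ aunit aR (c ⊗ d) = ra_l_inv aR c (F d) ∘ (idm c ⊠ aunit aR d).
Proof.
apply: (adjl_inj (a := aR)); rewrite adjl_natr adjl_natl adjl_ra_l_inv adjl_unit compm1.
by rewrite -compA hmul_nat compA fmor1 -tensMr adj_triL tensm1 comp1m.
Qed.

Lemma ra_r_unit c d : fmor R (mul' d c) ∘ aunit aR (d ⊗ c) = ra_r_inv aR (F d) c ∘ (aunit aR d ⊠ idm c).
Proof.
apply: (adjl_inj (a := aR)); rewrite adjl_natr adjl_natl (adjrK aR) adjl_unit compm1.
by rewrite -compA hmul_nat compA fmor1 -tensMl adj_triL tensm1 comp1m.
Qed.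

Lemma ra_l_inv_one a : fmor R (lunit a ∘ (one' ⊠ idm a)) ∘ ra_l_inv aR (unitc C) a = lunit (R a).
Proof.
apply: (adjl_inj (a := aR)); rewrite adjl_natr adjl_ra_l_inv.
rewrite !compA -(compA (lunit a)) -tensi tensi' !compA lunit_nat -!compA (compA (lunit _)) tf_lunit'.
by [].
Qed.

Lemma ra_l_inv_assoc c d a :
  fmor R ((mul c d ⊠ idm a) ∘ hinv (assoc _ _ _)) ∘ ra_l_inv aR c (F d ⊗ a) ∘ (idm c ⊠ ra_l_inv aR d a)
  = ra_l_inv aR (c ⊗ d) a ∘ hinv (assoc c d (R a)).
Proof.
have hr := adjl_ra_l_inv; move: (ra_l_inv aR) hr => r hr; apply: (adjl_inj (a := aR)); rewrite -!compA adjl_natr !adjl_natl !hr.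
rewrite -!compA hmul_nat fmor1 (compA (idm _ ⊠ acounit _ _)) -tensMr -/(adjl aR (r d a)).
rewrite hr tensMr -!compA (compA (hinv (assoc _ _ _))) hassoc_nat -!compA.
rewrite (tensm1 (F c)) (compA (mul c d ⊠ _)) -tensi tensi' -!compA; congr (_ ∘ _).
have i := tf_mul_iso F c (d ⊗ R a).
by rewrite !compA tf_assoc2 -!compA hinvV // compm1.
Qed.

Lemma ra_l_tev c a :
  fmor R (tev (tf_pair (rdp c)) a) ∘ ra_l_inv aR c^v (F c ⊗ a) ∘ (idm _ ⊠ ra_l_inv aR c a)
  = tev (rdp c) (R a).
Proof.
have hr := adjl_ra_l_inv; move: (ra_l_inv aR) hr => r hr; apply: (adjl_inj (a := aR)); rewrite -compA adjl_natr !adjl_natl !hr.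
rewrite -!compA hmul_nat fmor1 (compA (idm _ ⊠ acounit _ _)) -tensMr -/(adjl aR (r c a)).
rewrite hr tensMr -!compA (compA (tev _ _)) -tev_nat -!compA (compA (tev _ _)) -tf_tev.
have i := tf_mul_iso F c^v (c ⊗ R a).
by rewrite -!compA hinvV // compm1.
Qed.

End RightAdjoint.
End TensorFunctor.

Section RightRightAdjoint.
Variables (k : fieldType) (C D : ftcat k) (F : tfunctor C D).
Variables (R : functor D C) (aR : adjunction F R) (RR : functor C D) (aRR : adjunction R RR).
Implicit Types (c d x y : C) (a b : D).
Local Notation mul' c d := (hinv (tf_mul F c d)).

Lemma ra_l_nat c a b (f : hom a b) :
  ra_l aR c b ∘ fmor R (idm (F c) ⊠ f) = (idm c ⊠ fmor R f) ∘ ra_l aR c a.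
Proof. by apply: hinv_nat; [exact: ra_l_inv_iso..|exact: ra_l_inv_nat]. Qed.

Lemma ra_r_nat c a b (f : hom a b) :
  ra_r aR b c ∘ fmor R (f ⊠ idm (F c)) = (fmor R f ⊠ idm c) ∘ ra_r aR a c.
Proof. by apply: hinv_nat; [exact: ra_r_inv_iso..|exact: ra_r_inv_nat]. Qed.

Lemma adjl_rra_l_inv c d : adjl aRR (rra_l_inv aR aRR c d) = (idm c ⊠ acounit aRR d) ∘ ra_l aR c (RR d).
Proof. exact: (adjrK aRR). Qed.

Lemma adjl_rra_r_inv c d : adjl aRR (rra_r_inv aR aRR d c) = (acounit aRR d ⊠ idm c) ∘ ra_r aR (RR d) c.
Proof. exact: (adjrK aRR). Qed.

(** The same Yoneda argument one adjoint further, with the linearity of R in place of the tensor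
    structure of F. *)
Lemma rra_l_inv_iso c d : is_iso (rra_l_inv aR aRR c d).
Proof.
apply: iso_yoneda => a.
pose A (g : hom a (F c ⊗ RR d)) := adjl aRR (tev (tf_pair F (rdp c)) (RR d) ∘ (idm _ ⊠ g)) ∘ ra_l_inv aR c^v a.
have bA : bij A.
  apply: (bij_comp (iso_bijr d (ra_l_inv_iso aR c^v a))).
  exact: (bij_comp (adjl_bij aRR _ _) (ltens_bij (tf_pair F (rdp c)) a (RR d))).
have key g : A g = tev (rdp c) d ∘ (idm _ ⊠ adjl aRR (rra_l_inv aR aRR c d ∘ g)).
  rewrite /A [in RHS]adjl_natl adjl_rra_l_inv /adjl fmorM.
  have := ra_l_inv_nat aR c^v g; have := ra_l_tev aR c (RR d).
  have := hinvV (ra_l_inv_iso aR c (RR d)); rewrite /ra_l.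
  move: (ra_l_inv aR c (RR d)) (ra_l_inv aR c^v) => r r' hr e1 e2.
  rewrite -!compA -e2 -(comp1m (fmor R g)) -{1}hr -(compA r) tensMr !compA.
  rewrite -!(compA (acounit _ _)) e1 !compA tev_nat -!compA -!tensMr.
  by rewrite comp1m.
have b2 := bij_comp (ltens_bij (rdp c) (R a) d) (adjl_bij aRR a (c ⊗ d)).
apply: bijI => [g g' /= e|f]; first by apply: (bij_inj bA); rewrite !key e.
have [g hg] := bij_surj (tev (rdp c) d ∘ (idm _ ⊠ adjl aRR f)) bA.
by exists g; apply: (bij_inj b2); rewrite /= -key.
Qed.

Variable t : hom (unitc D) (chi RR).
Hypothesis tP : chi_trivialization aR aRR t.

(* F c -> RR c, from F c ⊗ 1 -> F c ⊗ chi = RR (c ⊗ 1). *)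
Definition frob_iota c : hom (F c) (RR c) :=
  locked (fmor RR (runit c) ∘ rra_l_inv aR aRR c (unitc C) ∘ (idm (F c) ⊠ t) ∘ hinv (runit (F c))).

Lemma frob_iotaE c : frob_iota c = fmor RR (runit c) ∘ rra_l_inv aR aRR c (unitc C) ∘ (idm (F c) ⊠ t) ∘ hinv (runit (F c)).
Proof. by rewrite /frob_iota -lock. Qed.

(** Here the triviality of the half-braiding enters: [frob_iota], defined through the left module
    structure of RR, has the same formula through the right one. *)
Lemma frob_iotaEr c : frob_iota c = fmor RR (lunit c) ∘ rra_r_inv aR aRR (unitc C) c ∘ (t ⊠ idm (F c)) ∘ hinv (lunit (F c)).
Proof.
have i2 := runit_iso c; have [_ /(_ c)] := tP; rewrite frob_iotaE /half_braiding.
move: (rra_l_inv aR aRR c _) (rra_l_inv_iso c (unitc C)) (rra_r_inv _ _ _ _) => r i1 r' h.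
rewrite -!compA -h.
rewrite !compA -(compA (fmor RR _)) hinvV // compm1 -fmorM compA hinvV // comp1m.
by [].
Qed.

Lemma frob_iota_iso c : is_iso (frob_iota c).
Proof.
have [ti _] := tP; rewrite frob_iotaE.
apply: is_iso_comp; last by apply: is_iso_hinv; exact: runit_iso.
apply: is_iso_comp; last by apply: tens_iso => //; exact: is_iso_id.
by apply: is_iso_comp; [apply: fmor_iso; exact: runit_iso|exact: rra_l_inv_iso].
Qed.

(** A second counit R (F c) -> c, available because [frob_iota] identifies F with RR. Under R (F c)
    = c ⊗ R 1 it is [frob_theta] on the second factor, the Frobenius form of the algebra R 1. *)
Definition frob_mate c : hom (R (F c)) c := locked (adjl aRR (frob_iota c)).
Definition frob_theta : hom (R (unitc D)) (unitc C) := locked (adjl aRR t).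

Lemma frob_mateE c : frob_mate c = acounit aRR c ∘ fmor R (frob_iota c).
Proof. by rewrite /frob_mate -lock. Qed.

Lemma frob_mate_l c : frob_mate c = runit c ∘ (idm c ⊠ frob_theta) ∘ ra_l aR c (unitc D) ∘ fmor R (hinv (runit (F c))).
Proof.
have := adjl_rra_l_inv c (unitc C); have : ra_l aR c (RR (unitc C)) ∘ fmor R (idm (F c) ⊠ t) = _ := ra_l_nat c t.
rewrite frob_mateE frob_iotaE /frob_theta -lock /adjl.
move: (rra_l_inv aR aRR c _) (ra_l aR c (RR _)) (ra_l aR c (unitc D)) => r r1 r2 e1 e2.
rewrite !fmorM tensMr.
by rewrite !compA -acounit_nat -!compA (compA (acounit _ _)) e2 -!compA (compA r1) e1 !compA.
Qed.

Lemma frob_mate_r c : frob_mate c = lunit c ∘ (frob_theta ⊠ idm c) ∘ ra_r aR (unitc D) c ∘ fmor R (hinv (lunit (F c))).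
Proof.
have := adjl_rra_r_inv c (unitc C); have : ra_r aR (RR (unitc C)) c ∘ fmor R (t ⊠ idm (F c)) = _ := ra_r_nat c t.
rewrite frob_mateE frob_iotaEr /frob_theta -lock /adjl.
move: (rra_r_inv aR aRR _ c) (ra_r aR (RR _) c) (ra_r aR (unitc D) c) => r r1 r2 e1 e2.
rewrite !fmorM tensMl.
by rewrite !compA -acounit_nat -!compA (compA (acounit _ _)) e2 -!compA (compA r1) e1 !compA.
Qed.

Lemma frob_mate_nat c d (f : hom c d) : frob_mate d ∘ fmor R (fmor F f) = f ∘ frob_mate c.
Proof.
have e : ra_l aR d (unitc D) ∘ fmor R (fmor F f ⊠ idm _) = (f ⊠ idm _) ∘ ra_l aR c (unitc D).
  apply: hinv_nat; [exact: ra_l_inv_iso..|].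
  apply: (adjl_inj (a := aR)); rewrite adjl_natr adjl_natl !adjl_ra_l_inv.
  by rewrite -compA hmul_nat fmor1 !compA -tensi' -tensi.
have := hrunit_nat (fmor F f); rewrite !frob_mate_l.
move: (ra_l aR c _) (ra_l aR d _) e => r r' e e2.
rewrite -!compA -fmorM e2 fmorM (compA r') e !compA; congr (_ ∘ _ ∘ _).
by rewrite -compA -tensi' tensi compA runit_nat -compA.
Qed.

(** Left linearity, read off [frob_mate_l]: both sides apply [frob_theta] to the last factor of (c ⊗
    d) ⊗ R 1, and [ra_l_inv_assoc] compares the bracketings. *)
Lemma frob_mate_mul c d : frob_mate (c ⊗ d) ∘ fmor R (tf_mul F c d) = (idm c ⊠ frob_mate d) ∘ ra_l aR c (F d).
Proof.
have i1 := ra_l_inv_iso aR c (F d); have i2 : is_iso (idm c ⊠ ra_l_inv aR d (unitc D)).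
  by apply: tens_iso; [exact: is_iso_id|exact: ra_l_inv_iso].
apply: (iso_cancel i1); rewrite -[RHS]compA /ra_l hinvK // compm1.
have i3 : is_iso (idm c ⊠ fmor R (runit (F d))).
  by apply: tens_iso; [exact: is_iso_id|apply: fmor_iso; exact: runit_iso].
apply: (iso_cancel i3); apply: (iso_cancel i2).
rewrite -(compA (idm c ⊠ frob_mate d)) -tensMr -tensMr (frob_mate_l d).
have -> : runit d ∘ (idm d ⊠ frob_theta) ∘ ra_l aR d (unitc D) ∘ fmor R (hinv (runit (F d))) ∘ (fmor R (runit (F d)) ∘ ra_l_inv aR d (unitc D)) = runit d ∘ (idm d ⊠ frob_theta).
  have j1 := ra_l_inv_iso aR d (unitc D); have j2 := runit_iso (F d).
  rewrite /ra_l; move: (ra_l_inv aR d _) j1 => r j1.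
  by rewrite !compA -(compA _ (fmor R _) (fmor R _)) -fmorM hinvK // fmor1 compm1 -compA hinvK // compm1.
have n1 := ra_l_inv_nat aR c (runit (F d)); have a1 := ra_l_inv_assoc aR c d (unitc D).
have j := ra_l_inv_iso aR (c ⊗ d) (unitc D); have ji := assoc_iso (F c) (F d) (unitc D).
have ai := assoc_iso c d (R (unitc D)); have ai' := assoc_iso c d (unitc C).
have e1 : tf_mul F c d ∘ (idm (F c) ⊠ runit (F d))
   = runit (F (c ⊗ d)) ∘ ((tf_mul F c d ⊠ idm _) ∘ hinv (assoc _ _ _)).
  rewrite compA runit_nat -runit_tens -!compA hinvV ?compm1 //.
rewrite (frob_mate_l (c ⊗ d)) /ra_l.
move: (ra_l_inv aR (c ⊗ d) _) (ra_l_inv aR d _) (ra_l_inv aR c) j a1 n1 => r1 r2 r3 j a1 n1.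
rewrite -!compA (compA (r3 _)) n1 -!compA (compA (fmor R (tf_mul F c d))) -fmorM e1.
rewrite fmorM -!compA (compA (fmor R (_ ∘ _))) a1 (compA (fmor R (hinv _))) -fmorM hinvK ?fmor1 ?comp1m; last exact: runit_iso.
rewrite (compA (hinv _)) hinvK // comp1m -runit_tens !tensMr -(tensm1 c d) -!compA; congr (_ ∘ _).
by rewrite compA assoc_nat -compA hinvV // compm1.
Qed.

Lemma frob_mate_one : frob_mate (unitc C) ∘ fmor R (tf_one F) = frob_theta.
Proof.
have oi := tf_one_iso F; have l1 := lunit_iso (unitc D); have r1 := runit_iso (F (unitc C)).
have ki : is_iso (lunit (unitc D) ∘ (hinv (tf_one F) ⊠ idm (unitc D))).
  by apply: is_iso_comp => //; apply: tens_iso; [exact: is_iso_hinv|exact: is_iso_id].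
have e : hinv (runit (F (unitc C))) ∘ tf_one F ∘ (lunit (unitc D) ∘ (hinv (tf_one F) ⊠ idm (unitc D))) = idm _.
  rewrite hrunit_nat -lunit_runit1 -!compA (compA (hinv _)) hinvK // comp1m.
  by rewrite -tensMl hinvV // tensm1.
have li := ra_l_inv_iso aR (unitc C) (unitc D).
have e2 := ra_l_inv_one aR (unitc D).
apply: (iso_cancel (lunit_iso _)); rewrite frob_mate_l /ra_l -{1}e2.
move: (ra_l_inv aR _ _) li e2 => r li e2.
have e' : fmor R (hinv (runit (F (unitc C)))) ∘ fmor R (tf_one F) ∘ fmor R (lunit (unitc D) ∘ (hinv (tf_one F) ⊠ idm (unitc D))) = idm _.
  by rewrite -!fmorM e fmor1.
rewrite !compA (cl3 _ e') compm1 -(compA _ (hinv r)) hinvK // compm1 -lunit_runit1 lunit_nat //.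
Qed.

(** Transpose g to R F c -> R F d and close it with the unit of F ⊣ R and [frob_mate]. A morphism F
    f goes to f composed with the hat of the identity, so this need not invert F on morphisms; what
    matters is its bilinearity. *)
Definition frob_hat c d (g : hom (F c) (F d)) : hom c d :=
  locked (frob_mate d ∘ fmor R g ∘ aunit aR c).

Lemma frob_hatE c d (g : hom (F c) (F d)) : frob_hat g = frob_mate d ∘ fmor R g ∘ aunit aR c.
Proof. by rewrite /frob_hat -lock. Qed.

Lemma frob_hat_natl c d d' (f : hom d d') (g : hom (F c) (F d)) : frob_hat (fmor F f ∘ g) = f ∘ frob_hat g.
Proof. by rewrite !frob_hatE fmorM !compA frob_mate_nat. Qed.

Lemma frob_hat_natr c c' d (f : hom c' c) (g : hom (F c) (F d)) : frob_hat (g ∘ fmor F f) = frob_hat g ∘ f.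
Proof. by rewrite !frob_hatE fmorM -!compA aunit_nat. Qed.

Lemma frob_hat_mul c d e (g : hom (F d) (F e)) :
  frob_hat (tf_mul F c e ∘ (idm (F c) ⊠ g) ∘ mul' c d) = idm c ⊠ frob_hat g.
Proof.
rewrite !frob_hatE !fmorM !compA frob_mate_mul -(compA _ (fmor R (mul' _ _))) ra_l_unit.
have := ra_l_nat c g; have := ra_l_inv_iso aR c (F d); rewrite /ra_l.
move: (ra_l_inv aR c (F d)) (ra_l_inv aR c (F e)) => r1 r2 r1i n.
by rewrite -!compA (compA (hinv r2)) n -!compA (compA (hinv r1)) hinvK // comp1m -!tensMr.
Qed.

Lemma frob_hat_one c (g : hom (F c) (unitc D)) : frob_hat (tf_one F ∘ g) = frob_theta ∘ fmor R g ∘ aunit aR c.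
Proof. by rewrite frob_hatE fmorM !compA frob_mate_one. Qed.

(** Right linearity. It rests on [frob_mate_r], hence on the half-braiding, whereas [frob_hat_mul]
    uses the left structure alone. *)
Lemma frob_hat_lunit c d (g : hom (F c) (unitc D)) :
  frob_hat (lunit (F d) ∘ (g ⊠ idm (F d)) ∘ mul' c d) = lunit d ∘ (frob_hat (tf_one F ∘ g) ⊠ idm d).
Proof.
rewrite frob_hat_one frob_hatE frob_mate_r.
have li := lunit_iso (F d); have := ra_r_unit aR d c.
have := ra_r_nat d g; have := ra_r_inv_iso aR d (F c); rewrite /ra_r.
move: (ra_r_inv aR (F c) d) (ra_r_inv aR (unitc D) d) => r1 r2 r1i n u.
rewrite !fmorM !compA -(compA _ (fmor R (hinv (lunit _)))) -fmorM hinvK // fmor1 compm1 -(compA _ (fmor R (mul' c d))) u.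
by rewrite -!compA (compA (hinv r2)) n -!compA (compA (hinv r1)) hinvK // comp1m -!tensMl !compA.
Qed.
End RightRightAdjoint.

(** * Serre functors of the pullback *)

Section PullbackHom.
Variables (k : fieldType) (C D : ftcat k) (F : tfunctor C D) (M : modcat D).
Local Notation FM := (pullback F M).
Local Notation mul' c d := (hinv (tf_mul F c d)).
Implicit Types (c d : C) (m n : M).

Lemma pb_aev c c' (dp : dualpair c c') m :
  (@aev k C FM c c' dp m : @hom k M _ _) = aev (tf_pair F dp) m.
Proof.
rewrite /aev -!lock /= /pb_munit /pb_mass /pb_actm.
have i1 := mass_iso (F c') (F c) m; have i2 := tf_mul_iso F c' c.
have i3 : is_iso (mul' c' c ▶ idm m) by apply: is_iso_actm; [exact: is_iso_hinv|exact: is_iso_id].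
have -> : @hinv k FM _ _ (mass (F c') (F c) m ∘ (mul' c' c ▶ idm m)) = (tf_mul F c' c ▶ idm m) ∘ hinv (mass (F c') (F c) m).
  have -> : tf_mul F c' c ▶ idm m = hinv (mul' c' c ▶ idm m).
    by rewrite act_hinv ?hinv1 ?hinv_hinv //; [exact: is_iso_hinv|exact: is_iso_id].
  exact: (@hinv_comp k M).
by rewrite !compA -!(compA (munit m)) -!actMl.
Qed.

Lemma pb_acoev c c' (dp : dualpair c c') m :
  (@acoev k C FM c c' dp m : @hom k M _ _) = acoev (tf_pair F dp) m.
Proof.
rewrite /acoev -!lock /= /pb_munit /pb_mass /pb_actm.
have i1 := munit_iso m; have i2 := tf_one_iso F.
have i3 : is_iso (hinv (tf_one F) ▶ idm m) by apply: is_iso_actm; [exact: is_iso_hinv|exact: is_iso_id].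
have -> : @hinv k FM _ _ (munit m ∘ (hinv (tf_one F) ▶ idm m)) = (tf_one F ▶ idm m) ∘ hinv (munit m).
  have -> : tf_one F ▶ idm m = hinv (hinv (tf_one F) ▶ idm m).
    by rewrite act_hinv ?hinv1 ?hinv_hinv //; [exact: is_iso_hinv|exact: is_iso_id].
  exact: (@hinv_comp k M).
by rewrite !compA -!(compA (mass _ _ m)) -!actMl.
Qed.

Lemma aev_change (a a' b b' : D) (dp : dualpair a a') (dp' : dualpair b b') (f : hom b' a') (g : hom b a) m :
  dp_ev dp ∘ (f ⊠ g) = dp_ev dp' -> aev dp m ∘ (f ▶ (g ▶ idm m)) = aev dp' m.
Proof. by move=> e; rewrite /aev -!lock -compA hmass_nat !compA -(compA (munit m)) -actMl e. Qed.

Lemma acoev_change (a a' b b' : D) (dp : dualpair a a') (dp' : dualpair b b') (f : hom b' a') (g : hom b a) m :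
  is_iso f -> is_iso g ->
  dp_ev dp ∘ (f ⊠ g) = dp_ev dp' -> (g ▶ (f ▶ idm m)) ∘ acoev dp' m = acoev dp m.
Proof.
move=> fi gi e; apply: (@adjl_inj _ _ _ _ _ (act_adj M dp) m _).
have -> : adjl (act_adj M dp) (acoev dp m) = idm (a' ▷ m) := adjl_unit (act_adj M dp) m.
rewrite /adjl /=.
have -> : idm a' ▶ ((g ▶ (f ▶ idm m)) ∘ acoev dp' m)
  = (f ▶ (g ▶ idm (a' ▷ m))) ∘ (idm b' ▶ (idm b ▶ (f ▶ idm m))) ∘ (idm b' ▶ acoev dp' m) ∘ (hinv f ▶ idm m).
  by rewrite -!actmM !(compm1, comp1m) hinvV.
rewrite !compA (aev_change _ e) -aev_nat -(compA _ (aev dp' _)) aev_triR compm1.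
by rewrite -actMl hinvV // actm1.
Qed.

Variables (HD : forall m n : M, ihom m n) (HC : forall m n : FM, ihom m n).

(** The transpose under F ⊣ R of the isomorphism between the internal Hom over C and R of the one
    over D ([pb_ihom_iso]). *)
Definition pb_kappa m n : hom (F (HC m n)) (HD m n) :=
  icurry HD (ih_ev (HC m n) : @hom k M (F (HC m n) ▷ m) n).

Lemma pb_kappaP c m n (g : hom c (HC m n)) : iunc (pb_kappa m n ∘ fmor F g) = (iunc g : @hom k M _ _).
Proof. by rewrite iunc_nat icurryK iuncE. Qed.

Lemma pb_kappa1 m n : iunc (pb_kappa m n) = (ih_ev (HC m n) : @hom k M _ _).
Proof. exact: icurryK. Qed.

Lemma pb_kappa_post m n n' (f : @hom k M n n') :
  pb_kappa m n' ∘ fmor F (ipost HC m (f : @hom k FM n n')) = ipost HD m f ∘ pb_kappa m n.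
Proof. by apply: (iunc_inj (H := HD)); rewrite pb_kappaP iunc_post iunc_post1 pb_kappa1. Qed.

Lemma pb_kappa_pre m m' n (f : @hom k M m' m) :
  pb_kappa m' n ∘ fmor F (ipre HC n (f : @hom k FM m' m)) = ipre HD n f ∘ pb_kappa m n.
Proof.
apply: (iunc_inj (H := HD)); rewrite pb_kappaP iunc_pre iunc_pre1 pb_kappa1 /=.
by rewrite /pb_actm fmor1.
Qed.

Lemma pb_kappa_istr c m n :
  pb_kappa m (F c ▷ n) ∘ fmor F (istr HC c m n) = istr HD (F c) m n ∘ (idm _ ⊠ pb_kappa m n) ∘ mul' c (HC m n).
Proof.
apply: (iunc_inj (H := HD)); rewrite pb_kappaP [RHS]iunc_nat iunc_istr pb_kappa1 istr1 /=.
by rewrite /pb_actm fmor1 /pb_mass !compA.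
Qed.

Lemma pb_kappa_icostr c m n :
  pb_kappa (F c ▷ m) n ∘ fmor F (icostr HC c m n)
  = icostr HD (F c) m n ∘ (pb_kappa m n ⊠ tf_rdual F c) ∘ mul' (HC m n) c^v.
Proof.
apply: (iunc_inj (H := HD)); rewrite pb_kappaP [RHS]iunc_nat iunc_icostr pb_kappa1 icostr1 /=.
rewrite pb_aev /pb_actm fmor1 /pb_mass !compA; congr (_ ∘ (_ ▶ _) ∘ _ ∘ _).
rewrite -(aev_change (dp := rdp (F c)) (f := tf_rdual F c) (g := idm _)) ?actm1 //.
exact: tf_rdualP.
Qed.

Variables (R : functor D C) (aR : adjunction F R).

Lemma pb_ihom_iso m n : is_iso (fmor R (pb_kappa m n) ∘ aunit aR (HC m n)).
Proof.
apply: iso_yoneda => c.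
have bC := iunc_bij HC c m n; have bD := bij_comp (iunc_bij HD (F c) m n) (adjl_bij aR c (HD m n)).
have key (g : hom c (HC m n)) : iunc (adjl aR (fmor R (pb_kappa m n) ∘ aunit aR _ ∘ g)) = (iunc g : @hom k M _ _).
  by rewrite adjl_natl -/(adjr aR _) adjrK pb_kappaP.
apply: bijI => [g g' /= e|f].
  by apply: (bij_inj bC); have := congr1 (fun u => iunc (adjl aR u)) e; rewrite !key.
have [g hg] := bij_surj (iunc (adjl aR f) : @hom k FM _ _) bC; exists g; apply: (bij_inj bD).
by rewrite /= key hg.
Qed.

End PullbackHom.

Lemma icostr_post (k : fieldType) (D : ftcat k) (M : modcat D) (H : forall m n : M, ihom m n) (d : D) m n n' (f : hom n n') :
  icostr H d m n' ∘ (ipost H m f ⊠ idm _) = ipost H (d ▷ m) f ∘ icostr H d m n.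
Proof. by rewrite !icostrE gcostr_post. Qed.

Lemma twist_trace (k : fieldType) (D : ftcat k) (M : modcat D) (T : trdata M) (d e : D) (m n : M)
    (tw : hom (d^v^v ▷ T m) (T (d ▷ m))) (a : hom e d^v^v) (f : hom n (T m)) :
  is_twist tw ->
  td_tr T (d ▷ m) ∘ ipost (td_hom T) (d ▷ m) (tw ∘ (a ▶ f)) ∘ istr (td_hom T) e (d ▷ m) n
    ∘ (idm e ⊠ icostr (td_hom T) d m n)
  = rev d^v ∘ (a ⊠ (lunit d^v ∘ ((td_tr T m ∘ ipost (td_hom T) m f) ⊠ idm d^v))).
Proof.
rewrite /is_twist => h.
rewrite ipostM -(compA (td_tr T _)) -(compA (ipost _ _ tw)) -istr_nat -!compA -tensmM compm1.
rewrite -[in LHS](comp1m a) -[_ ∘ icostr _ _ _ _]icostr_post tensmM !compA h -!compA -tensmM comp1m -!compA.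
by rewrite -tensMl.
Qed.

Section PullbackTrace.
Variables (k : fieldType) (C D : ftcat k) (F : tfunctor C D) (M : modcat D).
Local Notation FM := (pullback F M).
Local Notation mul' c d := (hinv (tf_mul F c d)).
Variables (R : functor D C) (aR : adjunction F R) (RR : functor C D) (aRR : adjunction R RR).
Variables (t : hom (unitc D) (chi RR)) (tP : chi_trivialization aR aRR t).
Variables (TD : trdata M) (TC : trdata FM).
Local Notation HD := (td_hom TD).
Local Notation HC := (td_hom TC).
Local Notation trD := (td_tr TD).
Local Notation trC := (td_tr TC).
Local Notation hat := (frob_hat aR aRR t).
Local Notation kap := (pb_kappa HD HC).
Implicit Types (c d : C) (m n : M).

Definition pb_tau m : hom (HC m (TD m)) (unitc C) := hat (tf_one F ∘ (trD m ∘ kap m (TD m))).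

Lemma pb_tau_post m n (g : @hom k M n (TD m)) :
  pb_tau m ∘ ipost HC m (g : @hom k FM _ _) = hat (tf_one F ∘ (trD m ∘ ipost HD m g ∘ kap m n)).
Proof. by rewrite /pb_tau -frob_hat_natr -!compA pb_kappa_post. Qed.

Lemma pb_tau_pre m m' (f : @hom k M m m') :
  pb_tau m ∘ ipre HC (TD m) (f : @hom k FM _ _) = hat (tf_one F ∘ (trD m ∘ ipre HD (TD m) f ∘ kap m' (TD m))).
Proof. by rewrite /pb_tau -frob_hat_natr -!compA pb_kappa_pre. Qed.

(** Hom(n, S^D m) = Hom(H^D(m,n), 1) = Hom(H^D(m,n), chi) = Hom(R H^D(m,n), 1) = Hom(H^C(m,n), 1),
    and the composite of these bijections is postcomposition of the hat trace. *)
Lemma pb_tau_bij m n : bij (fun g : @hom k M n (TD m) => pb_tau m ∘ ipost HC m (g : @hom k FM _ _)).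
Proof.
have [ti _] := tP.
have b1 := iso_bijr (unitc C) (pb_ihom_iso HD HC aR m n).
have b2 := bij_comp (adjl_bij aRR (HD m n) (unitc C)) (iso_bij (HD m n) ti).
refine (eq_bij _ (bij_comp b1 (bij_comp b2 (td_universal TD m n)))) => g.
rewrite pb_tau_post frob_hat_one // /adjl !fmorM /frob_theta -lock /adjl.
by rewrite !compA.
Qed.

Definition pb_comp m : @hom k M (TD m) (TC m) :=
  the_mor (fun j : @hom k M (TD m) (TC m) => trC m ∘ ipost HC m (j : @hom k FM _ _) = pb_tau m).

Lemma pb_compP m : trC m ∘ ipost HC m (pb_comp m : @hom k FM _ _) = pb_tau m.
Proof.
apply: (the_morP (P := fun j : @hom k M (TD m) (TC m) => trC m ∘ ipost HC m (j : @hom k FM _ _) = pb_tau m)).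
exact: (bij_surj (pb_tau m) (td_universal TC m (TD m))).
Qed.

Lemma pb_comp_uniq m (j : @hom k M (TD m) (TC m)) :
  trC m ∘ ipost HC m (j : @hom k FM _ _) = pb_tau m -> j = pb_comp m.
Proof. by move=> e; apply: (bij_inj (td_universal TC m (TD m))); rewrite /= e pb_compP. Qed.

Lemma pb_comp_iso m : is_iso (pb_comp m).
Proof.
apply: iso_yoneda => n; have bC := td_universal TC m n; have bD := pb_tau_bij m n.
have key (g : @hom k M n (TD m)) : trC m ∘ ipost HC m (pb_comp m ∘ g : @hom k FM _ _)
   = pb_tau m ∘ ipost HC m (g : @hom k FM _ _).
  by rewrite -pb_compP -compA -(@ipostM _ _ FM HC).
apply: bijI => [g g' /= e|f].
  by apply: (bij_inj bD); rewrite -!key e.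
have [g hg] := bij_surj (trC m ∘ ipost HC m (f : @hom k FM _ _)) bD; exists g.
by apply: (bij_inj bC); rewrite /= key hg.
Qed.

Lemma pb_comp_nat m n (f : @hom k M m n) :
  pb_comp n ∘ fmor TD f = (fmor TC (f : @hom k FM _ _) : @hom k M _ _) ∘ pb_comp m.
Proof.
apply: (bij_inj (td_universal TC n (TD m))) => /=.
rewrite (@ipostM _ _ FM HC) compA pb_compP pb_tau_post td_nat -pb_tau_pre //.
rewrite (@ipostM _ _ FM HC) compA td_nat -pb_compP -!compA.
by rewrite (@ipre_post _ _ FM HC).
Qed.

(** Both sides are tested against the trace of S^C. On the left this gives the hat of the trace
    equation of [twD]; hat then passes the double dual by left linearity and the dual of c by right
    linearity, which leaves the trace equation of [twC]. *)
Lemma pb_comp_twist c m twD twC : is_twist (T := TD) (d := F c) (m := m) twD ->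
  is_twist (T := TC) (d := c) (m := m) twC ->
  pb_comp (F c ▷ m) ∘ twD ∘ (tf_rdual2 F c ▶ idm (TD m))
  = (twC : @hom k M _ _) ∘ (idm (F c^v^v) ▶ pb_comp m).
Proof.
move=> hD hC; apply: (bij_inj (twist_bij TC c m c^v^v (TD m))) => /=.
have -> : (twC : @hom k M _ _) ∘ (idm (F c^v^v) ▶ pb_comp m)
   = @comp k FM _ _ _ twC (idm c^v^v ▶ (pb_comp m : @hom k FM _ _)).
  by rewrite /= /pb_actm fmor1.
have := @twist_trace k C FM TC c c^v^v m (TD m) twC (idm _) (pb_comp m) hC.
rewrite pb_compP => e1; apply: etrans (esym e1).
have e2 := twist_trace (tf_rdual2 F c) (idm (TD m)) hD.
rewrite -(compA (pb_comp _)) (@ipostM _ _ FM HC) compA pb_compP.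
rewrite (pb_tau_post (m := F c ▷ m)) -!frob_hat_natr.
have X1 : kap (F c ▷ m) (F c^v^v ▷ TD m) ∘ fmor F (istr HC c^v^v (pb_act F c m) (TD m)) = _ := pb_kappa_istr HD HC c^v^v (F c ▷ m) (TD m).
have X2 := hmul_nat F (idm c^v^v) (icostr HC c m (TD m)).
have X3 := pb_kappa_icostr HD HC c m (TD m).
(* The evaluation of F(c)^∨ becomes F of the evaluation of c^∨, so that naturality of hat can pull
   it out. *)
have X4 : tf_one F ∘ (rev (F c)^v ∘ (tf_rdual2 F c ⊠ tf_rdual F c)) = fmor F (rev c^v) ∘ tf_mul F c^v^v c^v.
  by rewrite tf_rdual2P /= !compA hinvV ?comp1m //; exact: tf_one_iso.
move: e2 X3 X4; rewrite ipost1 compm1; move: (tf_rdual2 F c) (tf_rdual F c) => xi ze e2 X3 X4.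
have -> : tf_one F ∘ (trD (F c ▷ m) ∘ ipost HD (F c ▷ m) (twD ∘ (xi ▶ idm (TD m)))
        ∘ kap (F c ▷ m) (pb_act F c^v^v (TD m)))
     ∘ fmor F (istr HC c^v^v (pb_act F c m) (TD m))
     ∘ fmor F (idm c^v^v ⊠ icostr HC c m (TD m))
  = fmor F (rev c^v) ∘ (tf_mul F c^v^v c^v ∘ (idm _ ⊠ (lunit _ ∘ ((trD m ∘ kap m (TD m)) ⊠ idm _) ∘ mul' _ c^v)) ∘ mul' c^v^v _).
  have X5 : lunit (F c)^v ∘ (trD m ⊠ idm (F c)^v) ∘ (kap m (TD m) ⊠ ze) = ze ∘ (lunit _ ∘ ((trD m ∘ kap m (TD m)) ⊠ idm _)).
    by rewrite -compA -tensmM comp1m tensi' !compA lunit_nat.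
  rewrite -!compA (compA (kap _ _)) X1 -!compA X2 fmor1 (compA (_ ⊠ kap _ _)) -tensMr X3.
  rewrite -!compA tensMr !compA -!(compA (tf_one F)) e2 -!compA (compA (xi ⊠ _)) -tensmM compm1 !compA.
  rewrite X5 -(compm1 xi) -(compA ze) tensmM !compA -(compA (tf_one F)) X4.
  by rewrite -!compA.
by rewrite frob_hat_natl // frob_hat_mul // frob_hat_lunit // tensMr.
Qed.

End PullbackTrace.

(** * Transport of Nakayama structures along F *)

Section NakstrTransport.
Variables (k : fieldType) (C : lincat k).

Section Source.
Variables (x x' t : C) (j : hom x x') (ji : is_iso j) (W : nakstr x t).

Lemma compPlr (y z : C) (f : hom y z) (w : C) a (u v : hom z w) : (a *: u + v) ∘ f = a *: (u ∘ f) + v ∘ f.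
Proof. exact: compPl. Qed.

Definition src_in y (p : {scalar hom x' y}) : hom y t := ns_in W (spull (@compPlr _ _ (hinv j) y) p).

Lemma src_cow : cowedge src_in.
Proof.
have [c1 c2] := ns_cow W; split=> [y a f g h e|y y' v f g e].
  by apply: c1 => w; rewrite !spullE e.
by apply: c2 => w; rewrite !spullE e compA.
Qed.

Lemma src_univ z (q : forall y, {scalar hom x' y} -> hom y z) : cowedge q ->
  exists! h : hom t z, forall y f, h ∘ src_in f = q y f.
Proof.
move=> [q1 q2].
have cq : cowedge (fun y (p : {scalar hom x y}) => q y (spull (@compPlr _ _ j y) p)).
  split=> [y a f g h e|y y' v f g e].
    by apply: q1 => w; rewrite !spullE e.
  by apply: q2 => w; rewrite !spullE e compA.
have [h [hh hU]] := ns_univ W cq.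
have K y (p : {scalar hom x' y}) : spull (@compPlr _ _ j y) (spull (@compPlr _ _ (hinv j) y) p) = p.
  by apply: scalar_ext => v; rewrite !spullE -compA hinvV // compm1.
have K' y (p : {scalar hom x y}) : spull (@compPlr _ _ (hinv j) y) (spull (@compPlr _ _ j y) p) = p.
  by apply: scalar_ext => v; rewrite !spullE -compA hinvK // compm1.
exists h; split=> [y p|h' hh']; first by rewrite /src_in hh K.
by apply: hU => y p; rewrite -hh' /src_in K'.
Qed.

Definition nakstr_src : nakstr x' t := NakStr src_cow src_univ.
End Source.

Section Target.
Variables (x t t' : C) (u : hom t t') (ui : is_iso u) (W : nakstr x t).

Definition tgt_in y (p : {scalar hom x y}) : hom y t' := u ∘ ns_in W p.

Lemma tgt_cow : cowedge tgt_in.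
Proof.
have [c1 c2] := ns_cow W; split=> [y a f g h e|y y' v f g e].
  by rewrite /tgt_in (c1 y a f g h e) compPr.
by rewrite /tgt_in -compA (c2 _ _ _ _ _ e).
Qed.

Lemma tgt_univ z (q : forall y, {scalar hom x y} -> hom y z) : cowedge q ->
  exists! h : hom t' z, forall y f, h ∘ tgt_in f = q y f.
Proof.
move=> cq; have [h [hh hU]] := ns_univ W cq.
exists (h ∘ hinv u); split=> [y f|g hg]; first by rewrite /tgt_in compA (cl _ (hinvK ui)) compm1.
have -> : h = g ∘ u by apply: hU => y f; rewrite -compA; exact: hg.
by rewrite -compA hinvV // compm1.
Qed.

Definition nakstr_tgt : nakstr x t' := NakStr tgt_cow tgt_univ.
End Target.
End NakstrTransport.

Section RestrictedModfun.
Variables (k : fieldType) (C D : ftcat k) (F : tfunctor C D) (M : modcat D).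
Local Notation FM := (pullback F M).
Implicit Types (G K : modfun M).

Definition pb_functor G : functor FM FM :=
  @Functor k FM FM (fun m => G m) (fun m n f => @fmor k M M G m n f)
    (fun m => fmor1 G m) (fun x y z f g => fmorM G f g) (fun x y a f g => fmorP G a f g).

Lemma mf_natl G (c d : D) (f : hom c d) m : mf_str G d m ∘ fmor G (f ▶ idm m) = (f ▶ idm _) ∘ mf_str G c m.
Proof. by rewrite mf_nat fmor1. Qed.

Definition pb_modfun G : modfun FM.
Proof.
refine (@ModFun k C FM (pb_functor G) (fun c m => mf_str G (F c) m) _ _ _ _).
- by move=> c m; exact: mf_iso.
- by move=> c d m n f g; exact: mf_nat.
- move=> c d m; rewrite /= /pb_mass /pb_actm fmor1 fmorM !compA -mf_ass.
  by rewrite -!(compA (mass _ _ _)) mf_natl.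
- move=> m; rewrite /= /pb_munit fmorM -mf_unit -!compA; congr (_ ∘ _).
  by rewrite mf_natl.
Defined.

Definition pb_modnat G K (s : modnat G K) : modnat (pb_modfun G) (pb_modfun K).
Proof.
refine (@ModNat k C FM (pb_modfun G) (pb_modfun K) (fun m => s m) _ _).
- by move=> m n f; exact: (mn_nat s f).
- by move=> c m; rewrite /= /pb_actm fmor1; exact: (mn_mod s).
Defined.

End RestrictedModfun.

Section TransportNakayama.
Variables (k : fieldType) (C D : ftcat k) (F : tfunctor C D) (M : modcat D).
Local Notation FM := (pullback F M).
Variables (R : functor D C) (aR : adjunction F R) (RR : functor C D) (aRR : adjunction R RR).
Variables (t : hom (unitc D) (chi RR)) (tP : chi_trivialization aR aRR t).
Variables (TD : trdata M) (TC : trdata FM).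
Local Notation jj := (pb_comp aR aRR t TD TC).
Implicit Types (K : modfun M).

Let ji m : is_iso (jj m) := pb_comp_iso tP TD TC m.

Lemma pb_act_eta (c : C) (n : M) : (idm (F c) ▶ (tf_rdual F c ▶ idm n)) ∘ acoev (tf_pair F (rdp c)) n = acoev (rdp (F c)) n.
Proof.
apply: acoev_change; [exact: tf_rdual_iso|exact: is_iso_id|].
exact: tf_rdualP.
Qed.

Lemma pb_aev_eps (c : C) (n : M) :
  aev (rdp (F c)^v) n ∘ (tf_rdual2 F c ▶ (tf_rdual F c ▶ idm n)) = aev (tf_pair F (rdp c^v)) n.
Proof. by apply: aev_change; exact: tf_rdual2P. Qed.

(** Only the source changes: K x was N^r(S^D x), and the comparison of Serre functors makes it
    N^r(S^C x). The axiom for the action reduces to [pb_comp_twist]. *)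
Definition pb_nakfam K (W : nakfam TD K) : nakfam TC (pb_modfun F K).
Proof.
refine (@NakFam k C FM TC (pb_modfun F K) (fun x => nakstr_src (ji x) (W x)) _ _).
- move=> x x' f n p q h; apply: (nf_nat W) => v; rewrite !spullE h -!compA; congr (p _).
  
  have e0 := @hinv_nat k M _ _ _ _ _ _ _ _ (ji x) (ji x') (pb_comp_nat aR aRR t TD TC f).
  exact: (congr1 (fun u => @comp k M _ _ _ v u) e0).
- move=> c x twC hC n p q h.
  have [twD hD] := twist_exists TD (F c) x.
  have e := pb_comp_twist tP hD hC.
  have zi := tf_rdual_iso F c.
  have zai : is_iso (tf_rdual F c ▶ idm n) by apply: is_iso_actm => //; exact: is_iso_id.
  pose q' : {scalar hom (TD x) (F c^v ▷ n)} := spull (@compPlr k M _ _ (hinv (jj x)) _) q.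
  pose p' := spull (@compPlr k M _ _ (hinv (jj (F c ▷ x))) _) p.
  have hP a (u v : hom (TD x) ((F c)^v ▷ n)) := compPr a (hinv (tf_rdual F c ▶ idm n)) u v.
  (* Over D the axiom involves F(c)^∨, over C it involves F(c^∨); [q''] is [q'] moved from the
     latter to the former along [tf_rdual]. *)
  pose q'' := spull hP q'.
  have main : mf_str K (F c) x ∘ ns_in (W (F c ▷ x)) p' = (idm (F c) ▶ ns_in (W x) q'') ∘ acoev (rdp (F c)) n.
    apply: (nf_act W hD) => v w hw; rewrite !spullE.
    apply: h; rewrite /= /pb_actm fmor1 pb_aev.
    have i3 : is_iso (idm (F c^v^v) ▶ jj x) by apply: is_iso_actm => //; exact: is_iso_id.
    apply: (iso_cancel i3); rewrite -[in LHS]compA -e.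
    move: (jj (F c ▷ x)) (ji (F c ▷ x)) => j1 j1i.
    rewrite -pb_aev_eps -!(compA w) -(compA j1) (compA (hinv j1)) hinvK // comp1m.
    move: (hinvV zai); move: (tf_rdual F c ▶ idm n) (tf_rdual2 F c) => z xi zz.
    rewrite !compA hw -!compA -!actmM !comp1m !compm1 -!compA hinvK ?compm1; last exact: ji.
    by rewrite !compA zz comp1m.
  have e3 : ns_in (W x) q'' ∘ (tf_rdual F c ▶ idm n) = ns_in (W x) q'.
    have [_ c2] := ns_cow (W x); apply: c2 => w; rewrite [in RHS]spullE; congr (q' _).
    by rewrite compA hinvK // comp1m.
  have -> : (idm c ▶ (ns_in (nakstr_src (ji x) (W x)) q : @hom k FM _ _)) ∘ acoev (rdp c) n
    = (idm (F c) ▶ ns_in (W x) q') ∘ acoev (tf_pair F (rdp c)) n.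
    by rewrite /= /pb_actm fmor1 pb_acoev.
  by rewrite -e3 actMr -(compA (idm (F c) ▶ _)) pb_act_eta; exact: main.
Defined.

Lemma is_iso_op (X : lincat k) (x y : X) (f : hom x y) : is_iso f -> @is_iso k (opc X) y x f.
Proof. by move=> [g [h1 h2]]; exists g. Qed.

(** Here the source x stays and the target K (S^D x) is replaced by K (S^C x), along the image under
    K of the comparison. *)
Definition pb_nakfaml K (W : nakfaml TD K) : nakfaml TC (pb_modfun F K).
Proof.
refine (@NakFaml k C FM TC (pb_modfun F K) (fun x => @nakstr_tgt k (opc M) _ _ _ (fmor K (hinv (jj x)))
   (is_iso_op (fmor_iso K (is_iso_hinv (ji x)))) (W x)) _ _).
- move=> x x' f n p q h.
  have e := nfl_nat W (f := f) h.
  have e0 := @hinv_nat k M _ _ _ _ _ _ _ _ (ji x) (ji x') (pb_comp_nat aR aRR t TD TC f).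
  have -> : ns_in (nakstr_tgt (is_iso_op (fmor_iso K (is_iso_hinv (ji x)))) (W x)) q = @comp k M _ _ _ (ns_in (W x) q) (fmor K (hinv (jj x))) by [].
  rewrite -e; have /= e1 := congr1 (fun u => @fmor k M M K _ _ u) e0; rewrite !fmorM in e1.
  apply: etrans _ (@compA k M _ _ _ _ _ _ _).
  apply: etrans (esym (@compA k M _ _ _ _ _ _ _)) _.
  by rewrite /= e1.
- move=> c x twC hC n p q h.
  have [twD hD] := twist_exists TD (F c) x.
  have e := pb_comp_twist tP hD hC.
  have zi := tf_rdual_iso F c.
  have hP a (u v : hom ((F c)^v ▷ n) x) : (a *: u + v) ∘ (tf_rdual F c ▶ idm n) = a *: (u ∘ (tf_rdual F c ▶ idm n)) + v ∘ (tf_rdual F c ▶ idm n) := compPl a u v _.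
  pose q' := spull hP (q : {scalar @hom k M (F c^v ▷ n) x}).
  pose A : @hom k M (K (TD (F c ▷ x))) n := ns_in (W (F c ▷ x)) p.
  pose B : @hom k M (K (TD x)) (F c^v ▷ n) := ns_in (W x) q.
  have eA : A ∘ fmor K twD = aev (rdp (F c)^v) n ∘ (idm _ ▶ ((tf_rdual F c ▶ idm n) ∘ B)) ∘ mf_str K _ (TD x).
    have -> : (tf_rdual F c ▶ idm n) ∘ B = ns_in (W x) q'.
      have [_ c2] := ns_cow (W x); apply: c2 => w; exact: spullE.
    apply: (nfl_act W hD) => v; rewrite spullE h /= pb_acoev /pb_actm fmor1 -pb_act_eta compA -actMr //.
  have ki : is_iso (idm (F c^v^v) ▶ jj x) by apply: is_iso_actm => //; exact: is_iso_id.
  suff main : A ∘ fmor K (hinv (jj (F c ▷ x))) ∘ fmor K twC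
     = aev (tf_pair F (rdp c^v)) n ∘ (idm (F c^v^v) ▶ (B ∘ fmor K (hinv (jj x)))) ∘ mf_str K (F c^v^v) (TC x).
    apply: etrans main _; rewrite /= pb_aev /pb_actm fmor1 //.
  apply: (iso_cancel (fmor_iso K ki)).
  have e' : hinv (jj (F c ▷ x)) ∘ ((twC : @hom k M _ _) ∘ (idm (F c^v^v) ▶ jj x)) = twD ∘ (tf_rdual2 F c ▶ idm (TD x)).
    rewrite -e; move: (jj (F c ▷ x)) (ji (F c ▷ x)) (tf_rdual2 F c) => j1 j1i xi.
    by rewrite !compA hinvK // comp1m.
  rewrite -[in LHS](compA (A ∘ _)) -[in LHS](compA A) -!fmorM e' -(compA _ (mf_str _ _ _)) mf_nat.
  rewrite fmorM [in LHS]compA eA -pb_aev_eps.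
  move: (tf_rdual2 F c) (tf_rdual F c) => xi ze.
  rewrite -!compA mf_nat fmor1 !compA; congr (_ ∘ _).
  rewrite -!compA -!actmM !comp1m !compm1 -!compA -fmorM hinvK ?fmor1 ?compm1 //.
Defined.
End TransportNakayama.

Section NakfamIso.
Variables (k : fieldType) (D : ftcat k) (M : modcat D) (T : trdata M) (K K' : modfun M).

Definition nakfam_iso (s : modnat K K') (si : forall m, is_iso (s m)) (W : nakfam T K) : nakfam T K'.
Proof.
refine (@NakFam k D M T K' (fun x => nakstr_tgt (si (x)) (W x)) _ _).
- move=> x x' f n p q h; rewrite /= /tgt_in compA -(mn_nat s) -compA; congr (_ ∘ _).
  exact: (nf_nat W).
- move=> d x tw htw n p q h; rewrite /= /tgt_in compA (mn_mod s) -compA (nf_act W htw h) compA.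
  by rewrite -actMr.
Defined.

Definition nakfaml_iso (s : modnat K K') (si : forall m, is_iso (s m)) (W : nakfaml T K) : nakfaml T K'.
Proof.
refine (@NakFaml k D M T K' (fun x => @nakstr_tgt k (opc M) _ _ _ (hinv (s (T x)))
   (is_iso_op (is_iso_hinv (si (T x)))) (W x)) _ _).
- move=> x x' f n p q h.
  have e : hinv (s (T x')) ∘ fmor K' (fmor T f) = fmor K (fmor T f) ∘ hinv (s (T x)).
    by apply: hinv_nat; [exact: si..|exact: mn_nat].
  have e2 := nfl_nat W h.
  have E a b : a ∘ fmor K (fmor T f) = b -> a ∘ hinv (s (T x')) ∘ fmor K' (fmor T f) = b ∘ hinv (s (T x)).
    by move=> <-; rewrite -compA e compA.
  exact: (E _ _ _ e2).
- move=> d x tw htw n p q h.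
  have e : hinv (s (T (d ▷ x))) ∘ fmor K' tw = fmor K tw ∘ hinv (s (d^v^v ▷ T x)).
    by apply: hinv_nat; [exact: si..|exact: mn_nat].
  have e2 := nfl_act W htw h.
  have E (a : hom _ n) b : a ∘ fmor K tw = aev (rdp d^v) n ∘ (idm _ ▶ b) ∘ mf_str K _ _ ->
      a ∘ hinv (s (T (d ▷ x))) ∘ fmor K' tw = aev (rdp d^v) n ∘ (idm _ ▶ (b ∘ hinv (s (T x)))) ∘ mf_str K' _ _.
    move=> e3; rewrite -compA e compA e3 actMr -!compA; congr (_ ∘ (_ ∘ _)).
    apply: (iso_cancel (si (d^v^v ▷ T x))); rewrite -!compA hinvK // compm1 mn_mod compA -actMr hinvK //.
    by rewrite actm1 comp1m.
  exact: (E _ _ e2).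
Defined.
End NakfamIso.

Section SerreEquivalence.
Variables (k : fieldType) (D : ftcat k) (M : modcat D) (S : serre M).

Lemma serre_surj : ess_surjective (serre_td S).
Proof.
move=> m; exists (sr_inv S m), (hinv (aunit (sr_adj S) m)).
by apply: is_iso_hinv; exact: sr_unit_iso.
Qed.

Lemma serre_full x y (g : hom (S x) (S y)) : exists f, fmor S f = g.
Proof.
have ci := sr_counit_iso S x.
exists (acounit (sr_adj S) y ∘ fmor (sr_inv S) g ∘ hinv (acounit (sr_adj S) x)).
have tr z : fmor S (acounit (sr_adj S) z) ∘ aunit (sr_adj S) (S z) = idm (S z) := adj_triR (sr_adj S) z.
rewrite !fmorM fmor_hinv //.
apply: (iso_cancel (fmor_iso S ci)); rewrite -compA hinvK ?compm1; last exact: fmor_iso.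
apply: (iso_cancel (sr_unit_iso S (S x))); rewrite -!compA tr compm1 -aunit_nat compA tr comp1m //.
Qed.

Lemma serre_twistP d m : is_twist (T := serre_td S) (serre_twist S d m).
Proof. exact: the_morP (twist_exists (serre_td S) d m). Qed.
End SerreEquivalence.

(** * Perfect and Frobenius tensor functors; exactness and unimodularity *)

Section Perfect.
Variables (k : fieldType) (C D : ftcat k) (F : tfunctor C D).

Lemma perfect_projective p : perfect F -> is_projective p -> is_projective (F p).
Proof.
move=> [R [aR Re]] pp x y e f ee.
have abD : is_abelian D by case: (ftcat_finite D).
have [g hg] := pp _ _ _ (adjr aR f) (exact_epi abD Re ee).
by exists (adjl aR g); apply: (adjr_inj (a := aR)); rewrite adjr_natr adjlK.
Qed.

Lemma pullback_exact (M : modcat D) : exact_module M -> perfect F -> exact_module (pullback F M).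
Proof. by move=> Me Fp p m pp; apply: Me; apply: perfect_projective. Qed.
End Perfect.

Section Frobenius.
Variables (k : fieldType) (C D : ftcat k) (F : tfunctor C D).
Variables (L R : functor D C) (aL : adjunction L F) (aR : adjunction F R).
Variable phi : forall d : D, hom (L d) (R d).
Hypothesis phi_iso : forall d, is_iso (phi d).
Hypothesis phi_nat : forall (d d' : D) (f : hom d d'), phi d' ∘ fmor L f = fmor R f ∘ phi d.
Hypothesis phi_l : forall (c : C) (d : D), ra_l aR c d ∘ phi (F c ⊗ d) = (idm c ⊠ phi d) ∘ la_l aL c d.
Hypothesis phi_r : forall (c : C) (d : D), ra_r aR d c ∘ phi (d ⊗ F c) = (phi d ⊠ idm c) ∘ la_r aL d c.

(** R is isomorphic to L, hence left adjoint to F: for a Frobenius functor F itself serves as RR,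
    chi is F 1, and the trivialization is [tf_one]. *)
Definition frobenius_adj : adjunction R F :=
  adj_natiso (fun d => is_iso_hinv (phi_iso d))
    (fun x y f => hinv_nat (phi_iso x) (phi_iso y) (phi_nat f)) aL.

(** Bilinearity of phi says that the module structure of F as a right adjoint of R is its own tensor
    structure. With [rra_r_mul] this makes the half-braiding on F 1 trivial. *)
Lemma rra_l_mul c d : rra_l_inv aR frobenius_adj c d = tf_mul F c d.
Proof.
apply: (adjl_inj (a := frobenius_adj)); rewrite adjl_rra_l_inv.
apply: (iso_cancel (phi_iso _)); rewrite -compA phi_l compA -tensMr.
have -> : acounit frobenius_adj d ∘ phi (F d) = acounit aL d by rewrite /= -compA hinvK ?compm1.
have -> : adjl frobenius_adj (tf_mul F c d) ∘ phi (F c ⊗ F d) = adjl aL (tf_mul F c d).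
  by rewrite /adjl /= -!compA -phi_nat (compA (hinv _)) hinvK // comp1m.
rewrite /la_l -/(adjl aL _) -adjl_natr; congr (adjl aL _).
by rewrite compA -tf_mul_nat -compA fmor1 -tensMr adj_triR tensm1 compm1.
Qed.

Lemma rra_r_mul c d : rra_r_inv aR frobenius_adj d c = tf_mul F d c.
Proof.
apply: (adjl_inj (a := frobenius_adj)); rewrite adjl_rra_r_inv.
apply: (iso_cancel (phi_iso _)); rewrite -compA phi_r compA -tensMl.
have -> : acounit frobenius_adj d ∘ phi (F d) = acounit aL d by rewrite /= -compA hinvK ?compm1.
have -> : adjl frobenius_adj (tf_mul F d c) ∘ phi (F d ⊗ F c) = adjl aL (tf_mul F d c).
  by rewrite /adjl /= -!compA -phi_nat (compA (hinv _)) hinvK // comp1m.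
rewrite /la_r -/(adjl aL _) -adjl_natr; congr (adjl aL _).
by rewrite compA -tf_mul_nat -compA fmor1 -tensMl adj_triR tensm1 compm1.
Qed.

Lemma frobenius_trivialization : chi_trivialization aR frobenius_adj (tf_one F : hom _ (chi F)).
Proof.
split=> [|c]; first exact: tf_one_iso.
rewrite /half_braiding rra_l_mul rra_r_mul.
have oi := tf_one_iso F; have mi := tf_mul_iso F c (unitc C); have ri := runit_iso (F c).
have li := lunit_iso (F c); have rci := runit_iso c.
rewrite fmorM -!compA (compA (tf_mul F _ _)) (compA (fmor F (lunit c))) (compA (fmor F (lunit c))) tf_lunit hinvV // compm1.
apply: (iso_cancell mi); rewrite compA hinvV // comp1m.
apply: (iso_cancell (fmor_iso F rci)); rewrite -fmorM hinvV // fmor1 !compA tf_runit hinvV //.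
Qed.
End Frobenius.

Lemma tensor_frobenius_trivialization k (C D : ftcat k) (F : tfunctor C D) : tensor_frobenius F ->
  exists (R : functor D C) (aR : adjunction F R) (RR : functor C D) (aRR : adjunction R RR)
    (t : hom (unitc D) (chi RR)), chi_trivialization aR aRR t.
Proof.
move=> [L [R [aL [aR [phi [h1 h2 h3 h4]]]]]].
exists R, aR, F, (frobenius_adj aL h1 h2), (tf_one F).
exact: frobenius_trivialization.
Qed.

(** An isomorphism id = N^l(id) over D puts a left Nakayama family on the identity functor; its
    pullback is again the identity functor, which is therefore N^l(id) over C. *)
Theorem pullback_unimodular k (C D : ftcat k) (F : tfunctor C D) (M : modcat D) :
  unimodular_module M -> perfect F -> tensor_frobenius F -> unimodular_module (pullback F M).
Proof.
move=> [Me [Dl [f fi]]] Fp Ff; have FMe := pullback_exact Me Fp; split=> //.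
have [R [aR [RR [aRR [t tP]]]]] := tensor_frobenius_trivialization Ff.
pose SD := serre_exists Me; pose SC := serre_exists FMe.
have hi : @is_iso k (modend M) _ _ (hinv f) := is_iso_hinv fi.
have W := nakfaml_iso (fun m => modnat_isoP m hi) (nakfaml_of (serre_td SD) Dl).
have WC := pb_nakfaml tP (serre_td SC) W.
(* The restriction of the identity module functor and the identity of [_F M] agree in all data and
   differ only in proofs, so the fields are repackaged. *)
have W1 : nakfaml (serre_td SC) (modfun_id (pullback F M)) := NakFaml (K := modfun_id (pullback F M)) (nfl_nat WC) (nfl_act WC).
exists (nakl_of (nakstrl_of_fam (serre_surj SC) (@serre_full _ _ _ SC) W1)), (@idm k (modend (pullback F M)) (dual_one _)).
exact: is_iso_id.
Qed.

(** * Transport of pivotal structures *)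

Section PivotalTransport.
Variables (k : fieldType) (C D : ftcat k) (F : tfunctor C D) (M : modcat D).
Local Notation FM := (pullback F M).
Variables (R : functor D C) (aR : adjunction F R) (RR : functor C D) (aRR : adjunction R RR).
Variables (t : hom (unitc D) (chi RR)) (tP : chi_trivialization aR aRR t).
Variables (SD : serre M) (SC : serre FM).
Variables (pC : pivotal C) (pD : pivotal D).

Lemma pb_pivotal (pt : forall m : M, hom m (SD m)) : pivotal_functor F pC pD -> pivotal_structure pD pt ->
  @pivotal_structure k C FM SC pC (fun m => pb_comp aR aRR t (serre_td SD) (serre_td SC) m ∘ pt m).
Proof.
move=> Fp [p1 p2 p3]; split=> [m|m n f|c m].
- by apply: (@is_iso_comp k M); [exact: (pb_comp_iso tP (serre_td SD) (serre_td SC) m)|exact: p1].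
- have E (x y x' y' z z' : M) (j2 : hom y y') (j1 : hom x x') (u : hom x y) (v : hom x' y') (p1' : hom z x) (p2' : hom z' y) (g : hom z z') :
      j2 ∘ u = v ∘ j1 -> p2' ∘ g = u ∘ p1' -> j2 ∘ p2' ∘ g = v ∘ (j1 ∘ p1').
    by move=> e1 e2; rewrite -compA e2 compA e1 compA.
  exact: (E _ _ _ _ _ _ _ _ _ _ _ _ _ (pb_comp_nat aR aRR t (serre_td SD) (serre_td SC) f) (p2 _ _ f)).
- have hD := serre_twistP SD (F c) m; have hC := serre_twistP SC c m.
  have e := pb_comp_twist tP hD hC.
  (* Pivotality of F, solved for the pivotal structure at F c; its factor [tf_rdual2] is the one
     that occurs in [pb_comp_twist]. *)
  have ep : pD (F c) = tf_rdual2 F c ∘ fmor F (pC c).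
    by rewrite /tf_rdual2 -compA -Fp compA hinvK ?comp1m //; apply: rdualm_iso; exact: tf_rdual_iso.
  have E (x x' y y' z : M) (a b b' : D) (j1 : hom y y') (tw : hom (b ▷ x) y) (twC : hom (b' ▷ x') y')
      (j2 : hom x x') (xi : hom b' b) (q : hom a b') (p' : hom z x) :
      j1 ∘ tw ∘ (xi ▶ idm x) = twC ∘ (idm b' ▶ j2) ->
      j1 ∘ (tw ∘ ((xi ∘ q) ▶ idm x) ∘ (idm a ▶ p')) = twC ∘ (q ▶ idm x') ∘ (idm a ▶ (j2 ∘ p')).
    by move=> e1; rewrite actMl !compA e1 -!compA -!actmM !(comp1m, compm1).
  have e3 := p3 (F c) m; rewrite ep in e3.
  have e4 := E _ _ _ _ _ _ _ _ _ _ _ _ _ (fmor F (pC c)) (pt m) e; rewrite -e3 in e4.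
  by apply: etrans e4 _; rewrite /= /pb_actm fmor1.
Qed.
End PivotalTransport.

Theorem pullback_pivotal k (C D : ftcat k) (F : tfunctor C D) (M : modcat D) (pC : pivotal C) (pD : pivotal D) :
  pivotal_module pD M -> perfect F -> pivotal_functor F pC pD -> tensor_frobenius F ->
  pivotal_module pC (pullback F M).
Proof.
move=> [Me [SD [pt pP]]] Fp Fpiv Ff; have FMe := pullback_exact Me Fp; split=> //.
have [R [aR [RR [aRR [t tP]]]]] := tensor_frobenius_trivialization Ff.
by exists (serre_exists FMe); exact: ex_intro (pb_pivotal tP (serre_exists FMe) Fpiv pP).
Qed.

(** * The module Radford isomorphism *)

Section NakfamCompare.
Variables (k : fieldType) (D : ftcat k) (M : modcat D) (T : trdata M) (K K' : modfun M).
Variables (W : nakfam T K) (W' : nakfam T K').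

Lemma ns_ext (x y z : M) (N : nakstr x y) (g h : hom y z) :
  (forall n (p : {scalar hom x n}), g ∘ ns_in N p = h ∘ ns_in N p) -> g = h.
Proof. exact: (@nr_ext _ _ _ (nakr_of N)). Qed.

(** The objectwise comparisons of coends are natural and D-linear, because both families satisfy the
    same compatibilities on inclusions. *)
Lemma nakfam_compare : exists s : modnat K K', (forall x, is_iso (s x)) /\
  forall x n (p : {scalar hom (T x) n}), s x ∘ ns_in (W x) p = ns_in (W' x) p.
Proof.
have ex x : exists h : hom (K x) (K' x), is_iso h /\ forall n (p : {scalar hom (T x) n}), h ∘ ns_in (W x) p = ns_in (W' x) p.
  exact: (nakr_iso_exists (nakr_of (W x)) (nakr_of (W' x))).
pose h x := sval (cid (ex x)); have hP x := svalP (cid (ex x)).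
have hi x : is_iso (h x) by case: (hP x).
have hE x n (p : {scalar hom (T x) n}) : h x ∘ ns_in (W x) p = ns_in (W' x) p by case: (hP x) => _; apply.
clearbody h; clear hP.
have h1 x x' (f : hom x x') : h x' ∘ fmor K f = fmor K' f ∘ h x.
  apply: (ns_ext (N := W x)) => n p.
  pose q := spull (@compPlr k M _ _ (fmor T f) n) p.
  have hq v : q v = p (v ∘ fmor T f) := spullE _ _ _.
  by rewrite -!compA (nf_nat W hq) !hE (nf_nat W' hq).
have h2 d x : mf_str K' d x ∘ h (d ▷ x) = (idm d ▶ h x) ∘ mf_str K d x.
  apply: (ns_ext (N := W (d ▷ x))) => n p.
  have tP a (u v : hom (T x) (d^v ▷ n)) : twist_transpose (a *: u + v) = a *: twist_transpose u + twist_transpose v.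
    rewrite /twist_transpose /adjr fmorP compPl compPr.
    exact: (@adjlP _ _ _ _ _ (trev_adj T (d ▷ x)) (dual_one M) _ a).
  pose q := spull tP p.
  have [tw htw] := twist_exists T d x.
  have hq v w : w ∘ tw = aev (rdp d^v) n ∘ (idm d^v^v ▶ v) -> q v = p w.
    move=> e; rewrite /q spullE; congr (p _); apply: (iso_cancel (twist_iso htw)).
    by rewrite e (twist_transposeP _ htw).
  by rewrite -!compA hE (nf_act W' htw hq) (nf_act W htw hq) compA -actMr hE.
by exists (ModNat h1 h2).
Qed.
End NakfamCompare.

Section DualSerre.
Variables (k : fieldType) (D : ftcat k) (M : modcat D) (S : serre M).
Local Notation H := (sr_hom S).
Local Notation Sb := (sr_inv S).
Local Notation T := (serre_td S).
Local Notation eta := (aunit (sr_adj S)).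
Implicit Types (m n x : M) (G K : modfun M).

(** Makes H(Sb m,-) ▷ n an internal Hom over the dual category: evaluation at m is evaluation at S
    (Sb m) up to the unit, and the latter is left adjoint to H(Sb m,-) ▷ -. *)
Definition dser_ev m n : hom (H (Sb m) m ▷ n) n :=
  ihact_counit' T (Sb m) n ∘ (ipost H (Sb m) (eta m) ▶ idm n).

Lemma dser_ev_adj m n G (w : modnat G (ihact H (Sb m) n)) :
  dser_ev m n ∘ w m = adjl (trev_adj T (Sb m)) (w : @hom k (modend M) _ _) ∘ fmor G (eta m).
Proof.
rewrite /dser_ev -compA -(mn_nat w (eta m)) compA.
by congr (_ ∘ _).
Qed.

Lemma dser_univ m n G : bij (fun w : modnat G (ihact H (Sb m) n) => dser_ev m n ∘ w m).
Proof.
refine (eq_bij _ (bij_comp (iso_bijr n (fmor_iso G (sr_unit_iso S m))) (adjl_bij (trev_adj T (Sb m)) G n))).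
exact: dser_ev_adj.
Qed.

Definition ihact_dual_ihom m n : dual_ihom m n :=
  @DualIHom k D M m n (ihact H (Sb m) n) (dser_ev m n) (fun G f => bij_uniq f (dser_univ m n G)).

Lemma mf_acoev (d d' : D) (dp : dualpair d d') G x :
  (idm d ▶ mf_str G d' x) ∘ mf_str G d (d' ▷ x) ∘ fmor G (acoev dp x) = acoev dp (G x).
Proof.
rewrite /acoev -!lock !fmorM !compA -mf_ass -!compA; congr (_ ∘ _).
rewrite compA mf_nat fmor1 -compA; congr (_ ∘ _).
rewrite fmor_hinv; last exact: munit_iso.
apply: (iso_cancel (fmor_iso G (munit_iso x))); rewrite -compA hinvK ?compm1; last by apply: fmor_iso; exact: munit_iso.
by rewrite -mf_unit compA hinvK ?comp1m //; exact: munit_iso.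
Qed.

Section Arbitrary.
Variables (m n : M) (A : dual_ihom m n).

Lemma dual_ihomE_adj x :
  adjl (act_adj M (ldp (H x m))) (dual_ihomE S A x) = dh_ev A ∘ mev H A x m.
Proof.
rewrite -[RHS](adjrK (act_adj M (ldp (H x m)))); congr (adjl _ _).
rewrite /adjr /= /dual_ihomE mevE.
have -> : (idm (ldual (H x m)) ▶ ih_ev (H x m)) ∘ mass _ _ x ∘ (lcoev (H x m) ▶ idm x) ∘ hinv (munit x)
   = (idm _ ▶ ih_ev (H x m)) ∘ acoev (ldp (H x m)) x by rewrite /acoev -lock !compA.
rewrite -(mf_acoev (ldp (H x m)) A x) !fmorM !actMr -!compA; congr (_ ∘ _).
rewrite compA -[X in X ▶ fmor _ _]/(idm _) mf_nat -!compA; congr (_ ∘ _).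
by rewrite !compA -actMr hinvK ?actm1 ?comp1m //; exact: mf_iso.
Qed.

Lemma dual_ihom_compare : exists th : modnat (ihact H (Sb m) n) A,
  @is_iso k (modend M) _ _ th /\ dh_ev A ∘ th m = dser_ev m n.
Proof.
have [th [hth _]] := @dh_univ _ _ _ _ _ A (ihact H (Sb m) n) (dser_ev m n).
have [ht [hht _]] := dh_univ (ihact_dual_ihom m n) (dh_ev A).
exists th; split=> //; exists ht; split.
  by apply: (bij_inj (dser_univ m n _)); rewrite /= compA hht hth compm1.
have [i [_ iU]] := dh_univ A (dh_ev A).
have e1 : i = modnat_id A by apply: iU; rewrite /= compm1.
have e2 : i = modnat_comp th ht by apply: iU; rewrite /= compA hth hht.
by apply: etrans (esym e2) e1.
Qed.

(** Identifies the unit in the definition of [nakr_dual_serre] with the explicit unit of the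
    enriched Yoneda adjunction at Sb m, for an arbitrary choice of internal Hom A. *)
Lemma dual_serre_unitE (th : modnat (ihact H (Sb m) n) A) :
  @is_iso k (modend M) _ _ th -> dh_ev A ∘ th m = dser_ev m n ->
  dual_serre_unit S A = th (Sb m) ∘ ihact_unit H (Sb m) n.
Proof.
move=> thi hth.
(* Transposed along the left dual of H(Sb m, m), the isomorphism [dual_ihomE] becomes the pairing
   given by the trace, so the defining equation can be solved by perfectness of that pairing. *)
have key v : adjl (act_adj M (ldp (H (Sb m) m))) (dual_ihomE S A (Sb m) ∘ (th (Sb m) ∘ v))
   = aev (trpair T (Sb m) (Sb m)) n ∘ (ipost H (Sb m) (eta m) ▶ v).
  rewrite adjl_natl dual_ihomE_adj [fmor _ _]actMr -compA (compA (mev _ _ _ _)).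
  have -> : mev H A (Sb m) m ∘ (idm (H (Sb m) m) ▶ th (Sb m)) = _ := esym (mev_nat H th (Sb m) m).
  rewrite -compA (compA (dh_ev A)) hth.
  rewrite mev_ihact /dser_ev /ihact_counit' aev_trpair -[RHS]compA hmass_pre !compA -!(compA (munit n)) -!actMl.
  by rewrite -(compA (td_tr T _) (icomp _ _ _ _)) icomp_postl !compA.
have inj e : injective (fun v : hom e (ihact H (Sb m) n (Sb m)) => aev (trpair T (Sb m) (Sb m)) n ∘ (ipost H (Sb m) (eta m) ▶ v)).
  move=> v v'; rewrite /= (acti' _ v) (acti' _ v') !compA => h.
  have pi : is_iso (ipost H (Sb m) (eta m) ▶ idm e).
    by apply: is_iso_actm; [exact: (fmor_iso (ihF H (Sb m)) (sr_unit_iso S m))|exact: is_iso_id].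
  exact: (adjl_inj (a := act_adj M (trpair T (Sb m) (Sb m))) (iso_cancel pi h)).
have base : adjl (act_adj M (ldp (H (Sb m) m)))
     ((lcurry (serre_tr S (Sb m) ∘ ipost H (Sb m) (eta m) ∘ runit _) ▶ idm n) ∘ hinv (munit n))
   = aev (trpair T (Sb m) (Sb m)) n ∘ (ipost H (Sb m) (eta m) ▶ ihact_unit H (Sb m) n).
  rewrite /adjl /= actMr /ihact_unit -[ipost _ _ _ in RHS]compm1 actmM !compA.
  congr (_ ∘ _).
  rewrite (aev_trpair T) /aev -lock.
  change (td_tr T (Sb m)) with (serre_tr S (Sb m)); move: (serre_tr S (Sb m)) => tr.
  have lk : dp_ev (ldp (H (Sb m) m)) ∘ (idm _ ⊠ lcurry (tr ∘ ipost H (Sb m) (eta m) ∘ runit _)) = _ := lcurryK _.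
  move: (lcurry _) lk => l lk.
  rewrite -!compA !hmass_nat !compA -!(compA (munit n)) -!actMl lk; congr (_ ∘ ((_ ▶ _) ∘ _)).
  by rewrite -(compA tr (icomp _ _ _ _)) (tensi (ipost _ _ _)) (compA (icomp _ _ _ _)) icomp_postl -(compA (ipost _ _ _)) icomp_iidr compA.
have ui : is_iso (th (Sb m)) := modnat_isoP (Sb m) thi.
apply: the_morE => [|g hg].
  by apply: (adjl_inj (a := act_adj M (ldp (H (Sb m) m)))); rewrite key base.
have -> : g = th (Sb m) ∘ (hinv (th (Sb m)) ∘ g) by rewrite compA hinvV // comp1m.
congr (_ ∘ _); apply: inj; rewrite -key (compA (th (Sb m))) hinvV // comp1m hg base.
by [].
Qed.
End Arbitrary.

(** The second half of the Radford isomorphism, evaluated on coend inclusions: it is the Nakayama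
    structure at Sb m, moved from S (Sb m) to m along the unit. *)
Lemma nakr_dual_serreP (AA : forall m n : M, dual_ihom m n) (E : nakr (dual_one M)) m (Nm : nakr m) :
  is_iso (nakr_dual_serre S AA E Nm) /\ forall n (f : {scalar hom m n}) (p : {scalar hom (T (Sb m)) n}), (forall v, p v = f (v ∘ eta m)) ->
    nakr_dual_serre S AA E Nm ∘ nr_in Nm f = ns_in (nakfam_str (serre_surj S) E (Sb m)) p.
Proof.
have ei := sr_unit_iso S m.
pose W := nakfam_str (serre_surj S) E (Sb m).
have [h [hi hh]] := nakr_iso_exists Nm (nakr_of (nakstr_src (is_iso_hinv ei) W)).
have hE n (f : {scalar hom m n}) (p : {scalar hom (T (Sb m)) n}) : (forall v, p v = f (v ∘ eta m)) ->
    h ∘ nr_in Nm f = ns_in W p.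
  move=> e; rewrite hh; congr (ns_in W _); apply: scalar_ext => v.
  by rewrite spullE e hinv_hinv.
have prop y (f : {scalar hom m y}) (g : {scalar @hom k (modend M) (dual_one M) (AA m y)}) :
    (forall w : modnat (modfun_id M) (AA m y), g w = f (dh_ev (AA m y) ∘ w m)) ->
    h ∘ nr_in Nm f = (nr_in E g : modnat _ _) (Sb m) ∘ dual_serre_unit S (AA m y).
  move=> e; have [th [thi hth]] := dual_ihom_compare (AA m y).
  rewrite (dual_serre_unitE thi hth).
  pose p := spull (@compPlr k M _ _ (eta m) y) f.
  rewrite (hE _ _ p) => [|v]; last exact: spullE.
  have e2 : @comp k (modend M) _ _ _ (nr_in E g) th = nr_in E (spull (@adjlP _ _ _ _ _ (trev_adj T (Sb m)) (dual_one M) y) p).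
    apply: nr_in_nat => w; rewrite !spullE e /= compA hth; congr (f _).
    apply: etrans _ (esym (dser_ev_adj (m := m) (n := y) w)); by [].
  have -> : ns_in W p = (nr_in E (spull (@adjlP _ _ _ _ _ (trev_adj T (Sb m)) (dual_one M) y) p) : modnat _ _) (Sb m) ∘ ihact_unit H (Sb m) y by [].
  by rewrite -e2 /= -compA.
have -> : nakr_dual_serre S AA E Nm = h.
  apply: the_morE => [y f g e|g hg]; first exact: prop.
  apply: nr_ext => y f.
  have P a (u v : @hom k (modend M) (dual_one M) (AA m y)) : dh_ev (AA m y) ∘ mn_fun (a *: u + v) m
     = a *: (dh_ev (AA m y) ∘ mn_fun u m) + dh_ev (AA m y) ∘ mn_fun v m.
    by rewrite /= !scale1r addr0 compPr.
  by rewrite (hg y f (spull P f)) ?(prop y f (spull P f)) // => w; rewrite spullE.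
by split.
Qed.
End DualSerre.

Lemma tev_one k (C : moncat k) (c c' : C) (dp : dualpair c c') : tev dp (unitc C) = dp_ev dp ∘ (idm c' ⊠ runit c).
Proof.
rewrite /tev -lock lunit_runit1 runit_nat -runit_tens -!compA hinvV ?compm1 //.
exact: assoc_iso.
Qed.

Section SerreCounit.
Variables (k : fieldType) (D : ftcat k) (M : modcat D) (S : serre M).
Local Notation H := (sr_hom S).
Local Notation T := (serre_td S).
Implicit Types (c d : D) (m n : M).

Lemma ipost_aev d d' (dp : dualpair d d') m n :
  ipost H m (aev dp n) ∘ istr H d' m (d ▷ n) ∘ (idm d' ⊠ istr H d m n) = tev dp (H m n).
Proof.
apply: (iunc_inj (H := H)); rewrite -compA iunc_post iunc_istr istr1 actMr !compA -aev_nat.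
rewrite -(compA _ (aev _ _)) aev_mass -!compA hinvK ?compm1; last exact: mass_iso.
by rewrite iuncE.
Qed.

(* The counit of the adjunction between Hom(m, -) and - ▷ S m. *)
Definition serre_e m d : hom (H m (d ▷ S m)) d :=
  locked (runit d ∘ (idm d ⊠ serre_tr S m) ∘ hinv (istr H d m (S m))).

Lemma serre_eE m d : serre_e m d = runit d ∘ (idm d ⊠ serre_tr S m) ∘ hinv (istr H d m (S m)).
Proof. by rewrite /serre_e -lock. Qed.

(** Dualise d: Hom(n, d ▷ S m) = Hom(d^∨ ▷ n, S m) = Hom(H(m, d^∨ ▷ n), 1) = Hom(d^∨ ⊗ H(m,n), 1) =
    Hom(H(m,n), d). *)
Lemma serre_e_bij m n d : bij (fun g : hom n (d ▷ S m) => serre_e m d ∘ ipost H m g).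
Proof.
have key (g : hom n (d ▷ S m)) : rev d ∘ (idm d^v ⊠ (serre_e m d ∘ ipost H m g))
    = serre_tr S m ∘ ipost H m (adjl (act_adj M (rdp d)) g) ∘ istr H d^v m n.
  have e := ipost_aev (rdp d) m (S m).
  rewrite /adjl /= serre_eE; move: (serre_tr S m) => tr; rewrite ipostM -!compA -istr_nat.
  have -> : ipost H m (aev (rdp d) (S m)) ∘ (istr H d^v m (d ▷ S m) ∘ (idm d^v ⊠ ipost H m g))
     = tev (rdp d) (H m (S m)) ∘ (idm d^v ⊠ (hinv (istr H d m (S m)) ∘ ipost H m g)).
    rewrite -e -!compA -tensMr (compA (istr H d m _)) hinvV ?comp1m //; exact: istr_iso.
  rewrite (compA tr) tev_nat tev_one /=.
  by rewrite -!compA -!tensMr !compA.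
have b1 := bij_comp (iso_bijr (unitc D) (istr_iso H d^v m n)) (bij_comp (td_universal T m (d^v ▷ n)) (adjl_bij (act_adj M (rdp d)) n (S m))).
have b2 := pair_bijl (rdp d) (H m n).
apply: bijI => [g g' /= e|f].
  by apply: (bij_inj b1); rewrite /= -!key e.
have [g hg] := bij_surj (rev d ∘ (idm _ ⊠ f)) b1; exists g; apply: (bij_inj b2).
by apply: etrans (key g) hg.
Qed.

Lemma serre_e_nat m c d (f : hom c d) : f ∘ serre_e m c = serre_e m d ∘ ipost H m (f ▶ idm (S m)).
Proof.
have e : hinv (istr H d m (S m)) ∘ ipost H m (f ▶ idm (S m)) = (f ⊠ idm _) ∘ hinv (istr H c m (S m)).
  apply: hinv_nat; [exact: istr_iso..|].
  by rewrite -istr_nat ipost1.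
rewrite !serre_eE; move: (serre_tr S m) => tr.
by rewrite -[in RHS]compA e !compA -runit_nat -!(compA (runit d)) -tensi -tensi'.
Qed.

Let V m := univ_functor (fun n d => serre_e_bij m n d : bij (fun g => serre_e m d ∘ fmor (ihF H m) g)).
Let b m : adjunction (ihF H m) (V m) := univ_adj (fun n d => serre_e_bij m n d : bij (fun g => serre_e m d ∘ fmor (ihF H m) g)).

Let VE m c d (f : hom c d) : fmor (V m) f = f ▶ idm (S m).
Proof.
apply: (bij_inj (serre_e_bij m _ d)); rewrite -serre_e_nat.
exact: (esym (acounit_nat (b m) f)).
Qed.

Let c m : adjunction (V m) (ihF H (S m)).
Proof.
refine (@adj_natiso k D M (actL (S m)) (V m) (ihF H (S m)) (fun d => idm (d ▷ S m)) _ _ (ih_adj H (S m))).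
- by move=> d; exact: is_iso_id.
- by move=> x y f; rewrite VE comp1m compm1.
Defined.

(** The first half of the Radford isomorphism on coend inclusions. As postcomposition into E ▷ S m
    is detected by [serre_e] ([serre_e_bij]), the equation determines it. *)
Lemma nakr_serreP (E : nakr (unitc D)) m (Nm : nakr m) :
  is_iso (nakr_serre S E Nm) /\
  forall n (f : {scalar hom m n}) (g : {scalar hom (unitc D) (H m n)}),
    (forall w, g w = f (iunc w ∘ hinv (munit m))) ->
    serre_e m E ∘ ipost H m (nakr_serre S E Nm ∘ nr_in Nm f) = nr_in E g.
Proof.
have mi := munit_iso m.
pose al n (w : hom (unitc D) (H m n)) := ih_ev (H m n) ∘ (w ▶ idm m) ∘ hinv (munit m).
pose ar n (w : hom m n) : hom (unitc D) (H m n) := icurry H (w ∘ munit m).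
have alE n w : al n w = iunc w ∘ hinv (munit m) by rewrite /al iuncE.
have alK n : cancel (al n) (ar n).
  by move=> w; rewrite alE /ar -compA hinvK // compm1 iuncK.
have arK n : cancel (ar n) (al n).
  by move=> w; rewrite alE /ar icurryK -compA hinvV // compm1.
have alP n a u v : al n (a *: u + v) = a *: al n u + al n v.
  by rewrite /al actmPl compPr compPl.
have al_nat y z (f : hom y z) w : al z (fmor (ihF H m) f ∘ w) = f ∘ al y w.
  by rewrite !alE iunc_post compA.
pose can n (h : hom (H m n) E) := the_mor (fun g : hom n (E ▷ S m) =>
       runit E ∘ (idm E ⊠ serre_tr S m) ∘ hinv (istr H E m (S m)) ∘ ipost H m g = h).
have bE n (h : hom (H m n) E) : serre_e m E ∘ ipost H m (adjr (b m) h) = h := adjrK (b m) h.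
have canE n (h : hom (H m n) E) : can n h = fmor (V m) h ∘ aunit (b m) n.
  rewrite /can -serre_eE; apply: the_morE => [|g hg]; first exact: bE.
  by apply: (bij_inj (serre_e_bij m n E)); rewrite hg [RHS]bE.
have [h1 h2] := nak_mateP (b := b m) (c m) alK arK alP al_nat Nm canE.
split=> [|n f g e]; first exact: h1.
rewrite h2 /mate_in.
apply: etrans (bE n _) _; congr (nr_in E _); apply: scalar_ext => w; by rewrite spullE e alE.
Qed.
End SerreCounit.

Section NakayamaRight.
Variables (k : fieldType) (C D : ftcat k) (F : tfunctor C D).
Variables (R : functor D C) (aR : adjunction F R) (RR : functor C D) (aRR : adjunction R RR).
Variables (t : hom (unitc D) (chi RR)) (tP : chi_trivialization aR aRR t).
Local Notation iota := (frob_iota aR aRR t).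

Lemma frob_iota_nat (x y : C) (f : hom x y) : iota y ∘ fmor F f = fmor RR f ∘ iota x.
Proof.
apply: (adjl_inj (a := aRR)); rewrite adjl_natl adjl_natr.
by have := frob_mate_nat aR aRR t f; rewrite /frob_mate -!lock.
Qed.

Let c : adjunction RR R.
Proof.
refine (@adj_natiso k C D F RR R (fun x => hinv (iota x)) _ _ aR).
- by move=> x; apply: is_iso_hinv; exact: frob_iota_iso.
- move=> x y f; apply: hinv_nat; [exact: frob_iota_iso..|exact: frob_iota_nat].
Defined.

Lemma nakr_rraP (EC : nakr (unitc C)) (ED : nakr (unitc D)) :
  is_iso (nakr_rra aR aRR EC ED) /\
  forall a (f : {scalar hom (unitc D) a}) (g : {scalar hom (unitc C) (R a)}),
    (forall w, g w = f (adjl aR w ∘ tf_one F)) ->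
    nakr_rra aR aRR EC ED ∘ nr_in ED f = adjr aRR (nr_in EC g).
Proof.
have oi := tf_one_iso F.
pose al a (w : hom (unitc C) (R a)) := acounit aR a ∘ fmor F w ∘ tf_one F.
pose ar a (w : hom (unitc D) a) := adjr aR (w ∘ hinv (tf_one F)).
have alK a : cancel (al a) (ar a).
  by move=> w; rewrite /al /ar -compA hinvV // compm1; exact: adjlK.
have arK a : cancel (ar a) (al a).
  by move=> w; rewrite /al -/(adjl aR _) /ar adjrK -compA hinvK // compm1.
have alP a x u v : al a (x *: u + v) = x *: al a u + al a v.
  by rewrite /al fmorP compPr compPl.
have al_nat y z (f : hom y z) w : al z (fmor R f ∘ w) = f ∘ al y w.
  by rewrite /al -!/(adjl aR _) adjl_natr !compA.
pose can y (h : hom (R y) EC) := fmor RR h ∘ aunit aRR y.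
have canE y h : can y h = fmor RR h ∘ aunit aRR y by [].
have [h1 h2] := nak_mateP (b := aRR) c alK arK alP al_nat ED canE.
split=> [|a f g e]; first exact: h1.
apply: etrans (h2 a f) _; rewrite /mate_in /adjr; congr (fmor RR (nr_in EC _) ∘ _).
by apply: scalar_ext => w; rewrite spullE e.
Qed.
End NakayamaRight.

Section NakayamaSerreCompare.
Variables (k : fieldType) (C D : ftcat k) (F : tfunctor C D) (M : modcat D).
Local Notation FM := (pullback F M).
Variables (R : functor D C) (aR : adjunction F R) (RR : functor C D) (aRR : adjunction R RR).
Variables (t : hom (unitc D) (chi RR)) (tP : chi_trivialization aR aRR t).
Variables (SD : serre M) (SC : serre FM).
Local Notation HD := (sr_hom SD).
Local Notation HC := (sr_hom SC).
Local Notation jj := (pb_comp aR aRR t (serre_td SD) (serre_td SC)).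
Local Notation kap := (pb_kappa HD HC).
Local Notation hat := (frob_hat aR aRR t).
Variables (EC : nakr (unitc C)) (ED : nakr (unitc D)).

(** The isomorphism N^r_D(1) = F(N^r_C(1)); [transport_one] is F(u) followed by its inverse. *)
Definition nak_beta : hom ED (F EC) := hinv (frob_iota aR aRR t EC) ∘ nakr_rra aR aRR EC ED.

(** The counit over C is the hat of the counit over D. This extends the definition of [pb_comp] from
    traces to all coefficients F c, by left linearity of hat. *)
Lemma serre_e_hat (c : C) m n (g : @hom k M n (F c ▷ SD m)) :
  serre_e SC m c ∘ ipost HC m ((idm (F c) ▶ jj m) ∘ g : @hom k FM _ _)
  = hat (serre_e SD m (F c) ∘ ipost HD m g ∘ kap m n).
Proof.
have e1 : hinv (istr HC c m (SC m)) ∘ ipost HC m (idm c ▶ (jj m : @hom k FM _ _))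
     = (idm c ⊠ ipost HC m (jj m : @hom k FM _ _)) ∘ hinv (istr HC c m (SD m)).
  by apply: hinv_nat; [exact: istr_iso..|rewrite -istr_nat].
have e2 := pb_kappa_istr HD HC c m (SD m).
have ii := istr_iso HC c m (SD m); have iD := istr_iso HD (F c) m (SD m).
have e3 : (idm _ ⊠ kap m (SD m)) ∘ hinv (tf_mul F c (HC m (SD m))) ∘ fmor F (hinv (istr HC c m (SD m)))
   = hinv (istr HD (F c) m (SD m)) ∘ kap m (F c ▷ SD m).
  apply: (iso_cancell iD); rewrite !compA -e2 hinvV // comp1m -compA -fmorM hinvV // fmor1 compm1.
  by [].
have e4 := pb_compP aR aRR t (serre_td SD) (serre_td SC) m.
have e5 : @comp k M _ _ _ (idm (F c) ▶ jj m) g = @comp k FM _ _ _ (idm c ▶ (jj m : @hom k FM _ _)) g.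
  by rewrite /= /pb_actm fmor1.
rewrite e5 (@ipostM _ _ FM HC) !serre_eE.
have e4' : serre_tr SC m ∘ ipost HC m (jj m : @hom k FM _ _) = hat (tf_one F ∘ (serre_tr SD m ∘ kap m (SD m))) := e4.
move: (serre_tr SC m) (serre_tr SD m) e4' => trC trD {}e4.
rewrite -!compA (compA (hinv (istr HC c m (SC m)))) e1 -!compA (compA (idm c ⊠ trC)) -tensMr e4.
rewrite -frob_hat_mul // -frob_hat_natr -frob_hat_natl //; congr (hat _).
rewrite !tensMr !fmorM !compA tf_runit -(compA _ (idm _ ⊠ kap _ _)) -(compA _ (_ ∘ _) (fmor F (hinv _))) e3.
by rewrite -!compA pb_kappa_post.
Qed.

Lemma pb_munit_hinv (m : M) : (@hinv k FM _ _ (pb_munit F m) : @hom k M _ _) = (tf_one F ▶ idm m) ∘ hinv (munit m).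
Proof.
have i1 := munit_iso m; have i2 := tf_one_iso F.
have i3 : is_iso (hinv (tf_one F) ▶ idm m) by apply: is_iso_actm; [exact: is_iso_hinv|exact: is_iso_id].
have -> : tf_one F ▶ idm m = hinv (hinv (tf_one F) ▶ idm m).
  by rewrite act_hinv ?hinv1 ?hinv_hinv //; [exact: is_iso_hinv|exact: is_iso_id].
exact: (@hinv_comp k M).
Qed.

(** Both sides are tested on coend inclusions by the counit over C; [serre_e_hat] turns this into
    the hat of the counit over D, where [nakr_serreP] and [nakr_rraP] evaluate it. *)
Lemma nakr_serre_compare (m : M) (Nm : @nakr k M m) :
  nakr_serre SC EC (Nm : @nakr k FM m) = (nak_beta ▶ jj m) ∘ nakr_serre SD ED Nm.
Proof.
have [_ sP] := nakr_serreP SD ED Nm.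
have [_ rP] := nakr_rraP tP EC ED.
have ii := frob_iota_iso tP EC.
have key n (f : {scalar @hom k M m n}) (g : {scalar hom (unitc C) (HC m n)}) :
    (forall w : hom (unitc C) (HC m n), g w = f (@comp k M _ _ _ (iunc w) (@hinv k FM _ _ (pb_munit F m)))) ->
    serre_e SC m EC ∘ ipost HC m ((nak_beta ▶ jj m) ∘ (nakr_serre SD ED Nm ∘ nr_in Nm f) : @hom k FM _ _) = nr_in EC g.
  move=> e.
  have P a (u v : hom (unitc D) (HD m n)) : iunc (a *: u + v) ∘ hinv (munit m) = a *: (iunc u ∘ hinv (munit m)) + iunc v ∘ hinv (munit m).
    by rewrite !iuncE actmPl compPr compPl.
  pose gD := spull P f.
  have {}sP := sP n f gD (fun w => spullE P f w).
  have P2 a (u v : hom (unitc C) (R (HD m n))) : adjl aR (a *: u + v) ∘ tf_one F = a *: (adjl aR u ∘ tf_one F) + adjl aR v ∘ tf_one F.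
    by rewrite adjlP compPl.
  pose gR := spull P2 gD.
  have {}rP := rP _ gD gR (fun w => spullE P2 gD w).
  rewrite acti' -compA serre_e_hat ipostM (compA (serre_e SD m _)) -serre_e_nat -(compA nak_beta) sP.
  rewrite frob_hatE frob_mateE.
  have e2 : frob_iota aR aRR t EC ∘ nak_beta = nakr_rra aR aRR EC ED by rewrite /nak_beta compA hinvV // comp1m.
  move: nak_beta e2 => be e2; rewrite -(compA (acounit _ _)) -fmorM !compA e2 rP.
  rewrite fmorM compA -/(adjl aRR _) adjrK -compA; apply: nr_in_nat => w.
  rewrite !spullE e adjl_natl; congr (f _).
  have e3 : adjl aR (fmor R (kap m n) ∘ aunit aR (HC m n)) = kap m n := adjrK aR _.
  by rewrite e3 iunc_nat pb_kappaP pb_munit_hinv !compA.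
have prop n (f : {scalar @hom k M m n}) (g : {scalar hom (unitc C) (HC m n)}) :
    (forall w : hom (unitc C) (HC m n), g w = f (ih_ev (HC m n) ∘ (w ▶ idm (m : FM)) ∘ @hinv k FM _ _ (munit (m : FM)))) ->
    (nak_beta ▶ jj m) ∘ nakr_serre SD ED Nm ∘ nr_in Nm f
    = the_mor (fun g' : @hom k FM n (EC ▷ SC m) =>
        runit EC ∘ (idm EC ⊠ serre_tr SC m) ∘ hinv (istr HC EC m (SC m)) ∘ ipost HC m g' = nr_in EC g).
  move=> e; have k1 := key n f g (fun w => etrans (e w) (congr1 (fun u => f (@comp k M _ _ _ u _)) (esym (iuncE w)))).
  rewrite -(@compA k M) -serre_eE; apply/esym/the_morE => [|g' hg']; first exact: k1.
  by apply: (bij_inj (serre_e_bij SC m n EC)); rewrite hg' -k1.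
apply: the_morE => [n f g e|h hh]; first exact: prop.
apply: (@nr_ext k FM m Nm) => n f.
have P a (u v : hom (unitc C) (HC m n)) : ih_ev (HC m n) ∘ ((a *: u + v) ▶ idm (m : FM)) ∘ @hinv k FM _ _ (munit (m : FM))
   = a *: (ih_ev (HC m n) ∘ (u ▶ idm (m : FM)) ∘ @hinv k FM _ _ (munit (m : FM))) + ih_ev (HC m n) ∘ (v ▶ idm (m : FM)) ∘ @hinv k FM _ _ (munit (m : FM)).
  by rewrite (@actmPl k C FM) (@compPr k FM) (@compPl k FM).
have E := spullE P f.
by rewrite (hh n f (spull P f)) ?(prop n f (spull P f)).
Qed.
End NakayamaSerreCompare.

(** * Comparison of the two Radford isomorphisms and sphericality *)

Section TransportSpherical.
Variables (k : fieldType) (C D : ftcat k) (F : tfunctor C D) (M : modcat D).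
Local Notation FM := (pullback F M).
Variables (R : functor D C) (aR : adjunction F R) (RR : functor C D) (aRR : adjunction R RR).
Variables (t : hom (unitc D) (chi RR)) (tP : chi_trivialization aR aRR t).
Variables (SD : serre M) (SC : serre FM).
Local Notation HD := (sr_hom SD).
Local Notation HC := (sr_hom SC).
Local Notation jj := (pb_comp aR aRR t (serre_td SD) (serre_td SC)).
Local Notation kap := (pb_kappa HD HC).
Implicit Types (m n x y : M).

Lemma pb_ihom_post m n n' (f : @hom k M n n') :
  pb_ihom aR SD SC m n' ∘ ipost HC m (f : @hom k FM _ _) = fmor R (ipost HD m f) ∘ pb_ihom aR SD SC m n.
Proof.
rewrite /pb_ihom -!/(pb_kappa HD HC _ _) -compA aunit_nat !compA -!fmorM; congr (fmor R _ ∘ _).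
exact: pb_kappa_post.
Qed.

Lemma serre_e_one m : serre_e SD m (unitc D) ∘ ipost HD m (hinv (munit (SD m))) = serre_tr SD m.
Proof.
have mi := munit_iso (SD m); have ii := istr_iso HD (unitc D) m (SD m).
have e : hinv (istr HD (unitc D) m (SD m)) ∘ ipost HD m (hinv (munit (SD m))) = hinv (lunit (HD m (SD m))).
  apply/esym/hinvE; rewrite -(istr_unit HD m (SD m)); split.
    by rewrite -compA (compA (ipost _ _ _) (ipost _ _ _)) -ipostM hinvK // ipost1 comp1m hinvK.
  by rewrite -compA (compA (istr _ _ _ _)) hinvV // comp1m -ipostM hinvV // ipost1.
rewrite serre_eE; move: (serre_tr SD m) => tr.
rewrite -compA e -compA -hlunit_nat compA -lunit_runit1 hinvV ?comp1m //; exact: lunit_iso.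
Qed.

(** [pb_serre_triv] satisfies the equation that characterises [pb_comp]: the trace with coefficients
    in chi, restricted along t, is the hat of the trace of S^D. *)
Lemma pb_serre_trivE m : pb_serre_triv aR aRR t SD SC m = jj m.
Proof.
apply: (@pb_comp_uniq _ _ _ _ _ _ aR _ aRR t (serre_td SD) (serre_td SC) m (pb_serre_triv aR aRR t SD SC m)); rewrite /pb_serre_triv.
pose P (j : @hom k M (chi RR ▷ SD m) (SC m)) := serre_tr SC m ∘ ipost HC m (j : @hom k FM _ _)
    = acounit aRR (unitc C)
        ∘ fmor R (runit _ ∘ (idm (chi RR) ⊠ serre_tr SD m) ∘ hinv (istr HD (chi RR) m (SD m)))
        ∘ pb_ihom aR SD SC m (chi RR ▷ SD m).
have h : P (pb_serre aR aRR SD SC m) by apply: the_morP; exact: (bij_surj _ (td_universal (serre_td SC) m (chi RR ▷ SD m))).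
rewrite /P -serre_eE in h.
have e : serre_e SD m (chi RR) ∘ ipost HD m ((t ▶ idm (SD m)) ∘ hinv (munit (SD m))) = t ∘ serre_tr SD m.
  by rewrite ipostM compA -serre_e_nat -compA serre_e_one.
have e2 := pb_ihom_post m ((t ▶ idm (SD m)) ∘ hinv (munit (SD m))).
rewrite -(@compA k M) (@ipostM _ _ FM HC) compA.
apply: etrans (congr1 (fun u => u ∘ _) h) _.
rewrite -[LHS]compA e2 compA -(compA (acounit _ _)) -fmorM e /pb_tau frob_hat_one // /frob_theta -lock /adjl /pb_ihom -/(pb_kappa HD HC m (SD m)).
change (td_tr (serre_td SD) m) with (serre_tr SD m); move: (serre_tr SD m) => tr.
by rewrite !fmorM !compA.
Qed.

Local Notation psi := (pb_serre_inv aR aRR t SD SC).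
Local Notation etaD := (aunit (sr_adj SD)).
Local Notation etaC := (aunit (sr_adj SC)).

Lemma pb_serre_invE m : psi m = adjl (sr_adj SC) (jj (sr_inv SD m) ∘ etaD m : @hom k FM _ _).
Proof. by rewrite /pb_serre_inv pb_serre_trivE. Qed.

Lemma pb_serre_inv_iso m : is_iso (psi m).
Proof.
rewrite pb_serre_invE /adjl; apply: (@is_iso_comp k FM); first exact: sr_counit_iso.
apply: (@fmor_iso k FM FM); apply: (@is_iso_comp k M); last exact: sr_unit_iso.
exact: (pb_comp_iso tP (serre_td SD) (serre_td SC) _).
Qed.

Lemma pb_serre_inv_unit m : jj (sr_inv SC m) ∘ fmor SD (hinv (psi m)) ∘ etaD m = (etaC m : @hom k M _ _).
Proof.
have pi := pb_serre_inv_iso m; have si := fmor_iso SD pi.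
have e : (fmor SC (psi m : @hom k FM _ _) : @hom k M _ _) ∘ etaC m = jj (sr_inv SD m) ∘ etaD m.
  by rewrite {1}pb_serre_invE; exact: (adjlK (sr_adj SC)).
have n := pb_comp_nat aR aRR t (serre_td SD) (serre_td SC) (psi m).
have sci : @is_iso k M _ _ (fmor SC (psi m : @hom k FM _ _)) := fmor_iso SC (pi : @is_iso k FM _ _ (psi m)).
apply: (iso_cancell sci); rewrite e !compA; congr (_ ∘ _).
rewrite -[X in X ∘ _]n -compA -[fmor _ _ ∘ fmor _ _]fmorM hinvV // fmor1 compm1 //.
Qed.

Variables (AD : forall m n : M, dual_ihom m n) (AC : forall m n : FM, dual_ihom m n).
Variables (N : forall m : M, nakr m).
Variables (EDM : nakr (dual_one M)) (ECM : nakr (dual_one FM)).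

Let W1 := pb_nakfam tP (serre_td SC) (nakfam_of (serre_surj SD) EDM).
Let W2 := nakfam_of (serre_surj SC) ECM.

(** [pb_dual] is defined object by object through N^r of M, which hides its naturality and
    C-linearity. This comparison of Nakayama families has both from the start, and [pb_dual_natP]
    shows that the two coincide. *)
Definition pb_dual_nat : modnat (pb_modfun F (dual_nr EDM)) (dual_nr ECM) := sval (cid (nakfam_compare W1 W2)).

Lemma pb_dual_nat_iso m : is_iso (pb_dual_nat m : @hom k M _ _).
Proof. by have [h _] := svalP (cid (nakfam_compare W1 W2)); exact: h. Qed.

Lemma pb_dual_natE x n (p : {scalar @hom k M (SC x) n}) :
  (pb_dual_nat x : @hom k M _ _) ∘ ns_in (W1 x) p = ns_in (W2 x) p.
Proof. by have [_ h] := svalP (cid (nakfam_compare W1 W2)); exact: h. Qed.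

(** On coend inclusions both halves are Nakayama structures, at the two quasi-inverses of m. They
    match by naturality of the family in x together with [pb_serre_inv_unit]. *)
Lemma nakr_dual_serre_compare m (Nm : @nakr k M m) :
  (nakr_dual_serre SC AC ECM (Nm : @nakr k FM m) : @hom k M _ _)
  = (pb_dual_nat (sr_inv SC m) : @hom k M _ _) ∘ fmor (dual_nr EDM) (hinv (psi m)) ∘ nakr_dual_serre SD AD EDM Nm.
Proof.
have [_ hC] := nakr_dual_serreP SC AC ECM (Nm : @nakr k FM m).
have [_ hD] := nakr_dual_serreP SD AD EDM Nm.
apply: nr_ext => n f.
pose pD := spull (@compPlr k M _ _ (etaD m) n) f.
pose pC := spull (@compPlr k M _ _ (etaC m : @hom k M _ _) n) f.
rewrite -compA (hD n f pD) => [|v]; last exact: spullE.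
apply: etrans (hC n f pC _) _ => [v|]; first exact: spullE.
rewrite -[LHS]pb_dual_natE -[in RHS]compA; congr (_ ∘ _).
pose q := spull (@compPlr k M _ _ (fmor SD (hinv (psi m))) n) pD.
have hq v : q v = pD (v ∘ fmor SD (hinv (psi m))) := spullE _ _ _.
apply: etrans _ (esym (nf_nat (nakfam_of (serre_surj SD) EDM) hq)).
have -> : ns_in (W1 (sr_inv SC m)) pC = ns_in (nakfam_of (serre_surj SD) EDM (sr_inv SC m)) (spull (@compPlr k M _ _ (hinv (jj (sr_inv SC m))) n) pC) by [].
congr (ns_in _ _); apply: scalar_ext => v; rewrite /q !spullE; congr (f _).
have ji := pb_comp_iso tP (serre_td SD) (serre_td SC) (sr_inv SC m).
rewrite -pb_serre_inv_unit; move: (jj _) ji => j ji.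
by rewrite !compA -(compA v) hinvK // compm1.
Qed.

Lemma pb_dual_natP x : (pb_dual_nat x : @hom k M _ _) = pb_dual aR aRR t SD SC AD AC N EDM ECM x.
Proof.
rewrite /pb_dual nakr_dual_serre_compare.
have [di _] := nakr_dual_serreP SD AD EDM (N (SC x)).
have pi := pb_serre_inv_iso (SC x).
have ci : @is_iso k M _ _ (acounit (sr_adj SC) x) := sr_counit_iso SC x.
have n := mn_nat pb_dual_nat (acounit (sr_adj SC) x).
move: (nakr_dual_serre SD AD EDM (N (SC x))) di => nd di.
have e1 : fmor (dual_nr EDM) (hinv (psi (SC x))) ∘ nd ∘ hinv nd ∘ fmor (dual_nr EDM) (psi (SC x)) = idm _.
  by rewrite -(compA _ nd) hinvV // compm1 -fmorM hinvK // fmor1.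
have e2 : (fmor (dual_nr ECM) (acounit (sr_adj SC) x) : @hom k M _ _) ∘ pb_dual_nat (sr_inv SC (SC x))
    = (pb_dual_nat x : @hom k M _ _) ∘ fmor (dual_nr EDM) (acounit (sr_adj SC) x : @hom k M _ _) by exact: esym n.
rewrite !compA e2 -!compA.
have -> : fmor (dual_nr EDM) (hinv (psi (SC x))) ∘ (nd ∘ (hinv nd ∘ (fmor (dual_nr EDM) (psi (SC x)) ∘ fmor (dual_nr EDM) (hinv (acounit (sr_adj SC) x : @hom k M _ _))))) = fmor (dual_nr EDM) (hinv (acounit (sr_adj SC) x : @hom k M _ _)).
  by rewrite !compA e1 comp1m.
by rewrite -fmorM hinvV // fmor1 compm1.
Qed.

Section Structures.
Variables (EC : nakr (unitc C)) (ED : nakr (unitc D)).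
Variables (uC : hom (unitc C) EC) (uM : @hom k (modend M) (dual_one M) EDM).
Hypothesis uMi : is_iso uM.

Lemma pb_unimodular_nat : exists s : @hom k (modend FM) (dual_one FM) ECM,
  is_iso s /\ forall m : M, mn_fun s m = (pb_dual_nat m : @hom k M _ _) ∘ mn_fun uM m.
Proof.
pose s := modnat_comp pb_dual_nat (pb_modnat F uM).
exists (@ModNat k C FM (modfun_id FM) (dual_nr ECM) (fun m => mn_fun s m) (mn_nat s) (mn_mod s)); split=> //.
apply: modnat_iso => m; apply: (@is_iso_comp k M); first exact: pb_dual_nat_iso.
exact: (modnat_isoP (M := M) m uMi).
Qed.

Lemma transport_oneE : transport_one aR aRR t ED uC = hinv (nakr_rra aR aRR EC ED) ∘ frob_iota aR aRR t EC ∘ fmor F uC ∘ tf_one F.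
Proof. by rewrite /transport_one frob_iotaE !compA. Qed.

Variable pt : forall m : M, hom m (SD m).

(** First part of the sphericality composite, m -> S m -> N^r(m). The comparison of Serre functors
    occurs in the pivotal structure and in the Radford isomorphism, and cancels. *)
Lemma pb_theta m :
  hinv (nakr_serre SC EC (N m : @nakr k FM m)) ∘ (uC ▶ idm (SC m)) ∘ hinv (munit (SC m : FM)) ∘ (jj m ∘ pt m : @hom k FM _ _)
  = (hinv (nakr_serre SD ED (N m)) ∘ (transport_one aR aRR t ED uC ▶ idm (SD m)) ∘ hinv (munit (SD m)) ∘ pt m : @hom k M _ _).
Proof.
have [si _] := nakr_serreP SD ED (N m); have [ri _] := nakr_rraP tP EC ED.
have ji := pb_comp_iso tP (serre_td SD) (serre_td SC) m; have ii := frob_iota_iso tP EC.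
have bi : is_iso (nak_beta aR aRR t EC ED ▶ jj m).
  by apply: is_iso_actm => //; apply: is_iso_comp => //; exact: is_iso_hinv.
have E (x y s s' : M) (e e' : D) (nd : hom x (e ▷ s)) (be : hom e e') (j : hom s s') (u : hom (unitc D) e') (p : hom y s) :
    is_iso nd -> is_iso be -> is_iso j ->
    hinv ((be ▶ j) ∘ nd) ∘ (u ▶ idm s') ∘ hinv (munit s') ∘ (j ∘ p)
    = hinv nd ∘ ((hinv be ∘ u) ▶ idm s) ∘ hinv (munit s) ∘ p.
  move=> ndi bei ji'; have bj : is_iso (be ▶ j) by apply: is_iso_actm.
  rewrite hinv_comp // act_hinv // !compA -(compA _ (hinv (munit s')) j) hmunit_nat !compA.
  by rewrite -!(compA (hinv nd)) -!actmM !compm1 hinvK.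
have bei : is_iso (nak_beta aR aRR t EC ED) by apply: is_iso_comp => //; exact: is_iso_hinv.
have e1 := E _ _ _ _ _ _ (nakr_serre SD ED (N m)) (nak_beta aR aRR t EC ED) (jj m) (fmor F uC ∘ tf_one F) (pt m) si bei ji.
have e2 : hinv (nak_beta aR aRR t EC ED) ∘ (fmor F uC ∘ tf_one F) = transport_one aR aRR t ED uC.
  rewrite transport_oneE /nak_beta hinv_comp //; last exact: is_iso_hinv.
  by rewrite hinv_hinv // !compA.
rewrite e2 -nakr_serre_compare // in e1.
apply: etrans e1.
have e3 : hinv (munit (SC m : FM)) = (tf_one F ▶ idm (SC m : M)) ∘ hinv (munit (SC m : M)) := pb_munit_hinv F (SC m).
rewrite e3 actMl !compA.
by [].
Qed.

(** Second part, N^r(m) -> Sb m -> m. The comparison of quasi-inverses occurs once in the Radford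
    half and once in the pivotal structure carried to the quasi-inverse, and cancels. *)
Lemma pb_psi (s : @hom k (modend FM) (dual_one FM) ECM) m : is_iso s ->
  (forall m : M, mn_fun s m = (pb_dual_nat m : @hom k M _ _) ∘ mn_fun uM m) ->
  (acounit (sr_adj SC) m ∘ fmor (sr_inv SC) (jj m ∘ pt m : @hom k FM _ _)
    ∘ hinv (mn_fun s (sr_inv SC m)) ∘ nakr_dual_serre SC AC ECM (N m : @nakr k FM m) : @hom k M _ _)
  = acounit (sr_adj SD) m ∘ fmor (sr_inv SD) (pt m) ∘ hinv (mn_fun uM (sr_inv SD m)) ∘ nakr_dual_serre SD AD EDM (N m).
Proof.
move=> si sE.
have gi := pb_dual_nat_iso (sr_inv SC m); have ui x : is_iso (mn_fun uM x) := modnat_isoP x uMi.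
have pi := pb_serre_inv_iso m.
have e1 : (@hinv k FM _ _ (mn_fun s (sr_inv SC m)) : @hom k M _ _) ∘ nakr_dual_serre SC AC ECM (N m : @nakr k FM m)
    = hinv (psi m) ∘ hinv (mn_fun uM (sr_inv SD m)) ∘ nakr_dual_serre SD AD EDM (N m).
  rewrite nakr_dual_serre_compare sE.
  have E (x y z w v : M) (g : hom y z) (u : hom x y) (h : hom w y) (nd : hom v w) : is_iso g -> is_iso u ->
      hinv (g ∘ u) ∘ (g ∘ h ∘ nd) = hinv u ∘ h ∘ nd.
    by move=> gi' ui'; rewrite hinv_comp // !compA -(compA (hinv u)) hinvK // compm1.
  apply: etrans (E _ _ _ _ _ _ _ _ _ gi (ui _)) _; congr (_ ∘ _).
  exact: (@hinv_nat k M _ _ _ _ _ _ _ _ (ui _) (ui _) (mn_nat uM (hinv (psi m)))).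
have e2 : (acounit (sr_adj SC) m : @hom k M _ _) ∘ fmor (sr_inv SC) (jj m ∘ pt m : @hom k FM _ _)
    = acounit (sr_adj SD) m ∘ fmor (sr_inv SD) (pt m) ∘ psi m.
  have n1 : fmor (sr_inv SD) (pt m) ∘ psi m = psi (SD m) ∘ (fmor (sr_inv SC) (pt m : @hom k FM _ _) : @hom k M _ _).
    rewrite !pb_serre_invE; apply: etrans (esym (adjl_natr (sr_adj SC) (jj (sr_inv SD m) ∘ etaD m : @hom k FM _ _) (fmor (sr_inv SD) (pt m) : @hom k FM _ _))) _.
    apply: etrans _ (adjl_natl (sr_adj SC) (jj (sr_inv SD (SD m)) ∘ etaD (SD m) : @hom k FM _ _) (pt m : @hom k FM _ _)).
    congr (adjl _ _).
    have n2 := pb_comp_nat aR aRR t (serre_td SD) (serre_td SC) (fmor (sr_inv SD) (pt m)).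
    apply: etrans (@compA k M _ _ _ _ _ _ _) _.
    apply: etrans (congr1 (fun u => @comp k M _ _ _ u (etaD m)) (esym n2)) _.
    by rewrite -!(@compA k M); congr (_ ∘ _); exact: (esym (aunit_nat (sr_adj SD) (pt m))).
  have n3 : acounit (sr_adj SD) m ∘ psi (SD m) = (acounit (sr_adj SC) m : @hom k M _ _) ∘ (fmor (sr_inv SC) (jj m : @hom k FM _ _) : @hom k M _ _).
    rewrite !pb_serre_invE.
    apply: etrans (esym (adjl_natr (sr_adj SC) (jj (sr_inv SD (SD m)) ∘ etaD (SD m) : @hom k FM _ _) (acounit (sr_adj SD) m : @hom k FM _ _))) _.
    rewrite /adjl; congr (_ ∘ fmor _ _).
    have n2 := pb_comp_nat aR aRR t (serre_td SD) (serre_td SC) (acounit (sr_adj SD) m).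
    apply: etrans (@compA k M _ _ _ _ _ _ _) _.
    apply: etrans (congr1 (fun u => @comp k M _ _ _ u (etaD (SD m))) (esym n2)) _.
    rewrite -(@compA k M); apply: etrans (congr1 (fun u => @comp k M _ _ _ (jj m) u) (adj_triR (sr_adj SD) m)) (@compm1 k M _ _ _).
  rewrite -compA n1 compA n3 -(@compA k M); congr (_ ∘ _); exact: (@fmorM k FM FM).
have E (x y z v w : M) (X : hom y x) (Y : hom z x) (ps : hom y z) (hs : hom v y) (nC : hom w v) (q : hom w z) :
    is_iso ps -> hs ∘ nC = hinv ps ∘ q -> X = Y ∘ ps -> X ∘ hs ∘ nC = Y ∘ q.
  by move=> psi' e3 ->; rewrite -compA e3 compA -(compA Y) hinvV // compm1.
apply: etrans (E _ _ _ _ _ _ _ _ _ _ _ pi (etrans e1 (esym (compA _ _ _))) e2) _.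
by rewrite !compA.
Qed.

(** Regrouped at N^r(m), the composite over C is the product of the parts treated in [pb_theta] and
    [pb_psi]; so it equals the composite over D, which is the identity. *)
Lemma pb_spherical (s : @hom k (modend FM) (dual_one FM) ECM) : is_iso s ->
  (forall m : M, mn_fun s m = (pb_dual_nat m : @hom k M _ _) ∘ mn_fun uM m) ->
  spherical_at AD N (transport_one aR aRR t ED uC) uM pt ->
  @spherical_at k C FM SC AC N EC ECM uC s (transport_pivotal aR aRR t SC pt).
Proof.
move=> si sE sp m; apply: etrans (sp m).
have E (X : lincat k) (x0 x1 x2 x3 x4 x5 x6 x7 : X) (a : hom x1 x0) (b : hom x2 x1) (h : hom x3 x2) (n : hom x4 x3)
    (i : hom x5 x4) (u : hom x6 x5) (v : hom x7 x6) (z : X) (p : hom z x7) :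
  a ∘ b ∘ (h ∘ (n ∘ i) ∘ u ∘ v) ∘ p = (a ∘ b ∘ h ∘ n) ∘ (i ∘ u ∘ v ∘ p) by rewrite !compA.
rewrite /module_radford_bar /module_radford [LHS]E [RHS]E.
have -> : transport_pivotal aR aRR t SC pt m = (jj m ∘ pt m : @hom k FM _ _) by rewrite /transport_pivotal pb_serre_trivE.
apply: etrans (congr1 (fun u => u ∘ _) (pb_psi m si sE)) _.
exact: (congr1 (fun u => _ ∘ u) (pb_theta m)).
Qed.

End Structures.
End TransportSpherical.

Section SphericalTransport.
Variables (k : fieldType) (C D : ftcat k) (F : tfunctor C D).
Variables (R : functor D C) (aR : adjunction F R) (RR : functor C D) (aRR : adjunction R RR).
Variables (t : hom (unitc D) (chi RR)) (tP : chi_trivialization aR aRR t).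

Lemma transport_one_iso (EC : nakr (unitc C)) (ED : nakr (unitc D)) (u : hom (unitc C) EC) :
  is_iso u -> is_iso (transport_one aR aRR t ED u).
Proof.
move=> ui; rewrite transport_oneE; have [ri _] := nakr_rraP tP EC ED.
apply: is_iso_comp; last exact: tf_one_iso.
apply: is_iso_comp; last exact: fmor_iso.
by apply: is_iso_comp; [exact: is_iso_hinv|exact: frob_iota_iso].
Qed.

Lemma transport_one_scale (EC : nakr (unitc C)) (ED : nakr (unitc D)) (u : hom (unitc C) EC) a :
  transport_one aR aRR t ED (a *: u) = a *: transport_one aR aRR t ED u.
Proof. by rewrite !transport_oneE fmorZ compZr compZl. Qed.

(** The endomorphisms of the unit are the scalars, so two trivializations of an object differ by a
    nonzero scalar. *)
Lemma unit_scale (X : ftcat k) (x : X) (u v : hom (unitc X) x) : is_iso u -> is_iso v ->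
  exists2 a : k, a != 0 & v = a *: u.
Proof.
move=> ui vi; have [a [ha _]] := ftcat_one (hinv u ∘ v).
have e : v = a *: u by rewrite -[v](comp1m v) -(hinvV ui) -compA ha compZr compm1.
exists a => //; apply/eqP => a0; have [b [_ bU]] := ftcat_one (0 : hom (unitc X) (unitc X)).
have id0 : idm (unitc X) = 0 by rewrite -(hinvK vi) e a0 scale0r comp0r.
have b0 := bU 0 (esym (scale0r _)); have b1 := bU 1; rewrite id0 scaler0 in b1.
by have := b1 erefl; rewrite b0 => /eqP; rewrite eq_sym oner_eq0.
Qed.

Lemma scale_iso (X : lincat k) (x y : X) (f : hom x y) a : a != 0 -> is_iso f -> is_iso (a *: f).
Proof.
move=> a0 [g [h1 h2]]; exists (a^-1 *: g); split; rewrite compZl compZr scalerA ?h1 ?h2.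
  by rewrite mulVf // scale1r.
by rewrite mulfV // scale1r.
Qed.

(** Sphericality trivializes N^l(1); its inverse N^r(1) is then trivial through [eps]. *)
Lemma spherical_trivial (p : pivotal C) : spherical p -> exists (E : nakr (unitc C)) (u : hom (unitc C) E), is_iso u.
Proof.
move=> [_ [Dl [Di [N [eps [u [ei ui _]]]]]]]; exists Di.
exists (hinv (eps ∘ (u ⊠ idm Di) ∘ hinv (lunit Di))); apply: is_iso_hinv.
apply: is_iso_comp; last by apply: is_iso_hinv; exact: lunit_iso.
by apply: is_iso_comp => //; apply: tens_iso => //; exact: is_iso_id.
Qed.

Variables (M : modcat D) (pC : pivotal C) (pD : pivotal D).
Local Notation FM := (pullback F M).

Theorem pullback_spherical_at (SD : serre M) (SC : serre FM)
    (AD : forall m n : M, dual_ihom m n) (AC : forall m n : FM, dual_ihom m n) (N : forall m : M, nakr m)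
    (EC : nakr (unitc C)) (ED : nakr (unitc D)) (EDM : nakr (dual_one M)) (ECM : nakr (dual_one FM))
    (pt : forall m : M, hom m (SD m)) (uC : hom (unitc C) EC) (uM : @hom k (modend M) (dual_one M) EDM) :
  pivotal_functor F pC pD -> pivotal_structure pD pt -> is_iso uM ->
  spherical_at AD N (transport_one aR aRR t ED uC) uM pt ->
  let ptF := transport_pivotal aR aRR t SC pt in
  pivotal_structure pC ptF
  /\ exists uMF : @hom k (modend FM) (dual_one FM) ECM,
       is_iso uMF
       /\ (forall m : FM, mn_fun uMF m = transport_unimodular aR aRR t SD SC AD AC N ECM uM m)
       /\ @spherical_at k C FM SC AC N EC ECM uC uMF ptF.
Proof.
move=> Fp pP uMi sp ptF.
split.
  have -> : ptF = (fun m => pb_comp aR aRR t (serre_td SD) (serre_td SC) m ∘ pt m : @hom k FM _ _).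
    by apply: functional_extensionality_dep => m; rewrite /ptF /transport_pivotal pb_serre_trivE.
  exact: pb_pivotal.
have [s [si sE]] := pb_unimodular_nat tP SD SC ECM uMi; exists s; split=> //; split.
  move=> m; rewrite /transport_unimodular -(pb_dual_natP tP SD SC AD AC N EDM ECM); exact: sE.
exact: (pb_spherical _ uMi si sE sp).
Qed.

Theorem pullback_spherical : exact_module M -> perfect F -> spherical pC -> pivotal_functor F pC pD ->
  spherical_module pD M -> spherical_module pC FM.
Proof.
move=> Me Fperf sC Fp [_ [SD [AD [N [ED [EDM [uD [uM [pt [uDi uMi pP sp]]]]]]]]]].
have FMe := pullback_exact Me Fperf; split=> //.
have [EC [u ui]] := spherical_trivial sC.
(* The given [uD] need not be of the form F(u). It is a multiple of such a morphism, and rescaling u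
   makes it one. *)
have [a a0 e] := unit_scale (transport_one_iso ED ui) uDi.
pose SC := serre_exists FMe; pose AC := ihact_dual_ihom SC.
have hi : @is_iso k (modend M) _ _ (hinv uM) := is_iso_hinv uMi.
(* Through [uM] the identity functor carries the Nakayama family over D; pulled back, it makes the
   identity of [_F M] an N^r(id) over C. *)
pose W := pb_nakfam tP (serre_td SC) (nakfam_iso (K' := modfun_id M) (fun m => modnat_isoP m hi) (nakfam_of (serre_surj SD) EDM)).
pose W1 : nakfam (serre_td SC) (modfun_id FM) := NakFam (K := modfun_id FM) (nf_nat W) (nf_act W).
pose ECM := nakr_of (nakstr_of_fam W1).
rewrite e -transport_one_scale in sp.
have [pF [s [si [_ sS]]]] := pullback_spherical_at SC AC ECM Fp pP uMi sp.
exists SC, AC, N, EC, ECM, (a *: u), s; eexists; split; [exact: scale_iso|exact: si|exact: pF|exact: sS].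
Qed.
End SphericalTransport.

Theorem theoremB (k : closedFieldType) (C D : ftcat k) (F : tfunctor C D)
    (M : modcat D) :
  (exact_module M -> perfect F -> exact_module (pullback F M))
  /\ (unimodular_module M -> perfect F -> tensor_frobenius F ->
      unimodular_module (pullback F M))
  /\ (forall (pC : pivotal C) (pD : pivotal D),
      pivotal_module pD M ->
      perfect F -> pivotal_functor F pC pD -> tensor_frobenius F ->
      pivotal_module pC (pullback F M))
  /\ (forall (pC : pivotal C) (pD : pivotal D),
      spherical pC -> spherical pD ->
      perfect F -> pivotal_functor F pC pD -> tensor_frobenius F ->
      (spherical_module pD M -> spherical_module pC (pullback F M))
      /\
      forall (R : functor D C) (aR : adjunction F R)
        (RR : functor C D) (aRR : adjunction R RR)
        (t : hom (unitc D) (chi RR)),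
      chi_trivialization aR aRR t ->
      forall (SD : serre M) (SC : serre (pullback F M))
        (AD : forall m n : M, dual_ihom m n)
        (AC : forall m n : pullback F M, dual_ihom m n)
        (N : forall m : M, nakr m)
        (EC : nakr (unitc C)) (ED : nakr (unitc D))
        (EDM : nakr (dual_one M)) (ECM : nakr (dual_one (pullback F M)))
        (pt : forall m : M, hom m (SD m))
        (uC : hom (unitc C) EC)
        (uM : @hom k (modend M) (dual_one M) EDM),
      exact_module M -> pivotal_structure pD pt ->
      is_iso uC -> is_iso uM ->
      spherical_at AD N (transport_one aR aRR t ED uC) uM pt ->
      let ptF := transport_pivotal aR aRR t SC pt in
      exact_module (pullback F M)
      /\ pivotal_structure pC ptF
      /\ exists uMF : @hom k (modend (pullback F M))
                        (dual_one (pullback F M)) ECM,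
           is_iso uMF
           /\ (forall m : pullback F M,
                 mn_fun uMF m
                 = transport_unimodular aR aRR t SD SC AD AC N ECM uM m)
           /\ @spherical_at k C (pullback F M) SC AC N EC ECM uC uMF ptF).
Proof.
split; first exact: pullback_exact.
split; first exact: pullback_unimodular.
split; first exact: pullback_pivotal.
move=> pC pD sC sD Fp Fpiv Ff; split=> [sM|].
  (* The existential claim leaves the trivialization free, and the Frobenius structure of F supplies
     one. *)
  have [R [aR [RR [aRR [t tP]]]]] := tensor_frobenius_trivialization Ff.
  by apply: (pullback_spherical tP _ Fp sC Fpiv sM); case: sM.
move=> R aR RR aRR t tP SD SC AD AC N EC ED EDM ECM pt uC uM Me pP uCi uMi sp ptF.
by split; [exact: pullback_exact|exact: pullback_spherical_at].
Qed.
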